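(* For every positive integer $n$, the degree of the complex special orthogonal group $\mathrm{SO}(n)$ is given by $$\deg \mathrm{SO}(n)=2^{n-1}\det \left( \binom{2n-2i-2j}{n-2i} \right)_{1\leq i , j \leq \lfloor n/2\rfloor}.$$
   Context: $\mathrm{SO}(n)=\mathrm{SO}(n,\mathbb{C})=\{M\in \mathrm{Mat}_{n,n}(\mathbb{C}) : \det M=1,\ M^{t}M=\mathrm{Id}\}$, viewed as an affine complex variety in the $n^2$-dimensional affine space $\mathrm{Mat}_{n,n}(\mathbb{C})\cong\mathbb{C}^{n^2}$. The degree of a complex variety $X$ embedded in affine space is the number of intersection points of $X$ with a generic (affine) linear space of complementary dimension. The determinant of an empty ($0\times 0$) matrix is $1$. *)

(* Defs.v *)
From mathcomp Require Import all_boot all_algebra.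
From mathcomp Require Import classical_sets cardinality reals.
From mathcomp Require Import complex mpoly.

Set Implicit Arguments.
Unset Strict Implicit.
Unset Printing Implicit Defensive.

Import GRing.Theory.
Local Open Scope classical_set_scope.
Local Open Scope card_scope.
Local Open Scope ring_scope.

Section AffineDegree.
Variable F : closedFieldType.

Definition mpoly_at (m : nat) (p : {mpoly F[m]}) (x : 'rV[F]_m) : F :=
  p.@[fun i => x 0 i].

(* Algebraic independence in the coordinate ring F[x_1, ..., x_N] / I(X):
   the only P with P(f_1, ..., f_k) in I(X) is 0. *)
Definition alg_independent_on (N : nat) (X : set 'rV[F]_N)
    (k : nat) (f : k.-tuple {mpoly F[N]}) : Prop :=
  forall P : {mpoly F[k]},
    (forall x, X x -> mpoly_at (P \mPo f) x = 0) -> P = 0.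

(* The transcendence degree over F of the coordinate ring of X. *)
Definition has_dimension (N : nat) (X : set 'rV[F]_N) (d : nat) : Prop :=
  (exists f : d.-tuple {mpoly F[N]}, alg_independent_on X f) /\
  (forall (k : nat) (f : k.-tuple {mpoly F[N]}),
     alg_independent_on X f -> (k <= d)%N).

(* Q holds on a nonempty Zariski-open subset of affine m-space. *)
Definition generically (m : nat) (Q : 'rV[F]_m -> Prop) : Prop :=
  exists2 P : {mpoly F[m]}, P != 0 & forall v, mpoly_at P v != 0 -> Q v.

(* Points are row vectors: the d columns of A and the entries of b are the
   coefficients of d affine equations, and when \rank A = d the solution set
   is an affine subspace of codimension d.  Every such subspace arises so. *)
Definition affine_subspace (N d : nat) (A : 'M[F]_(N, d)) (b : 'rV[F]_d) :
    set 'rV[F]_N :=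
  [set x | x *m A = b].

(* A generic affine subspace of codimension dim X is one given by a generic
   coefficient vector (A, b) in F^(N * d + d). *)
Definition has_degree (N : nat) (X : set 'rV[F]_N) (D : nat) : Prop :=
  exists2 d : nat, has_dimension X d &
    generically (fun v : 'rV[F]_(N * d + d) =>
      let A : 'M[F]_(N, d) := vec_mx (lsubmx v) in
      let b : 'rV[F]_d := rsubmx v in
      \rank A = d /\ X `&` affine_subspace A b #= `I_D).

End AffineDegree.

Definition SO (R : realType) (n : nat) : set 'M[R[i]]_n :=
  [set M | \det M = 1 /\ M^T *m M = 1%:M].

Arguments SO R n : clear implicits.

(* SO(n) as a subset of affine n^2-space, via Mat_(n,n) = C^(n * n). *)
Definition SO_variety (R : realType) (n : nat) : set 'rV[R[i]]_(n * n) :=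
  mxvec @` SO R n.

Arguments SO_variety R n : clear implicits.

(* Main.v *)
Require Import Defs.
From HB Require Import structures.
From mathcomp Require Import all_boot all_order all_algebra separable.
From mathcomp Require Import classical_sets boolp cardinality reals.
From mathcomp Require Import complex mpoly.
From mathcomp Require Import zify ring lra.

(* An irreducible closed variety whose affine Hilbert function is
   sum_(i <= d) c_i 'C(k, i) with c_d = D > 0 has degree D. Its generic linear
   projection to d + 1 dimensions is birational onto a hypersurface of some degree e,
   whose fibres are the roots of a separable polynomial (Kronecker); counting the
   monomials in the projected coordinates gives e <= D, and specialising to a Noether
   normalisation gives D <= e.

   SO(n) is irreducible because Cayley transforms, translated by diagonal sign
   matrices, cover it by overlapping rational charts. The functions of degree at most
   k on it form the sum of the V_lambda (x) V_lambda^* over the dominant weights with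
   sum_i |lambda_i| <= k. Uniqueness of the highest weight vectors follows from the
   density of the big cell L D U, and products of principal minors provide them.
   Projecting with the Casimir operator yields Freudenthal's relation, hence Weyl's
   dimension formula, without complete reducibility: the Hilbert function is a sum
   of squares of Vandermonde-like determinants over the lattice points of a simplex.
   Its leading coefficient is a determinant of factorials (rho_i + rho_j)!, which
   after division by the rho_i! is the determinant of binomial coefficients. *)

Set Implicit Arguments.
Unset Strict Implicit.
Unset Printing Implicit Defensive.

Import Order.TTheory GRing.Theory Num.Theory.
Local Open Scope classical_set_scope.
Local Open Scope ring_scope.

(** A degree counts points while a Hilbert function counts functions, and one relation has to carry
    both. The coefficients [A], [b] of the linear equations and a further form [u] stay variables:
    derivatives in [u] recover the points from the roots of the relation, while its degree bounds a
    rank. No representation is decomposed. By antisymmetry under the Weyl group, the dimension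
    formula needs only the coefficients of character times denominator at dominant exponents, and
    each is the trace of a projector onto highest weight vectors. Used on the left for the identity
    and on the right for the left projector, the formula yields the same dimension twice, hence
    squares, once joint highest weight vectors form lines. The group is conjugated into the
    stabiliser of an antidiagonal form, where the torus is diagonal and weights are read off
    monomials. For even n an odd number of sign changes lies outside the Weyl group, but on the left
    it is realised through conjugation by permutation matrices of determinant -1; so only weights
    with nonnegative coordinates, those reached by principal minors, need highest weight vectors. *)

Lemma mpoly_ringind (K : comNzRingType) (m : nat) (P : {mpoly K[m]} -> Prop) :
    (forall c, P c%:MP) -> (forall i, P 'X_i) ->
    (forall p q, P p -> P q -> P (p + q)) ->
    (forall p q, P p -> P q -> P (p * q)) -> forall p, P p.
Proof.
move=> PC PX PD PM p; elim/mpolyind: p => [|c mm p _ _ Pp]; first exact: (PC 0).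
apply: PD Pp; rewrite -mul_mpolyC; apply: (PM) => //.
rewrite mpolyXE_id; elim/big_ind: _ => [|x y Px Py|i _]; [exact: (PC 1)|exact: PM|].
by elim: (mm i) => [|k IH]; [rewrite expr0; exact: (PC 1)|rewrite exprS; exact: PM].
Qed.

(** * Polynomials, binomial sums and the Hilbert function *)

Section Curves.
Variables (F : numClosedFieldType) (m : nat).
Implicit Types (p : {mpoly F[m]}) (c : 'I_m -> {poly F}).

Definition along p c : {poly F} := mmap (@polyC F) c p.

Lemma alongE p c s : (along p c).[s] = p.@[fun i => (c i).[s]].
Proof.
elim/mpoly_ringind: p => [a|i|p q IHp IHq|p q IHp IHq].
- by rewrite /along mmapC hornerC mevalC.
- by rewrite /along mmapX mmap1U mevalXU.
- by rewrite /along mmapD hornerD mevalD -IHp -IHq.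
- by rewrite /along rmorphM hornerM mevalM -IHp -IHq.
Qed.

Lemma along_deriv p c :
  (along p c)^`() = \sum_i along p^`M(i) c * (c i)^`().
Proof.
elim/mpoly_ringind: p => [a|i|p q IHp IHq|p q IHp IHq].
- rewrite /along mmapC derivC big1 // => i _.
  by rewrite mderivC mmap0 mul0r.
- rewrite /along mmapX mmap1U (bigD1 i) //= big1 ?addr0 => [|j ji].
    rewrite mderivX mnm1E eqxx scale1r (_ : (_ - _)%MM = 0%MM).
      by rewrite mpolyX0 rmorph1 mul1r.
    by apply/mnmP=> k; rewrite !mnmE subnn.
  by rewrite mderivX mnm1E eq_sym (negbTE ji) scale0r mmap0 mul0r.
- rewrite /along mmapD derivD IHp IHq -big_split; apply: eq_bigr => i _.
  by rewrite mderivD /along mmapD mulrDl.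
- rewrite {1}/along rmorphM derivM IHp IHq mulr_suml mulr_sumr -big_split.
  apply: eq_bigr => i _ /=; rewrite mderivM /along mmapD !rmorphM /=; ring.
Qed.

Lemma polyF_eq0 (q : {poly F}) : (forall s, q.[s] = 0) -> q = 0.
Proof.
move=> q0; apply/eqP; apply: contraT => nz.
have := max_poly_roots nz (rs := [seq k%:R | k <- iota 0 (size q)]).
rewrite size_map size_iota ltnn; apply.
  by apply/allP => x _; apply/rootP.
by rewrite map_inj_uniq ?iota_uniq // => i j /eqP; rewrite eqr_nat => /eqP.
Qed.

Lemma mderiv_vanish p i : (forall v, p.@[v] = 0) -> forall v, p^`M(i).@[v] = 0.
Proof.
move=> p0 v; pose c j : {poly F} := (v j)%:P + (j == i)%:R *: 'X.
have a0 : along p c = 0 by apply: polyF_eq0 => s; rewrite alongE.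
have := along_deriv p c; rewrite a0 deriv0 => /(congr1 (horner^~ 0)).
rewrite horner0 horner_sum (bigD1 i) //= big1 ?addr0 => [|j ji]; last first.
  by rewrite /c (negbTE ji) scale0r addr0 derivC mulr0 horner0.
rewrite /c eqxx scale1r derivD derivC derivX add0r mulr1 alongE => ->.
apply: meval_eq => j; rewrite /c hornerD hornerC hornerZ hornerX mulr0 addr0 //.
Qed.

Lemma meval_origin p : p.@[fun=> 0] = p@_0%MM.
Proof.
elim/mpoly_ringind: p => [a|i|p q IHp IHq|p q IHp IHq].
- by rewrite mevalC mcoeffC eqxx mulr1.
- by rewrite mevalXU mcoeffX mnm1_eq0.
- by rewrite mevalD mcoeffD IHp IHq.
- by rewrite mevalM IHp IHq (mcoeff0_is_multiplicative m F).1.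
Qed.

(** Every coefficient is, up to a nonzero integer, an iterated derivative at the origin, and
    [mderiv_vanish] keeps the vanishing; characteristic 0 cancels the integer. *)
Lemma mpoly_eval_eq0 p : (forall v, p.@[v] = 0) -> p = 0.
Proof.
move=> p0; apply/mpolyP => mm; rewrite mcoeff0.
move: {2}(mdeg mm) (erefl (mdeg mm)) => k; elim: k p mm p0 => [|k IH] p mm p0.
  move/eqP; rewrite mdeg_eq0 => /eqP ->.
  by rewrite -meval_origin p0.
move=> hk; have [i hi] : exists i, mm i != 0%N.
  apply/existsP; apply: contraT => /existsPn h.
  suff h0 : mm = 0%MM by move: hk; rewrite h0 mdeg0.
  by apply/mnmP => i; rewrite mnm0E; apply/eqP; move: (h i); rewrite negbK.
have le1 : (U_(i) <= mm)%MM by rewrite lep1mP.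
have hs : mdeg (mm - U_(i)) = k.
  by have := congr1 (@mdeg m) (submK le1); rewrite mdegD mdeg1 hk addn1 => -[].
have := IH _ (mm - U_(i))%MM (@mderiv_vanish _ i p0) hs.
by rewrite mcoeff_deriv submK // => /eqP; rewrite mulrn_eq0 => /eqP.
Qed.

Lemma mpoly_neq0_eval p : p != 0 -> exists v : 'rV[F]_m, mpoly_at p v != 0.
Proof.
move=> nz; apply: contrapT => h; move/eqP: nz; apply; apply: mpoly_eval_eq0 => v.
apply/eqP; apply: contrapT => /negP hv; apply: h; exists (\row_i v i).
by rewrite /mpoly_at (meval_eq (v2 := v)) // => i; rewrite mxE.
Qed.

End Curves.

Lemma poly_neq0_eval (F : numClosedFieldType) (q : {poly F}) : q != 0 -> exists s, q.[s] != 0.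
Proof.
move=> nz; apply: contrapT => h; move/eqP: nz; apply; apply: polyF_eq0 => s.
by apply/eqP; apply: contrapT => /negP hs; apply: h; exists s.
Qed.

(* D is the coefficient in the basis of binomial coefficients, so the leading
   coefficient in the usual sense is D / d!. *)
Definition binpoly (d : nat) (D : rat) (f : nat -> rat) : Prop :=
  exists2 c : nat -> rat, c d = D &
    forall k, f k = \sum_(i < d.+1) c i * ('C(k, i))%:R.

Lemma binpoly_ext d D f g : f =1 g -> binpoly d D f -> binpoly d D g.
Proof. by move=> fg [c cd fc]; exists c => // k; rewrite -fg. Qed.

Lemma binpoly_bin d : binpoly d 1 (fun k => ('C(k, d))%:R).
Proof.
exists (fun i => (i == d)%:R) => [|k]; first by rewrite eqxx.
rewrite big_ord_recr /= eqxx mul1r big1 ?add0r // => i _.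
by rewrite ltn_eqF ?mul0r.
Qed.

Lemma binpoly_lower d D f : binpoly d D f -> binpoly d.+1 0 f.
Proof.
case=> c cd fc; exists (fun i => if i == d.+1 then 0 else c i) => [|k].
  by rewrite eqxx.
rewrite fc [RHS]big_ord_recr /= eqxx mul0r addr0; apply: eq_bigr => i _.
by rewrite ltn_eqF.
Qed.

Lemma binpoly_lowern d D f e : (d < e)%N -> binpoly d D f -> binpoly e 0 f.
Proof.
move=> de /binpoly_lower; rewrite -(subnKC de).
by elim: (e - d.+1)%N => [|k IH]; rewrite ?addn0 // addnS => /IH /binpoly_lower.
Qed.

Lemma binpolyD d D1 D2 f g :
  binpoly d D1 f -> binpoly d D2 g -> binpoly d (D1 + D2) (fun k => f k + g k).
Proof.
case=> c cd fc [c' c'd gc]; exists (fun i => c i + c' i) => [|k]; first by rewrite cd c'd.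
by rewrite fc gc -big_split; apply: eq_bigr => i _; rewrite mulrDl.
Qed.

Lemma binpolyZ d D f a : binpoly d D f -> binpoly d (a * D) (fun k => a * f k).
Proof.
case=> c cd fc; exists (fun i => a * c i) => [|k]; first by rewrite cd.
by rewrite fc mulr_sumr; apply: eq_bigr => i _; rewrite mulrA.
Qed.

Lemma binpoly0 d : binpoly d 0 (fun=> 0).
Proof. by exists (fun=> 0) => // k; rewrite big1 // => i _; rewrite mul0r. Qed.

Lemma binpoly_sum d (I : Type) (s : seq I) (P : pred I) D (f : I -> nat -> rat) :
  (forall i, binpoly d (D i) (f i)) ->
  binpoly d (\sum_(i <- s | P i) D i) (fun k => \sum_(i <- s | P i) f i k).
Proof.
move=> H; elim: s => [|a s IH].
  by rewrite big_nil; apply: binpoly_ext (binpoly0 d) => k; rewrite big_nil.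
rewrite big_cons; case: ifPn => Pa.
  by apply: binpoly_ext (binpolyD (H a) IH) => k; rewrite big_cons Pa.
by apply: binpoly_ext IH => k; rewrite big_cons (negbTE Pa).
Qed.

Lemma binpoly_succ d D f : binpoly d D f -> binpoly d D (fun k => f k.+1).
Proof.
case=> c cd fc.
exists (fun i => c i + (if (i < d)%N then c i.+1 else 0)) => [|k].
  by rewrite ltnn addr0.
under [RHS]eq_bigr => i _ do rewrite mulrDl.
rewrite fc big_split /= [LHS]big_ord_recl [X in _ = X + _]big_ord_recl /= !bin0.
under [in LHS]eq_bigr => i _ do rewrite /bump /= add1n binS natrD mulrDr.
rewrite big_split /= -!addrA; congr (_ + (_ + _)).
rewrite [RHS]big_ord_recr /= ltnn mul0r addr0; apply: eq_bigr => i _.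
by rewrite ltn_ord.
Qed.

Lemma binpoly_shift d D f s : binpoly d D f -> binpoly d D (fun k => f (k + s)%N).
Proof.
move=> H; elim: s => [|s IH]; first by apply: binpoly_ext H => k; rewrite addn0.
by apply: binpoly_ext (binpoly_succ IH) => k; rewrite addSn addnS.
Qed.

Lemma binpoly_diff d D f : binpoly d.+1 D f -> binpoly d D (fun k => f k.+1 - f k).
Proof.
case=> c cd fc; exists (fun i => c i.+1) => // k.
rewrite !fc -sumrB big_ord_recl /= !bin0 subrr add0r; apply: eq_bigr => i _.
by rewrite /bump /= add1n binS natrD mulrDr addrC addKr.
Qed.

(** Induction through differences: an eventual positive lower bound on [f k.+1 - f k] makes [f] grow
    at least linearly. *)
Lemma binpoly_pos d D f : 0 < D -> binpoly d D f ->
  exists2 e, 0 < e & exists K, forall k, (K <= k)%N -> e <= f k.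
Proof.
move=> Dp; elim: d f => [|d IH] f H.
  exists D => //; exists 0%N => k _; case: H => c cd ->.
  by rewrite big_ord_recl big_ord0 addr0 cd bin0 mulr1.
have [e ep [K HK]] := IH _ (binpoly_diff H).
have lb j : f K + e * j%:R <= f (K + j)%N.
  elim: j => [|j IHj]; first by rewrite mulr0 addr0 addn0.
  have := HK (K + j)%N (leq_addr _ _); rewrite lerBrDr addnS => h.
  by apply: le_trans h; rewrite -natr1 mulrDr mulr1 addrA addrC lerD2l.
exists e => //.
have b0 : 0 <= `|(e - f K) / e| by [].
have := archi_boundP b0; set B := Num.bound _ => hB.
exists (K + B)%N => k hk; have := lb (k - K)%N; rewrite subnKC; last by lia.
apply: le_trans; have : B%:R <= (k - K)%:R :> rat by rewrite ler_nat; lia.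
move=> h2; have h3 : (e - f K) / e < (k - K)%:R.
  by apply: le_lt_trans (ler_norm _) (lt_le_trans hB h2).
by move: h3; rewrite ltr_pdivrMr // mulrC => h3; rewrite addrC -lerBlDr ltW.
Qed.

Lemma binpoly_ge0 d D f : (forall k, 0 <= f k) -> binpoly d D f -> 0 <= D.
Proof.
move=> f0 H; rewrite leNgt; apply/negP => Dn.
have Dp : 0 < -1 * D by rewrite mulN1r oppr_gt0.
have [e ep [K HK]] := binpoly_pos Dp (binpolyZ (-1) H).
have := HK K (leqnn K); have := f0 K; lra.
Qed.

Lemma binpoly_le d D1 D2 f g : (forall k, f k <= g k) ->
  binpoly d D1 f -> binpoly d D2 g -> D1 <= D2.
Proof.
move=> fg H1 H2; have H := binpolyD H2 (binpolyZ (-1) H1).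
have : 0 <= D2 + -1 * D1 by apply: binpoly_ge0 H => k; have := fg k; lra.
lra.
Qed.

(** From [k * 'C(k, i) = i.+1 * 'C(k, i.+1) + i * 'C(k, i)], which is where the factor [d.+1] comes
    from. *)
Lemma binpoly_mulX d D f x :
  binpoly d D f -> binpoly d.+1 (d.+1%:R * D) (fun k => (k%:R + x) * f k).
Proof.
move=> H; have H1 := binpolyZ x (binpoly_lower H).
suff H2 : binpoly d.+1 (d.+1%:R * D) (fun k => k%:R * f k).
  have := binpolyD H2 H1; rewrite mulr0 addr0; apply: binpoly_ext => k; ring.
case: H => c cd fc {H1}.
exists (fun i => i%:R * (if i is j.+1 then c j else 0)
   + (if (i <= d)%N then i%:R * c i else 0)) => [|k].
  by rewrite ltnn addr0 cd.
under [RHS]eq_bigr => i _ do rewrite mulrDl.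
rewrite big_split /= [X in _ = X + _]big_ord_recl /= mulr0n !mul0r add0r.
rewrite [X in _ = _ + X]big_ord_recr /= ltnn mul0r addr0 -big_split fc mulr_sumr.
apply: eq_bigr => i _ /=; rewrite /bump /= add1n -ltnS ltn_ord.
have [ik|ki] := leqP i k; last by rewrite !bin_small ?mulr0 ?addr0 //; lia.
have -> : k%:R = i%:R + (k - i)%:R :> rat by rewrite -natrD subnKC.
have := mul_bin_left k i => /(congr1 (fun m => m%:R : rat)); rewrite !natrM => h.
have -> : i.+1%:R * c i * 'C(k, i.+1)%:R = c i * (i.+1%:R * 'C(k, i.+1)%:R) by ring.
rewrite h; ring.
Qed.

Lemma binpoly_powX a x : binpoly a (a`!)%:R (fun k => (k%:R + x) ^+ a).
Proof.
elim: a => [|a IH].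
  by apply: binpoly_ext (binpoly_bin 0) => k; rewrite bin0 expr0.
rewrite factS natrM.
by apply: binpoly_ext (binpoly_mulX x IH) => k; rewrite exprS.
Qed.

(** Combinatorially, the subsets of [a + b + 1] elements among [K + 1] are sorted by their element
    number [a + 1]; the proof uses Pascal's rule. *)
Lemma sum_bin_conv a b K :
  (\sum_(j < K.+1) 'C(j, a) * 'C(K - j, b) = 'C(K.+1, (a + b).+1))%N.
Proof.
elim: b K => [|b IHb] K.
  rewrite addn0; under eq_bigr => j _ do rewrite bin0 muln1.
  elim: K => [|K IH]; first by rewrite big_ord_recl big_ord0 addn0 binS bin0n; case: a.
  by rewrite big_ord_recr /= IH [RHS]binS addnC.
elim: K => [|K IHK].
  rewrite big_ord_recl big_ord0 subnn bin0n muln0 bin_small //; lia.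
rewrite big_ord_recr /= subnn bin0n muln0 addn0.
under eq_bigr => j _.
  rewrite subSn; last by rewrite -ltnS.
  rewrite binS mulnDr; over.
rewrite big_split /= IHK IHb [RHS]binS addnS //.
Qed.

(** In the basis of binomial coefficients convolution multiplies the leading coefficients without
    any extra constant. Only the pair of top indices reaches degree [a + b + 1]. *)
Lemma binpoly_conv a A g b B f : binpoly a A g -> binpoly b B f ->
  binpoly (a + b).+1 (A * B) (fun K => \sum_(j < K.+1) g j * f (K - j)%N).
Proof.
case=> c ca gc [c' cb fc].
have base i l : binpoly (i + l).+1 1 (fun K => ('C(K.+1, (i + l).+1))%:R).
  exact: (binpoly_succ (binpoly_bin (i + l).+1)).
have H (i : 'I_a.+1) (l : 'I_b.+1) : binpoly (a + b).+1
    (if (i == a :> nat) && (l == b :> nat) then A * B else 0)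
    (fun K => c i * c' l * ('C(K.+1, (i + l).+1))%:R).
  case: ifPn => [/andP[/eqP ia /eqP lb]|h].
    have := binpolyZ (c i * c' l) (base i l); rewrite mulr1 ia lb ca cb //.
  have hl : (i + l < a + b)%N.
    have := ltn_ord i; have := ltn_ord l; rewrite !ltnS => h1 h2.
    by move: h; rewrite negb_and => /orP[] h; lia.
  by apply: (binpoly_lowern (d := (i + l).+1)) (binpolyZ _ (base i l)); lia.
have Hi i := @binpoly_sum (a + b).+1 _ (index_enum 'I_b.+1) xpredT _ _ (H i).
have := @binpoly_sum (a + b).+1 _ (index_enum 'I_a.+1) xpredT _ _ Hi.
rewrite big_ord_recr /= big_ord_recr /= !eqxx /= big1; last first.
  by move=> i _; apply: big1 => l _; rewrite ltn_eqF.
rewrite big1 ?add0r; last by move=> l _; rewrite ltn_eqF.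
apply: binpoly_ext => K; symmetry.
under eq_bigr => j _ do rewrite gc fc mulr_suml.
rewrite exchange_big /=; apply: eq_bigr => i _.
under eq_bigr => j _ do rewrite mulr_sumr.
rewrite exchange_big /=; apply: eq_bigr => l _.
rewrite -sum_bin_conv natr_sum mulr_sumr; apply: eq_bigr => j _.
by rewrite natrM; ring.
Qed.

Lemma binpoly_ub d D f : binpoly d D f -> exists B : nat, forall k, f k <= (B * k.+1 ^ d)%:R.
Proof.
case=> c _ fc; exists (Num.bound (\sum_(i < d.+1) `|c i|)) => k.
have h : \sum_(i < d.+1) `|c i| <= (Num.bound (\sum_(i < d.+1) `|c i|))%:R.
  by apply: ltW; apply: archi_boundP; apply: sumr_ge0.
rewrite natrM fc; apply: le_trans (ler_wpM2r _ h) => //.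
rewrite mulr_suml; apply: ler_sum => i _.
apply: le_trans (ler_norm _) _; rewrite normrM ler_wpM2l // ger0_norm // ler_nat.
have : ('C(k, i) <= k.+1 ^ i)%N.
  elim: k (val i) => [|k' IH] [|j] //=.
  rewrite binS; apply: leq_trans (leq_add (IH j.+1) (IH j)) _.
  have h2 : (k'.+1 ^ j <= k'.+2 ^ j)%N by case: j => // j; rewrite leq_exp2r.
  by rewrite !expnS; nia.
move=> h1; apply: leq_trans h1 _; rewrite leq_pexp2l // -ltnS ltn_ord //.
Qed.

(** Linear algebra over a domain, phrased by evaluation. In the induction a free point is put into
    the last row of the determinant: either its expansion vanishes on [S], and the cofactors are the
    coefficients of a dependence, or a further point is found. *)
Lemma dependent_or_det (T : Type) (S : set T) (B : idomainType) (s : nat)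
    (phi : 'I_s -> T -> B) :
  (exists2 c : 'I_s -> B, exists i, c i != 0 &
     forall x, S x -> \sum_i c i * phi i x = 0) \/
  (exists2 x : 'I_s -> T, forall i, S (x i) &
     \det (\matrix_(i, j) phi j (x i)) != 0).
Proof.
elim: s phi => [|s IH] phi.
  have x : 'I_0 -> T by case.
  by right; exists x => [[]|] //; rewrite det_mx00 oner_neq0.
have [[c [i ci] cP]|[x Sx dx]] := IH (fun i => phi (lift ord_max i)).
  left; exists (fun j => if unlift ord_max j is Some j' then c j' else 0).
    by exists (lift ord_max i); rewrite liftK.
  move=> y Sy; rewrite (bigD1_ord ord_max) //= unlift_none mul0r add0r -[RHS](cP y Sy).
  by apply: eq_bigr => j _; rewrite liftK.
pose M v : 'M[B]_s.+1 := \matrix_(i, j)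
  if unlift ord_max i is Some i' then phi j (x i') else v j.
have detM v : \det (M v) = \sum_j cofactor (M (fun=> 0)) ord_max j * v j.
  rewrite (expand_det_row _ ord_max); apply: eq_bigr => j _.
  rewrite mulrC mxE unlift_none; congr (_ * _ * _); congr (\det _).
  by apply/matrixP => a b; rewrite !mxE liftK.
have [H|H] := pselect (forall y, S y -> \det (M (phi^~ y)) = 0).
  left; exists (cofactor (M (fun=> 0)) ord_max) => [|y Sy]; last by rewrite -detM H.
  exists ord_max; rewrite /cofactor mulf_eq0 signr_eq0 /=.
  move: dx.
  suff -> : row' ord_max (col' ord_max (M (fun=> 0))) =
    (\matrix_(i, j) phi (lift ord_max j) (x i) : 'M[B]_s) by [].
  by apply/matrixP => a b; rewrite !mxE liftK.
have [y Sy dy] : exists2 y, S y & \det (M (phi^~ y)) != 0.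
  apply: contrapT => h; case: H => y Sy; apply/eqP; apply: contrapT => /negP hy.
  by apply: h; exists y.
right; exists (fun i => if unlift ord_max i is Some i' then x i' else y).
  by move=> i; case: unliftP => [j|] _.
move: dy; congr (_ != _); congr (\det _); apply/matrixP => a b; rewrite !mxE.
by case: unliftP.
Qed.

(** * Polynomials vanishing on a variety and independence modulo them *)

Section Vanishing.
Variables (F : numClosedFieldType) (N : nat) (X : set 'rV[F]_N).
Implicit Types (p q : {mpoly F[N]}).

Definition vanish p := forall x, X x -> mpoly_at p x = 0.

Definition indep_on s (p : 'I_s -> {mpoly F[N]}) :=
  forall c : 'I_s -> F, vanish (\sum_i c i *: p i) -> forall i, c i = 0.

(* h is the value at k of the affine Hilbert function of X. *)
Definition hilbert k h :=
  (exists2 p : 'I_h -> {mpoly F[N]}, forall i, (msize (p i) <= k.+1)%N & indep_on p) /\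
  (forall s (p : 'I_s -> {mpoly F[N]}),
     (forall i, (msize (p i) <= k.+1)%N) -> indep_on p -> (s <= h)%N).

Definition irreducible_on := forall p q, vanish (p * q) -> vanish p \/ vanish q.

Lemma mpoly_atD p q x : mpoly_at (p + q) x = mpoly_at p x + mpoly_at q x.
Proof. exact: mevalD. Qed.
Lemma mpoly_atM p q x : mpoly_at (p * q) x = mpoly_at p x * mpoly_at q x.
Proof. exact: mevalM. Qed.
Lemma mpoly_atZ c p x : mpoly_at (c *: p) x = c * mpoly_at p x.
Proof. exact: mevalZ. Qed.
Lemma mpoly_at_sum I (s : seq I) P (f : I -> {mpoly F[N]}) x :
  mpoly_at (\sum_(i <- s | P i) f i) x = \sum_(i <- s | P i) mpoly_at (f i) x.
Proof. exact: raddf_sum. Qed.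

Lemma indep_on_det s (p : 'I_s -> {mpoly F[N]}) (x : 'I_s -> 'rV_N) :
  (forall i, X (x i)) -> \det (\matrix_(i, j) mpoly_at (p j) (x i)) != 0 -> indep_on p.
Proof.
move=> Sx dx c van i; set M := (\matrix_(_, _) _) in dx.
have : M *m \col_j c j = 0.
  apply/colP => a; rewrite !mxE -[RHS](van _ (Sx a)) mpoly_at_sum.
  by apply: eq_bigr => j _; rewrite !mxE mpoly_atZ mulrC.
have uM : M \in unitmx by rewrite unitmxE unitfE.
move=> /(congr1 (mulmx (invmx M))); rewrite mulKmx // mulmx0 => /colP/(_ i).
by rewrite !mxE.
Qed.

End Vanishing.

Section Monomials.
Variables (d k : nat).
Definition mon := {t : d.-tuple 'I_k.+1 | (\sum_(i <- t) i <= k)%N}.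

Lemma card_mon : #|{: mon}| = 'C(d + k, d).
Proof.
rewrite -card_partial_ord_partitions card_sig; apply: eq_card => t.
by rewrite !inE.
Qed.

Definition mon_mnm (t : mon) : 'X_{1..d} := [multinom (tnth (val t) i : nat) | i < d].

Lemma mdeg_mon t : (mdeg (mon_mnm t) <= k)%N.
Proof.
rewrite mdegE; apply: leq_trans (valP t); rewrite big_tuple.
by apply: leq_sum => i _; rewrite mnmE.
Qed.

Lemma mon_mnm_inj : injective mon_mnm.
Proof.
move=> t u /mnmP h; apply/val_inj/eq_from_tnth => i; apply/val_inj.
by have := h i; rewrite !mnmE.
Qed.

End Monomials.

(** [f] is only additive, as it will be a partial derivative applied to coefficients. *)
Lemma map_polyMXaddC (R S : nzRingType) (f : R -> S) (p : {poly R}) a :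
  f 0 = 0 -> {morph f : x y / x + y} ->
  map_poly f (p * 'X + a%:P) = map_poly f p * 'X + (f a)%:P.
Proof.
move=> f0 fD; apply/polyP => j.
rewrite coef_map_id0 // !coefD !coefMX !coefC fD.
by case: j => [|j] /=; rewrite ?f0 ?coef_map_id0.
Qed.

Lemma affine_mulmx (K : comNzRingType) (a b c : nat) (x : 'M[K]_(a, b))
    (B1 B2 : 'M_(b, c)) s i j :
  (x *m (B1 + s *: B2)) i j = (x *m B1) i j + s * (x *m B2) i j.
Proof. by rewrite mulmxDr -scalemxAr [LHS]mxE [X in _ + X]mxE. Qed.

(** * Generic projections and the degree *)

Section GenericProjection.
Variables (F : numClosedFieldType) (N : nat) (X : set 'rV[F]_N) (d : nat).

Local Notation M := (N * d + d + N)%N.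
Local Notation Q := {mpoly F[M]}.

Lemma subst_horner (S : comNzRingType) (inc : {rmorphism F -> S})
    (f : {rmorphism S -> F}) (q : 'I_M -> S) (t : S) (G : {poly Q}) :
  (forall a, f (inc a) = a) ->
  f (map_poly (mmap inc q) G).[t] = (map_poly (meval (fun i => f (q i))) G).[f t].
Proof.
move=> incK; rewrite -horner_map /= -map_poly_comp; congr (_.[_]).
apply: eq_map_poly => p /=.
elim/mpoly_ringind: p => [a|i|p1 p2 IHp IHq|p1 p2 IHp IHq].
- by rewrite mmapC mevalC incK.
- by rewrite mmapX mmap1U mevalXU.
- by rewrite mmapD rmorphD mevalD IHp IHq.
- by rewrite !rmorphM /= IHp IHq.
Qed.

Definition gev (w : 'rV[F]_M) (t : F) (G : {poly Q}) : F :=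
  (map_poly (meval (fun i => w 0 i)) G).[t].

Lemma gevD w t G H : gev w t (G + H) = gev w t G + gev w t H.
Proof. by rewrite /gev rmorphD hornerD. Qed.
Lemma gevN w t G : gev w t (- G) = - gev w t G.
Proof. by rewrite /gev rmorphN hornerN. Qed.
Lemma gevM w t G H : gev w t (G * H) = gev w t G * gev w t H.
Proof. by rewrite /gev rmorphM hornerM. Qed.
Lemma gevC w t (p : Q) : gev w t p%:P = p.@[fun i => w 0 i].
Proof. by rewrite /gev map_polyC hornerC. Qed.
Lemma gevX w t : gev w t 'X = t.
Proof. by rewrite /gev map_polyX hornerX. Qed.
Lemma gevXn w t G k : gev w t (G ^+ k) = gev w t G ^+ k.
Proof. by rewrite /gev rmorphXn horner_exp. Qed.
Lemma gev_sum w t I (s : seq I) P G :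
  gev w t (\sum_(i <- s | P i) G i) = \sum_(i <- s | P i) gev w t (G i).
Proof. by rewrite /gev rmorph_sum horner_sum. Qed.

Definition gpt (A : 'M[F]_(N, d)) (u : 'cV[F]_N) (x : 'rV[F]_N) : 'rV[F]_M :=
  row_mx (row_mx (mxvec A) (x *m A)) u^T.

Definition gval (G : {poly Q}) A u x := gev (gpt A u x) ((x *m u) 0 0) G.

(** The ideal of the generic projection of [X] to [d + 1] coordinates. An element of least degree in
    the main variable plays the role of the minimal polynomial of the form [u] over the [d] forms of
    [A]. *)
Definition proj_rel (G : {poly Q}) := forall A u x, X x -> gval G A u x = 0.

Definition iA (i : 'I_N) (j : 'I_d) : 'I_M := lshift N (lshift d (mxvec_index i j)).
Definition ib (j : 'I_d) : 'I_M := lshift N (rshift (N * d) j).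
Definition iu (i : 'I_N) : 'I_M := rshift (N * d + d) i.

Lemma gptA A u x i j : gpt A u x 0 (iA i j) = A i j.
Proof. by rewrite /gpt row_mxEl row_mxEl mxvecE. Qed.
Lemma gptb A u x j : gpt A u x 0 (ib j) = (x *m A) 0 j.
Proof. by rewrite /gpt row_mxEl row_mxEr. Qed.
Lemma gptu A u x i : gpt A u x 0 (iu i) = u i 0.
Proof. by rewrite /gpt row_mxEr mxE. Qed.

Lemma ixP (P : 'I_M -> Prop) : (forall i j, P (iA i j)) -> (forall j, P (ib j)) ->
  (forall i, P (iu i)) -> forall k, P k.
Proof.
move=> hA hb hu k; case: (split_ordP k) => [k1|k1] ->; last exact: hu.
case: (split_ordP k1) => [k2|k2] ->; last exact: hb.
by case/mxvec_indexP: k2 => i j; exact: hA.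
Qed.

Lemma gval_mpoly G A u : exists g : {mpoly F[N]}, forall x, mpoly_at g x = gval G A u x.
Proof.
have [|q hq] := @boolp.choice 'I_M {mpoly F[N]} (fun i qi =>
     forall x : 'rV_N, qi.@[fun j => x 0 j] = gpt A u x 0 i).
  apply: ixP => [i j|j|i].
  - by exists (A i j)%:MP => x; rewrite mevalC gptA.
  - exists (\sum_k A k j *: 'X_k) => x; rewrite gptb mxE raddf_sum /=.
    by apply: eq_bigr => k _; rewrite mevalZ mevalXU mulrC.
  - by exists (u i 0)%:MP => x; rewrite mevalC gptu.
exists (map_poly (mmap (@mpolyC N F) q) G).[\sum_k u k 0 *: 'X_k] => x.
rewrite /mpoly_at subst_horner => [|a]; last by rewrite /= mevalC.
rewrite /gval /gev; congr (_.[_]).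
  by apply: eq_map_poly => p; apply: meval_eq => i; exact: hq.
rewrite mxE raddf_sum /=.
by apply: eq_bigr => k _; rewrite mevalZ mevalXU mulrC.
Qed.

Lemma gval_line G (A1 : 'M_(N, d)) (u1 : 'cV_N) (A2 : 'M_(N, d)) (u2 : 'cV_N) x : exists g : {poly F}, forall s,
  g.[s] = gval G (A1 + s *: A2) (u1 + s *: u2) x.
Proof.
have [|q hq] := @boolp.choice 'I_M {poly F} (fun i qi =>
     forall s, qi.[s] = gpt (A1 + s *: A2) (u1 + s *: u2) x 0 i).
  apply: ixP => [i j|j|i].
  - exists ((A1 i j)%:P + A2 i j *: 'X) => s.
    by rewrite gptA !mxE hornerD hornerC hornerZ hornerX mulrC.
  - exists (((x *m A1) 0 j)%:P + (x *m A2) 0 j *: 'X) => s.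
    by rewrite gptb affine_mulmx hornerD hornerC hornerZ hornerX mulrC.
  - exists ((u1 i 0)%:P + u2 i 0 *: 'X) => s.
    by rewrite gptu !mxE hornerD hornerC hornerZ hornerX mulrC.
exists (map_poly (mmap (@polyC F) q) G).[((x *m u1) 0 0)%:P + (x *m u2) 0 0 *: 'X] => s.
have := @subst_horner _ (@polyC F) (horner_eval s) q
  (((x *m u1) 0 0)%:P + (x *m u2) 0 0 *: 'X) G.
rewrite /= /horner_eval => -> => [|a]; last by rewrite hornerC.
rewrite /gval /gev; congr (_.[_]).
  by apply: eq_map_poly => p; apply: meval_eq => i; exact: hq.
by rewrite affine_mulmx hornerD hornerC hornerZ hornerX mulrC.
Qed.

Hypothesis irrX : irreducible_on X.

(** This ideal is prime. Witnesses against [G] and [H] live at different [(A, u)]; at a generic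
    point of the line joining these, both still have witnesses, and irreducibility of [X] applies to
    the resulting polynomials in [x]. *)
Lemma proj_rel_mul G H : proj_rel (G * H) -> proj_rel G \/ proj_rel H.
Proof.
move=> GH; apply: contrapT => /not_orP[nG nH].
have wit K : ~ proj_rel K -> exists A u x, X x /\ gval K A u x != 0.
  move=> nK; apply: contrapT => h; apply: nK => A u x Xx; apply/eqP.
  by apply: contrapT => /negP hx; apply: h; exists A, u, x.
have [A1 [u1 [x1 [X1 h1]]]] := wit _ nG.
have [A2 [u2 [x2 [X2 h2]]]] := wit _ nH.
have [g1 hg1] := gval_line G A1 u1 (A2 - A1) (u2 - u1) x1.
have [g2 hg2] := gval_line H A1 u1 (A2 - A1) (u2 - u1) x2.
have n1 : g1 != 0.
  by apply: contraNneq h1 => g10; have := hg1 0; rewrite g10 horner0 !scale0r !addr0 => ->.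
have n2 : g2 != 0.
  apply: contraNneq h2 => g20; have := hg2 1; rewrite g20 horner0 !scale1r.
  by rewrite ![_ + (_ - _)]addrC !subrK => ->.
have [s] : exists s, (g1 * g2).[s] != 0 by apply: poly_neq0_eval; rewrite mulf_neq0.
rewrite hornerM mulf_eq0 negb_or hg1 hg2 => /andP[s1 s2].
set A := _ + _ in s1 s2; set u := u1 + _ in s1 s2.
have [p1 hp1] := gval_mpoly G A u; have [p2 hp2] := gval_mpoly H A u.
have : vanish X (p1 * p2).
  by move=> x Xx; rewrite mpoly_atM hp1 hp2 -gevM; exact: GH.
case/irrX => [/(_ _ X1)|/(_ _ X2)]; rewrite ?hp1 ?hp2; exact/eqP.
Qed.

Lemma gev_deriv_curve (G : {poly Q}) (c : 'I_M -> {poly F}) (t : {poly F}) :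
  ((map_poly (mmap (@polyC F) c) G).[t])^`() =
  (map_poly (mmap (@polyC F) c) G^`()).[t] * t^`() +
  \sum_i (map_poly (mmap (@polyC F) c) (map_poly (mderiv i) G)).[t] * (c i)^`().
Proof.
elim/poly_ind: G => [|G a IH].
  rewrite deriv0 !rmorph0 horner0 deriv0 mul0r add0r big1 // => i _.
  by rewrite !raddf0 horner0 mul0r.
have mdMX i : map_poly (mderiv i) (G * 'X + a%:P) =
    map_poly (mderiv i) G * 'X + (mderiv i a)%:P.
  exact: (map_polyMXaddC _ _ (mderiv0 _ i) (mderivD i)).
under eq_bigr => i _ do rewrite mdMX rmorphD rmorphM /= map_polyX map_polyC hornerD hornerM
  hornerX hornerC mulrDl.
rewrite derivD derivC addr0 derivM derivX mulr1.
rewrite !rmorphD !rmorphM /= !map_polyX map_polyC.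
rewrite !(hornerD, hornerM, hornerX, hornerC) derivD derivM IH big_split /=.
have -> : (mmap (@polyC F) c a)^`() =
    \sum_i mmap (@polyC F) c (mderiv i a) * (c i)^`() by exact: along_deriv.
under [X in _ + (X + _)]eq_bigr => i _ do rewrite mulrAC.
rewrite -mulr_suml; ring.
Qed.

(** Moving [u] in the direction [k] moves [x *m u] with speed [x 0 k] and leaves the relation true,
    so its derivative along this line vanishes. *)
Lemma proj_rel_deriv_u G : proj_rel G -> forall A u x (k : 'I_N), X x ->
  - gval (map_poly (mderiv (iu k)) G) A u x = x 0 k * gval G^`() A u x.
Proof.
move=> rG A u x k Xx.
pose c i : {poly F} := (gpt A u x 0 i)%:P + (i == iu k)%:R *: 'X.
pose t : {poly F} := ((x *m u) 0 0)%:P + x 0 k *: 'X.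
have ev s (H : {poly Q}) : (map_poly (mmap (@polyC F) c) H).[t].[s] =
    gval H A (u + s *: delta_mx k 0) x.
  have := @subst_horner _ (@polyC F) (horner_eval s) c t H.
  rewrite /= /horner_eval => -> => [|a]; last by rewrite hornerC.
  rewrite /gval /gev; congr (_.[_]).
    apply: eq_map_poly => p; apply: meval_eq => i.
    rewrite /c hornerD hornerC hornerZ hornerX; move: i; apply: ixP => [i j|j|i].
    - by rewrite !gptA eq_lrshift mul0r addr0.
    - by rewrite !gptb eq_lrshift mul0r addr0.
    - by rewrite !gptu (inj_eq (@rshift_inj _ _)) !mxE eqxx andbT mulrC.
  rewrite affine_mulmx /t hornerD hornerC hornerZ hornerX mulrC.
  congr (_ + _ * _).
  rewrite mxE (bigD1 k) //= big1 ?addr0 => [|j jk]; first by rewrite mxE !eqxx mulr1.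
  by rewrite mxE (negbTE jk) mulr0.
have P0 : (map_poly (mmap (@polyC F) c) G).[t] = 0.
  by apply: polyF_eq0 => s; rewrite ev rG.
have := congr1 (fun p : {poly F} => p^`().[0]) P0.
rewrite gev_deriv_curve /= deriv0 horner0 hornerD hornerM ev.
rewrite {1}/t derivD derivC add0r derivZ derivX hornerZ hornerC mulr1.
rewrite horner_sum (bigD1 (iu k)) //= big1 ?addr0 => [|i ik]; last first.
  by rewrite /c (negbTE ik) scale0r addr0 derivC mulr0 horner0.
rewrite hornerM ev /c eqxx scale1r derivD derivC add0r derivX hornerC mulr1.
by rewrite scale0r addr0 mulrC => /eqP; rewrite addr_eq0 => /eqP ->.
Qed.

End GenericProjection.

Lemma size_deriv_mpoly (F : numClosedFieldType) m (G : {poly {mpoly F[m]}}) e :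
  size G = e.+2 -> size G^`() = e.+1.
Proof.
move=> sizeG; have Gn0 : G != 0 by rewrite -size_poly_gt0 sizeG.
apply/eqP; rewrite eqn_leq; apply/andP; split.
  by have := lt_size_deriv Gn0; rewrite sizeG.
rewrite leqNgt; apply/negP => h.
have : G^`()`_e = 0 by rewrite nth_default.
rewrite coef_deriv => /eqP; rewrite -mulr_natr mulf_eq0 -mpolyC_nat mpolyC_eq0 pnatr_eq0 orbF.
by have := Gn0; rewrite -lead_coef_eq0 lead_coefE sizeG /= => /negbTE ->.
Qed.

(** * Fibres of the generic projection as roots of a minimal relation *)

Section MinimalRelation.
Variables (F : numClosedFieldType) (N : nat) (X : set 'rV[F]_N) (d : nat).

Local Notation M := (N * d + d + N)%N.
Local Notation Q := {mpoly F[M]}.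
Local Notation proj_rel := (@proj_rel F N X d).
Local Notation gev := (@gev F N d).

Hypothesis irrX : irreducible_on X.
Hypothesis closedX : forall x, (forall p, vanish X p -> mpoly_at p x = 0) -> X x.

Variables (G : {poly Q}) (e : nat).
Hypothesis relG : proj_rel G.
Hypothesis sizeG : size G = e.+2.
Hypothesis minG : forall H : {poly Q}, proj_rel H -> (size H < size G)%N -> H = 0.

Let Gn0 : G != 0. Proof. by rewrite -size_poly_gt0 sizeG. Qed.
Let GT := G^`().
Let Gu k := map_poly (mderiv (iu d k)) G.

Let size_GT : size GT = e.+1. Proof. exact: size_deriv_mpoly. Qed.

Let GTn0 : GT != 0. Proof. by rewrite -size_poly_gt0 size_GT. Qed.

Lemma proj_relE (H : {poly Q}) A u x : proj_rel H -> X x ->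
  gev (gpt A u x) ((x *m u) 0 0) H = 0.
Proof. by move=> rH Xx; exact: (rH A u x Xx). Qed.

Lemma proj_rel_not_small (H : {poly Q}) : H != 0 -> (size H < size G)%N -> ~ proj_rel H.
Proof. by move=> Hn sH rH; move: Hn; rewrite (minG rH sH) eqxx. Qed.

(** The remainder of the pseudo-division of [H] by [G] is a relation of smaller degree, hence 0. So
    [G] divides [H] up to a power of its leading coefficient, also at points [w] that do not come
    from [X]. *)
Lemma proj_rel_root (w : 'rV[F]_M) t (H : {poly Q}) : proj_rel H ->
  (lead_coef G).@[fun i => w 0 i] != 0 -> gev w t G = 0 -> gev w t H = 0.
Proof.
move=> rH lc G0.
have := Pdiv.Idomain.divp_eq H G; set k := Pdiv.Idomain.scalp H G.
set q := Pdiv.Idomain.divp H G; set r := Pdiv.Idomain.modp H G => eqH.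
have r0 : r = 0.
  apply: minG; last by rewrite Pdiv.Idomain.ltn_modp.
  move=> A u x Xx; have := congr1 (fun p => gval p A u x) eqH.
  rewrite /gval gevD -mul_polyC !gevM (proj_relE _ _ rH) // (proj_relE _ _ relG) //.
  by rewrite !mulr0 add0r => <-.
have := congr1 (gev w t) eqH; rewrite r0 addr0 -mul_polyC !gevM G0 mulr0 gevC rmorphXn /=.
by move/eqP; rewrite mulf_eq0 expf_eq0 (negbTE lc) andbF => /eqP.
Qed.

(** [rho] serves as a discriminant. If the gcd of [G] and its derivative had positive degree,
    primality would produce a relation shorter than [G]: either the cofactor of the gcd or the gcd
    itself. *)
Lemma bezout_disc : exists rho : Q, rho != 0 /\
  exists U V : {poly Q}, rho%:P = U * G + V * GT.
Proof.
have := Pdiv.Idomain.Bezoutp G GT; case=> [[U V]] /=.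
set g := Pdiv.Idomain.gcdp G GT => eqg.
have gn0 : g != 0 by rewrite Pdiv.Idomain.gcdp_eq0 negb_and Gn0.
have sg : size g = 1%N.
  apply/eqP; rewrite eqn_leq size_poly_gt0 gn0 andbT leqNgt; apply/negP => sg.
  have /Pdiv.Idomain.dvdpP [[c q] /= cn0 eqG] := Pdiv.Idomain.dvdp_gcdl G GT.
  rewrite -/g in eqG.
  have qn0 : q != 0.
    apply: contraNneq Gn0 => q0; move/eqP: eqG; rewrite q0 mul0r -mul_polyC mulf_eq0 polyC_eq0 (negbTE cn0) //.
  have : proj_rel (q * g).
    by move=> A u x Xx; rewrite -eqG /gval -mul_polyC gevM (proj_relE _ _ relG) ?mulr0.
  case/(proj_rel_mul irrX).
    apply: proj_rel_not_small => //; have := congr1 (fun p : {poly Q} => size p) eqG.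
    rewrite size_scale // size_mul // => ->; move: sg; case: (size g) => [|[|m]] // _.
    by rewrite !addnS /= ltnS leq_addr.
  apply: proj_rel_not_small => //; apply: leq_ltn_trans (Pdiv.Idomain.leq_gcdpr _ GTn0) _.
  by rewrite size_GT sizeG.
have /Pdiv.Idomain.eqpP [[c1 c2] /= /andP[c1n c2n] eq12] := eqg.
have [c cn0 gE] : exists2 c : Q, c != 0 & g = c%:P.
  by have /eqP/size_poly1P [c cn0 ->] := sg; exists c.
exists (c2 * c); split; first by rewrite mulf_neq0.
exists (c1 *: U), (c1 *: V).
by rewrite -!scalerAl -scalerDr eq12 gE -mul_polyC -polyCM.
Qed.

(* Kronecker: x_k = - G_{u_k} / G_T on X, so every polynomial in x becomes,
   after multiplication by a power of G_T, a polynomial in (A, b, u, T). *)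
Lemma kronecker_lift (p : {mpoly F[N]}) : exists k (H : {poly Q}), forall (w : 'rV[F]_M) t (x : 'rV[F]_N),
  (forall i, - gev w t (Gu i) = x 0 i * gev w t GT) ->
  gev w t H = mpoly_at p x * gev w t GT ^+ k.
Proof.
elim/mpoly_ringind: p => [a|i|p q [k1 [H1 h1]] [k2 [H2 h2]]|p q [k1 [H1 h1]] [k2 [H2 h2]]].
- exists 0%N, (a%:MP)%:P => w t x _.
  by rewrite gevC expr0 mulr1 /mpoly_at !mevalC.
- by exists 1%N, (- Gu i) => w t x h; rewrite gevN expr1 /mpoly_at mevalXU h.
- exists (k1 + k2)%N, (H1 * GT ^+ k2 + H2 * GT ^+ k1) => w t x h.
  rewrite gevD !gevM !gevXn (h1 _ _ _ h) (h2 _ _ _ h) mpoly_atD exprD; ring.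
- exists (k1 + k2)%N, (H1 * H2) => w t x h.
  rewrite gevM (h1 _ _ _ h) (h2 _ _ _ h) mpoly_atM exprD; ring.
Qed.

Lemma kronecker A u x : X x -> forall i,
  - gval (Gu i) A u x = x 0 i * gval GT A u x.
Proof. by move=> Xx i; exact: (proj_rel_deriv_u relG A u i Xx). Qed.

Section Fiber.
Variables (A : 'M[F]_(N, d)) (b : 'rV[F]_d) (u : 'cV[F]_N).
Let w := row_mx (row_mx (mxvec A) b) u^T.
Hypothesis lcw : (lead_coef G).@[fun i => w 0 i] != 0.
Variables (rho : Q) (U V : {poly Q}).
Hypothesis rhoE : rho%:P = U * G + V * GT.
Hypothesis rhow : rho.@[fun i => w 0 i] != 0.

Let g := map_poly (meval (fun i => w 0 i)) G.

Let gE t : g.[t] = gev w t G. Proof. by []. Qed.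

Let size_g : size g = e.+2.
Proof. by rewrite /g size_map_poly_id0. Qed.

Let GTw t : gev w t G = 0 -> gev w t GT != 0.
Proof.
move=> G0; apply: contraNneq rhow => GT0.
by rewrite -(gevC w t) rhoE gevD !gevM G0 GT0 !mulr0 addr0.
Qed.

Let pnt t : 'rV[F]_N := \row_k (- gev w t (Gu k) / gev w t GT).

Let pntE t : gev w t G = 0 ->
  forall i, - gev w t (Gu i) = pnt t 0 i * gev w t GT.
Proof. by move=> /GTw h i; rewrite mxE mulfVK. Qed.

Let w_A i j : w 0 (iA i j) = A i j.
Proof. by rewrite /w row_mxEl row_mxEl mxvecE. Qed.
Let w_b j : w 0 (ib N j) = b 0 j.
Proof. by rewrite /w row_mxEl row_mxEr. Qed.
Let w_u i : w 0 (iu d i) = u i 0.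
Proof. by rewrite /w row_mxEr mxE. Qed.

(** A polynomial of the ideal of [X] lifts to a relation, which must vanish at every root [t] of [G]
    over [w]. The candidate point thus satisfies all equations of the closed set [X]. *)
Let pnt_X t : gev w t G = 0 -> X (pnt t).
Proof.
move=> G0; apply: closedX => p vp; have [k [H hH]] := kronecker_lift p.
have rH : proj_rel H.
  move=> A' u' x Xx; rewrite /gval (hH _ _ x); last exact: kronecker.
  by rewrite vp // mul0r.
have := proj_rel_root rH lcw G0; rewrite (hH _ _ (pnt t)); last exact: pntE.
by move/eqP; rewrite mulf_eq0 expf_eq0 (negbTE (GTw G0)) andbF orbF => /eqP.
Qed.

Let pnt_b t : gev w t G = 0 -> pnt t *m A = b.
Proof.
move=> G0; apply/rowP => j.
pose H := \sum_k (- Gu k) * ('X_(iA k j))%:P - ('X_(ib N j))%:P * GT.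
have rH : proj_rel H.
  move=> A' u' x Xx; rewrite /gval gevD gevN gev_sum gevM gevC mevalXU gptb.
  rewrite [X in X - _](eq_bigr (fun k => x 0 k * A' k j *
      gev (gpt A' u' x) ((x *m u') 0 0) GT)) => [|k _].
    by rewrite -mulr_suml -mulrBl [X in _ - X]mxE subrr mul0r.
  by rewrite gevM gevN gevC mevalXU gptA [- _](kronecker A' u' Xx) mulrAC.
have := proj_rel_root rH lcw G0; rewrite gevD gevN gev_sum gevM gevC mevalXU w_b => /eqP.
rewrite subr_eq0 => /eqP h; apply: (mulIf (GTw G0)).
rewrite -h [(_ *m _) _ _]mxE mulr_suml.
by apply: eq_bigr => k _; rewrite gevM gevN gevC mevalXU w_A pntE // mulrAC.
Qed.

Let pnt_u t : gev w t G = 0 -> (pnt t *m u) 0 0 = t.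
Proof.
move=> G0; pose H := \sum_k (- Gu k) * ('X_(iu d k))%:P - 'X * GT.
have rH : proj_rel H.
  move=> A' u' x Xx; rewrite /gval gevD gevN gev_sum gevM gevX.
  rewrite [X in X - _](eq_bigr (fun k => x 0 k * u' k 0 *
      gev (gpt A' u' x) ((x *m u') 0 0) GT)) => [|k _].
    by rewrite -mulr_suml -mulrBl [X in _ - X]mxE subrr mul0r.
  by rewrite gevM gevN gevC mevalXU gptu [- _](kronecker A' u' Xx) mulrAC.
have := proj_rel_root rH lcw G0; rewrite gevD gevN gev_sum gevM gevX => /eqP.
rewrite subr_eq0 => /eqP h; apply: (mulIf (GTw G0)).
rewrite -h [(_ *m _) _ _]mxE mulr_suml.
by apply: eq_bigr => k _; rewrite gevM gevN gevC mevalXU w_u pntE // mulrAC.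
Qed.

(** [pnt] and the form [u] are inverse to each other between the roots of [g] and the section. The
    [e.+1] roots are simple because [rho] specialises to a nonzero constant in the ideal of [g] and
    its derivative. *)
Lemma fiber_card : (X `&` affine_subspace A b #= `I_(e.+1))%card.
Proof.
have [rs gprod] := closed_field_poly_normal g.
have gn0 : g != 0 by rewrite -size_poly_gt0 size_g.
have srs : size rs = e.+1.
  have := congr1 (fun p : {poly F} => size p) gprod.
  by rewrite size_g size_scale ?lead_coef_eq0 // size_prod_XsubC => -[].
have rsP t : (t \in rs) = (gev w t G == 0).
  rewrite -gE gprod hornerZ mulf_eq0 lead_coef_eq0 (negbTE gn0) /=.
  by rewrite -[_ == 0]/(root _ t) root_prod_XsubC.
have urs : uniq rs.
  rewrite -separable_prod_XsubC.
  have : separable_poly g.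
    have cst : (rho.@[fun i => w 0 i])%:P =
        map_poly (meval (fun i => w 0 i)) U * g + map_poly (meval (fun i => w 0 i)) V * g^`().
      by rewrite -map_polyC rhoE rmorphD !rmorphM /= deriv_map.
    rewrite unlock; apply/Bezout_eq1_coprimepP.
    exists ((rho.@[fun i => w 0 i])^-1 *: map_poly (meval (fun i => w 0 i)) U,
            (rho.@[fun i => w 0 i])^-1 *: map_poly (meval (fun i => w 0 i)) V) => /=.
    by rewrite -!scalerAl -scalerDr -cst -mul_polyC -polyCM mulVf.
  rewrite gprod !unlock derivZ coprimepZl ?lead_coef_eq0 //.
  by rewrite coprimepZr ?lead_coef_eq0.
pose f i := pnt (nth 0 rs i).
have fin i : (i < e.+1)%N -> gev w (nth 0 rs i) G = 0.
  by move=> hi; apply/eqP; rewrite -rsP mem_nth ?srs.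
have finj : {in `I_(e.+1) &, injective f}%classic.
  move=> i j; rewrite !inE /= => hi hj fij.
  have := congr1 (fun v : 'rV_N => (v *m u) 0 0) fij.
  by rewrite /f !pnt_u ?fin // => /eqP; rewrite nth_uniq ?srs // => /eqP.
suff -> : X `&` affine_subspace A b = (f @` `I_(e.+1))%classic by exact: inj_card_eq.
apply/seteqP; split=> [x [Xx xb]|_ [i /= /fin h <-]]; last first.
  by split; [exact: pnt_X|exact: pnt_b].
have wE : w = gpt A u x by rewrite /w /gpt -xb.
pose t := (x *m u) 0 0.
have G0 : gev w t G = 0 by rewrite wE; exact: relG.
have tin : t \in rs by rewrite rsP G0.
exists (index t rs) => /=; first by rewrite -srs index_mem.
rewrite /f nth_index //; apply/rowP => k; apply: (mulIf (GTw G0)).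
by rewrite -pntE //; have := kronecker A u Xx k; rewrite /gval -wE.
Qed.

End Fiber.

Lemma generic_fiber : (d <= N)%N ->
  generically (fun v : 'rV[F]_(N * d + d) =>
      let A : 'M[F]_(N, d) := vec_mx (lsubmx v) in
      let b : 'rV[F]_d := rsubmx v in
      \rank A = d /\ (X `&` affine_subspace A b #= `I_(e.+1))%card).
Proof.
move=> dN; have [rho [rhon0 [U [V rhoE]]]] := bezout_disc.
pose minorA : 'M[Q]_d := \matrix_(i, j) 'X_(iA (widen_ord dN i) j).
have minorE (A : 'M_(N, d)) b u :
    (\det minorA).@[fun i => row_mx (row_mx (mxvec A) b) u 0 i] =
    \det (rowsub (widen_ord dN) A).
  rewrite -det_map_mx; congr (\det _); apply/matrixP => i j.
  by rewrite !mxE /= mevalXU row_mxEl row_mxEl mxvecE.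
have minorn0 : \det minorA != 0.
  have := minorE (pid_mx d) 0 0; rewrite (_ : rowsub _ _ = 1%:M).
    by rewrite det1 => h; apply/eqP => h0; move/eqP: h; rewrite h0 meval0 eq_sym oner_eq0.
  apply/matrixP => i j; rewrite !mxE /= ltn_ord andbT.
  by rewrite -(inj_eq val_inj).
have Pn0 : lead_coef G * rho * \det minorA != 0.
  by rewrite !mulf_neq0 // lead_coef_eq0.
have [w0 hw0] := mpoly_neq0_eval Pn0.
(* Freezing [u] where the product is not identically zero leaves a nonzero condition on [(A, b)]
   alone: the leading coefficient and [rho] control the fibre, the minor the rank. *)
pose u := (rsubmx w0)^T.
pose T := [tuple (match fintype.split i with
  | inl j => 'X_j : {mpoly F[N * d + d]}
  | inr k => (u k 0)%:MP end) | i < M].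
have TE (p : Q) (v : 'rV_(N * d + d)) :
    mpoly_at (p \mPo T) v = p.@[fun i => row_mx v u^T 0 i].
  rewrite /mpoly_at comp_mpoly_meval; apply: meval_eq => i.
  rewrite tnth_mktuple; case: (split_ordP i) => j ->.
    by rewrite mevalXU row_mxEl.
  by rewrite mevalC row_mxEr [RHS]mxE.
exists ((lead_coef G * rho * \det minorA) \mPo T).
  apply/eqP => h; have := TE (lead_coef G * rho * \det minorA) (lsubmx w0).
  rewrite h /mpoly_at meval0 /u trmxK hsubmxK => h2; move/eqP: hw0; apply.
  by rewrite /mpoly_at -h2.
move=> v; rewrite TE !mevalM !mulf_eq0 !negb_or -{1 2 3}[v]hsubmxK -{1 2 3}[lsubmx v]vec_mxK.
move=> /andP[/andP[h1 h2] h3] /=; split.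
  apply/eqP; rewrite eqn_leq rank_leq_col /=.
  move: h3; rewrite minorE; set A := vec_mx _ => h3.
  have /mxrank_unit rk : rowsub (widen_ord dN) A \in unitmx by rewrite unitmxE unitfE.
  apply: leq_trans (mxrankM_maxr (rowsub (widen_ord dN) 1%:M) A).
  by rewrite -rowsubE rk.
exact: (fiber_card h1 rhoE h2).
Qed.

End MinimalRelation.

Section Degree.
Variables (K : idomainType) (m : nat).
Implicit Types p q : {mpoly K[m]}.

Lemma msizeM_leq p q a b :
  (msize p <= a.+1)%N -> (msize q <= b.+1)%N -> (msize (p * q) <= (a + b).+1)%N.
Proof.
have [->|p0] := eqVneq p 0; first by rewrite mul0r msize0.
have [->|q0] := eqVneq q 0; first by rewrite mulr0 msize0.
rewrite msizeM //; lia.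
Qed.

Lemma msizeXn_leq p a k : (msize p <= a.+1)%N -> (msize (p ^+ k) <= (a * k).+1)%N.
Proof.
move=> hp; elim: k => [|k IH]; first by rewrite expr0 msize1 muln0.
by rewrite exprS mulnS; apply: msizeM_leq.
Qed.

Lemma msize_prod_leq I (r : seq I) (f : I -> {mpoly K[m]}) (a : I -> nat) :
  (forall i, (msize (f i) <= (a i).+1)%N) ->
  (msize (\prod_(i <- r) f i) <= (\sum_(i <- r) a i).+1)%N.
Proof.
move=> h; elim: r => [|i r IH]; first by rewrite !big_nil msize1.
by rewrite !big_cons; apply: msizeM_leq.
Qed.

Lemma msize_sum_leq I (r : seq I) (f : I -> {mpoly K[m]}) a :
  (forall i, (msize (f i) <= a)%N) -> (msize (\sum_(i <- r) f i) <= a)%N.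
Proof.
move=> h; apply: leq_trans (msize_sum _ _ _) _.
by elim: r => [|i r IH]; rewrite ?big_nil // big_cons geq_max h.
Qed.

Lemma msizeC_leq (c : K) a : (msize (c%:MP : {mpoly K[m]}) <= a.+1)%N.
Proof. by rewrite msizeC; case: (c != 0). Qed.

Definition linform (u : 'cV[K]_m) : {mpoly K[m]} := \sum_k u k 0 *: 'X_k.

Lemma msize_linform u : (msize (linform u) <= 2)%N.
Proof.
apply: msize_sum_leq => k; apply: leq_trans (msizeZ_le _ _) _.
by rewrite msizeX mdeg1.
Qed.

Lemma linformE u (x : 'rV[K]_m) : (linform u).@[fun i => x 0 i] = (x *m u) 0 0.
Proof.
rewrite mxE /linform raddf_sum /=; apply: eq_bigr => k _.
by rewrite mevalZ mevalXU mulrC.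
Qed.

End Degree.

(** * Relations of small degree by counting monomials *)

Section RelationExists.
Variables (F : numClosedFieldType) (N : nat) (X : set 'rV[F]_N) (d : nat).
Variable h : nat -> nat.
Hypothesis hX : forall k, hilbert X k (h k).

Local Notation M := (N * d + d + N)%N.
Local Notation P := (N * d + N)%N.

Variables (k J : nat).
Local Notation I := (mon d k * 'I_J)%type.

Let L i (x : 'rV[F]_N) : {mpoly F[P]} := \sum_k x 0 k *: 'X_(lshift N (mxvec_index k i)).
Let Th (x : 'rV[F]_N) : {mpoly F[P]} := \sum_k x 0 k *: 'X_(rshift (N * d) k).
Let phi (z : I) (x : 'rV[F]_N) : {mpoly F[P]} :=
  (\prod_(i < d) L i x ^+ (mon_mnm z.1 i)) * Th x ^+ z.2.

Let phiE (z : I) x (A : 'M_(N, d)) (u : 'cV_N) :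
  (phi z x).@[fun i => row_mx (mxvec A) u^T 0 i] =
  (\prod_(i < d) ((x *m A) 0 i) ^+ (mon_mnm z.1 i)) * ((x *m u) 0 0) ^+ z.2.
Proof.
rewrite /phi mevalM rmorph_prod rmorphXn /=; congr (_ * _ ^+ _).
  apply: eq_bigr => i _; rewrite rmorphXn /= /L raddf_sum /=; congr (_ ^+ _); rewrite mxE.
  by apply: eq_bigr => j _; rewrite mevalZ mevalXU row_mxEl mxvecE.
rewrite /Th raddf_sum /= [RHS]mxE; apply: eq_bigr => j _.
by rewrite mevalZ mevalXU row_mxEr mxE.
Qed.

(** The ['C(d + k, d) * J] products of a monomial in [d] forms with a power of one more form are
    either dependent over the polynomials in [(A, u)], which is a relation, or independent on [X]
    for some values of [A] and [u]. In the second case their degree, at most [k + J], contradicts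
    [hX]. *)
Lemma relation_exists : (h (k + J) < 'C(d + k, d) * J)%N ->
  exists G : {poly {mpoly F[M]}}, [/\ G != 0, proj_rel X G & (size G <= J)%N].
Proof.
have cardI : #|{: I}| = ('C(d + k, d) * J)%N by rewrite card_prod card_mon card_ord.
rewrite -cardI => hlt.
have [[c0 [i0 c0n0] c0P]|[x Xx dx]] :=
    dependent_or_det X (fun (i : 'I_#|{: I}|) x => phi (enum_val i) x); last first.
  have [a ha] := mpoly_neq0_eval dx.
  pose A : 'M_(N, d) := vec_mx (lsubmx a); pose u := (rsubmx a)^T.
  have aE : a = row_mx (mxvec A) u^T by rewrite vec_mxK trmxK hsubmxK.
  pose p (i : 'I_#|{: I}|) : {mpoly F[N]} :=
    (\prod_(j < d) linform (col j A) ^+ (mon_mnm (enum_val i).1 j)) *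
    linform u ^+ (enum_val i).2.
  have pE i y : mpoly_at (p i) y = (phi (enum_val i) y).@[fun i => a 0 i].
    rewrite aE phiE /mpoly_at /p mevalM rmorph_prod rmorphXn /= linformE.
    congr (_ * _); apply: eq_bigr => j _; rewrite rmorphXn /= linformE.
    by congr (_ ^+ _); rewrite !mxE; apply: eq_bigr => l _; rewrite mxE.
  have ip : indep_on X p.
    apply: (indep_on_det Xx); move: ha; rewrite /mpoly_at -det_map_mx.
    by congr (\det _ != 0); apply/matrixP => i j; rewrite !mxE; exact/esym/pE.
  have [_ /(_ _ p)] := hX (k + J); rewrite leqNgt hlt => hh; suff : false by [].
  apply: hh => // i; rewrite -addnS; apply: (@leq_trans (k + (enum_val i).2).+1); last first.
    by rewrite -addnS leq_add2l ltnW // ltnS ltn_ord.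
  apply: msizeM_leq; last by rewrite -{2}[val _]mul1n; apply/msizeXn_leq/msize_linform.
  apply: leq_trans (msize_prod_leq (a := fun j => mon_mnm (enum_val i).1 j) _ _) _ => [j|].
    by rewrite -{2}[mon_mnm _ j]mul1n; apply/msizeXn_leq/msize_linform.
  by rewrite ltnS -mdegE mdeg_mon.
pose c (z : I) := c0 (enum_rank z).
have cP x : X x -> \sum_z c z * phi z x = 0.
  move=> Xx; rewrite -[RHS](c0P x Xx) (big_enum_val _ (A := predT)) /=.
  apply: eq_bigr => i _; by rewrite /c enum_valK.
have [z0 cz0] : exists z, c z != 0 by exists (enum_val i0); rewrite /c enum_valK.
pose T := [tuple (match fintype.split i with
  | inl j => 'X_(lshift N (lshift d j)) : {mpoly F[M]}
  | inr j => 'X_(rshift (N * d + d) j) end) | i < P].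
have TE (q : {mpoly F[P]}) (A : 'M_(N, d)) b (u : 'rV_N) :
    (q \mPo T).@[fun i => row_mx (row_mx (mxvec A) b) u 0 i] =
    q.@[fun i => row_mx (mxvec A) u 0 i].
  rewrite comp_mpoly_meval; apply: meval_eq => i.
  rewrite tnth_mktuple; case: (split_ordP i) => j ->.
    by rewrite mevalXU !row_mxEl.
  by rewrite mevalXU !row_mxEr.
pose mo (z : I) : {mpoly F[M]} := \prod_(i < d) 'X_(ib N i) ^+ (mon_mnm z.1 i).
have moE z A b u : (mo z).@[fun i => row_mx (row_mx (mxvec A) b) u 0 i] =
    \prod_(i < d) (b 0 i) ^+ (mon_mnm z.1 i).
  rewrite rmorph_prod; apply: eq_bigr => i _.
  by rewrite rmorphXn /= mevalXU row_mxEl row_mxEr.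
pose G : {poly {mpoly F[M]}} := \sum_z ((c z \mPo T) * mo z)%:P * 'X^(z.2).
exists G; split.
(* The forms in the monomials were replaced by the variables [b], so distinct monomials cannot
   cancel: with [A], [u] fixed where one coefficient is nonzero, a single power of the main variable
   is read as a polynomial in [b]. *)
- have [a ha] := mpoly_neq0_eval cz0.
  pose A : 'M_(N, d) := vec_mx (lsubmx a); pose u := rsubmx a.
  have aE : a = row_mx (mxvec A) u by rewrite vec_mxK hsubmxK.
  apply: contraNneq ha => G0.
  pose R : {mpoly F[d]} := \sum_(t : mon d k) mpoly_at (c (t, z0.2)) a *: 'X_[mon_mnm t].
  have R0 : R = 0.
    apply: mpoly_eval_eq0 => v; pose b : 'rV_d := \row_i v i.
    have := congr1 (fun H : {poly {mpoly F[M]}} =>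
      (H`_(z0.2)).@[fun i => row_mx (row_mx (mxvec A) b) u 0 i]) G0.
    rewrite /= coef0 meval0 => <-; rewrite coef_sum !raddf_sum /=.
    rewrite (eq_bigr (fun z : I => if z.2 == z0.2 then mpoly_at (c z) a *
       ('X_[mon_mnm z.1]).@[v] else 0)) => [|z _]; last first.
      rewrite coefCM coefXn val_eqE eq_sym mulr_natr mevalMn; case: eqVneq => [_|ne].
        rewrite mulr1n mevalM TE moE /mpoly_at -aE mevalX; congr (_ * _).
        by apply: eq_bigr => i _; rewrite mxE.
      by rewrite mulr0n.
    pose H t j := if j == z0.2 then mpoly_at (c (t, j)) a * ('X_[mon_mnm t]).@[v] else 0.
    rewrite (eq_bigr (fun z : I => H z.1 z.2)) => [|[t j] _] //.
    rewrite -(pair_bigA _ H) /H /=.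
    by apply: eq_bigr => t _; rewrite -big_mkcond big_pred1_eq mevalZ.
  have := congr1 (mcoeff (mon_mnm z0.1)) R0; rewrite mcoeff0 raddf_sum /=.
  rewrite (bigD1 z0.1) //= big1 => [|t tz]; last first.
    by rewrite mcoeffZ mcoeffX (inj_eq (@mon_mnm_inj d k)) (negbTE tz) mulr0.
  by rewrite mcoeffZ mcoeffX eqxx mulr1 addr0 -surjective_pairing => ->.
- move=> A u x Xx; rewrite /gval /G gev_sum.
  have := congr1 (meval (fun i => row_mx (mxvec A) u^T 0 i)) (cP x Xx).
  rewrite meval0 raddf_sum /= => cx0; rewrite -[RHS]cx0; apply: eq_bigr => z _.
  by rewrite gevM gevXn gevX gevC [RHS]mevalM phiE mevalM TE moE mulrA.
- apply: leq_trans (size_sum _ _ _) _; apply/bigmax_leqP => z _.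
  rewrite mul_polyC; apply: leq_trans (size_scale_leq _ _) _.
  by rewrite size_polyXn.
Qed.

End RelationExists.

(** * Division with control of the total degree *)

Section WeightedDegree.
Variables (F : numClosedFieldType) (m : nat).
Local Notation Pm := {mpoly F[m]}.
Implicit Types S T : {poly Pm}.

Lemma msize_leqP (p : Pm) n :
  (forall mm, p@_mm != 0 -> (mdeg mm < n)%N) <-> (msize p <= n)%N.
Proof.
split=> [h|h mm]; last by rewrite -mcoeff_msupp => /msize_mdeg_lt /leq_trans; apply.
rewrite msizeE; elim: (msupp p) (fun mm => @mcoeff_msupp m F p mm) => [|a s IH] hs.
  by rewrite big_nil.
rewrite big_seq_cond; apply: (big_ind (fun k => k <= n)%N) => // [x y hx hy|mm].
  by rewrite geq_max hx.
by rewrite andbT hs; exact: h.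
Qed.

Definition wdeg D S := forall j mm, (S`_j)@_mm != 0 -> (mdeg mm + j <= D)%N.

Lemma wdegD D S T : wdeg D S -> wdeg D T -> wdeg D (S + T).
Proof.
move=> hS hT j mm; rewrite coefD mcoeffD => h.
have [S0|/hS //] := eqVneq (S`_j)@_mm 0.
by apply: hT; move: h; rewrite S0 add0r.
Qed.

Lemma wdegN D S : wdeg D S -> wdeg D (- S).
Proof. by move=> hS j mm; rewrite coefN mcoeffN oppr_eq0 => /hS. Qed.

Lemma wdegM D1 D2 S T : wdeg D1 S -> wdeg D2 T -> wdeg (D1 + D2) (S * T).
Proof.
move=> hS hT j mm; apply: contraNT; rewrite -ltnNge => hlt.
rewrite coefM raddf_sum big1 //= => i _; rewrite mcoeffM big1 // => -[k1 k2] /= /eqP e.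
apply/eqP; rewrite mulf_eq0; apply: contraT; rewrite negb_or => /andP[/hS h1 /hT h2].
have := congr1 (@mdeg m) e; rewrite mdegD; have := ltn_ord i; rewrite ltnS; lia.
Qed.

Lemma wdeg_leq D D' S : (D <= D')%N -> wdeg D S -> wdeg D' S.
Proof. by move=> h hS j mm /hS hh; apply: leq_trans hh h. Qed.

Lemma wdegC D (p : Pm) : (msize p <= D.+1)%N -> wdeg D p%:P.
Proof.
move=> /msize_leqP h j mm; rewrite coefC; case: (j =P 0%N) => [->|_]; last by rewrite mcoeff0 eqxx.
by rewrite addn0 => /h.
Qed.

Lemma wdegXn k : wdeg k 'X^k.
Proof.
move=> j mm; rewrite coefXn; case: (j =P k) => [->|_]; last by rewrite mcoeff0 eqxx.
by rewrite mcoeff1; case: (mm =P 0%MM) => [->|_]; rewrite ?eqxx // mdeg0.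
Qed.

Lemma wdegX : wdeg 1 'X.
Proof. by have := @wdegXn 1%N; rewrite expr1. Qed.

Lemma wdeg1 : wdeg 0 1.
Proof. by rewrite -[1]/((1 : Pm)%:P); apply: wdegC; rewrite msize1. Qed.

Lemma wdegMn D S k : wdeg D S -> wdeg (D * k) (S ^+ k).
Proof.
move=> hS; elim: k => [|k IH]; first by rewrite expr0 muln0; exact: wdeg1.
by rewrite exprS mulnS; exact: wdegM.
Qed.

Lemma wdeg_prod I (r : seq I) (S : I -> {poly Pm}) (D : I -> nat) :
  (forall i, wdeg (D i) (S i)) -> wdeg (\sum_(i <- r) D i) (\prod_(i <- r) S i).
Proof.
move=> h; elim: r => [|i r IH]; rewrite ?big_nil ?big_cons; first exact: wdeg1.
exact: wdegM.
Qed.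

Definition wtop D S : F := (S`_D)@_0%MM.

Lemma wdeg_top D S : wdeg D S -> S`_D = (wtop D S)%:MP.
Proof.
move=> hS; apply/mpolyP => mm; rewrite mcoeffC /wtop.
have [->|n0] := eqVneq mm 0%MM; first by rewrite mulr1.
rewrite mulr0; apply/eqP; apply: contraT => /hS; rewrite addnC -leq_subRL // subnn leqn0.
by rewrite mdeg_eq0 (negbTE n0).
Qed.

Lemma wdeg_big D S j : wdeg D S -> (D < j)%N -> S`_j = 0.
Proof.
move=> hS hj; apply/mpolyP => mm; rewrite mcoeff0; apply/eqP; apply: contraT => /hS; lia.
Qed.

Lemma wdeg_size D S : wdeg D S -> (size S <= D.+1)%N.
Proof. by move=> hS; apply/leq_sizeP => j hj; exact: (wdeg_big hS). Qed.

Lemma wtopM D1 D2 S T : wdeg D1 S -> wdeg D2 T ->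
  wtop (D1 + D2) (S * T) = wtop D1 S * wtop D2 T.
Proof.
move=> hS hT; rewrite {1}/wtop coefM.
have h1 : (D1 < (D1 + D2).+1)%N by rewrite ltnS leq_addr.
rewrite (bigD1 (Ordinal h1)) //= addKn big1 => [|i ne].
  by rewrite addr0 (wdeg_top hS) (wdeg_top hT) -mpolyCM mcoeffC eqxx mulr1.
have [lt|ge] := ltnP D1 i; first by rewrite (wdeg_big hS lt) mul0r.
rewrite (wdeg_big hT) ?mulr0 //.
have : (i < D1)%N by rewrite ltn_neqAle ge andbT; apply: contraNneq ne => e; apply/eqP/val_inj.
lia.
Qed.

(** The coefficient of ['X^q] in [R] is a nonzero constant because the total degree of [R] is at
    most [q]. Division by [R] therefore never raises the total degree. *)
Lemma wdeg_reduce q (R : {poly Pm}) : wdeg q R -> wtop q R != 0 ->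
  forall D S, wdeg D S -> exists S' Q, [/\ (size S' <= q)%N, wdeg D S' & S = Q * R + S'].
Proof.
move=> hR topR D S; move: {2}(size S) (leqnn (size S)) => k.
elim: k S => [|k IH] S hk hS.
  by exists S, 0; rewrite mul0r add0r; split=> //; apply: leq_trans hk _.
have [small|big] := leqP (size S) q; first by exists S, 0; rewrite mul0r add0r.
set n := (size S).-1; have nE : size S = n.+1 by rewrite /n prednK // (leq_ltn_trans _ big).
have qn : (q <= n)%N by rewrite -ltnS -nE.
pose a := wtop q R; pose C : {poly Pm} := (a^-1 *: S`_n)%:P * 'X^(n - q).
have [n0|] := eqVneq S`_n 0.
  by have := lead_coef_eq0 S; rewrite lead_coefE nE n0 eqxx -size_poly_eq0 nE.
move=> Sn.
have nD : (n <= D)%N.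
  by rewrite leqNgt; apply/negP => /(wdeg_big hS) h; rewrite h eqxx in Sn.
have hC : wdeg (D - q) C.
  have -> : (D - q = (D - n) + (n - q))%N by lia.
  apply: wdegM (@wdegXn _); apply: wdegC; apply: leq_trans (msizeZ_le _ _) _.
  by apply/msize_leqP => mm /hS h; rewrite ltnS; lia.
have hCR : wdeg D (C * R) by rewrite -[D](subnK (leq_trans qn nD)); exact: wdegM.
have [||S' [Q [h1 h2 h3]]] := IH (S - C * R).
- apply/leq_sizeP => j hj; rewrite coefB.
  have sCR : (size (C * R)%R <= n.+1)%N.
    apply: leq_trans (size_mul_leq _ _) _; have := wdeg_size hR.
    have : (size C <= (n - q).+1)%N.
      by rewrite /C mul_polyC; apply: leq_trans (size_scale_leq _ _) _; rewrite size_polyXn.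
    lia.
  have [->|ne] := eqVneq j n; last first.
    have lt : (n < j)%N by move: hk; rewrite nE; move/eqP: ne; lia.
    by rewrite !nth_default ?subrr ?nE //; apply: leq_trans sCR lt.
  have -> : C * R = (a^-1 *: S`_n)%:P * (R * 'X^(n - q)) by rewrite /C; ring.
  rewrite coefCM coefMXn ltnNge leq_subr /= subKn // (wdeg_top hR) -/a.
  by rewrite mulrC mul_mpolyC scalerA divff // scale1r subrr.
- by apply: wdegD => //; exact: wdegN.
by exists S', (C + Q); split=> //; rewrite mulrDl -addrA -h3 addrC subrK.
Qed.

End WeightedDegree.

Section Span.
Variables (F : numClosedFieldType) (N : nat) (X : set 'rV[F]_N).

Lemma indep_on_span (J : finType) s (p : 'I_s -> {mpoly F[N]}) (g : J -> {mpoly F[N]})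
    (B : 'I_s -> J -> F) :
  indep_on X p ->
  (forall i x, X x -> mpoly_at (p i) x = \sum_j B i j * mpoly_at (g j) x) ->
  (s <= #|J|)%N.
Proof.
move=> ip pB; rewrite leqNgt; apply/negP => lt.
pose M : 'M[F]_(s, #|J|) := \matrix_(i, j) B i (enum_val j).
have kn0 : kermx M != 0.
  by rewrite -mxrank_eq0 mxrank_ker -lt0n subn_gt0 (leq_ltn_trans (rank_leq_col M)).
have /rowV0Pn [v /sub_kermxP vM vn0] := kn0.
suff v0 : v = 0 by rewrite v0 eqxx in vn0.
apply/rowP => i; rewrite mxE; apply: (ip (fun i => v 0 i)) => x Xx.
rewrite mpoly_at_sum; under eq_bigr => k _ do rewrite mpoly_atZ pB // mulr_sumr.
rewrite exchange_big big1 //= => j _.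
under eq_bigr => k _ do rewrite mulrA.
rewrite -mulr_suml; have /rowP/(_ (enum_rank j)) := vM.
rewrite !mxE => e; rewrite -[X in X * _]/(_) [X in X * _](_ : _ = 0) ?mul0r // -[RHS]e.
by apply: eq_bigr => k _; rewrite mxE enum_rankK.
Qed.

Lemma mon_mnmP d k (mm : 'X_{1..d}) : (mdeg mm <= k)%N ->
  exists t : mon d k, mon_mnm t = mm.
Proof.
move=> hm; have hi i : (mm i < k.+1)%N.
  by rewrite ltnS; apply: leq_trans hm; rewrite mdegE (bigD1 i) //= leq_addr.
pose t := [tuple Ordinal (hi i) | i < d].
have ht : (\sum_(i <- t) i <= k)%N.
  by rewrite big_tuple; under eq_bigr => i _ do rewrite tnth_mktuple /=; rewrite -mdegE.
by exists (Sub t ht); apply/mnmP => i; rewrite mnmE SubK tnth_mktuple.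
Qed.

Lemma mpoly_monE d k (c : {mpoly F[d]}) : (msize c <= k.+1)%N ->
  c = \sum_(t : mon d k) c@_(mon_mnm t) *: 'X_[mon_mnm t].
Proof.
move=> hc; apply/mpolyP => mm; rewrite raddf_sum /=.
have [|big] := leqP (mdeg mm) k.
  move=> /mon_mnmP [t <-]; rewrite (bigD1 t) //= mcoeffZ mcoeffX eqxx mulr1.
  rewrite big1 ?addr0 // => u ut.
  by rewrite mcoeffZ mcoeffX (inj_eq (@mon_mnm_inj d k)) (negbTE ut) mulr0.
rewrite big1 => [|t _]; first by apply: memN_msupp_eq0; apply: msize_mdeg_ge; apply: leq_trans hc big.
rewrite mcoeffZ mcoeffX; case: (mon_mnm t =P mm) => [e|_]; rewrite ?mulr0 //.
by have := mdeg_mon t; rewrite e leqNgt big.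
Qed.

End Span.

(** * Noether normalisation respecting degrees *)

Section Normalization.
Variables (F : numClosedFieldType) (N : nat) (X : set 'rV[F]_N).

(* Modulo I(X), every polynomial of degree k is a combination of the g j with
   coefficients of degree at most k in the linear forms x *m A. *)
Definition filtered_finite m (A : 'M[F]_(N, m)) (J : finType) (g : J -> {mpoly F[N]}) :=
  forall p : {mpoly F[N]}, exists2 c : J -> {mpoly F[m]},
    forall j, (msize (c j) <= msize p)%N &
    forall x, X x -> mpoly_at p x = \sum_j mpoly_at (c j) (x *m A) * mpoly_at (g j) x.

Lemma filtered_finite1 : filtered_finite 1%:M (fun _ : 'I_1 => 1).
Proof.
move=> p; exists (fun=> p) => // x _.
by rewrite big_ord_recl big_ord0 addr0 mulmx1 [X in _ * X]meval1 mulr1.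
Qed.

Lemma linform_prodE m (A : 'M[F]_(N, m)) (t : 'X_{1..m}) (x : 'rV[F]_N) :
  mpoly_at (\prod_(l < m) linform (col l A) ^+ t l) x = mpoly_at 'X_[t] (x *m A).
Proof.
rewrite /mpoly_at mevalX rmorph_prod; apply: eq_bigr => l _.
rewrite rmorphXn /= linformE; congr (_ ^+ _); rewrite !mxE.
by apply: eq_bigr => a _; rewrite mxE.
Qed.

Lemma filtered_span_bound m (A : 'M[F]_(N, m)) (J : finType) (g : J -> {mpoly F[N]}) k s
    (p : 'I_s -> {mpoly F[N]}) (c : 'I_s -> J -> {mpoly F[m]}) :
  indep_on X p -> (forall i j, (msize (c i j) <= k.+1)%N) ->
  (forall i x, X x -> mpoly_at (p i) x = \sum_j mpoly_at (c i j) (x *m A) * mpoly_at (g j) x) ->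
  (s <= 'C(m + k, m) * #|J|)%N.
Proof.
move=> ip c1 c2; rewrite -card_mon -card_prod.
apply: (@indep_on_span _ _ X _ _ p
  (fun z : mon m k * J => (\prod_(l < m) linform (col l A) ^+ (mon_mnm z.1 l)) * g z.2)
  (fun i z => (c i z.2)@_(mon_mnm z.1))) => // i x Xx.
rewrite c2 //.
rewrite -(pair_bigA _ (fun t j => (c i j)@_(mon_mnm t) *
  mpoly_at ((\prod_(l < m) linform (col l A) ^+ (mon_mnm t l)) * g j) x)) /=.
rewrite exchange_big /=; apply: eq_bigr => j _.
rewrite [in LHS](mpoly_monE (c1 i j)) mpoly_at_sum mulr_suml.
by apply: eq_bigr => t _; rewrite mpoly_atZ mpoly_atM mulrA linform_prodE.
Qed.

Lemma filtered_finite_bound m (A : 'M[F]_(N, m)) (J : finType) (g : J -> {mpoly F[N]}) k h :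
  filtered_finite A g -> hilbert X k h -> (h <= 'C(m + k, m) * #|J|)%N.
Proof.
move=> ff [[p sp ip] _].
have [|c cP] := @boolp.choice 'I_h (J -> {mpoly F[m]}) (fun i c =>
  (forall j, (msize (c j) <= msize (p i))%N) /\
  forall x, X x -> mpoly_at (p i) x = \sum_j mpoly_at (c j) (x *m A) * mpoly_at (g j) x).
  by move=> i; have [c c1 c2] := ff (p i); exists c.
apply: (filtered_span_bound ip (c := c)) => [i j|i x Xx]; have [c1 c2] := cP i.
  exact: leq_trans (c1 j) (sp i).
exact: c2.
Qed.

Section Step.
Variables (m : nat) (A : 'M[F]_(N, m.+1)) (P : {mpoly F[m.+1]}).
Hypothesis X_neq0 : exists x, X x.
Hypothesis Pn0 : P != 0.
Hypothesis PX : forall x, X x -> mpoly_at P (x *m A) = 0.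

Local Notation Pm := {mpoly F[m]}.
Local Notation inc := (@polyC Pm \o @mpolyC m F).

(** Noether's substitution [X_k + a_k T], with [T] the last form. The coefficient of [T] to the
    degree [q] of [P] becomes the top homogeneous part of [P] at [(a, 1)], a nonzero constant for
    generic [a]. *)
Let Y (a : 'rV[F]_m) (i : 'I_m.+1) : {poly Pm} :=
  if unlift ord_max i is Some k then ('X_k)%:P + ((a 0 k)%:MP)%:P * 'X else 'X.

Let wdegY a i : wdeg 1 (Y a i).
Proof.
rewrite /Y; case: (unlift _ _) => [k|]; last exact: wdegX.
apply: wdegD; first by apply: wdegC; rewrite msizeX mdeg1.
apply: (@wdegM _ _ 0 1); last exact: wdegX.
by apply: wdegC; exact: msizeC_leq.
Qed.

Let subst a (c : {mpoly F[m.+1]}) : {poly Pm} := mmap inc (Y a) c.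

Let substE a c : subst a c = \sum_(mm <- msupp c) (c@_mm)%:MP%:P * \prod_i Y a i ^+ mm i.
Proof. by []. Qed.

Let wdegYX a i k : wdeg k (Y a i ^+ k).
Proof. by have := @wdegMn _ _ _ _ k (@wdegY a i); rewrite mul1n. Qed.

Let wdeg_mon a (mm : 'X_{1..m.+1}) : wdeg (mdeg mm) (\prod_i Y a i ^+ mm i).
Proof.
rewrite mdegE; apply: wdeg_prod => i; exact: wdegYX.
Qed.

Let wdeg_subst a c D : (msize c <= D.+1)%N -> wdeg D (subst a c).
Proof.
move=> hc; rewrite substE big_seq; elim/big_ind: _ => [||mm hm].
- by move=> j mm; rewrite coef0 mcoeff0 eqxx.
- exact: wdegD.
apply: (@wdegM _ _ 0 D); first by apply: wdegC; exact: msizeC_leq.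
by apply: (@wdeg_leq _ _ (mdeg mm)) => //; rewrite -ltnS; apply: leq_trans (msize_mdeg_lt hm) hc.
Qed.

Let wtop_prod a (r : seq 'I_m.+1) (mm : 'X_{1..m.+1}) :
  wtop (\sum_(i <- r) mm i) (\prod_(i <- r) Y a i ^+ mm i) =
  \prod_(i <- r) wtop 1 (Y a i) ^+ mm i.
Proof.
have wX i k : wtop k (Y a i ^+ k) = wtop 1 (Y a i) ^+ k.
  elim: k => [|k IH]; first by rewrite /wtop !expr0 coef1 /= mcoeff1 eqxx.
  rewrite !exprS -[k.+1]add1n (wtopM (D1 := 1) (D2 := k)) ?IH //.
elim: r => [|i r IH]; first by rewrite !big_nil /wtop coef1 /= mcoeff1 eqxx.
rewrite !big_cons (@wtopM _ _ (mm i) (\sum_(j <- r) mm j)).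
- by rewrite IH wX.
- exact: wdegYX.
by apply: wdeg_prod => j; exact: wdegYX.
Qed.

Let wtopY a i : wtop 1 (Y a i) = if unlift ord_max i is Some k then a 0 k else 1.
Proof.
rewrite /wtop /Y; case: (unlift _ _) => [k|]; last by rewrite coefX /= mcoeff1 eqxx.
by rewrite coefD coefC coefCM coefX /= mulr1 mcoeffD mcoeff0 add0r mcoeffC eqxx mulr1.
Qed.

Let q := mdeg (mlead P).
Let rest (mm : 'X_{1..m.+1}) : 'X_{1..m} := [multinom mm (lift ord_max k) | k < m].

Let topP : {mpoly F[m]} :=
  \sum_(mm <- msupp P | mdeg mm == q) P@_mm *: 'X_[rest mm].

(** Setting the last variable to 1 merges no two monomials of the same degree, as the last exponent
    is determined by the others. *)
Let topP_neq0 : topP != 0.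
Proof.
apply/eqP => h; have := congr1 (mcoeff (rest (mlead P))) h.
rewrite mcoeff0 raddf_sum /= big_mkcond /= (bigD1_seq (mlead P)) ?mlead_supp ?msupp_uniq //=.
rewrite -/q eqxx.
rewrite mcoeffZ mcoeffX eqxx mulr1 big1 ?addr0 => [/eqP|mm ne].
  by rewrite mleadc_eq0 (negbTE Pn0).
case: ifP => // /eqP mq; rewrite mcoeffZ mcoeffX; case: (_ =P rest (mlead P)) => [/mnmP e|_]; rewrite ?mulr0 //.
case/negP: ne; apply/eqP/mnmP => i.
have el k : mm (lift ord_max k) = mlead P (lift ord_max k).
  by have := e k; rewrite !mnmE.
case: (unliftP ord_max i) => [k ->|->]; first exact: el.
move: mq; rewrite /q !mdegE !(bigD1_ord ord_max) //=.
by under eq_bigr => k _ do rewrite el; move/eqP; rewrite eqn_add2r => /eqP.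
Qed.

Let wtop_subst a : wtop q (subst a P) = mpoly_at topP a.
Proof.
rewrite substE /wtop coef_sum raddf_sum /topP mpoly_at_sum [RHS]big_mkcond /=.
rewrite !big_seq; apply: eq_bigr => mm hm.
rewrite coefCM mul_mpolyC mcoeffZ.
case: eqP => [mq|ne].
  rewrite mpoly_atZ; congr (_ * _); rewrite -mq mdegE -/(wtop _ _) wtop_prod.
  rewrite (bigD1_ord ord_max) //= wtopY unlift_none expr1n mul1r /mpoly_at mevalX.
  by apply: eq_bigr => k _; rewrite wtopY liftK mnmE.
rewrite (wdeg_big (@wdeg_mon a mm)) ?mcoeff0 ?mulr0 //.
rewrite ltn_neqAle (introN eqP ne) /=; have := msize_mdeg_lt hm.
by rewrite -mlead_deg.
Qed.

Let pev (y : 'rV[F]_m) (t : F) (S : {poly Pm}) := (map_poly (meval (fun k => y 0 k)) S).[t].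

Let substK (a : 'rV[F]_m) c (x : 'rV[F]_N) : let t := (x *m A) 0 ord_max in
  let A' := \matrix_(i, k) (A i (lift ord_max k) - a 0 k * A i ord_max) in
  pev (x *m A') t (subst a c) = mpoly_at c (x *m A).
Proof.
move=> t A'; elim/mpoly_ringind: c => [b|i|c1 c2 IH1 IH2|c1 c2 IH1 IH2].
- by rewrite /subst mmapC /pev /= map_polyC hornerC /= mevalC /mpoly_at mevalC.
- rewrite /subst mmapX mmap1U /Y /mpoly_at mevalXU.
  case: (unliftP ord_max i) => [k ->|->]; last by rewrite /pev map_polyX hornerX.
  rewrite /pev rmorphD rmorphM /= map_polyX !map_polyC hornerD hornerM !hornerC hornerX.
  rewrite /= mevalXU mevalC !mxE /t mxE mulr_sumr -big_split; apply: eq_bigr => l _ /=.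
  rewrite mxE; ring.
- by rewrite /subst mmapD /pev rmorphD hornerD mpoly_atD -IH1 -IH2.
- by rewrite /subst rmorphM /pev rmorphM hornerM mpoly_atM -IH1 -IH2.
Qed.

(** Division by [P] after Noether's substitution leaves coefficients of degree below [q] in the last
    form, whose powers below [q] join the generators; [wdeg_reduce] preserves the degree bounds. *)
Lemma filtered_finite_step (J : finType) (g : J -> {mpoly F[N]}) :
  filtered_finite A g ->
  exists (A' : 'M[F]_(N, m)) (J' : finType) (g' : J' -> {mpoly F[N]}), filtered_finite A' g'.
Proof.
move=> ff; have [a ha] := mpoly_neq0_eval topP_neq0.
pose A' : 'M[F]_(N, m) := \matrix_(i, k) (A i (lift ord_max k) - a 0 k * A i ord_max).
have wP : wdeg q (subst a P) by apply: wdeg_subst; rewrite mlead_deg.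
exists A', (J * 'I_q)%type, (fun z : J * 'I_q => g z.1 * linform (col ord_max A) ^+ z.2) => p.
have [p0|pn0] := eqVneq p 0.
  exists (fun=> 0) => [z|x _]; first by rewrite msize0.
  by rewrite p0 big1 => [|z _]; rewrite /mpoly_at meval0 ?mul0r.
have [c c1 c2] := ff p.
have [|S' S'P] := @boolp.choice J {poly Pm} (fun j S' => [/\ (size S' <= q)%N,
   wdeg (msize p).-1 S' & exists Q, subst a (c j) = Q * subst a P + S']).
  move=> j; have wc : wdeg (msize p).-1 (subst a (c j)).
    by apply: wdeg_subst; rewrite -mpolySpred.
  have [|S' [Q [h1 h2 h3]]] := wdeg_reduce wP _ wc; first by rewrite wtop_subst.
  by exists S'; split=> //; exists Q.
exists (fun z : J * 'I_q => (S' z.1)`_z.2) => [z|x Xx].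
  have [_ h2 _] := S'P z.1; rewrite [leqRHS]mpolySpred //; apply/msize_leqP => mm /h2; lia.
rewrite c2 // -(pair_bigA _ (fun j (i : 'I_q) => mpoly_at (S' j)`_i (x *m A') *
  mpoly_at (g j * linform (col ord_max A) ^+ i) x)) /=; apply: eq_bigr => j _.
have [h1 _ [Q h3]] := S'P j.
have e1 : mpoly_at (c j) (x *m A) = pev (x *m A') ((x *m A) 0 ord_max) (S' j).
  rewrite -(substK a) h3 /pev rmorphD rmorphM hornerD hornerM.
  by rewrite -[(map_poly _ (subst a P)).[_]]/(pev _ _ _) substK PX // mulr0 add0r.
rewrite e1 /pev (@horner_coef_wide _ q) ?mulr_suml; last first.
  by apply: leq_trans h1; exact: size_poly.
apply: eq_bigr => i _; rewrite coef_map /= mpoly_atM /mpoly_at rmorphXn /= linformE.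
have -> : (x *m col ord_max A) 0 0 = (x *m A) 0 ord_max.
  by rewrite !mxE; apply: eq_bigr => l _; rewrite mxE.
by ring.
Qed.

End Step.
End Normalization.

(** * Specialising generic relations to a fixed projection *)

Section Specialization.
Variables (F : numClosedFieldType) (N : nat) (X : set 'rV[F]_N) (d : nat).
Local Notation M := (N * d + d + N)%N.
Local Notation Q := {mpoly F[M]}.
Local Notation proj_rel := (@proj_rel F N X d).
Hypothesis irrX : irreducible_on X.

Let pt (A : 'M[F]_(N, d)) (b : 'rV[F]_d) (u : 'cV[F]_N) : 'rV[F]_M :=
  row_mx (row_mx (mxvec A) b) u^T.

Let pt_A A b u i j : pt A b u 0 (iA i j) = A i j.
Proof. by rewrite row_mxEl row_mxEl mxvecE. Qed.
Let pt_b A b u j : pt A b u 0 (ib N j) = b 0 j.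
Proof. by rewrite row_mxEl row_mxEr. Qed.
Let pt_u A b u i : pt A b u 0 (iu d i) = u i 0.
Proof. by rewrite row_mxEr mxE. Qed.

Let spec_line (c : Q) (A0 dA : 'M[F]_(N, d)) (u du : 'cV[F]_N) :
  exists C : {poly {mpoly F[d]}}, forall s (b : 'rV[F]_d),
  (map_poly (meval (fun k => b 0 k)) C).[s] = mpoly_at c (pt (A0 + s *: dA) b (u + s *: du)).
Proof.
elim/mpoly_ringind: c => [a|i|p q [C1 h1] [C2 h2]|p q [C1 h1] [C2 h2]].
- by exists a%:MP%:P => s b; rewrite map_polyC hornerC /= mevalC /mpoly_at mevalC.
- elim/ixP: i => [i j|j|i].
  + exists ((A0 i j)%:MP%:P + (dA i j)%:MP%:P * 'X) => s b.
    rewrite rmorphD rmorphM /= map_polyX !map_polyC hornerD hornerM !hornerC hornerX /= !mevalC.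
    by rewrite /mpoly_at mevalXU pt_A !mxE mulrC.
  + by exists ('X_j)%:P => s b; rewrite map_polyC hornerC /= /mpoly_at !mevalXU pt_b.
  + exists ((u i 0)%:MP%:P + (du i 0)%:MP%:P * 'X) => s b.
    rewrite rmorphD rmorphM /= map_polyX !map_polyC hornerD hornerM !hornerC hornerX /= !mevalC.
    by rewrite /mpoly_at mevalXU pt_u !mxE mulrC.
- by exists (C1 + C2) => s b; rewrite rmorphD hornerD h1 h2 mpoly_atD.
- by exists (C1 * C2) => s b; rewrite rmorphM hornerM h1 h2 mpoly_atM.
Qed.

Let ptE (v : 'rV[F]_M) : exists A b u, v = pt A b u.
Proof.
exists (vec_mx (lsubmx (lsubmx v))), (rsubmx (lsubmx v)), (rsubmx v)^T.
by rewrite /pt vec_mxK trmxK !hsubmxK.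
Qed.

(* Moving A from a generic matrix to A0 along a line and dividing the relation
   by the power of the parameter it contains keeps it nontrivial. *)
Lemma specialize_relation (A0 : 'M[F]_(N, d)) s (g : 'I_s -> {mpoly F[N]}) (c : 'I_s -> Q)
    (W : {poly Q}) :
  (exists j, c j != 0) -> ~ proj_rel W ->
  (forall A u x, X x ->
     gval W A u x * \sum_j mpoly_at (c j) (gpt A u x) * mpoly_at (g j) x = 0) ->
  exists2 c' : 'I_s -> {mpoly F[d]}, exists j, c' j != 0 &
    forall x, X x -> \sum_j mpoly_at (c' j) (x *m A0) * mpoly_at (g j) x = 0.
Proof.
move=> [j0 cj0] nW rel.
have [Aw [uw [xw [Xw Ww]]]] : exists A u x, X x /\ gval W A u x != 0.
  apply: contrapT => h; apply: nW => A u x Xx; apply/eqP; apply: contraT => ne.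
  by case: h; exists A, u, x.
have [A1 [u1 [b1 [W1 c1]]]] : exists A1 u1 b1,
    gval W A1 u1 xw != 0 /\ mpoly_at (c j0) (pt A1 b1 u1) != 0.
  have [v hv] := mpoly_neq0_eval cj0; have [A2 [b2 [u2 ev]]] := ptE v.
  have [g1 hg1] := gval_line W Aw uw (A2 - Aw) (u2 - uw) xw.
  have [C2 hC2] := spec_line (c j0) Aw (A2 - Aw) uw (u2 - uw).
  have n1 : g1 != 0.
    by apply: contraNneq Ww => g0; have := hg1 0; rewrite g0 horner0 !scale0r !addr0 => ->.
  have n2 : map_poly (meval (fun k => b2 0 k)) C2 != 0.
    apply: contraNneq hv => g0; have := hC2 1 b2; rewrite g0 horner0 !scale1r ev.
    by rewrite ![_ + (_ - _)]addrC !subrK => ->.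
  have [t] := poly_neq0_eval (mulf_neq0 n1 n2).
  rewrite hornerM mulf_eq0 negb_or hg1 hC2 => /andP[t1 t2].
  by exists (Aw + t *: (A2 - Aw)), (uw + t *: (u2 - uw)), b2.
have [|C CP] := @boolp.choice 'I_s {poly {mpoly F[d]}} (fun j Cj => forall t (b : 'rV[F]_d),
    (map_poly (meval (fun k => b 0 k)) Cj).[t] =
    mpoly_at (c j) (pt (A0 + t *: (A1 - A0)) b (u1 + t *: 0))).
  by move=> j; exact: spec_line.
have exo : exists o, [exists j, (C j)`_o != 0].
  have Cn0 : C j0 != 0.
    apply: contraNneq c1 => C0; have := CP j0 1 b1; rewrite C0 map_poly0 horner0 scaler0 addr0.
    by rewrite scale1r addrC subrK => ->.
  by exists (size (C j0)).-1; apply/existsP; exists j0; rewrite -lead_coefE lead_coef_eq0.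
case: (ex_minnP exo) => o /existsP[j1 cj1] mino.
exists (fun j => (C j)`_o); first by exists j1.
move=> x Xx.
have CE j : C j = drop_poly o (C j) * 'X^o.
  apply/polyP => i; rewrite coefMXn coef_drop_poly; case: ltnP => [lt|le]; last by rewrite subnK.
  apply/eqP; apply: contraTT lt => ne; rewrite -leqNgt; apply: mino; apply/existsP.
  by exists j.
pose cv k := ((x *m A0) 0 k)%:P + (x *m (A1 - A0)) 0 k *: 'X.
pose q := \sum_j (\sum_(i < size (drop_poly o (C j))) along (drop_poly o (C j))`_i cv * 'X^i) *
  (mpoly_at (g j) x)%:P.
have qE t : q.[t] = \sum_j
    (map_poly (meval (fun k => (x *m (A0 + t *: (A1 - A0))) 0 k)) (drop_poly o (C j))).[t] *
    mpoly_at (g j) x.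
  rewrite /q horner_sum; apply: eq_bigr => j _; rewrite hornerM hornerC; congr (_ * _).
  rewrite horner_sum (@horner_coef_wide _ (size (drop_poly o (C j)))) ?size_poly //.
  apply: eq_bigr => i _; rewrite hornerM hornerXn alongE coef_map_id0 ?meval0 //; congr (_ * _).
  apply: meval_eq => k; rewrite affine_mulmx /cv hornerD hornerC hornerZ hornerX mulrC //.
have [w hw] := gval_line W A0 u1 (A1 - A0) 0 xw.
have wn0 : w != 0.
  apply: contraNneq W1 => g0; have := hw 1; rewrite g0 horner0 scaler0 addr0 scale1r.
  by rewrite addrC subrK => ->.
(* The relation is known only after multiplication by [W], which depends on [x]. Where [w] does not
   vanish, [W] is not identically zero on [X] for these [A] and [u], and irreducibility cancels
   it. *)
have relt t : w.[t] != 0 -> t ^+ o * q.[t] = 0.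
  rewrite hw => wt; set A := A0 + _ in wt; set u := u1 + _ in wt.
  have [p1 hp1] := gval_mpoly W A u.
  have [|pc hpc] := @boolp.choice 'I_s {mpoly F[N]} (fun j p => forall x, mpoly_at p x = gval (c j)%:P A u x).
    by move=> j; exact: gval_mpoly.
  have pcE j y : mpoly_at (pc j) y = mpoly_at (c j) (gpt A u y) by rewrite hpc /gval gevC.
  have : vanish X (p1 * \sum_j pc j * g j).
    move=> y Xy; rewrite mpoly_atM hp1 mpoly_at_sum -[RHS](rel A u y Xy); congr (_ * _).
    by apply: eq_bigr => j _; rewrite mpoly_atM pcE.
  case/irrX => [/(_ _ Xw)|/(_ _ Xx)]; first by rewrite hp1 => w0; rewrite w0 eqxx in wt.
  rewrite mpoly_at_sum => h; rewrite -[RHS]h qE mulr_sumr; apply: eq_bigr => j _.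
  rewrite mpoly_atM pcE mulrA; congr (_ * _).
  rewrite -[gpt A u x]/(pt A (x *m A) u) -CP [in RHS]CE rmorphM hornerM mulrC; congr (_ * _).
  by rewrite rmorphXn /= map_polyX hornerXn.
have q0 : q = 0.
  have : w * ('X^o * q) = 0.
    apply: polyF_eq0 => t; rewrite !hornerM hornerXn.
    by have [->|/relt ->] := eqVneq w.[t] 0; rewrite ?mul0r ?mulr0.
  by move/eqP; rewrite !mulf_eq0 (negbTE wn0) /= expf_eq0 polyX_eq0 andbF => /eqP.
have q00 := qE 0; rewrite q0 horner0 in q00; rewrite [RHS]q00; apply: eq_bigr => j _; congr (_ * _).
by rewrite scale0r addr0 horner_coef0 coef_map_id0 ?meval0 // coef_drop_poly add0n.
Qed.

Definition indep_over (A : 'M[F]_(N, d)) s (g : 'I_s -> {mpoly F[N]}) :=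
  forall c : 'I_s -> {mpoly F[d]},
    (forall x, X x -> \sum_j mpoly_at (c j) (x *m A) * mpoly_at (g j) x = 0) ->
    forall j, c j = 0.

(** The evaluation points are coefficient indices below [t]. Among [s] of them two coincide, so the
    determinant has equal rows and only the dependence remains. *)
Lemma dependent_polys (t s : nat) (r : 'I_s -> {poly Q}) :
  (t < s)%N -> (forall j, size (r j) <= t)%N ->
  exists2 c : 'I_s -> Q, exists j, c j != 0 & \sum_j (c j)%:P * r j = 0.
Proof.
move=> lt hr; have [[c [j cj] cP]|[x _ /negP[]]] := @dependent_or_det 'I_t setT _ s (fun j i => (r j)`_i).
  exists c; first by exists j.
  apply/polyP => i; rewrite coef0 coef_sum; under eq_bigr => k _ do rewrite coefCM.
  have [it|ti] := ltnP i t; first exact: (cP (Ordinal it)).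
  by rewrite big1 // => k _; rewrite nth_default ?mulr0 // (leq_trans (hr k)).
have [i1 [i2 [ne e]]] : exists i1 i2, i1 != i2 /\ x i1 = x i2.
  apply: contrapT => h; suff /leq_card : injective x by rewrite !card_ord leqNgt lt.
  move=> i1 i2 e; apply/eqP; apply: contraT => ne; case: h; by exists i1, i2.
by rewrite (determinant_alternate ne) // => k; rewrite !mxE e.
Qed.

Section Minimal.
Variables (G : {poly Q}).
Hypothesis Gn0 : G != 0.
Hypothesis relG : proj_rel G.
Hypothesis minG : forall H : {poly Q}, proj_rel H -> (size H < size G)%N -> H = 0.
Variable A0 : 'M[F]_(N, d).
Hypothesis algA0 : forall P : {mpoly F[d]},
  (forall x, X x -> mpoly_at P (x *m A0) = 0) -> P = 0.

Let not_proj_rel1 : ~ proj_rel 1.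
Proof.
move=> r1; suff /eqP : (1 : {mpoly F[d]}) = 0 by rewrite oner_eq0.
apply: algA0 => x Xx; have := r1 A0 0 x Xx.
by rewrite /gval (gevC _ _ 1) meval1 => /eqP; rewrite oner_eq0.
Qed.

(** A relation free of the main variable would specialise to one between the forms [x *m A0],
    against [algA0]. *)
Lemma size_min_relation : (1 < size G)%N.
Proof.
rewrite ltnNge; apply/negP => /size1_polyC GC.
have c0 : G`_0 != 0 by rewrite -polyC_eq0 -GC.
have [|A u x Xx|c' [j c'j] c'P] :=
  @specialize_relation A0 1 (fun=> 1) (fun=> G`_0) 1 _ not_proj_rel1.
- by exists ord0.
- rewrite big_ord_recl big_ord0 addr0 -[mpoly_at G`_0 _](gevC _ ((x *m u) 0 0)) -GC.
  by rewrite -[gev _ _ G]/(gval G A u x) relG // mul0r mulr0.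
suff e : c' j = 0 by rewrite e eqxx in c'j.
apply: algA0 => x Xx; have := c'P x Xx.
by rewrite big_ord_recl big_ord0 addr0 [mpoly_at 1 x]meval1 mulr1 (ord1 j).
Qed.

(** Each [g j] times a power of the derivative of [G] lifts to a polynomial which modulo [G] has at
    most [(size G).-1] coefficients. More lifts than that are dependent, and [specialize_relation]
    carries the dependence to [A0]. *)
Lemma relation_bound s (g : 'I_s -> {mpoly F[N]}) : indep_over A0 g -> (s < size G)%N.
Proof.
move=> indg; rewrite ltnNge; apply/negP => les.
have [e sG] : exists e, size G = e.+2.
  by have := size_min_relation; case: (size G) => [|[|e]] // _; exists e.
pose GT := G^`().
have sGT : size GT = e.+1 by exact: size_deriv_mpoly.
have GTn0 : GT != 0 by rewrite -size_poly_gt0 sGT.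
have nGT : ~ proj_rel GT by move=> /minG h; move/eqP: GTn0; apply; apply: h; rewrite sGT sG.
have nW k : ~ proj_rel (GT ^+ k).
  elim: k => [|k IH]; first by rewrite expr0; exact: not_proj_rel1.
  by rewrite exprS => /(proj_rel_mul irrX) [].
have [|kH kHP] := @boolp.choice 'I_s (nat * {poly Q}) (fun j z => forall A u x, X x ->
    gval z.2 A u x = mpoly_at (g j) x * gval GT A u x ^+ z.1).
  move=> j; have [k [H hH]] := kronecker_lift G (g j); exists (k, H) => A u x Xx.
  by apply: hH; exact: (@kronecker _ _ _ _ _ relG A u x Xx).
pose K := (\sum_j (kH j).1)%N.
have leK j : ((kH j).1 <= K)%N by rewrite /K (bigD1 j) //= leq_addr.
pose H j := (kH j).2 * GT ^+ (K - (kH j).1).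
have HE j A u x : X x -> gval (H j) A u x = mpoly_at (g j) x * gval GT A u x ^+ K.
  by move=> Xx; rewrite /gval gevM gevXn -!/(gval _ _ _ _) kHP // -mulrA -exprD subnKC.
have [||c [j0 cj0] cP] := @dependent_polys (size G).-1 s (fun j => Pdiv.Idomain.modp (H j) G).
- by rewrite prednK // sG.
- by move=> j; rewrite -ltnS prednK ?sG // -sG; exact: Pdiv.Idomain.ltn_modpN0.
have lc0 : lead_coef G != 0 by rewrite lead_coef_eq0.
have [|A u x Xx|c' [j c'j] c'P] := @specialize_relation A0 s g
    (fun j => c j * lead_coef G ^+ Pdiv.Idomain.scalp (H j) G) (GT ^+ K) _ (nW K).
- by exists j0; rewrite mulf_neq0 // expf_neq0.
- set w := gpt A u x; pose t := (x *m u) 0 0.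
  have E : gev w t (\sum_j (c j)%:P * (lead_coef G ^+ Pdiv.Idomain.scalp (H j) G *: H j)) = 0.
    rewrite (eq_bigr (fun j => (c j)%:P * Pdiv.Idomain.divp (H j) G * G +
      (c j)%:P * Pdiv.Idomain.modp (H j) G)); last first.
      by move=> j _; rewrite Pdiv.Idomain.divp_eq mulrDr mulrA.
    rewrite big_split /= cP addr0 -mulr_suml gevM -[X in _ * X]/(gval G A u x) relG //.
    by rewrite mulr0.
  rewrite -[RHS]E gev_sum mulr_sumr; apply: eq_bigr => j _.
  rewrite -mul_polyC gevM gevC gevM gevC.
  have e1 : gval (GT ^+ K) A u x = gval GT A u x ^+ K by exact: gevXn.
  have e2 : gev w t (H j) = mpoly_at (g j) x * gval GT A u x ^+ K by exact: HE.
  set L := lead_coef G ^+ _.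
  have e3 : mpoly_at (c j * L) w = mpoly_at (c j) w * mpoly_at L w by exact: mpoly_atM.
  have ringE (a b q r : F) : r * (a * b * q) = a * (b * (q * r)) by ring.
  etransitivity; first by rewrite e1 e3; exact: ringE.
  by rewrite -e2.
by rewrite indg ?eqxx in c'j.
Qed.

End Minimal.
End Specialization.

Lemma bin_fact_lb m k : (k.+1 ^ m <= 'C(m + k, m) * m`!)%N.
Proof.
elim: m => [|m IH]; first by rewrite expn0 bin0.
have e : (m.+1 * 'C(m.+1 + k, m.+1) = (m.+1 + k) * 'C(m + k, m))%N.
  by rewrite -mul_bin_diag addSn.
rewrite expnS factS mulnA [X in (_ <= X * _)%N]mulnC e -mulnA leq_mul //.
by rewrite addSn ltnS leq_addl.
Qed.

(** * The degree as leading coefficient of the Hilbert function *)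

Section DegreeTheorem.
Variables (F : numClosedFieldType) (N : nat) (X : set 'rV[F]_N) (d : nat).
Hypothesis irrX : irreducible_on X.
Hypothesis closedX : forall x, (forall p, vanish X p -> mpoly_at p x = 0) -> X x.
Hypothesis X_neq0 : exists x, X x.
Hypothesis le_dN : (d <= N)%N.
Variables (h : nat -> nat) (D : nat).
Hypothesis hX : forall k, hilbert X k (h k).
Hypothesis D_gt0 : (0 < D)%N.
Hypothesis hD : binpoly d D%:R (fun k => (h k)%:R).

(** Polynomials of degree [k] in the [f i] have degree at most [s * k]. On [X] their dimension grows
    like [k ^ d], slower than the number of monomials in more than [d] variables. *)
Lemma alg_dependent m (f : 'I_m -> {mpoly F[N]}) s :
  (forall i, (msize (f i) <= s.+1)%N) -> (d < m)%N ->
  exists2 P : {mpoly F[m]}, P != 0 & forall x, X x -> P.@[fun i => mpoly_at (f i) x] = 0.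
Proof.
move=> sf dm; have [B hB] := binpoly_ub hD.
(* Makes [B (s k + 1)^d m!] at most [k (k + 1)^d], hence less than [(k + 1)^m], which [bin_fact_lb]
   bounds by [m!] times the number of monomials. *)
pose k := (m`! * (B * s.+1 ^ d))%N.
have lt : (h (s * k) < 'C(m + k, m))%N.
  rewrite -(ltn_pmul2r (fact_gt0 m)); apply: leq_trans (bin_fact_lb m k).
  apply: (@leq_trans (k.+1 ^ d.+1)); last by rewrite leq_pexp2l.
  apply: (@leq_ltn_trans (k * k.+1 ^ d)); last by rewrite expnS ltn_pmul2r // expn_gt0.
  have := hB (s * k)%N; rewrite ler_nat => hb.
  apply: (@leq_trans (B * (s * k).+1 ^ d * m`!)); first by rewrite leq_mul2r hb orbT.
  apply: (@leq_trans (B * (s.+1 ^ d * k.+1 ^ d) * m`!)).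
    have mono (a b n : nat) : (a <= b)%N -> (a ^ n <= b ^ n)%N.
      by move=> ab; elim: n => // n IH; rewrite !expnS leq_mul.
    by rewrite leq_mul2r leq_mul2l -expnMn mono ?orbT //; nia.
  by rewrite {2}/k; apply: eq_leq; move: (k.+1 ^ d)%N (s.+1 ^ d)%N m`! => a b c; ring.
pose p (t : mon m k) : {mpoly F[N]} := \prod_i f i ^+ mon_mnm t i.
pose P (c : 'I_#|{: mon m k}| -> F) : {mpoly F[m]} := \sum_i c i *: 'X_[mon_mnm (enum_val i)].
have PE c x : (P c).@[fun i => mpoly_at (f i) x] = mpoly_at (\sum_i c i *: p (enum_val i)) x.
  rewrite /P mpoly_at_sum raddf_sum; apply: eq_bigr => i _; rewrite /= mevalZ mpoly_atZ; congr (_ * _).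
  by rewrite mevalX /p /mpoly_at rmorph_prod; apply: eq_bigr => l _; rewrite rmorphXn.
apply: contrapT => nP.
have : (#|{: mon m k}| <= h (s * k))%N.
  have [_ hmax] := hX (s * k)%N; apply: (hmax _ (fun i => p (enum_val i))) => [i|c vc].
    apply: (@leq_trans (\sum_(l < m) s * mon_mnm (enum_val i) l).+1).
      by apply: msize_prod_leq => l; exact: msizeXn_leq.
    by rewrite ltnS -big_distrr /= -mdegE leq_mul2l mdeg_mon orbT.
  have P0 : P c = 0.
    apply: contrapT => /eqP Pn0; apply: nP; exists (P c) => // x Xx; rewrite PE; exact: vc.
  move=> i; have := congr1 (mcoeff (mon_mnm (enum_val i))) P0.
  rewrite mcoeff0 raddf_sum (bigD1 i) //= mcoeffZ mcoeffX eqxx mulr1 big1 ?addr0 // => l li.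
  rewrite mcoeffZ mcoeffX (inj_eq (@mon_mnm_inj m k)) (inj_eq enum_val_inj) (negbTE li) mulr0 //.
by rewrite card_mon leqNgt lt.
Qed.

Let finite_over m := exists (A : 'M[F]_(N, m)) (J : finType) (g : J -> {mpoly F[N]}),
  filtered_finite X A g.

Let finite_over_ge m : finite_over m -> (d <= m)%N.
Proof.
case=> A [J [g ff]]; rewrite leqNgt; apply/negP => md.
have b : binpoly m (#|J|%:R * 1) (fun k => #|J|%:R * ('C(k + m, m))%:R).
  by apply: binpolyZ; exact: (binpoly_shift m (binpoly_bin m)).
suff : D%:R <= 0 :> rat by rewrite leNgt ltr0n D_gt0.
apply: (binpoly_le _ hD (binpoly_lowern md b)) => k.
by rewrite -natrM ler_nat mulnC addnC; exact: filtered_finite_bound ff (hX k).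
Qed.

Let linform_rel m (A : 'M[F]_(N, m)) (P : {mpoly F[m]}) x :
  P.@[fun i => mpoly_at (linform (col i A)) x] = mpoly_at P (x *m A).
Proof.
apply: meval_eq => i; rewrite /mpoly_at linformE !mxE; apply: eq_bigr => l _; by rewrite mxE.
Qed.

Let finite_over_step m (A : 'M[F]_(N, m)) (J : finType) (g : J -> {mpoly F[N]}) P :
  filtered_finite X A g -> P != 0 -> (forall x, X x -> mpoly_at P (x *m A) = 0) ->
  finite_over m.-1.
Proof.
case: m A g P => [|m] A g P ff Pn0 PX; last exact: (filtered_finite_step Pn0 PX ff).
have [x Xx] := X_neq0; have [v hv] := mpoly_neq0_eval Pn0.
by move: hv; rewrite (_ : v = x *m A) ?PX ?eqxx //; apply/rowP => -[].
Qed.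

(** While more than [d] forms remain, [alg_dependent] relates them and one is removed. At [d] a
    relation would give finiteness over [d.-1] forms and a Hilbert function growing too slowly for
    [D_gt0]. *)
Lemma noether_normalization : exists (A : 'M[F]_(N, d)) (J : finType) (g : J -> {mpoly F[N]}),
  filtered_finite X A g /\
  forall P : {mpoly F[d]}, (forall x, X x -> mpoly_at P (x *m A) = 0) -> P = 0.
Proof.
have down m : (d <= m)%N -> finite_over m -> finite_over d.
  elim: m => [|m IH]; first by rewrite leqn0 => /eqP ->.
  rewrite leq_eqVlt => /orP[/eqP -> //|dm] [A [J [g ff]]]; apply: IH => //.
  have [|P Pn0 PX] := @alg_dependent m.+1 (fun i => linform (col i A)) 1 _ dm.
    by move=> i; exact: msize_linform.
  by apply: (finite_over_step ff Pn0) => x Xx; rewrite -linform_rel; exact: PX.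
have [|A [J [g ff]]] := down N le_dN.
  by exists 1%:M, 'I_1, (fun=> 1); exact: filtered_finite1.
exists A, J, g; split=> // P PX; apply: contrapT => /eqP Pn0.
have fo := finite_over_step ff Pn0 PX; have := finite_over_ge fo.
(* When [d] is 0 its predecessor is 0 again and finiteness contradicts nothing; but a nonzero
   polynomial in no variables has no zero, while [X] has a point. *)
move=> dd; have d0 : d = 0%N by case: (d) dd => // m; rewrite ltnn.
have [x Xx] := X_neq0; have [v hv] := mpoly_neq0_eval Pn0.
move: hv; rewrite (_ : v = x *m A) ?PX ?eqxx //; apply/rowP => i.
by have := ltn_ord i; rewrite {2}d0.
Qed.

Section Rank.
Variables (A : 'M[F]_(N, d)) (J : finType) (g : J -> {mpoly F[N]}).
Hypothesis ff : filtered_finite X A g.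
Hypothesis algA : forall P : {mpoly F[d]},
  (forall x, X x -> mpoly_at P (x *m A) = 0) -> P = 0.

Let maximal_span e (f : 'I_e -> {mpoly F[N]}) :
  indep_over X A f -> ~ (exists f' : 'I_e.+1 -> {mpoly F[N]}, indep_over X A f') ->
  forall q, exists2 z : {mpoly F[d]} * ('I_e -> {mpoly F[d]}), z.1 != 0 & forall x, X x ->
    mpoly_at z.1 (x *m A) * mpoly_at q x = \sum_k mpoly_at (z.2 k) (x *m A) * mpoly_at (f k) x.
Proof.
move=> indf nind q.
pose f' (i : 'I_e.+1) := if unlift ord_max i is Some k then f k else q.
have [c [cP [j cj]]] : exists c : 'I_e.+1 -> {mpoly F[d]},
    (forall x, X x -> \sum_j mpoly_at (c j) (x *m A) * mpoly_at (f' j) x = 0) /\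
    exists j, c j != 0.
  apply: contrapT => h0; apply: nind; exists f' => c cP j; apply: contrapT => /eqP cj.
  by apply: h0; exists c; split=> //; exists j.
have {}cP x : X x -> mpoly_at (c ord_max) (x *m A) * mpoly_at q x +
    \sum_k mpoly_at (c (lift ord_max k)) (x *m A) * mpoly_at (f k) x = 0.
  move=> /cP; rewrite (bigD1_ord ord_max) //= {1}/f' unlift_none => h0.
  by rewrite -[RHS]h0; congr (_ + _); apply: eq_bigr => k _; rewrite /f' liftK.
exists (c ord_max, fun k => - c (lift ord_max k)) => [|x Xx] /=; last first.
  apply/eqP; rewrite -subr_eq0 -[X in _ == X](cP _ Xx) -sumrN; apply/eqP; congr (_ + _).
  by apply: eq_bigr => k _; rewrite /mpoly_at mevalN mulNr opprK.
apply: contraNneq cj => cm.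
case: (unliftP ord_max j) => [k ->|->]; last by rewrite cm.
apply/eqP; apply: (indf (fun k => c (lift ord_max k))) => x Xx.
by have := cP x Xx; rewrite cm {1}/mpoly_at meval0 mul0r add0r.
Qed.

(** For a maximal family of [e] functions independent over the forms, one common denominator [De]
    maps all generators into its span. Functions of degree [k], multiplied by [De], then fill at
    most [e * 'C(d + k + gam, d)] dimensions, and leading coefficients give [D <= e]. *)
Lemma degree_le_rank b :
  (forall e (f : 'I_e -> {mpoly F[N]}), indep_over X A f -> (e < b)%N) -> (D < b)%N.
Proof.
move=> bnd.
pose Pe e := `[< exists f : 'I_e -> {mpoly F[N]}, indep_over X A f >].
have ex0 : exists e, Pe e by exists 0%N; apply/asboolP; exists (fun=> 0) => c _ [].
have ub e : Pe e -> (e <= b)%N by move=> /asboolP [f /bnd /ltnW].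
case: (ex_maxnP ex0 ub) => e /asboolP [f indf] maxe.
apply: (@leq_ltn_trans e); last exact: bnd indf.
have nind : ~ (exists f' : 'I_e.+1 -> {mpoly F[N]}, indep_over X A f').
  by move=> h0; have /maxe := asboolT h0; rewrite ltnn.
have [|z zP] := @boolp.choice J ({mpoly F[d]} * ('I_e -> {mpoly F[d]})) (fun j z => z.1 != 0 /\
    forall x, X x -> mpoly_at z.1 (x *m A) * mpoly_at (g j) x =
      \sum_k mpoly_at (z.2 k) (x *m A) * mpoly_at (f k) x).
  by move=> j; have [z z1 z2] := maximal_span indf nind (g j); exists z.
pose De := \prod_j (z j).1; pose Dj j := \prod_(i | i != j) (z i).1.
have Den0 : De != 0 by apply/prodf_neq0 => j _; have [] := zP j.
pose gam := (\sum_j \sum_k msize (Dj j * (z j).2 k))%N.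
have le_gam j k : (msize (Dj j * (z j).2 k) <= gam.+1)%N.
  by rewrite leqW // /gam (bigD1 j) //= (bigD1 k) //= -addnA leq_addr.
have DeE j x : X x -> mpoly_at De (x *m A) * mpoly_at (g j) x =
    \sum_k mpoly_at (Dj j * (z j).2 k) (x *m A) * mpoly_at (f k) x.
  move=> Xx; have [_ /(_ x Xx) hz] := zP j.
  transitivity (mpoly_at (Dj j) (x *m A) * (mpoly_at (z j).1 (x *m A) * mpoly_at (g j) x)).
    by rewrite /De (bigD1 j) //= -/(Dj j) mpoly_atM mulrCA mulrA.
  by rewrite hz mulr_sumr; apply: eq_bigr => k _; rewrite mpoly_atM mulrA.
have [q qE] : exists q : {mpoly F[N]}, forall x, mpoly_at q x = mpoly_at De (x *m A).
  exists (mmap (@mpolyC N F) (fun i => linform (col i A)) De) => x.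
  rewrite -linform_rel; elim/mpoly_ringind: (De) => [a|i|p1 p2 h1 h2|p1 p2 h1 h2].
  - by rewrite mmapC /mpoly_at !mevalC.
  - by rewrite mmapX mmap1U mevalXU.
  - by rewrite mmapD mpoly_atD h1 h2 mevalD.
  - by rewrite rmorphM mpoly_atM h1 h2 mevalM.
have le_h k : (h k <= 'C(d + (k + gam), d) * e)%N.
  have [[p sp ip] _] := hX k.
  have [|c cP] := @boolp.choice 'I_(h k) (J -> {mpoly F[d]}) (fun i c =>
    (forall j, (msize (c j) <= msize (p i))%N) /\
    forall x, X x -> mpoly_at (p i) x = \sum_j mpoly_at (c j) (x *m A) * mpoly_at (g j) x).
    by move=> i; have [c c1 c2] := ff (p i); exists c.
  have := @filtered_span_bound F N X d A 'I_e f (k + gam) (h k) (fun i => q * p i)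
    (fun i l => \sum_j c i j * (Dj j * (z j).2 l)).
  rewrite card_ord; apply=> [b0 v|i l|i x Xx].
  - have : vanish X (q * \sum_i b0 i *: p i).
      move=> x Xx; rewrite -[RHS](v x Xx) !mpoly_atM !mpoly_at_sum mulr_sumr.
      by apply: eq_bigr => i _; rewrite /= !mpoly_atZ mpoly_atM; ring.
    case/irrX => [vq|/ip //].
    by case/eqP: Den0; apply: algA => x Xx; rewrite -qE vq.
  - apply: msize_sum_leq => j; apply: msizeM_leq => //.
    by have [c1 _] := cP i; apply: leq_trans (c1 j) (sp i).
  rewrite mpoly_atM qE; have [_ ->] := cP i => //; rewrite mulr_sumr.
  under eq_bigr => j _ do rewrite mulrCA DeE // mulr_sumr.
  rewrite exchange_big; apply: eq_bigr => l _ /=; rewrite mpoly_at_sum mulr_suml.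
  by apply: eq_bigr => j _; rewrite [in RHS]mpoly_atM mulrA.
have b1 : binpoly d (e%:R * 1) (fun k => e%:R * ('C(k + (d + gam), d))%:R).
  by apply: binpolyZ; exact: (binpoly_shift (d + gam) (binpoly_bin d)).
have := binpoly_le _ hD b1; rewrite mulr1 ler_nat; apply => k.
by rewrite -natrM ler_nat mulnC addnCA.
Qed.

End Rank.

(** [D.+1] copies of ['C(k + d, d)] eventually exceed the Hilbert function at [k + D.+1], whose
    leading coefficient is only [D]. *)
Lemma degree_relation : exists G : {poly {mpoly F[N * d + d + N]}},
  [/\ G != 0, proj_rel X G & (size G <= D.+1)%N].
Proof.
have b1 : binpoly d (D.+1%:R * 1 + (-1) * D%:R)
    (fun k => D.+1%:R * ('C(k + d, d))%:R + (-1) * (h (k + D.+1))%:R).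
  apply: binpolyD; apply: binpolyZ; first exact: (binpoly_shift d (binpoly_bin d)).
  exact: (binpoly_shift D.+1 hD).
have [|e e0 [K KP]] := binpoly_pos _ b1; first by rewrite mulr1 mulN1r -natrB // subSnn.
apply: (@relation_exists _ _ X d h hX K).
have := lt_le_trans e0 (KP K (leqnn K)).
rewrite mulN1r subr_gt0 -natrM ltr_nat mulnC [(d + K)%N]addnC => lt_h; exact: lt_h.
Qed.

Theorem degree_of_hilbert : has_degree X D.
Proof.
have [A [J [g [ff algA]]]] := noether_normalization.
have [G [Gn0 relG sG minG]] : exists G : {poly {mpoly F[N * d + d + N]}},
   [/\ G != 0, proj_rel X G, (size G <= D.+1)%N &
    forall H : {poly {mpoly F[N * d + d + N]}}, proj_rel X H -> (size H < size G)%N -> H = 0].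
  pose Ps s := `[< exists G : {poly {mpoly F[N * d + d + N]}}, [/\ G != 0, proj_rel X G & size G = s] >].
  have [G0 [G01 G02 G03]] := degree_relation.
  have exs : exists s, Ps s by exists (size G0); apply/asboolP; exists G0.
  case: (ex_minnP exs) => s /asboolP [G [G1 G2 G3]] mins.
  exists G; split=> //.
    by rewrite G3; apply: leq_trans G03; apply: mins; apply/asboolP; exists G0.
  move=> H relH; rewrite G3 ltnNge => hs; apply: contrapT => /eqP Hn0.
  by case/negP: hs; apply: mins; apply/asboolP; exists H.
have eG : size G = D.+1.
  apply/eqP; rewrite eqn_leq sG /=; apply: (degree_le_rank ff algA) => e f.
  exact: (relation_bound irrX Gn0 relG minG algA).
exists d; last first.
  have [e eD] : exists e, D = e.+1 by case: (D) D_gt0 => // e _; exists e.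
  rewrite eD; apply: (generic_fiber irrX closedX relG _ minG le_dN).
  by rewrite eG eD.
split=> [|k f algf].
  exists [tuple linform (col i A) | i < d] => P vP; apply: algA => x Xx.
  rewrite -linform_rel -[RHS](vP x Xx) /mpoly_at comp_mpoly_meval; apply: meval_eq => i.
  by rewrite tnth_mktuple.
rewrite leqNgt; apply/negP => dk.
have [|P /eqP Pn0 vP] := @alg_dependent k (tnth f) (\sum_i msize (tnth f i)) _ dk.
  by move=> i; rewrite leqW // (bigD1 i) //= leq_addr.
apply: Pn0; apply: algf => x Xx; rewrite -[RHS](vP x Xx) /mpoly_at comp_mpoly_meval.
exact: meval_eq.
Qed.

End DegreeTheorem.

(** * The Casimir operator and the dimension formula *)

Section Euler.
Variables (F : numClosedFieldType) (r : nat).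
Implicit Types p q : {mpoly F[r]}.

Definition euler i p := 'X_i * p^`M(i).

Lemma eulerM i p q : euler i (p * q) = euler i p * q + p * euler i q.
Proof. by rewrite /euler mderivM mulrDr !mulrA [p * _]mulrC. Qed.

Lemma eulerD i p q : euler i (p + q) = euler i p + euler i q.
Proof. by rewrite /euler mderivD mulrDr. Qed.

Lemma eulerZ i c p : euler i (c *: p) = c *: euler i p.
Proof. by rewrite /euler mderivZ scalerAr. Qed.

Lemma eulerN i p : euler i (- p) = - euler i p.
Proof. by rewrite /euler mderivN mulrN. Qed.

Lemma euler_sum i I (rr : seq I) P (G : I -> {mpoly F[r]}) :
  euler i (\sum_(j <- rr | P j) G j) = \sum_(j <- rr | P j) euler i (G j).
Proof. by rewrite /euler raddf_sum mulr_sumr. Qed.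

Lemma eulerX i (m : 'X_{1..r}) : euler i 'X_[m] = (m i)%:R *: 'X_[m].
Proof.
rewrite /euler mderivX -scalerAr; have [->|mi] := posnP (m i); first by rewrite !scale0r.
by rewrite -mpolyXD addmC submK // lep1mP -lt0n.
Qed.

Lemma mcoeff_euler i p m : (euler i p)@_m = (m i)%:R * p@_m.
Proof.
have e : euler i p = euler i (\sum_(m' <- msupp p) p@_m' *: 'X_[m']) by rewrite -mpolyE.
have e2 : p@_m = (\sum_(m' <- msupp p) p@_m' *: 'X_[m'])@_m by rewrite -mpolyE.
rewrite e e2 euler_sum !raddf_sum /= mulr_sumr.
apply: eq_bigr => m' _; rewrite eulerZ eulerX !mcoeffZ mcoeffX.
by case: eqP => [->|_]; rewrite ?mulr0 // !mulr1 mulrC.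
Qed.

Lemma euler_prod i (T : finType) (P : pred T) (G : T -> {mpoly F[r]}) :
  euler i (\prod_(a | P a) G a) =
  \sum_(a | P a) euler i (G a) * \prod_(b | P b && (b != a)) G b.
Proof.
pose us := enum T; have us_u : uniq us by exact: enum_uniq.
have -> : \prod_(a | P a) G a = \prod_(a <- us | P a) G a by rewrite big_enum_cond.
have -> : \sum_(a | P a) euler i (G a) * \prod_(b | P b && (b != a)) G b =
    \sum_(a <- us | P a) euler i (G a) * \prod_(b <- us | P b && (b != a)) G b.
  by rewrite big_enum_cond; apply: eq_bigr => a _; rewrite big_enum_cond.
elim: us us_u => [_|a us IH /= /andP[aus us_u]].
  rewrite !big_nil; apply/mpolyP => m; rewrite mcoeff_euler mcoeff0 mcoeff1.
  by case: eqP => [->|_]; rewrite ?mulr0 // mnm0E mul0r.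
rewrite !big_cons; case: (boolP (P a)) => Pa /=; last first.
  by rewrite IH //; apply: eq_bigr => b Pb; rewrite big_cons (negbTE Pa).
rewrite eulerM IH // eqxx /=; congr (_ * _ + _).
  rewrite big_seq_cond [RHS]big_seq_cond; apply: eq_bigl => b.
  by case: eqP => [->|]; rewrite ?andbT // (negbTE aus).
rewrite mulr_sumr big_seq_cond [RHS]big_seq_cond; apply: eq_bigr => b /andP[bus Pb].
rewrite big_cons Pa /=; case: eqP => [e|_]; first by rewrite e bus in aus.
by rewrite /= mulrCA.
Qed.

End Euler.

(** * Freudenthal's relation and highest weight projectors *)

Section Casimir.
Variables (F : numClosedFieldType) (s' r K : nat).
Local Notation s := s'.+1.
Variables (wt : 'I_s -> 'X_{1..r}) (T : finType) (Phi : pred T).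
Variables (ap am : T -> 'X_{1..r}) (e f : T -> 'M[F]_s).
Hypothesis ewt : forall a i j, Phi a -> e a i j != 0 -> (wt i + am a = wt j + ap a)%MM.
Hypothesis fwt : forall a i j, Phi a -> f a i j != 0 -> (wt i + ap a = wt j + am a)%MM.

(** Weights are stored shifted by [K] to serve as exponents; here the shift is undone. *)
Definition cartan i : 'M[F]_s := diag_mx (\row_j ((wt j i)%:R - K%:R)).
Definition rootc a i : F := (ap a i)%:R - (am a i)%:R.

Hypothesis ef : forall a, Phi a ->
  e a *m f a - f a *m e a = \sum_i rootc a i *: cartan i.

Definition casimir : 'M[F]_s :=
  \sum_i cartan i *m cartan i + \sum_(a | Phi a) (e a *m f a + f a *m e a).
Local Notation C := casimir.

Hypothesis Ce : forall a, Phi a -> C *m e a = e a *m C.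

(** For [Q = 1%:M] the formal character, up to the shift by [K]. *)
Definition graded_trace (Q : 'M[F]_s) : {mpoly F[r]} := \sum_j Q j j *: 'X_[wt j].
Local Notation chi := graded_trace.

Definition weyl_denominator : {mpoly F[r]} := \prod_(a | Phi a) ('X_[ap a] - 'X_[am a]).
Local Notation delta := weyl_denominator.

Let kap i : F := \sum_(a | Phi a) ((ap a i)%:R + (am a i)%:R).
Let rho2 i : F := \sum_(a | Phi a) rootc a i.
Let R : F := \sum_i rho2 i ^+ 2.

Hypothesis delta_supp : forall m, delta@_m != 0 -> \sum_i (2 * (m i)%:R - kap i) ^+ 2 = R.

Let chiD Q1 Q2 : chi (Q1 + Q2) = chi Q1 + chi Q2.
Proof. by rewrite -big_split; apply: eq_bigr => j _; rewrite mxE scalerDl. Qed.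

Let chiZ c Q : chi (c *: Q) = c *: chi Q.
Proof. by rewrite scaler_sumr; apply: eq_bigr => j _; rewrite mxE scalerA. Qed.

Let chi0 : chi 0 = 0.
Proof. by apply: big1 => j _; rewrite mxE scale0r. Qed.

Let chi_sum I (rr : seq I) P (G : I -> 'M_s) :
  chi (\sum_(j <- rr | P j) G j) = \sum_(j <- rr | P j) chi (G j).
Proof. by elim/big_rec2: _ => [|i y x _ <-]; rewrite ?chi0 ?chiD. Qed.

Let t i (p : {mpoly F[r]}) := euler i p - K%:R *: p.

Let chi_H Q i : chi (Q *m cartan i) = t i (chi Q).
Proof.
rewrite /t /chi euler_sum scaler_sumr -sumrB; apply: eq_bigr => j _.
rewrite eulerZ eulerX mul_mx_diag !mxE !scalerA -scalerBl; congr (_ *: _); ring.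
Qed.

(** Cyclicity of the trace: moving [e a] to the other side shifts the weight by the root
    [ap a - am a]. *)
Let chi_shift Q a : Phi a -> Q *m e a = e a *m Q ->
  'X_[ap a] * chi (Q *m (f a *m e a)) = 'X_[am a] * chi (Q *m (e a *m f a)).
Proof.
move=> Pa Qe; rewrite [Q *m (e a *m _)]mulmxA Qe -mulmxA mulmxA.
set B := Q *m f a; rewrite /chi !mulr_sumr.
under eq_bigr => i _ do rewrite mxE scaler_suml mulr_sumr.
under [RHS]eq_bigr => i _ do rewrite mxE scaler_suml mulr_sumr.
rewrite exchange_big; apply: eq_bigr => i _; apply: eq_bigr => j _ /=.
have [->|/(ewt Pa) w] := eqVneq (e a i j) 0; first by rewrite mulr0 mul0r !scale0r !mulr0.
by rewrite -!scalerAr -!mpolyXD [(ap a + _)%MM]addmC -w [(am a + _)%MM]addmC mulrC.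
Qed.

Let chi_root Q a : Phi a -> Q *m e a = e a *m Q ->
  ('X_[ap a] - 'X_[am a]) * chi (Q *m (e a *m f a + f a *m e a)) =
  ('X_[ap a] + 'X_[am a]) * \sum_i rootc a i *: t i (chi Q).
Proof.
move=> Pa Qe; have sh := chi_shift Pa Qe.
have -> : \sum_i rootc a i *: t i (chi Q) = chi (Q *m (e a *m f a)) - chi (Q *m (f a *m e a)).
  rewrite -[X in _ - X]scale1r -scaleNr -chiZ -chiD scaleN1r -mulmxBr ef // mulmx_sumr chi_sum.
  by apply: eq_bigr => i _; rewrite -scalemxAr chiZ chi_H.
rewrite mulmxDr chiD; set x := chi _ in sh *; set y := chi _ in sh *.
apply/eqP; rewrite -subr_eq0 (_ : _ - _ = 2 * ('X_[ap a] * x - 'X_[am a] * y)); last by ring.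
by rewrite sh subrr mulr0.
Qed.

Let delta_a a : Phi a -> delta = ('X_[ap a] - 'X_[am a]) *
  \prod_(b | Phi b && (b != a)) ('X_[ap b] - 'X_[am b]).
Proof. by move=> Pa; rewrite /delta (bigD1 a). Qed.

Let S i (p : {mpoly F[r]}) := 2 *: euler i p - kap i *: p.

Let S_delta i : S i delta = \sum_(a | Phi a) rootc a i *: (('X_[ap a] + 'X_[am a]) *
  \prod_(b | Phi b && (b != a)) ('X_[ap b] - 'X_[am b])).
Proof.
rewrite /S {1}/delta euler_prod /kap scaler_sumr scaler_suml -sumrB.
apply: eq_bigr => a Pa; rewrite (delta_a Pa); move: (\prod_(b | _) _) => q.
rewrite eulerD eulerN !eulerX.
rewrite /rootc -!mul_mpolyC !rmorphB !rmorphD /= mpolyC_nat; ring.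
Qed.

(** The Casimir operator acts on characters as a second order differential operator whose
    denominators ['X_[ap a] - 'X_[am a]] are cleared by [delta]; the sum over roots then becomes the
    derivatives [S i delta]. *)
Let chi_C Q : (forall a, Phi a -> Q *m e a = e a *m Q) ->
  delta * chi (Q *m C) = delta * (\sum_i t i (t i (chi Q))) + \sum_i S i delta * t i (chi Q).
Proof.
move=> Qe; rewrite /C mulmxDr chiD mulrDr; congr (_ + _).
  congr (_ * _); rewrite mulmx_sumr chi_sum; apply: eq_bigr => i _.
  by rewrite mulmxA !chi_H.
rewrite mulmx_sumr chi_sum mulr_sumr.
under [RHS]eq_bigr => i _ do rewrite S_delta mulr_suml.
rewrite exchange_big; apply: eq_bigr => a Pa /=.
rewrite (delta_a Pa) mulrAC chi_root ?Qe // mulrAC mulr_sumr.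
by apply: eq_bigr => i _; rewrite -scalerAr scalerAl.
Qed.

(** The sum of the squares of the shifted Euler operators [U i], applied to [delta * chi Q],
    reproduces the operator of [chi_C]: the cross terms agree, and [delta] is an eigenvector for [R]
    by [delta_supp]. Each [U i] is a scalar on monomials. *)
Lemma freudenthal Q (m : 'X_{1..r}) : (forall a, Phi a -> Q *m e a = e a *m Q) ->
  (\sum_i (2 * (m i)%:R - 2 * K%:R - kap i) ^+ 2) * (delta * chi Q)@_m =
  R * (delta * chi Q)@_m + 4 * (delta * chi (Q *m C))@_m.
Proof.
move=> Qe; pose U i (p : {mpoly F[r]}) := 2 *: euler i p - (2 * K%:R + kap i) *: p.
have UM i p q : U i (p * q) = S i p * q + 2 *: (p * t i q).
  by rewrite /U /S /t eulerM -!mul_mpolyC !rmorphD !rmorphM /= ; ring.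
have Ucoeff i p : (U i p)@_m = (2 * (m i)%:R - 2 * K%:R - kap i) * p@_m.
  by rewrite /U mcoeffB !mcoeffZ mcoeff_euler; ring.
have SS : \sum_i S i (S i delta) = R *: delta.
  apply/mpolyP => m'; rewrite raddf_sum mcoeffZ /=.
  have Sc i p : (S i p)@_m' = (2 * (m' i)%:R - kap i) * p@_m'.
    by rewrite /S mcoeffB !mcoeffZ mcoeff_euler; ring.
  under eq_bigr => i _ do rewrite !Sc mulrA -expr2.
  rewrite -mulr_suml; have [->|/delta_supp -> //] := eqVneq delta@_m' 0.
  by rewrite !mulr0.
have e1 : \sum_i U i (U i (delta * chi Q)) = R *: (delta * chi Q) + 4 *: (delta * chi (Q *m C)).
  rewrite chi_C // scalerAl -SS mulr_suml scalerDr mulr_sumr addrA scaler_sumr -big_split /=.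
  rewrite scaler_sumr -big_split; apply: eq_bigr => i _ /=.
  have UD p q : U i (p + q) = U i p + U i q.
    by rewrite /U eulerD !scalerDr opprD addrACA.
  have UZ c p : U i (c *: p) = c *: U i p.
    rewrite /U eulerZ scalerBr !scalerA; congr (_ *: _ - _ *: _); ring.
  rewrite UM UD UZ !UM -!mul_mpolyC /=; ring.
have := congr1 (mcoeff m) e1; rewrite mcoeffD !mcoeffZ raddf_sum /= => <-.
by rewrite mulr_suml; apply: eq_bigr => i _; rewrite !Ucoeff mulrA expr2.
Qed.

Section HighestWeight.
Let col_mul (A B : 'M[F]_s) j : col j (A *m B) = A *m col j B.
Proof. by rewrite !colE mulmxA. Qed.

Variable lam : 'X_{1..r}.

Let alph a i : int := (ap a i)%:Z - (am a i)%:Z.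
(** The coordinates of [2 (lam + rho)] without the shift by [K]. Pairing with it, as [ell] does,
    orders the weights so that positive roots raise them. *)
Let nu i : int := 2 * ((lam i)%:Z - K%:Z) + \sum_(a | Phi a) alph a i.
Let ell (m : 'X_{1..r}) : int := \sum_i nu i * (m i)%:Z.

Hypothesis nu_pos : forall a, Phi a -> 0 < \sum_i nu i * alph a i.

Definition hw_vector (z : 'cV[F]_s) :=
  (forall j, z j 0 != 0 -> wt j = lam) /\ forall a, Phi a -> e a *m z = 0.

(** The eigenvalue [(mu, mu + 2 rho)] of the Casimir operator on highest weight vectors, as a
    difference of squared norms of [2 mu + 2 rho] and [2 rho]. *)
Let cas (mu : 'X_{1..r}) : F :=
  (\sum_i (2 * ((mu i)%:R - K%:R) + rho2 i) ^+ 2 - R) / 4.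

Let hw_casimir (z : 'cV[F]_s) mu : (forall j, z j 0 != 0 -> wt j = mu) ->
  (forall a, Phi a -> e a *m z = 0) -> C *m z = cas mu *: z.
Proof.
move=> zw ez.
have Hz i : cartan i *m z = ((mu i)%:R - K%:R) *: z.
  apply/colP => j; rewrite mul_diag_mx !mxE.
  by have [->|/zw ->//] := eqVneq (z j 0) 0; rewrite !mulr0.
have efz a : Phi a -> (e a *m f a + f a *m e a) *m z =
    (\sum_i rootc a i * ((mu i)%:R - K%:R)) *: z.
  move=> Pa; transitivity ((e a *m f a - f a *m e a) *m z).
    by rewrite mulmxDl mulmxBl -(mulmxA (f a)) ez // mulmx0 addr0 subr0.
  rewrite ef // mulmx_suml scaler_suml; apply: eq_bigr => i _.
  by rewrite -scalemxAl Hz scalerA.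
rewrite /C mulmxDl !mulmx_suml (eq_bigr _ efz) -scaler_suml.
under eq_bigr => i _ do rewrite -mulmxA Hz -scalemxAr Hz scalerA.
rewrite -scaler_suml -scalerDl; congr (_ *: _).
rewrite exchange_big /= -big_split /cas /R -sumrB mulr_suml /=; apply: eq_bigr => i _.
by rewrite -mulr_suml -/(rho2 i); field.
Qed.

Let top : 'X_{1..r} := (lam + \sum_(a | Phi a) ap a)%MM.

Let nuE i : (nu i)%:~R = 2 * ((lam i)%:R - K%:R) + rho2 i :> F.
Proof.
rewrite /nu rmorphD rmorphM rmorphB /= rmorph_sum /= -!pmulrn; congr (_ + _).
by apply: eq_bigr => a _; rewrite /alph rmorphB /= -!pmulrn.
Qed.

(** The difference of the two eigenvalues is [2 (lam + rho, mu - lam)] plus the squared norm of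
    [mu - lam]. *)
Let cas_neq (mu : 'X_{1..r}) : ell lam < ell mu -> cas mu != cas lam.
Proof.
move=> lt; rewrite /cas -subr_eq0 -mulrBl mulf_eq0 invr_eq0 pnatr_eq0 orbF.
rewrite opprB addrA subrK -sumrB.
rewrite (eq_bigr (fun i => (4 * (nu i * ((mu i)%:Z - (lam i)%:Z)) +
   4 * (((mu i)%:Z - (lam i)%:Z) * ((mu i)%:Z - (lam i)%:Z)))%:~R)) => [|i _].
  rewrite -rmorph_sum /= intr_eq0 big_split -!mulr_sumr /=.
  have : 0 <= \sum_i ((mu i)%:Z - (lam i)%:Z) * ((mu i)%:Z - (lam i)%:Z).
    by apply: sumr_ge0 => i _; rewrite -expr2 sqr_ge0.
  have : 0 < \sum_i nu i * ((mu i)%:Z - (lam i)%:Z).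
    by under eq_bigr => i _ do rewrite mulrBr; rewrite sumrB subr_gt0.
  move: (\sum_i _) (\sum_i _) => x y; lia.
rewrite -nuE.
have -> : 2 * ((mu i)%:R - K%:R) + rho2 i = (nu i)%:~R + 2 * ((mu i)%:R - (lam i)%:R) :> F.
  by rewrite nuE; ring.
move: (nu i) => v; rewrite rmorphD !rmorphM rmorphB /= -!pmulrn; ring.
Qed.

Let graded (B : 'M[F]_s) := forall i j, B i j != 0 -> wt i = wt j.

Let sum_neq0 (I : finType) (P : pred I) (G : I -> F) :
  \sum_(i | P i) G i != 0 -> exists2 i, P i & G i != 0.
Proof.
move=> h; apply: contrapT => h0; case/negP: h; apply/eqP; apply: big1 => i Pi.
by apply/eqP; apply: contraT => ne; case: h0; exists i.
Qed.

Let graded_C : graded C.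
Proof.
move=> i j; rewrite /C mxE => h.
have : (\sum_k cartan k *m cartan k) i j != 0 \/
   (\sum_(a | Phi a) (e a *m f a + f a *m e a)) i j != 0.
  have [h1|] := eqVneq ((\sum_k cartan k *m cartan k) i j) 0; last by left.
  by right; move: h; rewrite h1 add0r.
case; rewrite summxE => /sum_neq0 [k Pk].
  rewrite mul_diag_mx !mxE; case: (i =P j) => [->//|_]; by rewrite mulr0n mulr0 eqxx.
rewrite mxE => h1; have : (e k *m f k) i j != 0 \/ (f k *m e k) i j != 0.
  have [h2|] := eqVneq ((e k *m f k) i j) 0; last by left.
  by right; move: h1; rewrite h2 add0r.
case; rewrite mxE => /sum_neq0 [l _]; rewrite mulf_eq0 negb_or => /andP[].
  move=> /(ewt Pk) w1 /(fwt Pk) w2; apply: (@addIm _ (am k)); rewrite w1 w2 //.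
move=> /(fwt Pk) w1 /(ewt Pk) w2; apply: (@addIm _ (ap k)); by rewrite w1 w2.
Qed.

Let proj mu : 'M[F]_s := diag_mx (\row_j (wt j == mu)%:R).

Let graded_comm B : graded B -> forall mu, B *m proj mu = proj mu *m B.
Proof.
move=> gB mu; apply/matrixP => i j; rewrite mul_mx_diag mul_diag_mx !mxE.
by have [->|/gB ->] := eqVneq (B i j) 0; rewrite ?mulr0 ?mul0r // mulrC.
Qed.

Let comm_graded B : (forall mu, B *m proj mu = proj mu *m B) -> graded B.
Proof.
move=> cB i j Bij; have /matrixP/(_ i j) := cB (wt j).
rewrite mul_mx_diag mul_diag_mx !mxE eqxx mulr1; case: eqP => // _.
by rewrite mul0r => /eqP; rewrite (negbTE Bij).
Qed.

Let horner_eigen (p : {poly F}) c (z : 'cV[F]_s) : C *m z = c *: z ->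
  horner_mx C p *m z = p.[c] *: z.
Proof.
move=> Cz; elim/poly_ind: p => [|p k IH].
  by rewrite rmorph0 mul0mx horner0 scale0r.
rewrite rmorphD rmorphM /= horner_mx_X horner_mx_C hornerMXaddC mulmxDl.
by rewrite -[_ * C]/(_ *m C) -mulmxA Cz -scalemxAr IH scalerA mul_scalar_mx -scalerDl mulrC.
Qed.

(** The characteristic polynomial without its factor at [cas lam], normalised. In [C] it maps into
    the generalised eigenspace of [cas lam] and fixes the eigenvectors there. *)
Let split_char : exists (p : {poly F}) (k : nat), p.[cas lam] = 1 /\
  (C - (cas lam)%:M) ^+ k * horner_mx C p = 0.
Proof.
have [k [q]] := multiplicity_XsubC (char_poly C) (cas lam).
rewrite monic_neq0 ?char_poly_monic //= => qc eq.
exists ((q.[cas lam])^-1 *: q), k; split; first by rewrite hornerZ mulVf.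
have := Cayley_Hamilton C; rewrite eq rmorphM rmorphXn rmorphB /= horner_mx_X horner_mx_C => h.
rewrite linearZ /= -scalerAr.
have -> : C - (cas lam)%:M = horner_mx C ('X - (cas lam)%:P).
  by rewrite rmorphB /= horner_mx_X horner_mx_C.
rewrite -rmorphXn -rmorphM mulrC rmorphM rmorphXn rmorphB /= horner_mx_X horner_mx_C h.
by rewrite scaler0.
Qed.

Let delta_top : exists2 d' : {mpoly F[r]}, delta = 'X_[\sum_(a | Phi a) ap a] + d' &
  forall m, d'@_m != 0 -> ell m < ell (\sum_(a | Phi a) ap a)%MM.
Proof.
have ellD m1 m2 : ell (m1 + m2)%MM = ell m1 + ell m2.
  by rewrite /ell -big_split; apply: eq_bigr => i _; rewrite mnmDE PoszD mulrDr.
have msum (p : {mpoly F[r]}) k : (forall m, p@_m != 0 -> ell m < k) <->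
    {in msupp p, forall m, ell m < k}.
  by split=> h m; [rewrite mcoeff_msupp | rewrite -mcoeff_msupp]; exact: h.
rewrite /delta; elim/big_rec2: _ => [|a m p Pa [d' -> hd]].
  by exists 0 => [|m]; rewrite ?mpolyX0 ?addr0 // mcoeff0 eqxx.
exists ('X_[ap a] * d' - 'X_[am a] * ('X_[m] + d')); first by rewrite mpolyXD; ring.
have am_lt : ell (am a) < ell (ap a).
  rewrite -subr_gt0 /ell -sumrB; have := nu_pos Pa.
  by rewrite (eq_bigr (fun i => nu i * (ap a i)%:Z - nu i * (am a i)%:Z)) // => i _; rewrite mulrBr.
move=> k hk; have : k \in msupp ('X_[ap a] * d' - 'X_[am a] * ('X_[m] + d')).
  by rewrite mcoeff_msupp.
move=> /msuppB_le; rewrite mem_cat => /orP[].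
  move=> /msuppM_le /allpairsP [[k1 k2] /= [h1 h2 ->]].
  move: h1; rewrite msuppX inE => /eqP ->; rewrite !ellD ltrD2l.
  by apply: hd; rewrite -mcoeff_msupp.
move=> /msuppM_le /allpairsP [[k1 k2] /= [h1 h2 ->]].
move: h1; rewrite msuppX inE => /eqP ->; rewrite !ellD.
move: h2 => /msuppD_le; rewrite mem_cat => /orP[].
  by rewrite msuppX inE => /eqP ->; rewrite ltrD2r.
by rewrite mcoeff_msupp => /hd h2; apply: ltrD.
Qed.

(** [E] is the polynomial [p] of [split_char] in [C], restricted to weight [lam]. Above [lam] this
    polynomial vanishes: by descending induction on [ell], a column there would be a highest weight
    vector, an eigenvector of [C] for a value other than [cas lam]. So its columns of weight [lam]
    are killed by every [e a]. *)
Theorem hw_projector : exists E : 'M[F]_s,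
  [/\ forall i, hw_vector (col i E), forall z, hw_vector z -> E *m z = z,
    forall B, (forall a, Phi a -> B *m e a = e a *m B) ->
      (forall a, Phi a -> B *m f a = f a *m B) -> graded B -> B *m E = E *m B &
    forall Q, (forall a, Phi a -> Q *m e a = e a *m Q) ->
      (delta * chi Q)@_top = \tr (Q *m E)].
Proof.
have [p [k [pc killC]]] := split_char; pose PC := horner_mx C p.
have commPC B : B *m C = C *m B -> B *m PC = PC *m B by exact: comm_mx_horner.
have gPC : graded PC.
  by apply: comm_graded => mu; symmetry; apply: commPC; symmetry; exact: graded_comm.
have ePC a : Phi a -> e a *m PC = PC *m e a by move=> Pa; apply: commPC; rewrite Ce.
have e_col a j : Phi a -> e a *m col j PC = \sum_i e a i j *: col i PC.
  move=> Pa; rewrite -col_mul ePC //; apply/colP => l; rewrite summxE !mxE.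
  by apply: eq_bigr => i _; rewrite !mxE mulrC.
have ell_e a i j : Phi a -> e a i j != 0 -> ell (wt j) < ell (wt i).
  move=> Pa /(ewt Pa) w; have := nu_pos Pa.
  have -> : \sum_i nu i * alph a i = ell (wt i) - ell (wt j); last by rewrite subr_gt0.
  rewrite /ell -sumrB; apply: eq_bigr => l _; have /mnmP/(_ l) := w; rewrite !mnmDE => wl.
  rewrite /alph -mulrBr; congr (_ * _); lia.
have col0 j : ell lam < ell (wt j) -> col j PC = 0.
  pose Bd : int := \sum_j `|ell (wt j)|.
  have leBd i : ell (wt i) <= Bd.
    by apply: le_trans (ler_norm _) _; rewrite /Bd (bigD1 i) //= lerDl sumr_ge0.
  have main (n : nat) : forall j, Bd - ell (wt j) < n%:Z -> ell lam < ell (wt j) -> col j PC = 0.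
    elim: n => [|n IH] {}j hj lt; first by have := leBd j; lia.
    have ez a : Phi a -> e a *m col j PC = 0.
      move=> Pa; rewrite e_col // big1 // => i _.
      have [->|h] := eqVneq (e a i j) 0; first by rewrite scale0r.
      have := ell_e a i j Pa h => lt2; rewrite IH ?scaler0 //; [lia|exact: lt_trans lt lt2].
    have zw i : (col j PC) i 0 != 0 -> wt i = wt j by rewrite mxE; exact: gPC.
    have Cz := hw_casimir zw ez.
    have : horner_mx C (('X - (cas lam)%:P) ^+ k) *m col j PC = 0.
      rewrite rmorphXn rmorphB /= horner_mx_X horner_mx_C -col_mul.
      by rewrite -[_ *m PC]/(_ * PC) killC col0.
    rewrite (horner_eigen _ Cz) horner_exp hornerXsubC => /eqP.
    by rewrite scaler_eq0 expf_eq0 subr_eq0 (negbTE (cas_neq lt)) andbF => /eqP.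
  by apply: (main `|Bd - ell (wt j)|.+1); lia.
pose E := PC *m proj lam.
have colE j : col j E = (wt j == lam)%:R *: col j PC.
  by apply/colP => i; rewrite /E mul_mx_diag !mxE mulrC.
exists E; split.
- move=> j; rewrite colE; have [wj|_] := eqVneq (wt j) lam; last first.
    by split=> [i|a _]; rewrite scale0r ?mulmx0 // mxE eqxx.
  rewrite scale1r; split=> [i|a Pa]; first by rewrite mxE => /gPC ->.
  rewrite e_col // big1 // => i _; have [->|h] := eqVneq (e a i j) 0; first by rewrite scale0r.
  by rewrite col0 ?scaler0 // -wj; exact: ell_e h.
- move=> z [zw ez]; have -> : E *m z = PC *m z.
    rewrite /E -mulmxA; congr (_ *m _); apply/colP => j; rewrite mul_diag_mx !mxE.
    by have [->|/zw ->] := eqVneq (z j 0) 0; rewrite ?mulr0 // eqxx mul1r.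
  by rewrite (horner_eigen _ (hw_casimir zw ez)) pc scale1r.
- move=> B Be Bf gB; rewrite /E mulmxA commPC.
    by rewrite -!mulmxA graded_comm.
  have BH i : B *m cartan i = cartan i *m B.
    apply/matrixP => a b; rewrite mul_mx_diag mul_diag_mx !mxE.
    by have [->|/gB ->] := eqVneq (B a b) 0; rewrite ?mulr0 ?mul0r // mulrC.
  rewrite /C mulmxDr mulmxDl !mulmx_sumr !mulmx_suml; congr (_ + _); apply: eq_bigr => i Pi.
    by rewrite mulmxA BH -!mulmxA BH.
  rewrite mulmxDr mulmxDl !mulmxA Be // Bf // -!mulmxA Be // Bf //.
move=> Q Qe.
have casE (m := top) : \sum_i (2 * (m i)%:R - 2 * K%:R - kap i) ^+ 2 = R + 4 * cas lam.
  rewrite /cas [4 * _]mulrC divfK ?pnatr_eq0 // addrC subrK; apply: eq_bigr => i _; congr (_ ^+ 2).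
  rewrite /m mnmDE mnm_sumE natrD natr_sum /kap /rho2 /rootc sumrB big_split /=; ring.
have step Q' : (forall a, Phi a -> Q' *m e a = e a *m Q') ->
    (delta * chi (Q' *m C))@_top = cas lam * (delta * chi Q')@_top.
  move=> Q'e; have := freudenthal top Q'e; rewrite casE mulrDl => /addrI.
  by rewrite -mulrA => /mulfI ->; rewrite ?pnatr_eq0.
(* Freudenthal's relation iterated: a polynomial in [C] multiplies the coefficient at [top] by its
   value at [cas lam], which is 1 for [p]. *)
have hornerQ (p0 : {poly F}) : (delta * chi (Q *m horner_mx C p0))@_top =
    p0.[cas lam] * (delta * chi Q)@_top.
  elim/poly_ind: p0 => [|p1 k1 IH].
    by rewrite rmorph0 mulmx0 chi0 mulr0 mcoeff0 horner0 mul0r.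
  rewrite rmorphD rmorphM /= horner_mx_X horner_mx_C hornerMXaddC mulmxDr chiD mulrDr mcoeffD.
  rewrite -[_ * C]/(_ *m C) mulmxA step ?IH; last first.
    move=> a Pa; rewrite -mulmxA (_ : horner_mx C p1 *m e a = e a *m horner_mx C p1).
      by rewrite mulmxA Qe // mulmxA.
    by symmetry; apply: comm_mx_horner; rewrite /comm_mx Ce.
  by rewrite mul_mx_scalar chiZ -scalerAr mcoeffZ; ring.
rewrite -[LHS]mul1r -pc -hornerQ -/PC; have [d' dE dlt] := delta_top.
have ellD m1 m2 : ell (m1 + m2)%MM = ell m1 + ell m2.
  by rewrite /ell -big_split; apply: eq_bigr => i _; rewrite mnmDE PoszD mulrDr.
rewrite /mxtrace mulr_sumr raddf_sum /=; apply: eq_bigr => j _.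
rewrite -scalerAr mcoeffZ /E mulmxA mul_mx_diag !mxE.
have QPC0 : ell lam < ell (wt j) -> \sum_i Q j i * PC i j = 0.
  by move=> /col0 /colP h; apply: big1 => i _; have := h i; rewrite !mxE => ->; rewrite mulr0.
have [q0|qn0] := eqVneq (\sum_i Q j i * PC i j) 0; first by rewrite q0 !mul0r.
congr (_ * _); rewrite dE mulrDl mcoeffD -mpolyXD mcoeffX.
(* A lower monomial of [delta] reaches [top] only with a weight above [lam], where the columns of
   [PC] vanish. *)
have -> : (d' * 'X_[wt j])@_top = 0.
  apply: contraNeq qn0 => h; apply/eqP; apply: QPC0.
  have : top \in msupp (d' * 'X_[wt j]) by rewrite mcoeff_msupp.
  move=> /msuppM_le /allpairsP [[k1 k2] /= [h1 h2 topE]].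
  move: h2 h1; rewrite msuppX inE => /eqP k2E; rewrite mcoeff_msupp => /dlt.
  have : ell top = ell k1 + ell k2 by rewrite topE ellD.
  by rewrite /top ellD k2E; move: (ell _) (ell _) (ell _) (ell _) => x y z w; lia.
rewrite addr0 /top addmC; congr (_%:R); apply: congr1.
by apply/eqP/eqP => [/addIm ->|->].
Qed.

End HighestWeight.

End Casimir.

From mathcomp Require Import fingroup perm.
Import Order.TTheory GRing.Theory Num.Theory.

Lemma prod_lt_swap (R : comNzRingType) r (G : 'I_r -> 'I_r -> R) :
  \prod_(k < r) \prod_(l < r | (k < l)%N) G l k = \prod_(k < r) \prod_(l < r | (l < k)%N) G k l.
Proof. by rewrite (exchange_big_dep predT). Qed.

(** * Positive roots in types B and D *)

Section RootData.
Variables (r : nat) (o : bool).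

(* The positive roots e_k - e_l, e_k + e_l (k < l), and e_k when o is true. *)
Definition root : finType := ('I_r * 'I_r * bool + 'I_r)%type.

Definition pos_root (t : root) : bool :=
  match t with inl (k, l, _) => (k < l)%N | inr _ => o end.

Definition root_plus (t : root) : 'X_{1..r} :=
  match t with
  | inl (k, l, b) => if b then (U_(k) + U_(l))%MM else U_(k)%MM
  | inr k => U_(k)%MM
  end.

Definition root_minus (t : root) : 'X_{1..r} :=
  match t with inl (_, l, b) => if b then 0%MM else U_(l)%MM | inr _ => 0%MM end.

(* n - 2, where n = 2 r + o *)
Definition wexp : nat := (r.*2 + o - 2)%N.
Local Notation q := wexp.

(** The sum of the positive roots, [n - 2 - 2 i] in coordinate [i]: twice the usual [rho]. *)
Definition rho2 (i : nat) : nat := (q - i.*2)%N.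

Lemma big_pos_root (R : Type) (idx : R) (op : Monoid.com_law idx) (G : root -> R) :
  \big[op/idx]_(t | pos_root t) G t =
  op (\big[op/idx]_(k < r) \big[op/idx]_(l < r | (k < l)%N)
        op (G (inl (k, l, true))) (G (inl (k, l, false))))
     (if o then \big[op/idx]_(k < r) G (inr k) else idx).
Proof.
rewrite big_sumType /=; congr (op _ _); last first.
  by case: o; [|rewrite big_pred0].
rewrite (pair_big_dep predT (fun k l : 'I_r => (k < l)%N)
  (fun k l => op (G (inl (k, l, true))) (G (inl (k, l, false))))) /=.
transitivity (\big[op/idx]_(z : 'I_r * 'I_r * bool | (z.1.1 < z.1.2)%N && true) G (inl z)).
  by apply: eq_big => [[[k l] b]|[[k l] b] _] //=; rewrite andbT.
transitivity (\big[op/idx]_(p : 'I_r * 'I_r | (p.1 < p.2)%N) \big[op/idx]_(b : bool) G (inl (p, b))).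
  by rewrite pair_big_dep; apply: eq_bigr => -[].
by apply: eq_bigr => -[k l] _; rewrite big_bool.
Qed.

Lemma le_rho2 (i : 'I_r) : (i.*2 <= q)%N.
Proof. by have := ltn_ord i; rewrite /q; case: (o) => /=; lia. Qed.

Lemma odd_rho2 (i : 'I_r) : odd (rho2 i) = o.
Proof.
rewrite oddB ?le_rho2 // odd_double addbF /q oddB.
  by rewrite oddD odd_double addbF /=; case: (o).
by have := ltn_ord i; case: (o) => /=; lia.
Qed.

Let count_gt (i : 'I_r) : (\sum_(k < r) \sum_(l < r | (k < l)%N) (k == i) = r - 1 - i)%N.
Proof.
rewrite (bigD1 i) //= [X in (_ + X)%N]big1 ?addn0 => [|k /negbTE ->]; last by rewrite big1.
rewrite eqxx sum1_card -[RHS]card_ord; pose h (z : 'I_(r - 1 - i)) := (i + 1 + z)%N.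
have hP z : (h z < r)%N by rewrite /h; have := ltn_ord z; lia.
have hi : injective (fun z => Ordinal (hP z)).
  by move=> a b [] /addnI e; apply: val_inj.
rewrite -(card_codom hi); apply: eq_card => l; rewrite [LHS]unfold_in; apply/idP/codomP.
  move=> il; have zP : (l - (i + 1) < r - 1 - i)%N by have := ltn_ord l; lia.
  by exists (Ordinal zP); apply: val_inj; rewrite /= /h /= subnKC // addn1.
by move=> [z ->]; rewrite /= /h; lia.
Qed.

Let count_lt (i : 'I_r) : (\sum_(k < r) \sum_(l < r | (k < l)%N) (l == i) = i)%N.
Proof.
rewrite (exchange_big_dep predT) //= (bigD1 i) //= [X in (_ + X)%N]big1 ?addn0; last first.
  by move=> l /negbTE ->; rewrite big1.
rewrite eqxx sum1_card -[RHS]card_ord.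
have hP (z : 'I_i) : (z < r)%N by have := ltn_ord z; have := ltn_ord i; lia.
have hi : injective (fun z => Ordinal (hP z)) by move=> a b [] e; apply: val_inj.
rewrite -(card_codom hi); apply: eq_card => l; rewrite [LHS]unfold_in; apply/idP/codomP.
  by move=> li; exists (Ordinal li); apply: val_inj.
by move=> [z ->] /=; exact: ltn_ord.
Qed.

Lemma sum_root_plus (i : 'I_r) : (\sum_(t | pos_root t) root_plus t i = q - i)%N.
Proof.
rewrite big_pos_root /=.
have -> : (if o then \sum_(k < r) U_(k)%MM i else 0)%N = o.
  case: (o) => //; rewrite (bigD1 i) //= mnm1E eqxx big1 // => k ki.
  by rewrite mnm1E (negbTE ki).
rewrite (eq_bigr (fun k : 'I_r => \sum_(l < r | (k < l)%N) (k == i) +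
    \sum_(l < r | (k < l)%N) (k == i) + \sum_(l < r | (k < l)%N) (l == i))%N) => [|k _]; last first.
  by rewrite -!big_split; apply: eq_bigr => l _ /=; rewrite mnmDE !mnm1E addnAC.
rewrite !big_split /= count_gt count_lt.
by have := ltn_ord i; rewrite /q; case: (o) => /=; lia.
Qed.

Lemma sum_root_minus (i : 'I_r) : (\sum_(t | pos_root t) root_minus t i = i)%N.
Proof.
rewrite big_pos_root /=.
rewrite (eq_bigr (fun k : 'I_r => \sum_(l < r | (k < l)%N) (l == i))%N) => [|k _]; last first.
  by apply: eq_bigr => l _; rewrite mnm0E add0n mnm1E.
by rewrite count_lt; case: (o); rewrite ?addn0 // big1 ?addn0 // => k _; exact: mnm0E.
Qed.

End RootData.

Arguments wexp : simpl never.
Arguments rho2 : simpl never.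

(** * The Weyl denominator formula *)

Section WeylDenominator.
Variables (F : numClosedFieldType) (r : nat) (o : bool).
Hypothesis ro : (0 < r + o)%N.
Local Notation q := (wexp r o).
Local Notation rho2 := (rho2 r o).
Local Notation signed_perm := ('S_r * {ffun 'I_r -> bool})%type.

Definition wsign (w : signed_perm) : F := (-1) ^+ w.1 * \prod_(i < r) (-1) ^+ (o && w.2 i).

(** The image of [rho] under [w], moved by [q / 2] into natural exponents: half of
    [q + rho2 (w.1 i)] without a flip, half of [q - rho2 (w.1 i)] with one. *)
Definition wmon (w : signed_perm) : 'X_{1..r} :=
  [multinom (if w.2 i then w.1 i : nat else (q - w.1 i)%N) | i < r].

(** For even n the last coordinate of [rho] is 0; flipping it changes neither [wmon] nor [wsign], so
    every term occurs twice. *)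
Definition wmult : F := if o then 1 else 2.

Let dlt : {mpoly F[r]} := weyl_denominator F (pos_root o) (@root_plus r) (@root_minus r).

Let alternating : {mpoly F[r]} := \sum_w wsign w *: 'X_[wmon w].

Let alternatingE (x : 'I_r -> F) : alternating.@[x] =
  \det (\matrix_(i, j) (x i ^+ (q - j) + (-1) ^+ o * x i ^+ j)).
Proof.
rewrite /alternating raddf_sum /determinant.
rewrite -(pair_bigA _ (fun (s : 'S_r) (u : {ffun 'I_r -> bool}) =>
  (wsign (s, u) *: 'X_[wmon (s, u)]).@[x])) /=; apply: eq_bigr => s _.
under [X in _ = _ * X]eq_bigr => i _ do rewrite mxE.
have -> : \prod_i (x i ^+ (q - s i) + (-1) ^+ o * x i ^+ s i) =
    \prod_i \sum_(b : bool) (-1) ^+ (o && b) * x i ^+ (if b then s i : nat else (q - s i)%N).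
  apply: eq_bigr => i _; rewrite big_bool /= andbT andbF expr0 mul1r addrC //.
rewrite bigA_distr_bigA mulr_sumr; apply: eq_bigr => u _.
rewrite mevalZ mevalX /wsign /= -mulrA -big_split; congr (_ * _) => /=.
by apply: eq_bigr => i _; rewrite mnmE.
Qed.

Let g (x : F) : F := if o then x - 1 else 1.

(* The Chebyshev-like polynomials expressing x^m +- x^-m in x + 1/x. *)
Let chebyshev m : exists p p' : {poly F}, [/\ size p' = m.+2, p' \is monic, (size p <= m.+1)%N &
  forall x : F, x != 0 ->
    g x * p.[x + x^-1] * x ^+ m = x ^+ (m.*2 + o) + (-1) ^+ o /\
    g x * p'.[x + x^-1] * x ^+ m.+1 = x ^+ (m.+1.*2 + o) + (-1) ^+ o].
Proof.
elim: m => [|m [p [p' [sp' mp' sp hp]]]].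
  exists wmult%:P, ('X + (o%:R)%:P); split.
  - by rewrite size_XaddC.
  - exact: monicXaddC.
  - by rewrite size_polyC; case: eqP.
  move=> x x0; rewrite hornerC hornerD hornerX hornerC /g /wmult.
  by case: (o); split; rewrite /= ?addn0 ?addn1 ?expr0 ?expr1; field.
exists p', (p' * 'X - p).
have s1 : size (p' * 'X) = m.+3 by rewrite size_mulX ?monic_neq0 // sp'.
have lt : (size (- p) < size (p' * 'X)%R)%N by rewrite size_polyN s1 ltnS leqW.
split=> //.
- by rewrite size_polyDl.
- by rewrite monicE lead_coefDl // lead_coefMX.
- by rewrite sp'.
move=> x x0; have [h1 h2] := hp x x0; split=> //.
rewrite hornerD hornerN hornerMX.
have -> : g x * (p'.[x + x^-1] * (x + x^-1) - p.[x + x^-1]) * x ^+ m.+2 =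
   (g x * p'.[x + x^-1] * x ^+ m.+1) * (x ^+ 2 + 1) - (g x * p.[x + x^-1] * x ^+ m) * x ^+ 2.
  by rewrite !exprS; field.
rewrite h1 h2 !doubleS !addSn !exprS; ring.
Qed.

Let monic_cheb m : exists2 p : {poly F}, p \is monic /\ size p = m.+1 &
  forall x : F, x != 0 -> (if (m == 0%N) && ~~ o then 2 else 1) * (g x * p.[x + x^-1]) * x ^+ m =
    x ^+ (m.*2 + o) + (-1) ^+ o.
Proof.
case: m => [|m]; last first.
  have [p [p' [sp' mp' _ hp]]] := chebyshev m; exists p' => // x x0.
  by rewrite /= mul1r; have [_ ->] := hp x x0.
exists 1 => [|x x0]; first by rewrite monic1 size_poly1.
rewrite hornerC /g expr0 double0 add0n; case: (o); rewrite /=; ring.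
Qed.

Let det_monic (P : 'I_r -> {poly F}) (y : 'I_r -> F) :
  (forall j, P j \is monic /\ size (P j) = (r - 1 - j).+1) ->
  \det (\matrix_(i, j) (P j).[y i]) = \prod_(i < r) \prod_(j < r | (i < j)%N) (y i - y j).
Proof.
move=> hP; pose rp := perm (@rev_ord_inj r).
pose L : 'M[F]_r := \matrix_(j, t) (P (rev_ord j))`_t.
have sL j : size (P (rev_ord j)) = j.+1.
  by have [_ ->] := hP (rev_ord j); rewrite /= subnS; have := ltn_ord j; lia.
have detL : \det L = 1.
  rewrite det_trig; last first.
    by apply/is_trig_mxP => i j ij; rewrite mxE nth_default // sL.
  apply: big1 => i _; rewrite mxE; have [/monicP + _] := hP (rev_ord i).
  by rewrite lead_coefE sL.
pose a : 'rV[F]_r := \row_i y (rev_ord i).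
have e : L *m Vandermonde r a = row_perm rp (col_perm rp (\matrix_(i, j) (P j).[y i])^T).
  apply/matrixP => j i; rewrite !mxE !permE (@horner_coef_wide _ r) ?sL //.
  by apply: eq_bigr => t _; rewrite !mxE.
have := congr1 determinant e; rewrite det_mulmx detL mul1r det_Vandermonde.
rewrite row_permE col_permE !det_mulmx !det_perm det_tr odd_permV mulrCA -signr_addb addbb mulr1.
move=> <-; rewrite (reindex_inj rev_ord_inj) /=.
under eq_bigr => i _ do rewrite (reindex_inj rev_ord_inj) /=.
rewrite (exchange_big_dep predT) //=; apply: eq_bigr => i _; apply: eq_big => [j|j _].
  by have := ltn_ord i; have := ltn_ord j; lia.
by rewrite !mxE !rev_ordK.
Qed.

(** After row scaling the columns are monic polynomials in [x + x^-1], so the determinant is a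
    Vandermonde product. Each factor [x + x^-1 - (y + y^-1)] is [(x y - 1) (x - y) / (x y)], two
    roots at once; [g] accounts for the short roots. *)
Let dltE (x : 'I_r -> F) : (forall i, x i != 0) ->
  wmult * dlt.@[x] = \det (\matrix_(i, j) (x i ^+ (q - j) + (-1) ^+ o * x i ^+ j)).
Proof.
move=> x0; have [|P hP] := @boolp.choice 'I_r {poly F} (fun j p =>
    (p \is monic /\ size p = (r - 1 - j).+1) /\ forall x : F, x != 0 ->
     (if (r - 1 - j == 0)%N && ~~ o then 2 else 1) * (g x * p.[x + x^-1]) * x ^+ (r - 1 - j) =
    x ^+ ((r - 1 - j).*2 + o) + (-1) ^+ o).
  by move=> j; have [p hp1 hp2] := monic_cheb (r - 1 - j); exists p.
pose cc (j : 'I_r) : F := if (r - 1 - j == 0)%N && ~~ o then 2 else 1.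
pose y i := x i + (x i)^-1.
have -> : \matrix_(i, j) (x i ^+ (q - j) + (-1) ^+ o * x i ^+ j) =
    diag_mx (\row_i (x i ^+ (r - 1) * g (x i))) *m (\matrix_(i, j) (P j).[y i]) *m
    diag_mx (\row_j cc j).
  apply/matrixP => i j; rewrite mul_mx_diag mul_diag_mx !mxE.
  have [_ /(_ _ (x0 i)) h] := hP j; have lt := ltn_ord j.
  have -> : (q - j = ((r - 1 - j).*2 + o) + j)%N by rewrite /wexp; case: (o) => /=; lia.
  rewrite exprD -mulrDl -h -/(cc j) -/(y i).
  have -> : (r - 1 = (r - 1 - j) + j)%N by lia.
  rewrite exprD addnK; ring.
rewrite !det_mulmx !det_diag det_monic; last by move=> j; have [] := hP j.
have -> : \prod_j (\row_j cc j) 0 j = wmult.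
  rewrite /wmult; case: (boolP o) => oo.
    by apply: big1 => j _; rewrite mxE /cc oo andbF.
  have r0 : (0 < r)%N by move: ro; rewrite (negbTE oo) addn0.
  have lt : (r - 1 < r)%N by lia.
  rewrite (bigD1 (Ordinal lt)) //= mxE /cc subnn oo /= big1 ?mulr1 // => j ne.
  rewrite mxE /cc; have -> : (r - 1 - j == 0)%N = false; last by [].
  apply/eqP => e; case/eqP: ne; apply: val_inj => /=; have := ltn_ord j; lia.
rewrite mulrC; congr (_ * _); under eq_bigr => i _ do rewrite mxE.
rewrite big_split /= /dlt /weyl_denominator rmorph_prod /= big_pos_root /=.
have -> : (if o then \prod_(k < r) ('X_[U_(k)] - 'X_[0] : {mpoly F[r]}).@[x] else 1) = \prod_i g (x i).
  rewrite /g; case: (o); last by rewrite big1.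
  by apply: eq_bigr => k _; rewrite mevalB mevalXU mpolyX0 meval1.
rewrite [RHS]mulrAC; congr (_ * _).
have -> : \prod_i x i ^+ (r - 1) = \prod_(k < r) \prod_(l < r | (k < l)%N) (x k * x l).
  under [RHS]eq_bigr => k _ do rewrite big_split /=.
  rewrite big_split /= (prod_lt_swap (fun k l => x k)) -big_split; apply: eq_bigr => k _ /=.
  rewrite !prodr_const -exprD; congr (_ ^+ _); rewrite addnC.
  have := cardC1 k; rewrite card_ord -subn1 => <-.
  rewrite -!sum1_card (bigID (fun l : 'I_r => (l < k)%N)) /=; congr (_ + _)%N.
    by apply: eq_bigl => l; rewrite !inE -val_eqE /=; lia.
  by apply: eq_bigl => l; rewrite !inE -val_eqE /=; lia.
rewrite -big_split; apply: eq_bigr => k _ /=; rewrite -big_split; apply: eq_bigr => l _ /=.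
rewrite !mevalB !mpolyXD mpolyX0 mevalM !mevalXU meval1 /y.
by have := x0 k; have := x0 l => *; field; apply/andP.
Qed.

Lemma weyl_denominatorE : wmult *: dlt = alternating.
Proof.
apply/eqP; rewrite -subr_eq0; apply/eqP.
(* The product of the variables confines the comparison to points with nonzero coordinates, where
   [dltE] applies. *)
have h : (wmult *: dlt - alternating) * \prod_i 'X_i = 0.
  apply: mpoly_eval_eq0 => x; rewrite mevalM rmorph_prod /=.
  under eq_bigr => i _ do rewrite mevalXU.
  have [/existsP [i /eqP xi]|/existsPn nx] := boolP [exists i, x i == 0].
    by rewrite (bigD1 i) //= xi mul0r mulr0.
  by rewrite mevalB mevalZ dltE // alternatingE subrr mul0r.
move/eqP: h; rewrite mulf_eq0 => /orP[/eqP //|/prodf_eq0 [i _]].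
by rewrite -msupp_eq0 msuppX.
Qed.

End WeylDenominator.

(** * Weyl's dimension formula through signed permutations *)

Section SignedPerm.
Variables (F : numClosedFieldType) (r : nat) (o : bool).
Hypothesis ro : (0 < r + o)%N.
Local Notation q := (wexp r o).
Local Notation rho2 := (rho2 r o).
Local Notation signed_perm := ('S_r * {ffun 'I_r -> bool})%type.
Local Notation wsign := (@wsign F r o).
Local Notation c := (wmult F o).
Local Notation delta := (weyl_denominator F (pos_root o) (@root_plus r) (@root_minus r)).

(** The action centred at [N / 2], the place of weight 0 after the shifts: [N = 2 K] for weights,
    [N = 2 K + q] for exponents of [delta * chi]. *)
Definition wact N (w : signed_perm) (m : 'X_{1..r}) : 'X_{1..r} :=
  [multinom (if w.2 k then N - m (w.1 k) else m (w.1 k))%N | k < r].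

Definition wcomp (v w : signed_perm) : signed_perm :=
  ((v.1 * w.1)%g, [ffun k => v.2 k (+) w.2 (v.1 k)]).

Lemma wcomp_inj v : injective (wcomp v).
Proof.
move=> [a b] [a' b'] [/mulgI -> /ffunP h]; congr (_, _); apply/ffunP => k.
by have := h ((v.1^-1)%g k); rewrite !ffunE permKV => /addbI.
Qed.

Lemma wsign_comp v w : wsign (wcomp v w) = wsign v * wsign w.
Proof.
rewrite /wsign /= odd_permM signr_addb -!mulrA; congr (_ * _); rewrite mulrCA; congr (_ * _).
rewrite [X in _ = _ * X](reindex_inj (@perm_inj _ v.1)) -big_split; apply: eq_bigr => k _ /=.
by rewrite -signr_addb ffunE; case: (o); case: (v.2 k); case: (w.2 _).
Qed.

Lemma wsign2 w : wsign w * wsign w = 1.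
Proof.
rewrite /wsign mulrACA -signr_addb addbb mul1r -big_split big1 // => k _.
by rewrite /= -signr_addb addbb.
Qed.

Let c_neq0 : c != 0.
Proof. by rewrite /wmult; case: (o); rewrite ?oner_eq0 // pnatr_eq0. Qed.

Let le_q (i : 'I_r) : (i <= q)%N.
Proof. by have := le_rho2 o i; lia. Qed.

Let wmon_le (w : signed_perm) k : (wmon o w k <= q)%N.
Proof.
by rewrite mnmE; case: (w.2 k); [exact: le_q | exact: leq_subr].
Qed.

Let wmon_comp (v w : signed_perm) : wmon o (wcomp v w) = wact q v (wmon o w).
Proof.
apply/mnmP => k; rewrite !mnmE ffunE permM.
by case: (v.2 k); case: (w.2 _) => //=; rewrite subKn ?le_q.
Qed.

Lemma sum_rootc i : \sum_(a | pos_root o a) rootc F (@root_plus r) (@root_minus r) a i = (rho2 i)%:R.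
Proof.
rewrite /rootc sumrB -!natr_sum sum_root_plus sum_root_minus /rho2 -natrB.
  by rewrite -subnDA addnn.
by have := le_rho2 o i; lia.
Qed.

Lemma sum_root_pm (i : 'I_r) : \sum_(a | pos_root o a)
  ((root_plus a i)%:R + (root_minus a i)%:R) = q%:R :> F.
Proof.
rewrite big_split -!natr_sum /= sum_root_plus sum_root_minus -natrD subnK //.
Qed.

Lemma delta_supp m : delta@_m != 0 ->
  \sum_i (2 * (m i)%:R - \sum_(a | pos_root o a)
    ((root_plus a i)%:R + (root_minus a i)%:R)) ^+ 2 =
  \sum_i (\sum_(a | pos_root o a) rootc F (@root_plus r) (@root_minus r) a i) ^+ 2.
Proof.
move=> dm; have /eqP : (c *: delta)@_m != 0 by rewrite mcoeffZ mulf_neq0.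
rewrite weyl_denominatorE // raddf_sum => /eqP h.
have [w wm] : exists w, wmon o w = m.
  apply: contrapT => h0; case/negP: h; apply/eqP; apply: big1 => w _ /=.
  rewrite mcoeffZ mcoeffX; case: eqP => [e|_]; last by rewrite mulr0.
  by case: h0; exists w.
rewrite [RHS](reindex_inj (@perm_inj _ w.1)); apply: eq_bigr => i _ /=.
rewrite sum_root_pm sum_rootc -wm mnmE.
have -> : (rho2 (w.1 i))%:R = q%:R - 2 * (w.1 i)%:R :> F.
  by rewrite /rho2 natrB ?le_rho2 // -muln2 natrM mulrC.
case: (w.2 i); first by ring.
by rewrite natrB ?le_q //; ring.
Qed.

(* The Vandermonde-like determinant giving, up to a constant, dimensions by the
   Weyl dimension formula. *)
Definition weyl_dim (z : 'I_r -> F) : F := \det (\matrix_(i, j) z i ^+ rho2 j).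
Local Notation Delta := weyl_dim.

Let sum_parity (g : nat -> F) : \sum_(t < (r.*2 + o).-1) g t * (1 + (-1) ^+ (o + t)) =
  \sum_(u < r) g (u.*2 + o)%N * 2.
Proof.
elim: r => [|r' IH]; first by case: (o); rewrite !big_ord0.
have -> : (r'.+1.*2 + o).-1 = (r'.*2 + o).+1 by lia.
rewrite [RHS]big_ord_recr -IH big_ord_recr /=.
have e : (-1) ^+ (o + (r'.*2 + o)) = 1 :> F.
  by rewrite -signr_odd !oddD odd_double; case: (o).
rewrite e; congr (_ + _); case: (posnP (r'.*2 + o)) => [->|]; first by rewrite !big_ord0.
case: (r'.*2 + o)%N e => // t e _; rewrite big_ord_recr /=.
have -> : (-1) ^+ (o + t) = -1 :> F.
  by move: e; rewrite addnS exprS mulN1r => /eqP; rewrite eqr_oppLR => /eqP.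
by rewrite subrr mulr0 addr0.
Qed.

Let rho2_rev (u : 'I_r) : (u.*2 + o)%N = rho2 (rev_ord u).
Proof. by rewrite /rho2 /wexp /=; have := ltn_ord u; case: (o) => /=; lia. Qed.

Let binom_parity (h x : F) (j : 'I_r) :
  (h + x) ^+ rho2 j + (-1) ^+ o * (h - x) ^+ rho2 j =
  \sum_(u < r) (2 * 'C(rho2 j, rho2 u)%:R * h ^+ (rho2 j - rho2 u)) * x ^+ rho2 u.
Proof.
pose g t := 'C(rho2 j, t)%:R * h ^+ (rho2 j - t) * x ^+ t.
transitivity (\sum_(t < (r.*2 + o).-1) g t * (1 + (-1) ^+ (o + t))); last first.
  rewrite sum_parity (reindex_inj rev_ord_inj); apply: eq_bigr => u _.
  rewrite rho2_rev rev_ordK /g; ring.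
have le : ((rho2 j).+1 <= (r.*2 + o).-1)%N.
  by have := ltn_ord j; rewrite /rho2 /wexp; case: (o) => /=; lia.
rewrite -(big_mkord xpredT (fun t => g t * (1 + (-1) ^+ (o + t)))).
rewrite (@big_cat_nat _ _ _ (rho2 j).+1) //= [X in _ = _ + X]big_nat_cond.
rewrite [X in _ = _ + X]big1 => [|t]; last first.
  by rewrite andbT => /andP[lt _]; rewrite /g bin_small // !mul0r.
rewrite addr0 big_mkord.
have e1 := exprDn h x (rho2 j); have e2 := exprDn h (- x) (rho2 j).
rewrite e1 e2 mulr_sumr -big_split; apply: eq_bigr => t _.
rewrite /= /g [(- x) ^+ _]exprNn exprD mulrnAr -mulrnDl -!mulrA mulr_natl; congr (_ *+ _).
move: (h ^+ _) (x ^+ _) ((-1) ^+ t) ((-1) ^+ o) => a1 a2 a4 a5; ring.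
Qed.

(** The substitute for the limit in Weyl's formula. The sum over flips keeps one parity of powers
    ([binom_parity]), so the sum over permutations is the determinant of [L t *m V]; up to a
    permutation [L t] is triangular with 2 on the diagonal, and [h] disappears. *)
Lemma weyl_dim_const (h : 'I_r -> F) :
  \sum_w wsign w * Delta (fun i => h i + (-1) ^+ (w.2 i) * (rho2 (w.1 i))%:R) =
  2 ^+ r * r`!%:R * Delta (fun i => (rho2 i)%:R).
Proof.
pose B (t s : 'S_r) i := (h i + (rho2 (s i))%:R) ^+ rho2 (t i) +
  (-1) ^+ o * (h i - (rho2 (s i))%:R) ^+ rho2 (t i).
transitivity (\sum_(t : 'S_r) (-1) ^+ t * \sum_(s : 'S_r) (-1) ^+ s * \prod_i B t s i).
  rewrite -(pair_bigA _ (fun s u => wsign (s, u) *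
    Delta (fun i => h i + (-1) ^+ (u : {ffun 'I_r -> bool}) i * (rho2 (s i))%:R))) /=.
  under [RHS]eq_bigr => t _ do rewrite mulr_sumr.
  rewrite [RHS]exchange_big; apply: eq_bigr => s _ /=.
  have DE (u : {ffun 'I_r -> bool}) :
    wsign (s, u) * Delta (fun i => h i + (-1) ^+ u i * (rho2 (s i))%:R) =
    \sum_(t : 'S_r) (-1) ^+ t * ((-1) ^+ s * \prod_i ((-1) ^+ (o && u i) *
       (h i + (-1) ^+ u i * (rho2 (s i))%:R) ^+ rho2 (t i))).
    rewrite /Delta /determinant mulr_sumr; apply: eq_bigr => t _.
    have -> : \prod_i (\matrix_(i, j) (h i + (-1) ^+ u i * (rho2 (s i))%:R) ^+ rho2 j) i (t i) =
        \prod_i (h i + (-1) ^+ u i * (rho2 (s i))%:R) ^+ rho2 (t i).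
      apply: eq_bigr => i _.
      by rewrite mxE.
    rewrite /wsign big_split /=; move: (\prod_i _) (\prod_i _) ((-1) ^+ t) => a1 a2 a3.
    by move: ((-1) ^+ s) => a4; ring.
  rewrite (eq_bigr _ (fun u _ => DE u)) exchange_big; apply: eq_bigr => t _ /=.
  rewrite -!mulr_sumr; congr (_ * (_ * _)); rewrite -(bigA_distr_bigA (fun i (b : bool) =>
    (-1) ^+ (o && b) * (h i + (-1) ^+ b * (rho2 (s i))%:R) ^+ rho2 (t i))) /=.
  apply: eq_bigr => i _; rewrite big_bool /= andbT andbF !expr0 !mul1r expr1 mulN1r.
  by rewrite addrC.
pose V : 'M[F]_r := \matrix_(u, j) (rho2 j)%:R ^+ rho2 u.
pose L (t : 'S_r) : 'M[F]_r :=
  \matrix_(i, u) (2 * 'C(rho2 (t i), rho2 u)%:R * h i ^+ (rho2 (t i) - rho2 u)).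
have detB t : \sum_(s : 'S_r) (-1) ^+ s * \prod_i B t s i = \det (L t *m V).
  rewrite /determinant; apply: eq_bigr => s _; congr (_ * _); apply: eq_bigr => i _.
  rewrite !mxE /B binom_parity; apply: eq_bigr => u _; by rewrite !mxE.
have detL t : \det (L t) = (-1) ^+ t * 2 ^+ r.
  rewrite /determinant (bigD1 t) //= [X in _ + X]big1 ?addr0 => [|s st].
    congr (_ * _); rewrite -[in RHS](card_ord r) -prodr_const; apply: eq_bigr => i _.
    by rewrite mxE binn subnn expr0 !mulr1.
  have [i lt] : exists i : 'I_r, (rho2 (t i) < rho2 (s i))%N.
    apply: contrapT => h0; case/eqP: st; apply/permP => i.
    have le k : (rho2 (s k) <= rho2 (t k))%N.
      by rewrite leqNgt; apply/negP => lt; apply: h0; exists k.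
    have : (\sum_k rho2 (s k) = \sum_k rho2 (t k))%N.
      transitivity (\sum_(k < r) rho2 k)%N; first by rewrite [RHS](reindex_inj (@perm_inj _ s)).
      by rewrite (reindex_inj (@perm_inj _ t)).
    rewrite (bigD1 i) //= [RHS](bigD1 i) //= => e.
    have : (\sum_(k | k != i) rho2 (s k) <= \sum_(k | k != i) rho2 (t k))%N by apply: leq_sum.
    have := le i; move: e; set x := (\sum_(k | _) _)%N; set y := (\sum_(k | _) _)%N => e h1 h2.
    have : rho2 (s i) = rho2 (t i) by lia.
    rewrite /rho2 => h3; apply: val_inj => /=; have := le_rho2 o (s i); have := le_rho2 o (t i); lia.
  by rewrite (bigD1 i) //= mxE bin_small // mulr0 !mul0r mulr0.
under eq_bigr => t _ do rewrite detB det_mulmx detL mulrA mulrA -signr_addb addbb mul1r.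
rewrite sumr_const card_Sn -[_ *+ r`!]mulr_natl mulrA [r`!%:R * _]mulrC; congr (_ * _).
by rewrite /Delta -det_tr; congr (\det _); apply/matrixP => i j; rewrite !mxE.
Qed.

Section GradedTrace.
Variables (s' K : nat).
Local Notation s := s'.+1.
Variable wt : 'I_s -> 'X_{1..r}.
Hypothesis wt_le : forall j k, (wt j k <= 2 * K)%N.
Local Notation chi := (graded_trace wt).

Let wm := (wmon o : signed_perm -> 'X_{1..r}).

Let coefE (Q : 'M[F]_s) m : c * (delta * chi Q)@_m =
  \sum_w wsign w * \sum_j Q j j * ((wm w + wt j)%MM == m)%:R.
Proof.
rewrite -mcoeffZ scalerAl weyl_denominatorE // mulr_suml raddf_sum; apply: eq_bigr => w _ /=.
rewrite -scalerAl mcoeffZ; congr (_ * _); rewrite mulr_sumr raddf_sum; apply: eq_bigr => j _ /=.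
by rewrite -scalerAr mcoeffZ -mpolyXD mcoeffX.
Qed.

(** Conjugation by [U] makes the traces of [Q] on weight spaces invariant under [w], while the
    alternating expansion of [delta] changes by the sign of [w]. *)
Lemma chi_antisym (Q U U' : 'M[F]_s) w (m : 'X_{1..r}) : U *m U' = 1%:M -> Q *m U = U *m Q ->
  (forall i j, U i j != 0 -> wt i = wact (2 * K) w (wt j)) ->
  (forall k, m k <= 2 * K + q)%N ->
  (delta * chi Q)@_(wact (2 * K + q) w m) = wsign w * (delta * chi Q)@_m.
Proof.
move=> UU QU Uwt hm; apply: (mulfI c_neq0); rewrite [RHS]mulrCA !coefE.
have sym (G : 'X_{1..r} -> F) : \sum_j Q j j * G (wt j) = \sum_j Q j j * G (wact (2 * K) w (wt j)).
  pose D1 : 'M[F]_s := diag_mx (\row_j G (wt j)).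
  pose D2 : 'M[F]_s := diag_mx (\row_j G (wact (2 * K) w (wt j))).
  have trE (d : 'rV[F]_s) : \tr (Q *m diag_mx d) = \sum_j Q j j * d 0 j.
    by apply: eq_bigr => j _; rewrite mul_mx_diag mxE.
  have UD : U *m D2 = D1 *m U.
    apply/matrixP => i j; rewrite mul_mx_diag mul_diag_mx !mxE.
    by have [->|/Uwt ->] := eqVneq (U i j) 0; rewrite ?mulr0 ?mul0r // mulrC.
  transitivity (\tr (Q *m D1)); first by rewrite trE; apply: eq_bigr => j _; rewrite mxE.
  transitivity (\tr (Q *m D2)); last by rewrite trE; apply: eq_bigr => j _; rewrite mxE.
  rewrite -[D1]mulmx1 -UU !mulmxA -[Q *m D1 *m U]mulmxA -UD mulmxA QU.
  by rewrite mxtrace_mulC !mulmxA (mulmx1C UU) mul1mx.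
rewrite mulr_sumr (reindex_inj (@wcomp_inj w)); apply: eq_bigr => u _ /=.
rewrite wsign_comp -mulrA; congr (_ * (_ * _)).
rewrite (sym (fun x => ((wm (wcomp w u) + x)%MM == wact (2 * K + q) w m)%:R)).
apply: eq_bigr => j _; congr (_ * _%:R); rewrite /wm wmon_comp.
congr nat_of_bool; apply/eqP/eqP => [|<-].
  move=> /mnmP e; apply/mnmP => k; have := e ((w.1^-1)%g k).
  have := wmon_le u k; have := wt_le j k; have := hm k.
  by rewrite !mnmE !permKV; case: (w.2 _); lia.
apply/mnmP => k; rewrite !mnmE; have := wmon_le u (w.1 k); have := wt_le j (w.1 k).
by rewrite mnmE; case: (w.2 k); lia.
Qed.

(** Wide enough for all exponents of [delta * chi]: at most [q] from [delta] and [2 * K] from the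
    weights. *)
Definition box : finType := {ffun 'I_r -> 'I_(2 * K + q).+1}.

Definition box_mnm (f : box) : 'X_{1..r} := [multinom (f i : nat) | i < r].

(** The coordinates of [2 (lam + rho)] with both shifts undone; doubling keeps them integral. *)
Definition box_wt (f : box) (i : 'I_r) : int := 2 * (f i)%:Z - 2 * K%:Z - q%:Z.

Definition box_dim (f : box) : F := Delta (fun i => (box_wt f i)%:~R).

(** Pairing with [box_dim] turns each weight [wt j] into the alternating sum of [weyl_dim_const] at
    [h = 2 (wt j - K)], whose value is the same for all [j]. *)
Lemma sum_box_dim (Q : 'M[F]_s) :
  c * \sum_f (delta * chi Q)@_(box_mnm f) * box_dim f =
  2 ^+ r * r`!%:R * Delta (fun i => (rho2 i)%:R) * \tr Q.
Proof.
have E1 f : c * ((delta * chi Q)@_(box_mnm f) * box_dim f) =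
    \sum_w \sum_j Q j j * (wsign w * (((wm w + wt j)%MM == box_mnm f)%:R * box_dim f)).
  rewrite mulrA coefE mulr_suml; apply: eq_bigr => w _.
  by rewrite mulr_sumr mulr_suml; apply: eq_bigr => j _; rewrite mulrCA !mulrA.
rewrite mulr_sumr (eq_bigr _ (fun f _ => E1 f)) exchange_big /=.
transitivity (\sum_w \sum_j Q j j * (wsign w * Delta (fun i =>
    2 * ((wt j i)%:R - K%:R) + (-1) ^+ (w.2 i) * (rho2 (w.1 i))%:R))).
  apply: eq_bigr => w _; rewrite exchange_big; apply: eq_bigr => j _ /=.
  have lt k : (wm w k + wt j k < (2 * K + q).+1)%N.
    by have := wmon_le w k; have := wt_le j k; rewrite /wm; lia.
  pose f0 : box := [ffun k => Ordinal (lt k)].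
  rewrite (bigD1 f0) //= big1 ?addr0 => [|f ff].
    have -> : ((wm w + wt j)%MM == box_mnm f0).
      by apply/eqP/mnmP => k; rewrite mnmDE [RHS]mnmE ffunE.
    rewrite mul1r; congr (_ * (_ * _)); congr (\det _); apply/matrixP => i l.
    rewrite !mxE; congr (_ ^+ _); rewrite /box_wt ffunE /= /wm mnmE.
    rewrite !rmorphB !rmorphM /= -!pmulrn natrD.
    have -> : (rho2 (w.1 i))%:R = q%:R - 2 * (w.1 i)%:R :> F.
      by rewrite /rho2 natrB ?le_rho2 // -muln2 natrM mulrC.
    case: (w.2 i); rewrite ?(@natrB _ q (w.1 i)) ?le_q // natrD ?(@natrB _ q (w.1 i)) ?le_q //; ring.
  case: eqP => [e|_]; last by rewrite mul0r !mulr0.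
  case/eqP: ff; apply/ffunP => k; apply: val_inj; have /mnmP/(_ k) := e.
  rewrite mnmDE [RHS]mnmE ffunE. by [].
rewrite exchange_big /mxtrace mulr_sumr; apply: eq_bigr => j _.
by rewrite -mulr_sumr weyl_dim_const mulrC.
Qed.

End GradedTrace.

Section Box.
Variable K : nat.
Local Notation box := (box K).
Local Notation box_wt := (@box_wt K).
Local Notation box_dim := (@box_dim K).

Definition box_act (w : signed_perm) (f : box) : box :=
  [ffun k => if w.2 k then rev_ord (f (w.1 k)) else f (w.1 k)].

Lemma box_act_mnm w f : box_mnm (box_act w f) = wact (2 * K + q) w (box_mnm f).
Proof. by apply/mnmP => k; rewrite !mnmE ffunE; case: (w.2 k). Qed.

Lemma box_act_comp v w f : box_act v (box_act w f) = box_act (wcomp v w) f.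
Proof.
apply/ffunP => k; rewrite !ffunE permM.
by case: (v.2 k); case: (w.2 _); rewrite //= rev_ordK.
Qed.

Lemma box_act_wt w f k : box_wt (box_act w f) k = (-1) ^+ (w.2 k) * box_wt f (w.1 k).
Proof.
rewrite /box_wt ffunE; case: (w.2 k); rewrite ?mul1r // expr1 mulN1r /=.
by have := ltn_ord (f (w.1 k)); move: (nat_of_ord _) => x; lia.
Qed.

Lemma box_dim_act w f : box_dim (box_act w f) = wsign w * box_dim f.
Proof.
rewrite /box_dim /Delta; set M := \matrix_(i, j) (box_wt f i)%:~R ^+ rho2 j.
have -> : \matrix_(i, j) (box_wt (box_act w f) i)%:~R ^+ rho2 j =
    diag_mx (\row_i (-1) ^+ (o && w.2 i)) *m row_perm w.1 M :> 'M[F]_r.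
  apply/matrixP => i j; rewrite mul_diag_mx !mxE box_act_wt rmorphM rmorphXn rmorphN1 /= exprMn.
  by rewrite -exprM mulnC exprM -[_ ^+ rho2 j]signr_odd odd_rho2; case: (o); rewrite ?expr1 ?expr0 ?expr1n.
rewrite det_mulmx det_diag row_permE det_mulmx det_perm mulrA /wsign; congr (_ * _).
by rewrite mulrC; congr (_ * _); apply: eq_bigr => i _; rewrite mxE.
Qed.

Lemma box_dim_regular f : box_dim f != 0 -> forall k l, k != l ->
  box_wt f k != box_wt f l /\ box_wt f k != - box_wt f l.
Proof.
move=> fn0 k l kl; split; apply: contraNneq fn0 => e; apply/eqP.
  by rewrite /box_dim /Delta (determinant_alternate kl) // => j; rewrite !mxE e.
apply/eqP/det0P; exists (delta_mx 0 k - (-1) ^+ o *: delta_mx 0 l).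
  apply/eqP => /rowP/(_ k); rewrite !mxE !eqxx (negbTE kl) andbF mulr0 subr0 => /eqP.
  by rewrite oner_eq0.
rewrite mulmxBl -scalemxAl -!rowE; apply/rowP => j; rewrite !mxE e rmorphN /= [(- _%:~R) ^+ _]exprNn.
have sg : (-1) ^+ rho2 j = (-1) ^+ o :> F by rewrite -signr_odd odd_rho2.
by rewrite sg subrr.
Qed.

Lemma box_dim_neq0 f k : o -> box_wt f k != 0.
Proof.
move=> oo; rewrite /box_wt; have : exists u, q = u.*2.+1.
  by exists (r - 1)%N; rewrite /wexp oo; have := ltn_ord k; lia.
case=> u qu; have -> : q%:Z = u.*2.+1%:Z by rewrite qu.
by apply/eqP; lia.
Qed.

Let signed_sum_max (H : pred signed_perm) (f : box) : H (1%g, [ffun=> false]) ->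
  (forall v w, H v -> H w -> H (wcomp v w)) ->
  exists2 w, H w & forall v, H v ->
    \sum_(i < r) (r - i)%:Z * box_wt (box_act v (box_act w f)) i <=
    \sum_(i < r) (r - i)%:Z * box_wt (box_act w f) i.
Proof.
move=> H1 Hc; pose G w := \sum_(i < r) (r - i)%:Z * box_wt (box_act w f) i.
have [w Hw wmax] := @Order.TotalTheory.arg_maxP _ _ _ (1%g, [ffun=> false]) H G H1.
by exists w => // v Hv; rewrite box_act_comp; apply: wmax; exact: Hc.
Qed.

Definition refl_minus (k l : 'I_r) : signed_perm := (tperm k l, [ffun=> false]).
Definition refl_plus (k l : 'I_r) : signed_perm := (tperm k l, [ffun i => (i == k) || (i == l)]).
Definition refl_short (k : 'I_r) : signed_perm := (1%g, [ffun i => i == k]).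

Let sum2 (a b : 'I_r -> int) (k l : 'I_r) : k != l -> (forall i, i != k -> i != l -> a i = b i) ->
  \sum_(i < r) (r - i)%:Z * a i - \sum_(i < r) (r - i)%:Z * b i =
  (r - k)%:Z * (a k - b k) + (r - l)%:Z * (a l - b l).
Proof.
move=> kl ab; rewrite -sumrB (bigD1 k) //= (bigD1 l) 1?eq_sym //= big1 => [|i /andP[ik il]].
  by rewrite addr0 -!mulrBr.
by rewrite ab // subrr.
Qed.

(* A signed permutation maximising a strictly dominant functional makes the
   weight dominant, since no reflection can increase the functional. *)
Lemma dominant_conj (H : pred signed_perm) f : H (1%g, [ffun=> false]) ->
  (forall v w, H v -> H w -> H (wcomp v w)) ->
  exists2 w, H w & let z := box_wt (box_act w f) in
  [/\ forall k l : 'I_r, (k < l)%N -> H (refl_minus k l) -> z l <= z k,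
      forall k l : 'I_r, (k < l)%N -> H (refl_plus k l) -> 0 <= z k + z l &
      forall k, H (refl_short k) -> 0 <= z k].
Proof.
move=> H1 Hc; have [w Hw wmax] := signed_sum_max f H1 Hc; exists w => //=.
move: (box_act w f) wmax => g wmax; split.
- move=> k l kl Hr; have ne : k != l by rewrite -val_eqE /=; lia.
  have := wmax _ Hr; rewrite -subr_le0 (sum2 ne) => [|i ik il]; last first.
    by rewrite box_act_wt ffunE mul1r tpermD // eq_sym.
  rewrite !box_act_wt !ffunE !mul1r tpermL tpermR.
  move: (box_wt _ k) (box_wt _ l) => x y; have := ltn_ord l; have := ltn_ord k; nia.
- move=> k l kl Hr; have ne : k != l by rewrite -val_eqE /=; lia.
  have := wmax _ Hr; rewrite -subr_le0 (sum2 ne) => [|i ik il]; last first.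
    by rewrite box_act_wt ffunE (negbTE ik) (negbTE il) mul1r tpermD // eq_sym.
  rewrite !box_act_wt !ffunE !eqxx orbT /= expr1 !mulN1r tpermL tpermR.
  move: (box_wt _ k) (box_wt _ l) => x y; have := ltn_ord l; have := ltn_ord k; nia.
move=> k Hr; have := wmax _ Hr; rewrite -subr_le0 -sumrB (bigD1 k) //= big1 => [|i ik].
  rewrite box_act_wt ffunE eqxx expr1 mulN1r perm1 addr0 -mulrBr.
  by move: (box_wt _ k) => x; have := ltn_ord k; nia.
by rewrite box_act_wt ffunE (negbTE ik) mul1r perm1 subrr.
Qed.

End Box.

End SignedPerm.

(** * Dominant weights and Weyl group orbits *)

Section Dominance.
Variables (F : numClosedFieldType) (r : nat) (o : bool) (K : nat).
Hypothesis ro : (0 < r + o)%N.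
Local Notation q := (wexp r o).
Local Notation rho2 := (rho2 r o).
Local Notation signed_perm := ('S_r * {ffun 'I_r -> bool})%type.
Local Notation delta := (weyl_denominator F (pos_root o) (@root_plus r) (@root_minus r)).
Local Notation box := (box r o K).
Local Notation box_wt := (@box_wt r o K).
Local Notation box_dim := (@box_dim F r o K).

(** Strict inequalities, as [box_wt g] stands for [2 (lam + rho)]; the weight [lam] itself may lie
    on a wall. *)
Definition dominant (g : box) : Prop :=
  (forall k l : 'I_r, (k < l)%N -> box_wt g l < box_wt g k /\ 0 < box_wt g k + box_wt g l) /\
  (o -> forall k, 0 < box_wt g k).

Lemma dominant_root g t : dominant g -> pos_root o t ->
  0 < \sum_i box_wt g i * ((root_plus t i)%:Z - (root_minus t i)%:Z).
Proof.
move=> [h1 h2].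
have sumU k : \sum_i box_wt g i * (U_(k)%MM i)%:Z = box_wt g k.
  rewrite (bigD1 k) //= mnm1E eqxx mulr1 big1 ?addr0 // => i ik.
  by rewrite mnm1E eq_sym (negbTE ik) mulr0.
case: t => [[[k l] b]|k] /=; last first.
  move=> oo; rewrite (eq_bigr (fun i => box_wt g i * (U_(k)%MM i)%:Z)) ?sumU; first exact: h2.
  by move=> i _; rewrite mnm0E subr0.
move=> kl; have [h3 h4] := h1 k l kl; case: b => /=.
  rewrite (eq_bigr (fun i => box_wt g i * (U_(k)%MM i)%:Z + box_wt g i * (U_(l)%MM i)%:Z)).
    by rewrite big_split /= !sumU.
  by move=> i _; rewrite mnm0E subr0 mnmDE PoszD mulrDr.
rewrite (eq_bigr (fun i => box_wt g i * (U_(k)%MM i)%:Z - box_wt g i * (U_(l)%MM i)%:Z)).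
  by rewrite sumrB !sumU subr_gt0.
by move=> i _; rewrite mulrBr.
Qed.

Lemma dominant_chain g : dominant g -> forall k l : 'I_r, (k <= l)%N -> (g l + (l - k) <= g k)%N.
Proof.
move=> [h1 _] k l; move: {2}(l - k)%N (erefl (l - k)%N) => n.
elim: n k => [|n IH] k e kl.
  by have -> : k = l by [apply: val_inj => /=; lia]; rewrite subnn addn0.
have k1 : (k.+1 < r)%N by have := ltn_ord l; lia.
have [+ _] := h1 k (Ordinal k1) (leqnn _); rewrite /box_wt.
have := IH (Ordinal k1); rewrite /= => /(_ ltac:(lia) ltac:(lia)).
move: (nat_of_ord (g k)) (nat_of_ord (g (Ordinal k1))) (nat_of_ord (g l)) => x y z; lia.
Qed.

(** This keeps the subtraction in [box_lam] from truncating. For even n the last coordinate can be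
    negative; the bound then uses the first one, which the box limits to [2 K + q]. *)
Lemma dominant_ge g : dominant g -> forall i : 'I_r, (q - i <= g i)%N.
Proof.
move=> dg i; have r0 := ltn_ord i; have chain := dominant_chain dg.
have lt1 : (r - 1 < r)%N by lia.
pose L := Ordinal lt1; have := chain i L _; rewrite /= => /(_ ltac:(lia)) c1.
have [h1 h2] := dg; have [oo|oo] : o \/ ~~ o by case: (o); [left | right].
  have qE : (q = r.*2 - 1)%N by rewrite /wexp oo; lia.
  have := h2 oo L; rewrite /box_wt; move: c1.
  by move: (nat_of_ord (g L)) (nat_of_ord (g i)) => x y; lia.
have qE : (q = r.*2 - 2)%N by rewrite /wexp (negbTE oo) addn0.
have [r1|r2] := leqP r 1; first by move: qE; move: q (nat_of_ord (g i)) => q0 x; lia.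
have lt2 : (r - 2 < r)%N by lia.
have lt0 : (0 < r)%N by lia.
have [_] := h1 (Ordinal lt2) L ltac:(by rewrite /=; lia).
have := chain (Ordinal lt0) (Ordinal lt2) (leq0n _); have := ltn_ord (g (Ordinal lt0)).
rewrite /box_wt /= subn0; move: qE c1.
move: (nat_of_ord (g (Ordinal lt2))) (nat_of_ord (g L)) (nat_of_ord (g (Ordinal lt0))) => x y z.
move: (nat_of_ord (g i)) => t; lia.
Qed.

Lemma dominant_ge_nonneg g : dominant g -> (forall k, 0 <= box_wt g k) ->
  forall i : 'I_r, (K + (q - i) <= g i)%N.
Proof.
move=> dg g0 i; have r0 := ltn_ord i; have chain := dominant_chain dg.
have lt1 : (r - 1 < r)%N by lia.
pose L := Ordinal lt1; have := chain i L _; rewrite /= => /(_ ltac:(lia)) c1.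
have := g0 L; rewrite /box_wt; move: c1.
move: (nat_of_ord (g i)) (nat_of_ord (g L)) => x y.
by rewrite /wexp; case: (o) => /=; lia.
Qed.

Definition box_lam (g : box) : 'X_{1..r} := [multinom (g i - (q - i))%N | i < r].

Section OneSide.
Variables (s' : nat).
Local Notation s := s'.+1.
Variables (wt : 'I_s -> 'X_{1..r}) (e f : root r -> 'M[F]_s).

Record root_action : Prop := RootAction {
  ra_e : forall a i j, pos_root o a -> e a i j != 0 -> (wt i + root_minus a = wt j + root_plus a)%MM;
  ra_f : forall a i j, pos_root o a -> f a i j != 0 -> (wt i + root_plus a = wt j + root_minus a)%MM;
  ra_ef : forall a, pos_root o a -> e a *m f a - f a *m e a =
    \sum_i rootc F (@root_plus r) (@root_minus r) a i *: cartan F K wt i;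
  ra_C : forall a, pos_root o a -> casimir K wt (pos_root o) e f *m e a =
    e a *m casimir K wt (pos_root o) e f;
  ra_wt : forall j k, (wt j k <= 2 * K)%N }.

Hypothesis ra : root_action.

Lemma dominant_projector g : dominant g -> exists E : 'M[F]_s,
  [/\ forall i, hw_vector wt (pos_root o) e (box_lam g) (col i E),
      forall z, hw_vector wt (pos_root o) e (box_lam g) z -> E *m z = z,
      forall B, (forall a, pos_root o a -> B *m e a = e a *m B) ->
        (forall a, pos_root o a -> B *m f a = f a *m B) ->
        (forall i j, B i j != 0 -> wt i = wt j) -> B *m E = E *m B &
      forall Q, (forall a, pos_root o a -> Q *m e a = e a *m Q) ->
        (delta * graded_trace wt Q)@_(box_mnm g) = \tr (Q *m E)].
Proof.
move=> dg; have ge := dominant_ge dg.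
have leq (i : 'I_r) : (i <= q)%N by have := le_rho2 o i; lia.
have zE i : 2 * ((box_lam g i)%:Z - K%:Z) +
    \sum_(a | pos_root o a) ((root_plus a i)%:Z - (root_minus a i)%:Z) = box_wt g i.
  rewrite sumrB -!(big_morph Posz PoszD (erefl 0%:Z)) sum_root_plus sum_root_minus mnmE.
  by rewrite /box_wt; have := ge i; have := leq i; move: (nat_of_ord (g i)) => x; lia.
have [|E [E1 E2 E3 E4]] := hw_projector (ra_e ra) (ra_f ra) (ra_ef ra) (ra_C ra)
    (@delta_supp F r o ro) (lam := box_lam g).
  by move=> a pa; under eq_bigr => i _ do rewrite zE; exact: dominant_root.
exists E; split=> // Q Qe; rewrite -E4 //; congr (_@__).
apply/mnmP => i; rewrite mnmDE mnm_sumE sum_root_plus !mnmE; have := ge i; lia.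
Qed.

End OneSide.

Definition parity (u : {ffun 'I_r -> bool}) : bool := \big[addb/false]_i u i.

(** The Weyl group: all signed permutations for odd n (type B), those with evenly many flips for
    even n (type D). *)
Definition allowed (w : signed_perm) : bool := o || ~~ parity w.2.

Let parity_comp v w : parity (wcomp v w).2 = parity v.2 (+) parity w.2.
Proof.
rewrite /parity [X in _ = _ (+) X](reindex_inj (@perm_inj _ v.1)) -big_split /=.
by apply: eq_bigr => i _; rewrite ffunE.
Qed.

Lemma allowed1 : allowed (1%g, [ffun=> false]).
Proof. by rewrite /allowed /parity big1 ?orbT // => i _; rewrite ffunE. Qed.

Lemma allowed_comp v w : allowed v -> allowed w -> allowed (wcomp v w).
Proof. by rewrite /allowed parity_comp; case: (o) => //= /negbTE -> /negbTE ->. Qed.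

Lemma dominant_conj_allowed g : box_dim g != 0 -> exists2 w, allowed w & dominant (box_act w g).
Proof.
move=> gn0; have [w Hw [h1 h2 h3]] := dominant_conj F ro g allowed1 allowed_comp.
exists w => //; have gw : box_dim (box_act w g) != 0.
  by rewrite box_dim_act // mulf_neq0 // (contraNneq _ (oner_neq0 F)) // -(wsign2 F o w) => ->; rewrite mul0r.
have reg := box_dim_regular gw; split=> [k l kl|oo k].
  have ne : k != l by rewrite -val_eqE /=; lia.
  have [r1 r2] := reg k l ne; have a1 : allowed (refl_minus k l).
    by rewrite /allowed /parity big1 ?orbT // => i _; rewrite ffunE.
  have a2 : allowed (refl_plus k l).
    rewrite /allowed /parity (bigD1 k) //= (bigD1 l) 1?eq_sym //= big1 => [|i /andP[ik il]].
      by rewrite !ffunE !eqxx orbT /= orbT.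
    by rewrite ffunE (negbTE ik) (negbTE il).
  have := h1 k l kl a1; have := h2 k l kl a2.
  move: (box_wt _ k) (box_wt _ l) r1 r2 => x y; lia.
have a3 : allowed (refl_short k) by rewrite /allowed oo.
have := h3 k a3; have := box_dim_neq0 F ro (box_act w g) k oo.
by move: (box_wt _ k) => x; lia.
Qed.

Let box_inv w : exists2 v : signed_perm, (allowed w -> allowed v) &
  forall g : box, box_act v (box_act w g) = g.
Proof.
exists ((w.1^-1)%g, [ffun k => w.2 ((w.1^-1)%g k)]) => [|g].
  suff e : parity [ffun k => w.2 ((w.1^-1)%g k)] = parity w.2 by rewrite /allowed e.
  rewrite /parity [RHS](reindex_inj (@perm_inj _ (w.1^-1)%g)).
  by apply: eq_bigr => k _; rewrite ffunE.
rewrite box_act_comp /wcomp /= mulVg; apply/ffunP => k.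
by rewrite !ffunE /= addbb perm1.
Qed.

(** A regular weight has trivial stabiliser. For even n one coordinate may be 0, and flipping that
    one alone is excluded by parity. *)
Let box_act_inj g : box_dim g != 0 -> {in [set w | allowed w]%SET &, injective (fun w => box_act w g)}.
Proof.
move=> gn0 w w'; rewrite !inE => aw aw' e; have reg := box_dim_regular gn0.
have e1 k : (-1) ^+ w.2 k * box_wt g (w.1 k) = (-1) ^+ w'.2 k * box_wt g (w'.1 k).
  by rewrite -!(box_act_wt F ro) e.
have e2 k : w.1 k = w'.1 k.
  apply/eqP; apply: contraT => ne; have [r1 r2] := reg _ _ ne; move: (e1 k) r1 r2.
  by case: (w.2 k); case: (w'.2 k); rewrite ?expr1 ?expr0 ?mulN1r ?mul1r;
     move: (box_wt g _) (box_wt g _) => x y; lia.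
have z0 k : w.2 k != w'.2 k -> box_wt g (w.1 k) = 0.
  have := e1 k; rewrite -e2; case: (w.2 k); case: (w'.2 k) => // + _;
     rewrite ?expr1 ?expr0 ?mulN1r ?mul1r; move: (box_wt g _) => x; lia.
rewrite (surjective_pairing w) (surjective_pairing w'); congr (_, _); first exact/permP.
apply/ffunP => k; apply/eqP; apply: contraT => ne; have zk := z0 k ne.
have oF : o = false.
  by apply/negbTE/negP => oo; have := box_dim_neq0 F ro g (w.1 k) oo; rewrite zk.
have eq i : i != k -> w.2 i = w'.2 i.
  move=> ik; apply/eqP; apply: contraT => ne'; have zi := z0 i ne'.
  have ne3 : w.1 i != w.1 k by rewrite (inj_eq perm_inj).
  by have [] := reg _ _ ne3; rewrite zi zk eqxx.
have pw : parity w.2 = w.2 k (+) \big[addb/false]_(i | i != k) w.2 i by rewrite /parity (bigD1 k).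
have pw' : parity w'.2 = w'.2 k (+) \big[addb/false]_(i | i != k) w.2 i.
  by rewrite /parity (bigD1 k) //= (eq_bigr _ eq).
move: aw aw'; rewrite /allowed oF /= pw pw'; move: ne.
by case: (w.2 k); case: (w'.2 k); case: (\big[_/_]_(_ | _) _).
Qed.

Let card_allowed : wmult F o * #|[set w | allowed w]%SET|%:R = 2 ^+ r * r`!%:R.
Proof.
have cW : #|{: signed_perm}| = (r`! * 2 ^ r)%N by rewrite card_prod card_Sn card_ffun card_bool card_ord.
rewrite /wmult; case: (boolP o) => oo.
  rewrite mul1r (_ : [set w | allowed w]%SET = [set: signed_perm]%SET) ?cardsT ?cW.
    by rewrite natrM natrX mulrC.
  by apply/setP => w; rewrite !inE /allowed oo.
have r0 : (0 < r)%N by move: ro; rewrite (negbTE oo) addn0.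
rewrite cardsE -sum1_card natr_sum mulr_sumr big_mkcond /=.
transitivity (\sum_(w : signed_perm) (1 + \prod_i (-1) ^+ (w.2 i)) : F).
  apply: eq_bigr => w _; have -> : \prod_i (-1) ^+ (w.2 i) = (-1) ^+ parity w.2 :> F.
    rewrite /parity; elim/big_rec2: _ => [|i b y _ ->]; first by rewrite expr0.
    by rewrite signr_addb.
  rewrite unfold_in /allowed (negbTE oo) /=; case: (parity _); rewrite /= ?expr1 ?expr0 ?subrr //.
  by rewrite mulr1.
rewrite big_split /= sumr_const cW -(pair_bigA _ (fun (s : 'S_r) (u : {ffun 'I_r -> bool}) =>
  \prod_i (-1) ^+ (u i))) /= -(bigA_distr_bigA (fun i (b : bool) => (-1) ^+ b)).
rewrite (bigD1 (Ordinal r0)) //= big_bool /= expr1 expr0 addNr mul0r sumr_const mul0rn addr0.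
by rewrite natrM natrX mulrC.
Qed.

(** [T] is constant on one free orbit of the Weyl group and zero elsewhere; [card_allowed] gives the
    size of the orbit. *)
Lemma sum_orbit (T : box -> F) g : box_dim g != 0 ->
  (forall w g', allowed w -> T (box_act w g') = T g') ->
  (forall g', T g' != 0 -> exists2 w, allowed w & box_act w g' = g) ->
  wmult F o * \sum_g' T g' = 2 ^+ r * r`!%:R * T g.
Proof.
move=> gn0 inv orb; rewrite -card_allowed -mulrA; congr (_ * _).
transitivity (\sum_(g' in [set box_act w g | w in [set w | allowed w]%SET]%SET) T g').
  rewrite [RHS]big_mkcond; apply: eq_bigr => g' _; case: imsetP => // h.
  apply/eqP; apply: contraT => /orb [w aw e]; case: h.
  by have [v av vK] := box_inv w; exists v; rewrite ?inE ?av // -e vK.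
rewrite big_imset /=; last exact: box_act_inj.
rewrite (eq_bigr (fun=> T g)) => [|w]; last by rewrite inE => /inv.
by rewrite sumr_const [RHS]mulr_natl.
Qed.

End Dominance.

(** * Commuting left and right actions *)

Section Bimodule.
Variables (F : numClosedFieldType) (r : nat) (o : bool) (K s' : nat).
Hypothesis ro : (0 < r + o)%N.
Local Notation s := s'.+1.
Local Notation q := (wexp r o).
Local Notation rho2 := (rho2 r o).
Local Notation delta := (weyl_denominator F (pos_root o) (@root_plus r) (@root_minus r)).
Local Notation box := (box r o K).
Local Notation box_wt := (@box_wt r o K).
Local Notation box_dim := (@box_dim F r o K).
Variables (wtL wtR : 'I_s -> 'X_{1..r}) (eL fL eR fR : root r -> 'M[F]_s).
Hypothesis raL : root_action o K wtL eL fL.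
Hypothesis raR : root_action o K wtR eR fR.
Hypothesis comm_ee : forall a b, pos_root o a -> pos_root o b -> eL a *m eR b = eR b *m eL a.
Hypothesis comm_ef : forall a b, pos_root o a -> pos_root o b -> eL a *m fR b = fR b *m eL a.
Hypothesis comm_fe : forall a b, pos_root o a -> pos_root o b -> fL a *m eR b = eR b *m fL a.
Hypothesis comm_ff : forall a b, pos_root o a -> pos_root o b -> fL a *m fR b = fR b *m fL a.
Hypothesis eL_wtR : forall a i j, pos_root o a -> eL a i j != 0 -> wtR i = wtR j.
Hypothesis fL_wtR : forall a i j, pos_root o a -> fL a i j != 0 -> wtR i = wtR j.
Hypothesis eR_wtL : forall a i j, pos_root o a -> eR a i j != 0 -> wtL i = wtL j.
Hypothesis fR_wtL : forall a i j, pos_root o a -> fR a i j != 0 -> wtL i = wtL j.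
Hypothesis symL : forall w, exists U U' : 'M[F]_s, U *m U' = 1%:M /\
  forall i j, U i j != 0 -> wtL i = wact (2 * K) w (wtL j).
Hypothesis symR : forall w, allowed o w -> exists U U' : 'M[F]_s, [/\ U *m U' = 1%:M,
  forall i j, U i j != 0 -> wtR i = wact (2 * K) w (wtR j),
  forall i j, U i j != 0 -> wtL i = wtL j &
  forall a, pos_root o a -> U *m eL a = eL a *m U /\ U *m fL a = fL a *m U].

Definition joint_hw lam lam' (z : 'cV[F]_s) :=
  hw_vector wtL (pos_root o) eL lam z /\ hw_vector wtR (pos_root o) eR lam' z.

Hypothesis joint_wt : forall lam lam' z, joint_hw lam lam' z -> z != 0 ->
  lam = lam' /\ \sum_i `|(lam i)%:Z - K%:Z| <= K%:Z.
Hypothesis joint_uniq : forall lam z z', joint_hw lam lam z -> joint_hw lam lam z' -> z != 0 ->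
  exists c, z' = c *: z.
Hypothesis joint_ex : forall lam : 'X_{1..r}, (forall i, K <= lam i)%N ->
  (forall i j : 'I_r, (i <= j)%N -> lam j <= lam i)%N ->
  (\sum_i (lam i - K) <= K)%N -> exists2 z, z != 0 & joint_hw lam lam z.

Let rhoF : F := weyl_dim o (fun i : 'I_r => (rho2 i)%:R).
(** For dominant [g] with nonnegative coordinates, the bound [K] on the sum of the coordinates of
    [lam], in a form invariant under signed permutations. *)
Let small (g : box) : bool := (\sum_i `|box_wt g i| <= 2 * K%:Z + \sum_(i < r) (rho2 i)%:Z).

Section Fixed.
Variables (g : box).
Hypothesis dg : dominant g.
Hypothesis dg0 : forall k, 0 <= box_wt g k.
Hypothesis gn0 : box_dim g != 0.
Variable E : 'M[F]_s.
Hypothesis E_hw : forall i, hw_vector wtL (pos_root o) eL (box_lam g) (col i E).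
Hypothesis E_id : forall z, hw_vector wtL (pos_root o) eL (box_lam g) z -> E *m z = z.
Hypothesis E_comm : forall B, (forall a, pos_root o a -> B *m eL a = eL a *m B) ->
        (forall a, pos_root o a -> B *m fL a = fL a *m B) ->
        (forall i j, B i j != 0 -> wtL i = wtL j) -> B *m E = E *m B.

Let E_mul z : hw_vector wtL (pos_root o) eL (box_lam g) (E *m z).
Proof.
split=> [j|a pa].
  rewrite mxE => h; have [i hi] : exists i, E j i != 0.
    apply: contrapT => h0; case/negP: h; apply/eqP; apply: big1 => i _.
    have -> : E j i = 0 by apply/eqP; apply: contraT => ne; case: h0; exists i.
    by rewrite mul0r.
  by have [h1 _] := E_hw i; apply: h1; rewrite mxE.
rewrite mulmxA (_ : eL a *m E = 0) ?mul0mx //; apply/matrixP => i j.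
have [_ /(_ a pa) /colP/(_ i)] := E_hw j; rewrite !mxE => h; rewrite -[RHS]h.
by apply: eq_bigr => l _; rewrite mxE.
Qed.

Let E_eR a : pos_root o a -> E *m eR a = eR a *m E.
Proof.
move=> pa; symmetry; apply: E_comm => [b pb|b pb|i j]; last exact: eR_wtL.
  by rewrite comm_ee.
by rewrite comm_fe.
Qed.

Let E_wtR i j : E i j != 0 -> wtR i = wtR j.
Proof.
move=> Eij; pose B : 'M[F]_s := diag_mx (\row_l (wtR l == wtR j)%:R).
have BM (M : 'M[F]_s) : (forall i j, M i j != 0 -> wtR i = wtR j) -> B *m M = M *m B.
  move=> hM; apply/matrixP => a b; rewrite mul_mx_diag mul_diag_mx !mxE.
  by have [->|/hM ->] := eqVneq (M a b) 0; rewrite ?mulr0 ?mul0r // mulrC.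
have : B *m E = E *m B.
  apply: E_comm => [a pa|a pa|a b]; try by apply: BM => ? ?; [exact: eL_wtR | exact: fL_wtR].
  - by apply: BM => ? ?; exact: eL_wtR.
  - by apply: BM => ? ?; exact: fL_wtR.
  by rewrite !mxE; case: (a =P b) => [->//|_]; rewrite mulr0n eqxx.
move=> /matrixP/(_ i j); rewrite mul_mx_diag mul_diag_mx !mxE eqxx mulr1.
by case: eqP => // _; rewrite mul0r => h; rewrite -h eqxx in Eij.
Qed.

Let b (g' : box) := (delta * graded_trace wtR E)@_(box_mnm g').

Let joint_col (g' : box) (E' : 'M[F]_s) j : dominant g' ->
  hw_vector wtR (pos_root o) eR (box_lam g') (col j E') ->
  joint_hw (box_lam g) (box_lam g') (col j (E *m E')).
Proof.
move=> dg' [z1 z2]; have colE : col j (E *m E') = E *m col j E' by rewrite !colE mulmxA.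
rewrite colE; split; first exact: E_mul.
split=> [i|a pa]; last by rewrite mulmxA -E_eR // -mulmxA z2 // mulmx0.
rewrite mxE => h; have [l hl] : exists l, E i l * col j E' l 0 != 0.
  apply: contrapT => h0; case/negP: h; apply/eqP; apply: big1 => l _.
  by apply/eqP; apply: contraT => ne; case: h0; exists l.
by move: hl; rewrite mulf_eq0 negb_or => /andP[/E_wtR -> /z1].
Qed.

Let tr_neq0 (M : 'M[F]_s) : \tr M != 0 -> exists j, col j M != 0.
Proof.
move=> tr0; apply: contrapT => h; case/negP: tr0; apply/eqP; apply: big1 => i _.
have /colP/(_ i) : col i M = 0 by apply/eqP; apply: contraT => ne; case: h; exists i.
by rewrite [LHS]mxE => ->; rewrite mxE.
Qed.

Let b_dominant (g' : box) : dominant g' -> b g' != 0 -> g' = g /\ \sum_i `|(box_lam g i)%:Z - K%:Z| <= K%:Z.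
Proof.
move=> dg'; have [E' [E'1 E'2 E'3 E'4]] := dominant_projector ro raR dg'.
rewrite /b E'4; last exact: E_eR.
move=> /tr_neq0 [j hj]; have jh := joint_col dg' (E'1 j).
have [/mnmP e sml] := joint_wt jh hj; split=> //; apply/ffunP => i; apply: val_inj => /=.
have := e i; rewrite !mnmE; have := dominant_ge ro dg' i; have := dominant_ge ro dg i.
by move: (nat_of_ord (g i)) (nat_of_ord (g' i)) => x y; lia.
Qed.

Let ge_K i : (K <= box_lam g i)%N.
Proof. by rewrite mnmE; have := dominant_ge_nonneg ro dg dg0 i; lia. Qed.

Let small_lam : small g = (\sum_i (box_lam g i - K) <= K)%N.
Proof.
have e : \sum_i `|box_wt g i| = 2 * (\sum_i (box_lam g i - K))%N%:Z + \sum_(i < r) (rho2 i)%:Z.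
  rewrite (big_morph Posz PoszD (erefl 0%:Z)) mulr_sumr -big_split; apply: eq_bigr => i _ /=.
  rewrite ger0_norm ?dg0 // /box_wt; have := dominant_ge_nonneg ro dg dg0 i; have := le_rho2 o i.
  by rewrite mnmE /rho2; move: (nat_of_ord (g i)) => x; lia.
by rewrite /small e lerD2r; apply/idP/idP; lia.
Qed.

(** For small [g], uniqueness makes every column of [E *m E'] a multiple of one joint highest weight
    vector, which the product fixes: rank one and trace 1. *)
Let b_self : b g = (small g)%:R.
Proof.
case: (boolP (small g)) => sm; last first.
  apply/eqP; apply: contraNT sm => /(b_dominant dg) [_ h]; rewrite small_lam -lez_nat.
  rewrite (big_morph Posz PoszD (erefl 0%:Z)); apply: le_trans h; apply: ler_sum => i _.
  by have := ge_K i; lia.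
have [E' [E'1 E'2 E'3 E'4]] := dominant_projector ro raR dg.
rewrite /b E'4; last exact: E_eR.
have [|z zn0 [zL zR]] := joint_ex ge_K _ (etrans (esym small_lam) sm).
  move=> i j ij; rewrite !mnmE; have := dominant_chain ro dg ij; have := le_rho2 o j.
  by have := dominant_ge ro dg j; lia.
have [|y yP] := @boolp.choice 'I_s F (fun j c => col j (E *m E') = c *: z).
  by move=> j; exact: (joint_uniq (conj zL zR) (joint_col dg (E'1 j)) zn0).
have eEE : E *m E' = z *m (\row_j y j).
  apply/matrixP => i j; have /colP/(_ i) := yP j; rewrite [LHS]mxE => ->.
  by rewrite !mxE big_ord1 !mxE mulrC.
have : (E *m E') *m z = z by rewrite -mulmxA E'2 // E_id.
rewrite eEE -mulmxA mxtrace_mulC [_ *m z]mx11_scalar mul_mx_scalar mxtrace_scalar.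
move/eqP; rewrite -subr_eq0 -[X in _ - X]scale1r -scalerBl scaler_eq0 (negbTE zn0) orbF subr_eq0.
by move/eqP => ->.
Qed.

(** Weyl's formula for the right action with [Q = E], which commutes with it. The only right highest
    weight met is that of [g], so the multiplicity on the left is a dimension on the right. *)
Lemma trace_hw : rhoF * \tr E = (small g)%:R * box_dim g.
Proof.
pose T g' := b g' * box_dim g'.
have inv w g' : allowed o w -> T (box_act w g') = T g'.
  move=> aw; have [U [U' [UU UwR UwL Uc]]] := symR aw.
  have QU : E *m U = U *m E.
    by symmetry; apply: E_comm => // a pa; have [] := Uc a pa.
  have hm k : (box_mnm g' k <= 2 * K + q)%N by rewrite mnmE -ltnS.
  rewrite /T /b box_act_mnm (chi_antisym ro (ra_wt raR) UU QU UwR hm) box_dim_act //.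
  by rewrite mulrACA wsign2 mul1r.
have orb g' : T g' != 0 -> exists2 w, allowed o w & box_act w g' = g.
  rewrite mulf_eq0 negb_or => /andP[b0 d0]; have [w aw dw] := dominant_conj_allowed ro d0.
  exists w => //; have [||//] := @b_dominant (box_act w g').
    by [].
  have : T (box_act w g') != 0 by rewrite inv // mulf_neq0.
  by rewrite mulf_eq0 negb_or => /andP[].
have := sum_orbit ro gn0 inv orb; rewrite (sum_box_dim ro (ra_wt raR)) -mulrA /T b_self.
by move/mulfI; apply; rewrite mulf_neq0 ?expf_neq0 ?pnatr_eq0 // -lt0n fact_gt0.
Qed.

End Fixed.

Let b1 (g : box) := (delta * graded_trace wtL 1%:M)@_(box_mnm g).

(** Left characters are symmetric under all signed permutations, even those outside the Weyl group
    of type D, so [g] may be moved to nonnegative coordinates, where [joint_ex] applies. *)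
Let b1E g : box_dim g != 0 -> rhoF * b1 g = (small g)%:R * box_dim g.
Proof.
move=> gn0; have [w _ [h1 h2 h3]] := @dominant_conj F r o ro K predT g isT (fun _ _ _ _ => isT).
pose g' := box_act w g.
have g'n0 : box_dim g' != 0.
  by rewrite box_dim_act // mulf_neq0 // (contraNneq _ (oner_neq0 F)) // -(wsign2 F o w) => ->; rewrite mul0r.
have z0 k : 0 <= box_wt g' k by exact: h3.
have dg' : dominant g'.
  split=> [k l kl|oo k].
    have ne : k != l by rewrite -val_eqE /=; lia.
    have [r1 r2] := box_dim_regular g'n0 ne; have := h1 k l kl isT; rewrite -/g'.
    by have := z0 l; move: (box_wt _ k) (box_wt _ l) r1 r2 => x y; lia.
  by have := z0 k; have := box_dim_neq0 F ro g' k oo; move: (box_wt _ k) => x; lia.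
have [E [E1 E2 E3 E4]] := dominant_projector ro raL dg'.
have := trace_hw dg' z0 g'n0 E1 E2 E3; have := E4 1%:M.
rewrite mul1mx => <-; last by move=> a _; rewrite mul1mx mulmx1.
have [U [U' [UU Uw]]] := symL w.
have hm k : (box_mnm g k <= 2 * K + q)%N by rewrite mnmE -ltnS.
rewrite {1}/g' box_act_mnm (chi_antisym ro (ra_wt raL) UU _ Uw hm); last by rewrite mul1mx mulmx1.
rewrite -/(b1 g) {2}/g' box_dim_act //.
have -> : small g' = small g.
  rewrite /small; congr (_ <= _); rewrite [RHS](reindex_inj (@perm_inj _ w.1)).
  by apply: eq_bigr => i _; rewrite box_act_wt // normrM normrX normrN1 expr1n mul1r.
move: (wsign2 F o w); move: (wsign F o w) (b1 g) (box_dim g) (_%:R) => x y z t xx h.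
have {}h : x * x * (rhoF * y) = x * x * (t * z).
  have -> : x * x * (rhoF * y) = x * (rhoF * (x * y)) by ring.
  by rewrite h; ring.
by move: h; rewrite xx !mul1r.
Qed.

(** Weyl's formula on the left for the identity weights each dimension by a multiplicity, which
    [b1E] shows to be that dimension again. *)
Theorem sum_weyl_dim :
  2 ^+ r * r`!%:R * rhoF ^+ 2 * s%:R = wmult F o * \sum_(g | small g) box_dim g ^+ 2.
Proof.
have h := sum_box_dim ro (ra_wt raL) (1%:M : 'M[F]_s); rewrite mxtrace_scalar in h.
rewrite expr2 mulrA mulrAC -h -mulrA; congr (_ * _).
rewrite mulrC mulr_sumr [RHS]big_mkcond; apply: eq_bigr => g _; rewrite mulrA -/(b1 g).
have [->|gn0] := eqVneq (box_dim g) 0; first by rewrite mulr0 expr0n; case: ifP.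
by rewrite b1E // -mulrA -expr2; case: ifP => _; rewrite ?mul1r ?mul0r.
Qed.

End Bimodule.

(** * The orthogonal Lie algebra acting on matrix polynomials *)

Section Halves.
Variable (n' : nat).
Local Notation n := n'.+1.
Local Notation r := (n./2).
Local Notation o := (odd n).

Lemma half_lt : (r < n)%N.
Proof. by rewrite -divn2 ltn_Pdiv. Qed.

Definition low (k : 'I_r) : 'I_n := widen_ord (ltnW half_lt) k.
Definition mid : 'I_n := Ordinal half_lt.

Lemma halfE : n = (r + o + r)%N.
Proof. by rewrite addnAC addnn addnC odd_double_half. Qed.

Lemma rev_mid : o -> rev_ord mid = mid.
Proof. by move=> oo; apply: val_inj => /=; have := halfE; rewrite oo; lia. Qed.

Lemma low_inj : injective low.
Proof. by move=> k l /(congr1 val) /= e; apply: val_inj. Qed.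

Lemma low_neq_rev k l : low k != rev_ord (low l).
Proof.
by rewrite -val_eqE /=; have := ltn_ord k; have := ltn_ord l; have := halfE; case: (o) => /=; lia.
Qed.

Lemma low_neq_mid k : low k != mid.
Proof. by rewrite -val_eqE /= neq_ltn ltn_ord. Qed.

Lemma big_halves (R : Type) (idx : R) (op : Monoid.com_law idx) (phi : 'I_n -> R) :
  \big[op/idx]_k phi k = op (\big[op/idx]_(i < r) op (phi (low i)) (phi (rev_ord (low i))))
    (if o then phi mid else idx).
Proof.
pose g k := phi (inord k).
have gE (k : 'I_n) : phi k = g k by rewrite /g inord_val.
rewrite (eq_bigr _ (fun k _ => gE k)) -(big_mkord xpredT g).
rewrite (@big_cat_nat _ _ _ r) //=; last by rewrite ltnW // half_lt.
rewrite (@big_cat_nat _ _ _ (r + o)%N r) //=; [|exact: leq_addr|]; last first.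
  by have := halfE; lia.
rewrite big_split /= big_mkord -Monoid.mulmA; congr (op _ _).
  by apply: eq_bigr => i _; rewrite gE.
rewrite Monoid.mulmC; congr (op _ _).
  rewrite big_nat_rev /= -{1}[(r + o)%N]add0n big_addn big_mkord.
  have -> : (n - (r + o) = r)%N by rewrite {1}halfE addKn.
  apply: eq_bigr => i _; rewrite gE /=; congr g; have := halfE; have := ltn_ord i; lia.
by case: (~~ odd n'); rewrite ?addn1 ?addn0 ?big_nat1 ?big_geq //= gE.
Qed.

Lemma sum_halves (V : zmodType) (phi : 'I_n -> V) :
  \sum_k phi k = \sum_(i < r) (phi (low i) + phi (rev_ord (low i))) + (if o then phi mid else 0).
Proof. exact: big_halves. Qed.

Lemma sum_pairs (V : zmodType) m (g : 'I_m -> 'I_m -> V) :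
  \sum_i \sum_j g i j = \sum_i g i i + \sum_(i < m) \sum_(j < m | (i < j)%N) (g i j + g j i).
Proof.
under [X in _ = _ + X]eq_bigr => i _ do rewrite big_split /=.
rewrite big_split /= [X in _ + (_ + X)](exchange_big_dep predT) //= -!big_split /=.
apply: eq_bigr => i _; rewrite (bigD1 i) //=; congr (_ + _).
rewrite (bigID (fun j : 'I_m => (i < j)%N)) /=; congr (_ + _); apply: eq_bigl => j.
  by rewrite -val_eqE /=; lia.
by rewrite -val_eqE /=; lia.
Qed.

Section Relations.
Variables (F : numClosedFieldType) (s' K : nat).
Local Notation s := s'.+1.
Variables (wt : 'I_s -> 'X_{1..r}) (E : 'I_n -> 'I_n -> 'M[F]_s).

(* The defining relations of the orthogonal Lie algebra preserving the
   antidiagonal form, with E k l the image of E_{kl} - E_{l'k'}. *)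
Definition so_relations : Prop :=
  (forall k l, E (rev_ord l) (rev_ord k) = - E k l) /\
  (forall a b k l, E a b *m E k l - E k l *m E a b =
    E a l *+ (b == k) - E (rev_ord b) l *+ (rev_ord a == k) - E k b *+ (a == l) +
    E k (rev_ord a) *+ (rev_ord b == l)).

Hypothesis so : so_relations.

Let E_rev k l : E (rev_ord l) (rev_ord k) = - E k l. Proof. by case: so => + _; apply. Qed.

Let E0 (M : 'M[F]_s) : M = - M -> M = 0.
Proof.
move=> h; apply/matrixP => i j; have /matrixP/(_ i j) := h; rewrite !mxE => /eqP.
by rewrite -subr_eq0 opprK -mulr2n mulrn_eq0 /= => /eqP.
Qed.

Let E_anti k : E k (rev_ord k) = 0.
Proof. by apply: E0; rewrite -E_rev rev_ordK. Qed.

Let E_mid : o -> E mid mid = 0.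
Proof. by move=> oo; apply: E0; rewrite -E_rev rev_mid. Qed.

Let total : 'M[F]_s := \sum_k \sum_l E k l *m E l k.

(** [total] is the Casimir element of the trace form up to normalisation. The commutators with its
    two factors give the same sums [P] and [R] with opposite signs. *)
Let total_comm a b : E a b *m total = total *m E a b.
Proof.
have [_ rel] := so.
have e : E a b * total - total * E a b = \sum_k \sum_l
   ((E a b * E k l - E k l * E a b) * E l k + E k l * (E a b * E l k - E l k * E a b)).
  rewrite /total mulr_sumr mulr_suml -sumrB; apply: eq_bigr => k _.
  rewrite mulr_sumr mulr_suml -sumrB; apply: eq_bigr => l _.
  by rewrite mulrBl mulrBr !mulrA addrA subrK.
have selL m0 (f : 'I_n -> 'I_n -> 'M[F]_s) : \sum_k \sum_l f k l *+ (m0 == k) = \sum_l f m0 l.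
  rewrite (bigD1 m0) //= eqxx [X in _ + X]big1 ?addr0 // => k km.
  by rewrite eq_sym (negbTE km) big1.
have selR m0 (f : 'I_n -> 'I_n -> 'M[F]_s) : \sum_k \sum_l f k l *+ (m0 == l) = \sum_k f k m0.
  by rewrite exchange_big; exact: (selL m0 (fun k l => f l k)).
apply/eqP; rewrite -subr_eq0; apply/eqP; rewrite [LHS]e.
pose P x y := \sum_l E x l * E l y; pose R x y := \sum_k E k x * E y k.
transitivity (P a b - P (rev_ord b) (rev_ord a) - R b a + R (rev_ord a) (rev_ord b) +
  (R b a - R (rev_ord a) (rev_ord b) - P a b + P (rev_ord b) (rev_ord a))); last first.
  move: (P a b) (P _ _) (R b a) (R _ _) => x y z t.
  by apply/matrixP => i j; rewrite !mxE; ring.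
have g1 : P a b - P (rev_ord b) (rev_ord a) - R b a + R (rev_ord a) (rev_ord b) =
    \sum_k \sum_l (E a b * E k l - E k l * E a b) * E l k.
  rewrite /P /R -(selL b (fun k l => E a l * E l k))
    -(selL (rev_ord a) (fun k l => E (rev_ord b) l * E l k))
    -(selR a (fun k l => E k b * E l k)) -(selR (rev_ord b) (fun k l => E k (rev_ord a) * E l k)).
  rewrite -!sumrB -big_split; apply: eq_bigr => k _ /=.
  rewrite -!sumrB -big_split; apply: eq_bigr => l _ /=.
  by rewrite [E a b * E k l - _]rel !mulrDl !mulNr !mulrnAl.
have g2 : R b a - R (rev_ord a) (rev_ord b) - P a b + P (rev_ord b) (rev_ord a) =
    \sum_k \sum_l E k l * (E a b * E l k - E l k * E a b).
  rewrite /P /R -(selR b (fun k l => E k l * E a k))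
    -(selR (rev_ord a) (fun k l => E k l * E (rev_ord b) k))
    -(selL a (fun k l => E k l * E l b)) -(selL (rev_ord b) (fun k l => E k l * E l (rev_ord a))).
  rewrite -!sumrB -big_split; apply: eq_bigr => k _ /=.
  rewrite -!sumrB -big_split; apply: eq_bigr => l _ /=.
  by rewrite [E a b * E l k - _]rel !mulrDr !mulrN !mulrnAr.
rewrite g1 g2 -big_split; apply: eq_bigr => k _ /=.
by rewrite -big_split.
Qed.

Let eidx (t : root r) : 'I_n * 'I_n :=
  match t with
  | inl (k, l, b) => (low k, if b then rev_ord (low l) else low l)
  | inr k => (low k, mid)
  end.

Definition so_e t := E (eidx t).1 (eidx t).2.
Definition so_f t := E (eidx t).2 (eidx t).1.

Hypothesis E_cartan : forall i, E (low i) (low i) = cartan F K wt i.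
Hypothesis E_wt : forall k l i j, E k l i j != 0 ->
  (forall c : 'I_r, wt i c + (l == low c) + (k == rev_ord (low c)) =
     wt j c + (k == low c) + (l == rev_ord (low c)))%N.
Hypothesis wt_le : forall j c, (wt j c <= 2 * K)%N.

(** The symmetry [E_rev] makes each root and each Cartan element occur twice in the double sum,
    while antidiagonal terms vanish; hence the 2. *)
Let total_casimir : total = 2 *: casimir K wt (pos_root o) so_e so_f.
Proof.
pose G k l := E k l *m E l k.
have G_rev k l : G (rev_ord l) (rev_ord k) = G k l.
  by rewrite /G !E_rev mulmxN mulNmx opprK.
have G_rev1 k l : G (rev_ord k) l = G (rev_ord l) k by rewrite -G_rev rev_ordK.
have G_rev2 k l : G k (rev_ord l) = G l (rev_ord k) by rewrite -G_rev rev_ordK.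
have G_anti k : G k (rev_ord k) = 0 by rewrite /G E_anti mul0mx.
have G_anti' k : G (rev_ord k) k = 0 by rewrite /G E_anti mulmx0.
pose A k := \sum_l G k l.
have AE k : A k = \sum_j (G k (low j) + G k (rev_ord (low j))) + (if o then G k mid else 0).
  exact: sum_halves.
rewrite -[total]/(\sum_k A k) sum_halves.
have A1 i : A (low i) + A (rev_ord (low i)) = \sum_j (G (low i) (low j) + G (low i) (rev_ord (low j)) +
    (G (rev_ord (low i)) (low j) + G (low j) (low i))) +
    (if o then G (low i) mid + G mid (low i) else 0).
  rewrite !AE addrACA -big_split /=; congr (_ + _).
    by apply: eq_bigr => j _; rewrite G_rev.
  case oo: (~~ odd n'); last by rewrite addr0.
  by rewrite (G_rev1 (low i) mid) (rev_mid oo).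
have A2 : (if o then A mid else 0) = if o then \sum_j (G mid (low j) + G (low j) mid) else 0.
  case: ifP => // oo; rewrite AE.
  have -> : (if o then G mid mid else 0) = 0 by case: ifP => // h; rewrite /G E_mid // mulmx0.
  rewrite addr0.
  by apply: eq_bigr => j _; rewrite [G mid (rev_ord _)]G_rev2 rev_mid.
have S1 : \sum_i (G (low i) (low i) + G (low i) (rev_ord (low i)) +
    (G (rev_ord (low i)) (low i) + G (low i) (low i))) =
    2 *: \sum_i cartan F K wt i *m cartan F K wt i.
  rewrite scaler_sumr; apply: eq_bigr => i _.
  by rewrite G_anti G_anti' addr0 add0r scaler_nat mulr2n /G E_cartan.
have S2 : \sum_(i < r) \sum_(j < r | (i < j)%N) (G (low i) (low j) + G (low i) (rev_ord (low j)) +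
      (G (rev_ord (low i)) (low j) + G (low j) (low i)) +
     (G (low j) (low i) + G (low j) (rev_ord (low i)) +
      (G (rev_ord (low j)) (low i) + G (low i) (low j)))) =
    2 *: \sum_(k < r) \sum_(l < r | (k < l)%N)
      ((G (low k) (rev_ord (low l)) + G (rev_ord (low l)) (low k)) +
       (G (low k) (low l) + G (low l) (low k))).
  rewrite scaler_sumr; apply: eq_bigr => i _; rewrite scaler_sumr; apply: eq_bigr => j _.
  rewrite [G (low j) (rev_ord _)]G_rev2 [G (rev_ord (low i)) _]G_rev1 scaler_nat mulr2n.
  move: (G _ _) (G _ _) (G _ _) (G _ _) => x y z t.
  by apply/matrixP => a b; rewrite !mxE; ring.
rewrite (eq_bigr _ (fun i _ => A1 i)) A2 big_split /= -addrA sum_pairs S1 S2 /casimir big_pos_root /=.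
rewrite !scalerDr -!addrA; congr (_ + (_ + _)) => /=.
case: (~~ odd n'); last by rewrite scaler0 addr0 big1.
rewrite -big_split scaler_sumr; apply: eq_bigr => i _ /=.
by rewrite scaler_nat mulr2n [G mid _ + G _ mid]addrC.
Qed.

Theorem so_root_action : root_action o K wt so_e so_f.
Proof.
have lowE k c : (low k == low c) = (k == c) by rewrite (inj_eq low_inj).
have lowR k c : (low k == rev_ord (low c)) = false by apply/negbTE; exact: low_neq_rev.
have revL k c : (rev_ord (low k) == low c) = false.
  by rewrite -(inj_eq rev_ord_inj) rev_ordK lowR.
have revR k c : (rev_ord (low k) == rev_ord (low c)) = (k == c).
  by rewrite (inj_eq rev_ord_inj) lowE.
have midL c : (mid == low c) = false by rewrite eq_sym (negbTE (low_neq_mid c)).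
have midR c : o -> (mid == rev_ord (low c)) = false.
  by move=> oo; rewrite -(inj_eq rev_ord_inj) rev_ordK rev_mid // midL.
have E_ll l : E (rev_ord l) (rev_ord l) = - E l l by exact: E_rev.
have cU (k : 'I_r) : \sum_i (U_(k)%MM i)%:R *: cartan F K wt i = cartan F K wt k.
  rewrite (bigD1 k) //= mnm1E eqxx scale1r big1 ?addr0 // => i ik.
  by rewrite mnm1E eq_sym (negbTE ik) scale0r.
split=> //.
- move=> [[[k l] b]|k] i j pa h; apply/mnmP => c; have := E_wt h c; rewrite /= !mnmDE.
    by case: b pa {h} => pa /=; rewrite ?mnmDE ?mnm0E ?mnm1E ?lowE ?lowR ?revL ?revR ?addn0 // => ->; rewrite ?addnA.
  have oo : o := pa.
  have := E_wt (h : E (low k) mid i j != 0) c.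
  by rewrite mnm0E mnm1E lowE midL midR // lowR !addn0.
- move=> [[[k l] b]|k] i j pa h; apply/mnmP => c; have := E_wt h c; rewrite /= !mnmDE.
    by case: b pa {h} => pa /=; rewrite ?mnmDE ?mnm0E ?mnm1E ?lowE ?lowR ?revL ?revR ?addn0 // addnA.
  have oo : o := pa.
  have := E_wt (h : E mid (low k) i j != 0) c.
  by rewrite mnm0E mnm1E lowE midL midR // lowR !addn0.
- have [_ rel] := so.
  move=> [[[k l] b]|k] pa; rewrite /so_e /so_f rel !eqxx !mulr1n /rootc.
    have kl : (k == l) = false by apply/negbTE; rewrite -val_eqE neq_ltn; move: pa => /= ->.
    case: b pa => pa /=.
      rewrite revR rev_ordK lowE [l == k]eq_sym kl E_ll !E_cartan !subr0 !addr0 opprK.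
      under eq_bigr => i _ do rewrite mnmDE mnm0E subr0 natrD scalerDl.
      by rewrite big_split /= !cU.
    rewrite !revL !E_cartan subr0 addr0.
    under eq_bigr => i _ do rewrite scalerBl.
    by rewrite sumrB !cU.
  have oo : o := pa.
  have revM : (rev_ord (low k) == mid) = false by rewrite -(inj_eq rev_ord_inj) rev_ordK (rev_mid oo) (negbTE (low_neq_mid k)).
  rewrite /= revM (rev_mid oo) midL (E_mid oo) !subr0 addr0 E_cartan.
  by under eq_bigr => i _ do rewrite mnm0E subr0; rewrite cU.
move=> a pa; have t2 := total_comm (eidx a).1 (eidx a).2.
have : (2 : F) *: (casimir K wt (pos_root o) so_e so_f *m so_e a) =
       2 *: (so_e a *m casimir K wt (pos_root o) so_e so_f).
  by rewrite scalemxAl scalemxAr -total_casimir t2.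
by move/scalerI; apply; rewrite pnatr_eq0.
Qed.

End Relations.
End Halves.

(** * Infinitesimal translations of matrix polynomials *)

Section MatrixPolynomials.
Variables (F : numClosedFieldType) (n' : nat).
Local Notation n := n'.+1.
Local Notation Pn := {mpoly F[n * n]}.
Implicit Types (p q : Pn) (A Z W : 'M[F]_n) (U V : 'M[Pn]_n).

Local Notation ix := (@mxvec_index n n).

Definition pe p A : F := mpoly_at p (mxvec A).

Lemma mxvec_indP (P : 'I_(n * n) -> Prop) : (forall i j, P (ix i j)) -> forall k, P k.
Proof. by move=> h k; case/mxvec_indexP: k. Qed.

Lemma ix_eq i j k l : (ix i j == ix k l) = (i == k) && (j == l).
Proof.
apply/eqP/andP => [e|[/eqP -> /eqP ->] //].
by have [] := (enum_rank_inj (cast_ord_inj e)) => -> ->.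
Qed.

Lemma peX i j A : pe 'X_(ix i j) A = A i j.
Proof. by rewrite /pe /mpoly_at mevalXU mxvecE. Qed.

Lemma peD p q A : pe (p + q) A = pe p A + pe q A. Proof. exact: mpoly_atD. Qed.
Lemma peM p q A : pe (p * q) A = pe p A * pe q A. Proof. exact: mpoly_atM. Qed.
Lemma peZ c p A : pe (c *: p) A = c * pe p A. Proof. exact: mpoly_atZ. Qed.
Lemma peC c A : pe c%:MP A = c. Proof. exact: mevalC. Qed.
Lemma pe_sum I (s : seq I) P (f : I -> Pn) A :
  pe (\sum_(i <- s | P i) f i) A = \sum_(i <- s | P i) pe (f i) A.
Proof. exact: mpoly_at_sum. Qed.

Lemma sum_ix (V : zmodType) (f : 'I_(n * n) -> V) : \sum_k f k = \sum_i \sum_j f (ix i j).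
Proof.
rewrite pair_big /= (reindex (uncurry ix)) /=.
  by apply: eq_bigr => -[].
exact: curry_mxvec_bij.
Qed.

Definition vfield V p : Pn := \sum_i \sum_j V i j * p^`M(ix i j).

Lemma vfieldD V p q : vfield V (p + q) = vfield V p + vfield V q.
Proof.
rewrite -big_split; apply: eq_bigr => i _; rewrite -big_split; apply: eq_bigr => j _ /=.
by rewrite mderivD mulrDr.
Qed.

Lemma vfieldZ V c p : vfield V (c *: p) = c *: vfield V p.
Proof.
rewrite scaler_sumr; apply: eq_bigr => i _; rewrite scaler_sumr; apply: eq_bigr => j _.
by rewrite mderivZ scalerAr.
Qed.

Lemma vfieldC V c : vfield V c%:MP = 0.
Proof. by apply: big1 => i _; apply: big1 => j _; rewrite mderivC mulr0. Qed.

Lemma vfield0 V : vfield V 0 = 0. Proof. by rewrite -mpolyC0 vfieldC. Qed.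

Lemma vfieldM V p q : vfield V (p * q) = vfield V p * q + p * vfield V q.
Proof.
rewrite mulr_suml mulr_sumr -big_split; apply: eq_bigr => i _.
rewrite mulr_suml mulr_sumr -big_split; apply: eq_bigr => j _ /=.
rewrite mderivM mulrDr; ring.
Qed.

Lemma vfieldX V i j : vfield V 'X_(ix i j) = V i j.
Proof.
have dX k l : ('X_(ix i j) : Pn)^`M(ix k l) = ((i == k) && (j == l))%:R.
  rewrite mderivX mnm1E ix_eq; case: (boolP ((i == k) && (j == l))) => [/andP[/eqP -> /eqP ->]|_].
    by rewrite -{1}[U_(_)%MM]add0m addmK mpolyX0 scale1r.
  by rewrite scale0r.
rewrite /vfield (bigD1 i) //= (bigD1 j) //= dX !eqxx mulr1 !big1 ?addr0 // => k ki.
  apply: big1 => l _; by rewrite dX eq_sym (negbTE ki) mulr0.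
by rewrite dX [j == k]eq_sym (negbTE ki) andbF mulr0.
Qed.

Lemma vfield_sum V I (s : seq I) P (f : I -> Pn) :
  vfield V (\sum_(i <- s | P i) f i) = \sum_(i <- s | P i) vfield V (f i).
Proof.
elim/big_rec2: _ => [|i y x _ <-]; last by rewrite vfieldD.
by rewrite -mpolyC0 vfieldC.
Qed.

Lemma vfieldDl U V p : vfield (U + V) p = vfield U p + vfield V p.
Proof.
rewrite -big_split; apply: eq_bigr => i _; rewrite -big_split; apply: eq_bigr => j _ /=.
by rewrite mxE mulrDl.
Qed.

Lemma vfield_eq0 V p : V = 0 -> vfield V p = 0.
Proof. by move=> ->; apply: big1 => i _; apply: big1 => j _; rewrite mxE mul0r. Qed.

Lemma vfield_bracket V U p : vfield V (vfield U p) - vfield U (vfield V p) =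
  vfield (\matrix_(i, j) (vfield V (U i j) - vfield U (V i j))) p.
Proof.
elim/mpoly_ringind: p => [c|i|p q h1 h2|p q h1 h2].
- by rewrite !vfieldC ?vfield0 ?vfieldC subrr.
- by elim/mxvec_indP: i => i j; rewrite !vfieldX mxE.
- by rewrite !vfieldD -h1 -h2 opprD addrACA.
- by rewrite !vfieldM !vfieldD !vfieldM -h1 -h2; ring.
Qed.

Definition genmx : 'M[Pn]_n := \matrix_(i, j) 'X_(ix i j).
Local Notation cst := (map_mx (@mpolyC (n * n) F)).

(* The infinitesimal right and left translations A -> A (1 + s Z), (1 + s Z) A. *)
Definition rtrans Z p := vfield (genmx *m cst Z) p.
Definition ltrans Z p := vfield (cst Z *m genmx) p.

Let vfield_gen V i j : vfield V (genmx i j) = V i j.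
Proof. by rewrite mxE vfieldX. Qed.

Let vfield_r V Z i j : vfield V ((genmx *m cst Z) i j) = (V *m cst Z) i j.
Proof.
rewrite !mxE vfield_sum; apply: eq_bigr => k _.
by rewrite vfieldM vfield_gen mxE vfieldC mulr0 addr0.
Qed.

Let vfield_l V Z i j : vfield V ((cst Z *m genmx) i j) = (cst Z *m V) i j.
Proof.
rewrite !mxE vfield_sum; apply: eq_bigr => k _.
by rewrite vfieldM vfield_gen mxE vfieldC mul0r add0r.
Qed.

Let cstM Z W : cst (Z *m W) = cst Z *m cst W. Proof. exact: map_mxM. Qed.

Lemma rtrans_bracket Z W p :
  rtrans Z (rtrans W p) - rtrans W (rtrans Z p) = rtrans (Z *m W - W *m Z) p.
Proof.
rewrite vfield_bracket /rtrans; congr (vfield _ p); apply/matrixP => i j.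
by rewrite mxE !vfield_r -!mulmxA -!cstM map_mxB mulmxBr [RHS]mxE [X in _ = _ + X]mxE.
Qed.

(** Left translations reverse brackets; taking them along [Z^T] restores the order, hence the
    transposes in the left action. *)
Lemma ltrans_bracket Z W p :
  ltrans Z (ltrans W p) - ltrans W (ltrans Z p) = ltrans (W *m Z - Z *m W) p.
Proof.
rewrite vfield_bracket /ltrans; congr (vfield _ p); apply/matrixP => i j.
by rewrite mxE !vfield_l !mulmxA -!cstM map_mxB mulmxBl [RHS]mxE [X in _ = _ + X]mxE.
Qed.

Lemma rltrans_comm Z W p : ltrans Z (rtrans W p) = rtrans W (ltrans Z p).
Proof.
apply/eqP; rewrite -subr_eq0 vfield_bracket; apply/eqP; apply: vfield_eq0.
by apply/matrixP => i j; rewrite mxE vfield_r vfield_l mulmxA subrr mxE.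
Qed.

Lemma rtransD Z W p : rtrans (Z + W) p = rtrans Z p + rtrans W p.
Proof. by rewrite /rtrans map_mxD mulmxDr vfieldDl. Qed.

Lemma rtransZ c Z p : rtrans (c *: Z) p = c *: rtrans Z p.
Proof.
rewrite /rtrans map_mxZ -scalemxAr scaler_sumr; apply: eq_bigr => i _.
rewrite scaler_sumr; apply: eq_bigr => j _; by rewrite [in LHS]mxE mul_mpolyC scalerAl.
Qed.

Lemma rtrans0 p : rtrans 0 p = 0.
Proof. by apply: vfield_eq0; rewrite map_mx0 mulmx0. Qed.

Lemma rtrans_sum I (s : seq I) P (f : I -> 'M[F]_n) p :
  rtrans (\sum_(i <- s | P i) f i) p = \sum_(i <- s | P i) rtrans (f i) p.
Proof. by elim/big_rec2: _ => [|i y x _ <-]; rewrite ?rtrans0 ?rtransD. Qed.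

Lemma pe_rtrans Z p A :
  pe (rtrans Z p) A = \sum_i \sum_j (A *m Z) i j * pe (p^`M(ix i j)) A.
Proof.
rewrite /rtrans /vfield pe_sum; apply: eq_bigr => i _; rewrite pe_sum; apply: eq_bigr => j _.
rewrite peM; congr (_ * _); rewrite !mxE pe_sum; apply: eq_bigr => k _.
by rewrite peM !mxE peX peC.
Qed.

(* Differentiation along the matrix curve C with C' = C Y. *)
Lemma along_mx p (C : 'M[{poly F}]_n) s Z :
  (forall i j, ((C i j)^`()).[s] = (map_mx (horner_eval s) C *m Z) i j) ->
  (along p (fun k => mxvec C 0 k))^`().[s] = pe (rtrans Z p) (map_mx (horner_eval s) C).
Proof.
move=> h; rewrite along_deriv horner_sum sum_ix pe_rtrans; apply: eq_bigr => i _.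
apply: eq_bigr => j _; rewrite hornerM mxvecE h mulrC; congr (_ * _); rewrite alongE.
by apply: meval_eq => k; elim/mxvec_indP: k => a b; rewrite !mxvecE mxE.
Qed.

Lemma along_pe p (C : 'M[{poly F}]_n) s :
  (along p (fun k => mxvec C 0 k)).[s] = pe p (map_mx (horner_eval s) C).
Proof. by rewrite alongE; apply: meval_eq => k; elim/mxvec_indP: k => a b; rewrite !mxvecE mxE. Qed.

(** Polarisation operators. Translations along matrix units are sums of these, which displays their
    effect on row and column degrees. *)
Definition pol (a b : 'I_(n * n)) p : Pn := 'X_a * p^`M(b).

Lemma polX a b (m : 'X_{1..n * n}) :
  pol a b 'X_[m] = (m b)%:R *: 'X_[m - U_(b) + U_(a)].
Proof. by rewrite /pol mderivX -scalerAr -mpolyXD addmC. Qed.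

Lemma pol_supp a b p (m' : 'X_{1..n * n}) : (pol a b p)@_m' != 0 ->
  exists2 m, p@_m != 0 & (m' + U_(b) = m + U_(a))%MM.
Proof.
move=> h; have : m' \in msupp (\sum_(m <- msupp p) p@_m *: pol a b 'X_[m]).
  rewrite mcoeff_msupp; suff <- : pol a b p = \sum_(m <- msupp p) p@_m *: pol a b 'X_[m] by [].
  rewrite {1}(mpolyE p) /pol raddf_sum mulr_sumr; apply: eq_bigr => m _ /=.
  by rewrite mderivZ scalerAr.
move=> /msupp_sum_le /flatten_mapP [m]; rewrite filter_predT => mp /msuppZ_le.
rewrite mcoeff_msupp polX mcoeffZ mcoeffX => h2; exists m; first by rewrite -mcoeff_msupp.
have mb : (0 < m b)%N by rewrite lt0n; apply: contraNneq h2 => ->; rewrite mul0r.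
move: h2; case: (_ =P m') => [<- _|_]; last by rewrite mulr0 eqxx.
by rewrite addmC addmA [(U_(b) + _)%MM]addmC submK // lep1mP -lt0n.
Qed.

Lemma rtrans_delta k l p : rtrans (delta_mx k l) p = \sum_i pol (ix i k) (ix i l) p.
Proof.
rewrite /rtrans /vfield; apply: eq_bigr => i _; rewrite (bigD1 l) //= big1 ?addr0 => [|j jl].
  rewrite /pol mxE (bigD1 k) //= !mxE !eqxx mulr1 big1 ?addr0 // => a ak.
  by rewrite !mxE (negbTE ak) mpolyC0 mulr0.
rewrite mxE big1 ?mul0r // => a _; by rewrite !mxE (negbTE jl) andbF mpolyC0 mulr0.
Qed.

Lemma ltrans_delta k l p : ltrans (delta_mx k l) p = \sum_j pol (ix l j) (ix k j) p.
Proof.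
rewrite /ltrans /vfield (bigD1 k) //= [X in _ + X]big1 ?addr0 => [|i ik].
  apply: eq_bigr => j _; rewrite /pol mxE (bigD1 l) //= !mxE !eqxx mul1r big1 ?addr0 // => a al.
  by rewrite !mxE (negbTE al) andbF mpolyC0 mul0r.
apply: big1 => j _; rewrite mxE big1 ?mul0r // => a _.
by rewrite !mxE (negbTE ik) mpolyC0 mul0r.
Qed.

Definition soG (k l : 'I_n) : 'M[F]_n := delta_mx k l - delta_mx (rev_ord l) (rev_ord k).

Lemma soG_rev k l : soG (rev_ord l) (rev_ord k) = - soG k l.
Proof. by rewrite /soG !rev_ordK opprB. Qed.

Lemma soG_tr k l : (soG k l)^T = soG l k.
Proof. by rewrite /soG linearB /= !trmx_delta. Qed.

Lemma soG_bracket a b k l : soG a b *m soG k l - soG k l *m soG a b =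
    soG a l *+ (b == k) - soG (rev_ord b) l *+ (rev_ord a == k) - soG k b *+ (a == l) +
    soG k (rev_ord a) *+ (rev_ord b == l).
Proof.
have r1 (x y : 'I_n) : (x == rev_ord y) = (rev_ord x == y) by rewrite -(inj_eq rev_ord_inj) rev_ordK.
rewrite /soG !mulmxBl !mulmxBr !mul_delta_mx_cond !rev_ordK.
have e1 : (b == rev_ord l) = (rev_ord b == l) by exact: r1.
have e2 : (rev_ord a == rev_ord l) = (a == l) by exact: (inj_eq rev_ord_inj).
have e3 : (l == a) = (a == l) by exact: eq_sym.
have e4 : (l == rev_ord b) = (rev_ord b == l) by exact: eq_sym.
have e5 : (rev_ord k == a) = (rev_ord a == k) by rewrite eq_sym r1.
have e6 : (rev_ord k == rev_ord b) = (b == k) by rewrite eq_sym (inj_eq rev_ord_inj).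
rewrite e1 e2 e3 e4 e5 e6; move: (b == k) (rev_ord a == k) (a == l) (rev_ord b == l) => b1 b2 b3 b4.
by apply/matrixP => x y; rewrite ?mxE; case: b1; case: b2; case: b3; case: b4;
  rewrite ?mulr1n ?mulr0n ?mxE; ring.
Qed.

Definition trp p : Pn := mmap (@mpolyC (n * n) F)
  (fun k => mxvec (\matrix_(i, j) 'X_(ix j i)) 0 k) p.

Lemma pe_trp p A : pe (trp p) A = pe p A^T.
Proof.
rewrite /trp; elim/mpoly_ringind: p => [c|k|p q h1 h2|p q h1 h2].
- by rewrite mmapC !peC.
- by elim/mxvec_indP: k => i j; rewrite mmapX mmap1U mxvecE mxE !peX mxE.
- by rewrite mmapD !peD h1 h2.
- by rewrite rmorphM !peM h1 h2.
Qed.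

Lemma rtrans_trp Z p : rtrans Z (trp p) = trp (ltrans Z^T p).
Proof.
have tX i j : trp 'X_(ix i j) = 'X_(ix j i) by rewrite /trp mmapX mmap1U mxvecE mxE.
have tC c : trp c%:MP = c%:MP by rewrite /trp mmapC.
have tD p1 q1 : trp (p1 + q1) = trp p1 + trp q1 by rewrite /trp mmapD.
have tM p1 q1 : trp (p1 * q1) = trp p1 * trp q1 by rewrite /trp rmorphM.
have tS I (s : seq I) (f : I -> Pn) : trp (\sum_(i <- s) f i) = \sum_(i <- s) trp (f i).
  by rewrite /trp raddf_sum.
elim/mpoly_ringind: p => [c|k|p q h1 h2|p q h1 h2].
- by rewrite tC /ltrans /rtrans !vfieldC -mpolyC0 tC.
- elim/mxvec_indP: k => i j; rewrite tX /rtrans /ltrans !vfieldX !mxE tS; apply: eq_bigr => k _.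
  by rewrite !mxE tM tC tX mulrC.
- by rewrite tD /rtrans /ltrans !vfieldD tD -h1 -h2.
- by rewrite tM /rtrans /ltrans !vfieldM tD !tM -h1 -h2.
Qed.

End MatrixPolynomials.

(** * The group of the antidiagonal form and Cayley curves in it *)

Section Cayley.
Variables (F : numClosedFieldType) (n' : nat).
Local Notation n := n'.+1.
Local Notation Pn := {mpoly F[n * n]}.
Implicit Types (p f : Pn) (A Z M u : 'M[F]_n).

Definition antidiag : 'M[F]_n := \matrix_(i, j) (j == rev_ord i)%:R.
Local Notation J := antidiag.

(* Conjugate to SO(n), but with a diagonal maximal torus and triangular unipotents. *)
Definition SOJ A := \det A = 1 /\ A^T *m J *m A = J.
Definition vanJ p := forall A, SOJ A -> pe p A = 0.
Definition soJ Z := Z^T *m J = - (J *m Z).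
Definition strict_upper M := forall i j : 'I_n, (j <= i)%N -> M i j = 0.

Lemma antidiag_mul M i j : (J *m M) i j = M (rev_ord i) j.
Proof.
rewrite mxE (bigD1 (rev_ord i)) //= mxE eqxx mul1r big1 ?addr0 // => k ki.
by rewrite mxE (negbTE ki) mul0r.
Qed.

Lemma mul_antidiag M i j : (M *m J) i j = M i (rev_ord j).
Proof.
rewrite mxE (bigD1 (rev_ord j)) //= mxE rev_ordK eqxx mulr1 big1 ?addr0 // => k kj.
rewrite mxE (_ : (j == rev_ord k) = false) ?mulr0 //.
by rewrite -(inj_eq rev_ord_inj) rev_ordK eq_sym; exact: negbTE.
Qed.

Lemma antidiag_tr : J^T = J.
Proof.
by apply/matrixP => i j; rewrite !mxE -(inj_eq rev_ord_inj) rev_ordK eq_sym.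
Qed.

Lemma antidiagK : J *m J = 1%:M.
Proof. by apply/matrixP => i j; rewrite antidiag_mul !mxE rev_ordK eq_sym. Qed.

Lemma antidiag_unit : J \in unitmx.
Proof. by have [] := mulmx1_unit antidiagK. Qed.

Lemma SOJ1 : SOJ 1%:M.
Proof. by split; rewrite ?det1 // trmx1 mul1mx mulmx1. Qed.

Lemma SOJM A M : SOJ A -> SOJ M -> SOJ (A *m M).
Proof.
move=> [d1 o1] [d2 o2]; split; first by rewrite det_mulmx d1 d2 mulr1.
by rewrite trmx_mul !mulmxA -[M^T *m A^T *m J]mulmxA -[M^T *m _ *m A]mulmxA o1 o2.
Qed.

Lemma SOJ_tr A : SOJ A -> SOJ A^T.
Proof.
move=> [d1 o1]; split; first by rewrite det_tr.
have : (J *m A^T *m J) *m A = 1%:M by rewrite -mulmxA -mulmxA [A^T *m _]mulmxA o1 antidiagK.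
move=> /mulmx1C h; have h2 : A *m J *m A^T *m J = 1%:M by rewrite -h !mulmxA.
by rewrite trmxK -[LHS]mulmx1 -antidiagK mulmxA h2 mul1mx.
Qed.

Lemma soG_soJ k l : soJ (soG F k l).
Proof.
apply/matrixP => i j; rewrite mul_antidiag [RHS]mxE antidiag_mul !mxE.
have r1 (x y : 'I_n) : (rev_ord x == y) = (x == rev_ord y) by rewrite -(inj_eq rev_ord_inj) rev_ordK.
rewrite !r1 !rev_ordK.
by case: (j == rev_ord k); case: (i == l); case: (j == l); case: (i == rev_ord k) => /=; ring.
Qed.

Lemma nilpotent_upper M : strict_upper M -> M ^+ n = 0.
Proof.
move=> sM; suff h m : forall i j : 'I_n, (j < i + m)%N -> (M ^+ m) i j = 0.
  by apply/matrixP => i j; rewrite h ?mxE // ltn_addl.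
elim: m => [|m IH] i j ij.
  by rewrite expr0 mxE (_ : (i == j) = false) //; apply/negbTE; rewrite -val_eqE /=; lia.
rewrite exprS -[_ * _]/(_ *m _) mxE big1 // => k _.
have [ki|ik] := leqP k i; first by rewrite sM // mul0r.
by rewrite IH ?mulr0 //; lia.
Qed.

Definition upper M := forall i j : 'I_n, (j < i)%N -> M i j = 0.

Lemma upperM M N : upper M -> upper N -> upper (M * N).
Proof.
move=> uM uN i j ji; rewrite -mulmxE mxE big1 // => k _.
have [ki|ik] := ltnP k i; first by rewrite uM // mul0r.
by rewrite uN ?mulr0 //; exact: leq_trans ji ik.
Qed.

Lemma strict_upperM M N : strict_upper M -> upper N -> strict_upper (M * N).
Proof.
move=> uM uN i j ji; rewrite -mulmxE mxE big1 // => k _.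
have [ki|ik] := leqP k i; first by rewrite uM // mul0r.
by rewrite uN ?mulr0 //; exact: leq_ltn_trans ji ik.
Qed.

Lemma strict_upperW M : strict_upper M -> upper M.
Proof. by move=> sM i j /ltnW; exact: sM. Qed.

Section Curve.
Variable Z : 'M[F]_n.
Hypotheses (soZ : soJ Z) (nilZ : Z ^+ n = 0).

(** The inverse of [1 - s *: Z] for nilpotent [Z]: the Cayley transform becomes a polynomial curve
    in the group. *)
Definition geom s : 'M[F]_n := \sum_(i < n) (s *: Z) ^+ i.
Definition cayley s : 'M[F]_n := (1 + s *: Z) * geom s.
(** The logarithmic derivative of the curve: [cayley s] has derivative
    [cayley s * cayley_field s]. *)
Definition cayley_field s : 'M[F]_n := 2 *: (Z * geom s * geom (- s)).

Lemma geomr s : (1 - s *: Z) * geom s = 1.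
Proof.
have := subrX1 (s *: Z) n; rewrite exprZn nilZ scaler0 sub0r => h.
by rewrite -opprB mulNr -h opprK.
Qed.

Lemma geoml s : geom s * (1 - s *: Z) = 1. Proof. exact: mulmx1C (geomr s). Qed.
Let geomNr s : (1 + s *: Z) * geom (- s) = 1. Proof. by have := geomr (- s); rewrite scaleNr opprK. Qed.
Let geomNl s : geom (- s) * (1 + s *: Z) = 1. Proof. exact: mulmx1C (geomNr s). Qed.

Lemma geom_comm s : Z * geom s = geom s * Z.
Proof.
rewrite /geom mulr_sumr mulr_suml; apply: eq_bigr => i _.
by rewrite exprZn -scalerAr -scalerAl -exprS -exprSr.
Qed.

Let tr1 s : (1 + s *: Z)^T *m J = J *m (1 - s *: Z).
Proof.
rewrite linearD linearZ /= mulmxDl mulmxBr -scalemxAl -scalemxAr soZ scalerN.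
by rewrite -[(1 : 'M_n)]/(1%:M) trmx1 mul1mx mulmx1.
Qed.

Let trg s : (geom s)^T *m J = J *m geom (- s).
Proof.
have e : (1 - s *: Z)^T *m J = J *m (1 + s *: Z) by have := tr1 (- s); rewrite scaleNr opprK.
have : (geom s)^T *m ((1 - s *: Z)^T *m J) = J.
  have gr : (1 - s *: Z) *m geom s = 1%:M by exact: geomr.
  by rewrite mulmxA -trmx_mul gr trmx1 mul1mx.
rewrite e mulmxA => h; rewrite -{2}h -!mulmxA [(1 + _) *m _]geomNr -idmxE.
by rewrite mulmx1.
Qed.

Let abC s : (1 - s *: Z) * (1 + s *: Z) = (1 + s *: Z) * (1 - s *: Z).
Proof. by rewrite [LHS]mulrBl [RHS]mulrBr mul1r mulr1 mulrDr mulrDl mulr1 mul1r. Qed.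

Lemma cayley_SOJ s : SOJ (cayley s).
Proof.
split; last first.
  have e1 : (cayley s)^T *m J = J *m (geom (- s) * (1 - s *: Z)).
    by rewrite /cayley -!mulmxE trmx_mul -mulmxA tr1 mulmxA trg -mulmxA.
  rewrite e1 -mulmxA /cayley [(_ * _) *m _](_ : _ = 1) -?idmxE ?mulmx1 //.
  rewrite mulmxE -mulrA [_ * (_ * geom s)]mulrA abC -[_ * _ * geom s]mulrA geomr mulr1.
  exact: geomNl.
have dJ : \det J != 0 by rewrite -unitfE -unitmxE antidiag_unit.
have d1 : \det (1 + s *: Z) = \det (1 - s *: Z).
  apply: (mulfI dJ); rewrite -[RHS]det_mulmx -tr1 det_mulmx det_tr mulrC //.
by rewrite /cayley -mulmxE det_mulmx d1 -det_mulmx mulmxE geomr -idmxE det1.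
Qed.

Lemma cayley_field_soJ s : soJ (cayley_field s).
Proof.
rewrite /soJ /cayley_field linearZ /= -scalemxAl -scalemxAr -scalerN; congr (_ *: _).
rewrite -!mulmxE !trmx_mul -!mulmxA soZ !mulmxN [_ *m (J *m Z)]mulmxA trg; congr (- _).
rewrite -[J *m _ *m Z]mulmxA [_ *m (J *m _)]mulmxA trg opprK -!mulmxA; congr (_ *m _).
by rewrite !mulmxE -[geom (- s) * Z]geom_comm !mulrA geom_comm.
Qed.

Lemma cayley_field_upper s : strict_upper Z -> strict_upper (cayley_field s).
Proof.
move=> sZ; have ug t : upper (geom t).
  move=> i j ji; rewrite /geom summxE big1 // => k _; rewrite exprZn mxE.
  suff h : upper (Z ^+ k) by rewrite h // mulr0.
  elim: (k : nat) => [|m IH]; last by rewrite exprS; apply: upperM => //; exact: strict_upperW.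
  move=> a b ba; rewrite expr0 mxE (_ : (a == b) = false) //.
  by apply/negbTE; rewrite -val_eqE /=; lia.
move=> i j ji; rewrite /cayley_field mxE (strict_upperM (strict_upperM sZ (ug _)) (ug _)) //.
exact: mulr0.
Qed.

Lemma cayley0 : cayley 0 = 1 /\ cayley_field 0 = 2 *: Z.
Proof.
have g0 : geom 0 = 1 by have := geomr 0; rewrite scale0r subr0 mul1r.
by rewrite /cayley /cayley_field oppr0 g0 scale0r addr0 !mulr1.
Qed.

Lemma cayley_deriv p A : exists q : {poly F}, forall s, q.[s] = pe p (A *m cayley s) /\
  q^`().[s] = pe (rtrans (cayley_field s) p) (A *m cayley s).
Proof.
pose cm := map_mx (@polyC F) : 'M[F]_n -> 'M[{poly F}]_n.
pose T : 'M[{poly F}]_n := 'X *: cm Z; pose S : 'M[{poly F}]_n := \sum_(i < n) T ^+ i.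
pose C := cm A *m ((1 + T) * S).
pose ev s := map_mx (horner_eval s) : 'M[{poly F}]_n -> 'M[F]_n.
have evc s M : ev s (cm M) = M by apply/matrixP => i j; rewrite !mxE /horner_eval hornerC.
have evT s : ev s T = s *: Z.
  by apply/matrixP => i j; rewrite !mxE /horner_eval hornerM hornerX hornerC.
have evM s (M N : 'M[{poly F}]_n) : ev s (M *m N) = ev s M *m ev s N by exact: map_mxM.
have evD s (M N : 'M[{poly F}]_n) : ev s (M + N) = ev s M + ev s N by exact: map_mxD.
have ev1 s : ev s 1 = 1 by exact: map_mx1.
have evS s : ev s S = geom s.
  rewrite /ev rmorph_sum /=; apply: eq_bigr => i _; rewrite rmorphXn /=.
  by rewrite -[map_mx _ T]/(ev s T) evT.
have evC s : ev s C = A *m cayley s by rewrite evM evc -[_ * _]/(_ *m _) evM evD ev1 evT evS.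
pose dm := map_mx (@deriv F) : 'M[{poly F}]_n -> 'M[{poly F}]_n.
have dmM (M N : 'M[{poly F}]_n) : dm (M *m N) = dm M *m N + M *m dm N.
  apply/matrixP => i j; rewrite !mxE raddf_sum -big_split; apply: eq_bigr => k _ /=.
  by rewrite derivM !mxE.
have dmD (M N : 'M[{poly F}]_n) : dm (M + N) = dm M + dm N by apply/matrixP => i j; rewrite !mxE derivD.
have dmc M : dm (cm M) = 0 by apply/matrixP => i j; rewrite !mxE derivC.
have dmT : dm T = cm Z by apply/matrixP => i j; rewrite !mxE derivM derivX derivC mulr0 addr0 mul1r.
have dm1 : dm 1 = 0 by rewrite -[1]/(1%:M) -(map_mx1 (@polyC F)) dmc.
have TS : (1 - T) *m S = 1.
  have := subrX1 T n; rewrite /T exprZn -rmorphXn nilZ rmorph0 scaler0 sub0r => h.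
  by rewrite -[_ *m _]/(_ * _) -opprB mulNr -h opprK.
have dS s : ev s (dm S) = geom s * Z * geom s.
  have : dm ((1 - T) *m S) = 0 by rewrite TS.
  have dmN (M : 'M[{poly F}]_n) : dm (- M) = - dm M by apply/matrixP => i j; rewrite !mxE derivN.
  rewrite dmM dmD dm1 add0r dmN dmT => h; have := congr1 (ev s) h.
  rewrite evD !evM evD ev1 evS.
  have evN (M : 'M[{poly F}]_n) : ev s (- M) = - ev s M by apply/matrixP => i j; rewrite !mxE /horner_eval hornerN.
  rewrite !evN evc evT [ev s 0](_ : _ = 0); last by apply/matrixP => i j; rewrite !mxE /horner_eval horner0.
  rewrite mulNmx addrC => /eqP; rewrite subr_eq0 => /eqP h2.
  by rewrite -[ev s (dm S)]mul1r -(geoml s) -mulrA -[(1 - _) * _]/(_ *m _) h2 mulmxE mulrA.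
exists (along p (fun k => mxvec C 0 k)) => s; rewrite along_pe -/(ev s C) evC; split=> //.
rewrite (@along_mx _ _ _ _ _ (cayley_field s)) -/(ev s C) ?evC // => i j.
have -> : ((C i j)^`()).[s] = ev s (dm C) i j by rewrite !mxE.
rewrite dmM dmc mul0mx add0r evM evc -mulmxA; congr ((A *m _) i j).
rewrite dmM evD !evM dmD dm1 add0r dmT evD ev1 evc evS evT dS /cayley /cayley_field.
have aZ : (1 + s *: Z) * Z = Z * (1 + s *: Z).
  by rewrite mulrDl mulrDr mul1r mulr1 -scalerAl -scalerAr.
have ag : (1 + s *: Z) * geom s = geom s * (1 + s *: Z).
  by rewrite mulrDl mulrDr mul1r mulr1 -scalerAl -scalerAr geom_comm.
rewrite !mulmxE.
have -> : (1 + s *: Z) * geom s * (2 *: (Z * geom s * geom (- s))) = 2 *: (Z * geom s * geom s).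
  rewrite -scalerAr; congr (_ *: _); rewrite ag -!mulrA [(1 + _) * (Z * _)]mulrA aZ -!mulrA.
  by rewrite [(1 + _) * (geom s * _)]mulrA ag -mulrA geomNr mulr1 !mulrA geom_comm.
have e1 : Z * geom s = Z * (1 - s *: Z) * geom s * geom s.
  by rewrite -!mulrA [(1 - _) * (_ * _)]mulrA geomr mul1r.
have e2 : (1 + s *: Z) * (geom s * Z * geom s) = Z * (1 + s *: Z) * geom s * geom s.
  by rewrite -geom_comm !mulrA aZ.
rewrite {1}e1 e2 -mulrDl -mulrDl -mulrDr addrACA addNr addr0 mulrDr mulr1 -[Z + Z]mulr2n.
by rewrite -scaler_nat -!scalerAl.
Qed.

Lemma vanJ_rtrans_nilp p : vanJ p -> vanJ (rtrans Z p).
Proof.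
move=> vp A SA; have [q hq] := cayley_deriv p A.
have q0 : q = 0.
  by apply: polyF_eq0 => s; have [-> _] := hq s; apply: vp; apply: SOJM => //; exact: cayley_SOJ.
have [_] := hq 0; have [-> ->] := cayley0; rewrite q0 deriv0 horner0 -idmxE mulmx1 rtransZ peZ.
by move=> /esym/eqP; rewrite mulf_eq0 pnatr_eq0 /= => /eqP.
Qed.

End Curve.

Lemma vanJ_rtrans p k l : k != l -> vanJ p -> vanJ (rtrans (soG F k l) p).
Proof.
move=> kl; apply: vanJ_rtrans_nilp; first exact: soG_soJ.
have up (a b : 'I_n) : (a < b)%N -> strict_upper (soG F a b).
  move=> ab i j ji; rewrite !mxE.
  have -> : (i == a) && (j == b) = false.
    by apply/negbTE/negP => /andP[/eqP ia /eqP jb]; move: ji; rewrite ia jb; lia.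
  have -> : (i == rev_ord b) && (j == rev_ord a) = false.
    apply/negbTE/negP => /andP[/eqP ib /eqP ja]; move: ji; rewrite ib ja /=.
    by have := ltn_ord a; have := ltn_ord b; lia.
  by rewrite subrr.
have [lt|gt|/val_inj e] := ltngtP k l; last by rewrite e eqxx in kl.
  by apply: nilpotent_upper; exact: up.
have trX M m : M^T ^+ m = (M ^+ m)^T.
  elim: m => [|m IH]; first by rewrite !expr0 -idmxE trmx1.
  by rewrite exprS exprSr IH -!mulmxE trmx_mul.
by rewrite -soG_tr trX nilpotent_upper ?trmx0 //; exact: up.
Qed.

Lemma vanJ_trp p : vanJ (trp p) <-> vanJ p.
Proof.
split=> h A SA; last by rewrite pe_trp; apply: h; exact: SOJ_tr.
by have := h A^T (SOJ_tr SA); rewrite pe_trp trmxK.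
Qed.

Lemma vanJ_ltrans p k l : k != l -> vanJ p -> vanJ (ltrans (soG F k l) p).
Proof.
rewrite eq_sym => kl /vanJ_trp /(vanJ_rtrans kl); rewrite rtrans_trp soG_tr.
by move/vanJ_trp.
Qed.

Lemma so_decomp Y : soJ Y -> 2 *: Y = \sum_k \sum_l Y k l *: soG F k l.
Proof.
move=> sY; under [RHS]eq_bigr => k _ do under eq_bigr => l _ do rewrite scalerBr.
under [RHS]eq_bigr => k _ do rewrite sumrB.
rewrite sumrB -matrix_sum_delta scaler_nat mulr2n; congr (_ + _).
apply/matrixP => a b; rewrite mxE summxE (bigD1 (rev_ord b)) //= summxE (bigD1 (rev_ord a)) //=.
rewrite [X in _ + _ + X]big1 => [|k kb]; last first.
  rewrite summxE big1 // => l _; rewrite !mxE (_ : (b == rev_ord k) = false) ?andbF ?mulr0 //.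
  by rewrite -(inj_eq rev_ord_inj) rev_ordK eq_sym; exact: negbTE.
rewrite big1 => [|l la]; last first.
  rewrite !mxE (_ : (a == rev_ord l) = false) ?mulr0 //.
  by rewrite -(inj_eq rev_ord_inj) rev_ordK eq_sym; exact: negbTE.
rewrite !mxE !rev_ordK !eqxx mulr1 !addr0.
have /matrixP/(_ (rev_ord a) b) := sY; rewrite mul_antidiag [RHS]mxE antidiag_mul rev_ordK mxE => ->.
by rewrite opprK.
Qed.

(** [u] is the value at 1 of the Cayley curve of [Z = (u - 1) (u + 1)^-1], strictly upper triangular
    in the Lie algebra. Along the curve the derivative of [f] is a combination of the translations
    that kill it. *)
Lemma hw_invariant f A u : (forall k l : 'I_n, (k < l)%N -> vanJ (rtrans (soG F k l) f)) ->
  SOJ A -> strict_upper (u - 1) -> u^T *m J *m u = J -> pe f (A *m u) = pe f A.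
Proof.
move=> hf SA su ou; pose N := u - 1; have nilN := nilpotent_upper su.
pose V := geom N (- 2^-1); pose Z := 2^-1 *: (N * V).
have Vr := geomr nilN (- 2^-1); have Vl := geoml nilN (- 2^-1).
have wE : 1 - (- 2^-1) *: N = 2^-1 *: (u + 1).
  by rewrite scaleNr opprK /N; apply/matrixP => i j; rewrite !mxE; field.
rewrite wE in Vr Vl.
have Zw : Z * (u + 1) = N.
  by rewrite /Z -scalerAl -mulrA -/V scalerAr scalerAr Vl mulr1.
have NV : N * V = V * N by exact: geom_comm.
have wZ : (u + 1) * Z = N.
  have -> : (u + 1) * Z = Z * (u + 1); last by [].
  have -> : u + 1 = N + 2%:R by rewrite /N mulr2n addrA subrK.
  rewrite /Z mulrDl mulrDr -!scalerAl -!scalerAr; congr (_ + _).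
    by rewrite -mulrA -NV.
  by rewrite mulr_natl mulr_natr.
have sZ : strict_upper Z.
  move=> i j ji; rewrite /Z mxE strict_upperM ?mulr0 //.
  move=> a b ba; rewrite /V /geom summxE big1 // => k _; rewrite exprZn mxE.
  suff h : upper (N ^+ k) by rewrite h // mulr0.
  elim: (k : nat) => [|m IH]; last by rewrite exprS; apply: upperM => //; exact: strict_upperW.
  move=> c e ec; rewrite expr0 mxE (_ : (c == e) = false) //.
  by apply/negbTE; rewrite -val_eqE /=; lia.
have nilZ := nilpotent_upper sZ.
have soZ : soJ Z.
  apply/eqP; rewrite -addr_eq0; set Y := _ + _.
  have wY : (u + 1)^T *m Y *m (u + 1) = 0.
    have -> : (u + 1)^T *m Y *m (u + 1) = N^T *m J *m (u + 1) + (u + 1)^T *m J *m N.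
      rewrite -Zw /Y; move: (u + 1) => w.
      by rewrite mulmxDr mulmxDl -[Z * w]/(Z *m w) trmx_mul !mulmxA.
    rewrite /N.
    rewrite [(u - 1)^T]linearB [(u + 1)^T]linearD /= -idmxE trmx1.
    rewrite !(mulmxDl, mulmxDr, mulmxN, mulNmx, mul1mx, mulmx1) ou.
    by apply/matrixP => i j; rewrite !mxE; ring.
  have wv : (u + 1) *m (2^-1 *: V) = 1%:M by rewrite -scalemxAr scalemxAl; exact: Vr.
  have -> : Y = (2^-1 *: V)^T *m ((u + 1)^T *m Y *m (u + 1)) *m (2^-1 *: V).
    by rewrite !mulmxA -trmx_mul wv trmx1 mul1mx -mulmxA wv mulmx1.
  by rewrite wY mulmx0 mul0mx.
have gu : cayley Z 1 = u.
  have e : 1 + 1 *: Z = u * (1 - 1 *: Z).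
    have Ze : Z = u - 1 - u * Z by rewrite -[u - 1]/N -wZ mulrDl mul1r [_ + Z]addrC addrK.
    by rewrite !scale1r mulrBr mulr1 {1}Ze addrA [1 + _]addrC subrK.
  by rewrite /cayley e -mulrA geomr // mulr1.
have [q hq] := cayley_deriv nilZ f A.
have SC s : SOJ (A *m cayley Z s) by apply: SOJM => //; exact: cayley_SOJ.
have dq : q^`() = 0.
  apply: polyF_eq0 => s; have [_ ->] := hq s; set Y := cayley_field Z s.
  have : 2 * pe (rtrans Y f) (A *m cayley Z s) = 0.
    rewrite -peZ -rtransZ so_decomp; last exact: cayley_field_soJ.
    rewrite rtrans_sum pe_sum big1 // => k _; rewrite rtrans_sum pe_sum big1 // => l _.
    rewrite rtransZ peZ; have [lk|kl] := leqP l k; first by rewrite /Y cayley_field_upper // mul0r.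
    by rewrite hf ?mulr0.
  by move=> /eqP; rewrite mulf_eq0 pnatr_eq0 /= => /eqP.
have qc : q = (q`_0)%:P.
  apply/polyP => -[|i]; rewrite coefC //=; have := congr1 (fun p : {poly F} => p`_i) dq.
  by rewrite coef_deriv coef0 => /eqP; rewrite mulrn_eq0 => /eqP.
have [h1 _] := hq 1; have [h0 _] := hq 0; have [c0 _] := cayley0 nilZ.
rewrite -gu -h1 qc hornerC; rewrite qc hornerC in h0; rewrite h0 c0 -idmxE mulmx1 //.
Qed.

Lemma hw_invariant_l f A u : (forall k l : 'I_n, (k < l)%N -> vanJ (ltrans (soG F l k) f)) ->
  SOJ A -> strict_upper (u - 1) -> u^T *m J *m u = J -> pe f (u^T *m A) = pe f A.
Proof.
move=> hf SA su ou; have := @hw_invariant (trp f) A^T u _ (SOJ_tr SA) su ou.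
rewrite !pe_trp trmx_mul trmxK; apply=> k l kl; rewrite rtrans_trp soG_tr.
by apply/vanJ_trp; exact: hf.
Qed.

End Cayley.

(** * Monomial bases of the quotient compatible with weights *)

Section GradedQuotient.
Variables (F : numClosedFieldType) (N : nat) (X : set 'rV[F]_N) (K : nat).
Implicit Types (p q : {mpoly F[N]}) (m : 'X_{1..N}).

Definition mfilter (P : pred 'X_{1..N}) p : {mpoly F[N]} :=
  \sum_(m <- msupp p | P m) p@_m *: 'X_[m].

Lemma mcoeff_mfilter P p m : (mfilter P p)@_m = if P m then p@_m else 0.
Proof.
rewrite /mfilter raddf_sum /= big_mkcond /=.
rewrite (eq_bigr (fun m' => p@_m' * ((m' == m)%:R * (P m)%:R))) => [|m' _]; last first.
  by rewrite mcoeffZ mcoeffX; case: eqP => [->|_]; case: ifP; rewrite ?mulr1 ?mulr0 ?mul0r ?mulr0.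
have [mp|mp] := boolP (m \in msupp p).
  rewrite (bigD1_seq m) ?msupp_uniq //= eqxx mul1r big1 ?addr0 => [|m' /negbTE ->]; last first.
    by rewrite mul0r mulr0.
  by case: (P m); rewrite ?mulr1 ?mulr0.
rewrite (memN_msupp_eq0 mp) if_same big1_seq // => m' /andP[_ mp'].
rewrite (_ : (m' == m) = false) ?mul0r ?mulr0 //.
by apply/negbTE; apply: contraNneq mp => <-.
Qed.

Lemma msize_mcoeff p k : (forall m, p@_m != 0 -> (mdeg m <= k)%N) -> (msize p <= k.+1)%N.
Proof.
by move=> h; rewrite msizeE; apply/bigmax_leqP_seq => m mp _; rewrite ltnS h // -mcoeff_msupp.
Qed.

Lemma mcoeff_mdeg p k m : (msize p <= k.+1)%N -> p@_m != 0 -> (mdeg m <= k)%N.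
Proof. by move=> sp; rewrite -mcoeff_msupp => /msize_mdeg_lt h; rewrite -ltnS (leq_trans h). Qed.

Lemma msize_mfilter P p k : (msize p <= k.+1)%N -> (msize (mfilter P p) <= k.+1)%N.
Proof.
move=> sp; apply: msize_mcoeff => m; rewrite mcoeff_mfilter; case: ifP => _; last by rewrite eqxx.
exact: mcoeff_mdeg.
Qed.

Definition filter_stable (P : pred 'X_{1..N}) :=
  forall p, (msize p <= K.+1)%N -> vanish X p -> vanish X (mfilter P p).

Lemma filter_stableI P Q : filter_stable P -> filter_stable Q -> filter_stable (predI P Q).
Proof.
move=> sP sQ p sp vp; rewrite (_ : mfilter _ p = mfilter P (mfilter Q p)).
  by apply: sP; [exact: msize_mfilter|exact: sQ].
by apply/mpolyP => m; rewrite !mcoeff_mfilter /=; case: (P m).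
Qed.

Lemma eq_filter_stable P Q : P =1 Q -> filter_stable P -> filter_stable Q.
Proof.
move=> PQ sP p sp vp; rewrite (_ : mfilter Q p = mfilter P p); first exact: sP.
by apply/mpolyP => m; rewrite !mcoeff_mfilter PQ.
Qed.

Lemma filter_stable_all (I : Type) (s : seq I) (P : I -> pred 'X_{1..N}) :
  (forall i, filter_stable (P i)) -> filter_stable (fun m => all (fun i => P i m) s).
Proof.
move=> sP; elim: s => [|i s IH] /=.
  move=> p _ vp; rewrite (_ : mfilter _ p = p) //.
  by apply/mpolyP => m; rewrite mcoeff_mfilter.
exact: filter_stableI.
Qed.

(** A torus preserving [X] multiplies monomials by powers of [t]; a polynomial in [t] vanishing
    everywhere has zero coefficients, one per weight. The factor [t ^+ K] clears negative
    exponents. *)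
Lemma filter_stable_stat (f : 'X_{1..N} -> nat) (w : nat) :
  (forall x t, X x -> t != 0 -> exists2 y, X y & forall m, (mdeg m <= K)%N ->
     t ^+ K * mpoly_at 'X_[m] y = t ^+ f m * mpoly_at 'X_[m] x) ->
  filter_stable (fun m => f m == w).
Proof.
move=> hf p sp vp x Xx.
pose q : {poly F} := \sum_(m <- msupp p) (p@_m * mpoly_at 'X_[m] x) *: 'X^(f m).
have q0 : q * 'X = 0.
  apply: polyF_eq0 => t; rewrite hornerM hornerX.
  have [->|t0] := eqVneq t 0; first by rewrite mulr0.
  have [y Xy hy] := hf x t Xx t0; rewrite (_ : q.[t] = 0) ?mul0r //.
  transitivity (t ^+ K * mpoly_at p y); last by rewrite vp ?mulr0.
  rewrite {1}(mpolyE p) mpoly_at_sum mulr_sumr horner_sum; apply: eq_big_seq => m mp.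
  rewrite hornerZ hornerXn mpoly_atZ mulrCA hy; first by rewrite mulrAC mulrA.
  by apply: (mcoeff_mdeg sp); rewrite -mcoeff_msupp.
have {}q0 : q = 0 by move/eqP: q0; rewrite mulf_eq0 polyX_eq0 orbF => /eqP.
have := congr1 (fun q : {poly F} => q`_w) q0; rewrite coef0 coef_sum => h.
rewrite /mfilter mpoly_at_sum -[RHS]h big_mkcond; apply: eq_bigr => m _.
rewrite coefZ coefXn eq_sym; case: eqP => _; rewrite ?mulr1 ?mulr0 //.
by rewrite mpoly_atZ.
Qed.

Variables (T : eqType) (W : 'X_{1..N} -> T).
Hypothesis gr : forall w, filter_stable (fun m => W m == w).
Hypothesis X_neq0 : exists x, X x.

(** The basis is a maximal set of monomials independent on [X]. By [gr] the reduction of a monomial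
    can be filtered to its own weight, so [red] introduces no new weights. *)
Lemma monomial_basis : exists s' (b : 'I_s'.+1 -> 'X_{1..N}) (red : {mpoly F[N]} -> 'cV[F]_s'.+1),
  [/\ forall j, (mdeg (b j) <= K)%N, indep_on X (fun j => 'X_[b j]),
      forall p, (msize p <= K.+1)%N -> vanish X (p - \sum_j red p j 0 *: 'X_[b j]) &
      forall p j, (msize p <= K.+1)%N -> red p j 0 != 0 ->
        exists2 m, p@_m != 0 & W (b j) = W m].
Proof.
pose mX (t : mon N K) : {mpoly F[N]} := 'X_[mon_mnm t].
pose P (A : {set mon N K}) := `[< forall c : mon N K -> F,
  vanish X (\sum_(t in A) c t *: mX t) -> forall t, t \in A -> c t = 0 >].
have [|A /maxsetP[/asboolP iA maxA] _] := @maxset_exists _ P finset.set0.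
  by apply/asboolP => c _ t; rewrite inE.
have dep t : exists c : mon N K -> F, vanish X (mX t - \sum_(u in A) c u *: mX u).
  have [tA|tA] := boolP (t \in A).
    exists (fun u => (u == t)%:R) => x Xx; rewrite (bigD1 t) //= eqxx scale1r big1 => [|u /andP[_ /negbTE ->]].
      by rewrite addr0 subrr -mpolyC0 [LHS]mevalC.
    by rewrite scale0r.
  have nP : ~ P (t |: A)%SET.
    move=> /maxA h; move: tA; rewrite -h ?setU11 //; exact: finset.subsetUr.
  have /existsNP[c /not_implyP[vc /existsNP[u /not_implyP[uA /eqP cu]]]] :
    ~ (forall c : mon N K -> F, vanish X (\sum_(v in (t |: A)%SET) c v *: mX v) ->
      forall u, u \in (t |: A)%SET -> c u = 0) by move=> h; apply: nP; rewrite /P; exact/asboolP.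
  rewrite big_setU1 //= in vc; have ct : c t != 0.
    apply: contraNneq cu => ct; rewrite ct scale0r add0r in vc.
    by move: uA; rewrite !inE => /orP[/eqP -> //|]; [rewrite ct | move=> uA; rewrite (iA c vc u uA)].
  exists (fun u => - ((c t)^-1 * c u)) => x Xx.
  have -> : mX t - \sum_(u in A) - ((c t)^-1 * c u) *: mX u =
    (c t)^-1 *: (c t *: mX t + \sum_(u in A) c u *: mX u).
    rewrite scalerDr scalerA mulVf // scale1r scaler_sumr -sumrN; congr (_ + _).
    by apply: eq_bigr => v _; rewrite scaleNr opprK scalerA.
  by rewrite mpoly_atZ vc ?mulr0.
have {}dep t : exists c : mon N K -> F, vanish X (mX t - \sum_(u in A) c u *: mX u) /\
    forall u, c u != 0 -> W (mon_mnm u) = W (mon_mnm t).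
  have [c v] := dep t; set w := W (mon_mnm t).
  exists (fun u => if W (mon_mnm u) == w then c u else 0); split; last first.
    by move=> u; case: (_ =P w) => // _; rewrite eqxx.
  have sz : (msize (mX t - \sum_(u in A) c u *: mX u) <= K.+1)%N.
    have sX u : (msize (mX u) <= K.+1)%N by rewrite msizeX ltnS mdeg_mon.
    apply: leq_trans (msizeD_le _ _) _; rewrite geq_max sX msizeN.
    rewrite big_mkcond; apply: msize_sum_leq => u; case: ifP => _; last by rewrite msize0.
    exact: leq_trans (msizeZ_le _ _) (sX u).
  have := gr w sz v; congr (vanish X _); apply/mpolyP => m.
  have cs (g : mon N K -> {mpoly F[N]}) : (\sum_(u in A) g u)@_m = \sum_(u in A) (g u)@_m.
    exact: raddf_sum.
  rewrite mcoeff_mfilter !mcoeffB !cs mcoeffX.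
  have e u : ((if W (mon_mnm u) == w then c u else 0) *: mX u)@_m =
      if W m == w then (c u *: mX u)@_m else 0.
    rewrite !mcoeffZ !mcoeffX; case: (mon_mnm u =P m) => [->|_]; last by rewrite !mulr0 if_same.
    by case: ifP; rewrite ?mul0r.
  rewrite (eq_bigr _ (fun u _ => e u)); case: (W m =P w) => [//|h].
  rewrite big1 // subr0; case: (mon_mnm t =P m) => // tm; by case: h; rewrite -tm.
have [cc ccP] := boolp.choice dep.
have [t0 t0E] : exists t : mon N K, mon_mnm t = 0%MM by apply: mon_mnmP; rewrite mdeg0.
(* The constant 1 does not vanish on [X], so the basis is nonempty; its size has to be a successor
   for square matrices to form a ring. *)
have A0 : (0 < #|A|)%N.
  rewrite lt0n cards_eq0; apply/eqP => A0; have [vc _] := ccP t0; have [x Xx] := X_neq0.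
  have := vc x Xx; rewrite A0 big_set0 subr0 /mX t0E mpolyX0 => /eqP.
  by rewrite [mpoly_at _ _]meval1 oner_eq0.
have [s' [ev [evA evS evI]]] : exists s' (ev : 'I_s'.+1 -> mon N K), [/\ forall j, ev j \in A,
    forall (g : mon N K -> {mpoly F[N]}), \sum_(u in A) g u = \sum_j g (ev j) & injective ev].
  exists #|A|.-1; rewrite prednK //; exists (fun j => enum_val j); split; last exact: enum_val_inj.
    by move=> j; exact: enum_valP.
  by move=> g; rewrite big_enum_val.
exists s', (fun j => mon_mnm (ev j)), (fun p => \col_j \sum_(t : mon N K) p@_(mon_mnm t) * cc t (ev j)).
split=> [j|c vc j|p sp|p j sp].
- exact: mdeg_mon.
- pose c' u := \sum_(i | ev i == u) c i.
  have c'E i : c' (ev i) = c i.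
    by rewrite /c' (big_pred1 i) // => k; rewrite (inj_eq evI).
  rewrite -c'E; apply: iA => //; rewrite evS; move: vc; congr (vanish X _).
  by apply: eq_bigr => i _; rewrite c'E.
- move=> x Xx; rewrite [X in X - _](mpoly_monE sp).
  have -> : \sum_j (\col_j \sum_(t : mon N K) p@_(mon_mnm t) * cc t (ev j)) j 0 *: 'X_[mon_mnm (ev j)] =
     \sum_(t : mon N K) p@_(mon_mnm t) *: \sum_(u in A) cc t u *: mX u.
    under [RHS]eq_bigr => t _ do rewrite evS scaler_sumr.
    rewrite exchange_big /=; apply: eq_bigr => j _; rewrite mxE scaler_suml.
    by apply: eq_bigr => t _; rewrite scalerA.
  rewrite -sumrB mpoly_at_sum big1 // => t _; rewrite -scalerBr mpoly_atZ.
  by have [h _] := ccP t; rewrite h // mulr0.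
rewrite mxE => h; have [t /eqP ht] : exists t, p@_(mon_mnm t) * cc t (ev j) <> 0.
  by apply: contrapT => /forallNP h0; case/eqP: h; apply: big1 => t _; apply: contrapT; exact: h0.
rewrite mulf_eq0 negb_or in ht; case/andP: ht => ht1 ht2.
by exists (mon_mnm t) => //; have [_ ->] := ccP t.
Qed.

End GradedQuotient.

(** * Matrices of operators on the quotient *)

Section Operators.
Variables (F : numClosedFieldType) (N : nat) (X : set 'rV[F]_N) (K : nat).
Variables (T : eqType) (W : 'X_{1..N} -> T).
Variables (s' : nat) (b : 'I_s'.+1 -> 'X_{1..N}) (red : {mpoly F[N]} -> 'cV[F]_s'.+1).
Local Notation s := s'.+1.
Hypothesis b_deg : forall j, (mdeg (b j) <= K)%N.
Hypothesis b_indep : indep_on X (fun j => 'X_[b j]).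
Hypothesis red_van : forall p, (msize p <= K.+1)%N -> vanish X (p - \sum_j red p j 0 *: 'X_[b j]).
Hypothesis red_supp : forall p j, (msize p <= K.+1)%N -> red p j 0 != 0 ->
  exists2 m, p@_m != 0 & W (b j) = W m.
Implicit Types (p q : {mpoly F[N]}) (z : 'cV[F]_s).

Lemma hilbert_basis : hilbert X K s.
Proof.
split; first by exists (fun j => 'X_[b j]) => // i; rewrite msizeX ltnS.
move=> h p sp ip; rewrite -[s]card_ord.
apply: (@indep_on_span _ _ _ _ _ p (fun j => 'X_[b j]) (fun i j => red (p i) j 0) ip) => i x Xx.
have := red_van (sp i) Xx; rewrite mpoly_atD -scaleN1r mpoly_atZ mulN1r => /eqP.
rewrite subr_eq0 => /eqP ->; rewrite mpoly_at_sum; apply: eq_bigr => j _.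
by rewrite mpoly_atZ.
Qed.

Definition expand z : {mpoly F[N]} := \sum_j z j 0 *: 'X_[b j].

Lemma expandB z z' : expand (z - z') = expand z - expand z'.
Proof. by rewrite -sumrB; apply: eq_bigr => j _; rewrite !mxE scalerBl. Qed.

Lemma msize_expand z : (msize (expand z) <= K.+1)%N.
Proof.
by apply: msize_sum_leq => j; apply: leq_trans (msizeZ_le _ _) _; rewrite msizeX ltnS.
Qed.

Lemma vanish_expand z : vanish X (expand z) -> z = 0.
Proof. by move=> v; apply/colP => j; rewrite (b_indep v) mxE. Qed.

Lemma vanishD p q : vanish X p -> vanish X q -> vanish X (p + q).
Proof. by move=> vp vq x Xx; rewrite mpoly_atD vp ?vq ?addr0. Qed.

Lemma vanishZ c p : vanish X p -> vanish X (c *: p).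
Proof. by move=> vp x Xx; rewrite mpoly_atZ vp ?mulr0. Qed.

Lemma vanishB p q : vanish X p -> vanish X q -> vanish X (p - q).
Proof. by move=> vp vq; rewrite -scaleN1r; apply: vanishD => //; exact: vanishZ. Qed.

Lemma red_eq p z : (msize p <= K.+1)%N -> vanish X (p - expand z) -> red p = z.
Proof.
move=> sp v; apply/eqP; rewrite -subr_eq0; apply/eqP; apply: vanish_expand; rewrite expandB.
have -> : expand (red p) - expand z = (p - expand z) - (p - expand (red p)).
  by move: (expand _) (expand _) => x y; ring.
by apply: vanishB => //; exact: red_van.
Qed.

Lemma red_expand z : red (expand z) = z.
Proof. by apply: red_eq; rewrite ?subrr; [exact: msize_expand | move=> x _; rewrite -mpolyC0 [LHS]mevalC]. Qed.

Lemma vanish_red p : (msize p <= K.+1)%N -> vanish X p -> red p = 0.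
Proof.
move=> sp v; apply: red_eq => //; rewrite /expand big1 ?subr0 // => j _.
by rewrite mxE scale0r.
Qed.

Lemma red_vanish p : (msize p <= K.+1)%N -> red p = 0 -> vanish X p.
Proof.
move=> sp r0 x Xx; have := red_van sp Xx; rewrite r0 big1 ?subr0 // => j _.
by rewrite mxE scale0r.
Qed.

Lemma expandD z z' : expand (z + z') = expand z + expand z'.
Proof. by rewrite -big_split; apply: eq_bigr => j _; rewrite !mxE scalerDl. Qed.

Lemma expandZ c z : expand (c *: z) = c *: expand z.
Proof. by rewrite scaler_sumr; apply: eq_bigr => j _; rewrite !mxE scalerA. Qed.

Lemma redD p q : (msize p <= K.+1)%N -> (msize q <= K.+1)%N -> red (p + q) = red p + red q.
Proof.
move=> sp sq; apply: red_eq.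
  by apply: leq_trans (msizeD_le _ _) _; rewrite geq_max sp sq.
rewrite expandD opprD addrACA; apply: vanishD; exact: red_van.
Qed.

Lemma redZ c p : (msize p <= K.+1)%N -> red (c *: p) = c *: red p.
Proof.
move=> sp; apply: red_eq; first exact: leq_trans (msizeZ_le _ _) sp.
by rewrite expandZ -scalerBr; apply: vanishZ; exact: red_van.
Qed.

Lemma redB p q : (msize p <= K.+1)%N -> (msize q <= K.+1)%N -> red (p - q) = red p - red q.
Proof.
move=> sp sq; by rewrite redD ?msizeN // -scaleN1r redZ // scaleN1r.
Qed.

Record quot_op (D : {mpoly F[N]} -> {mpoly F[N]}) : Prop := QuotOp {
  qo_add : forall p q, D (p + q) = D p + D q;
  qo_scale : forall c p, D (c *: p) = c *: D p;
  qo_size : forall p, (msize p <= K.+1)%N -> (msize (D p) <= K.+1)%N;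
  qo_van : forall p, (msize p <= K.+1)%N -> vanish X p -> vanish X (D p) }.

Definition opmx (D : {mpoly F[N]} -> {mpoly F[N]}) : 'M[F]_s := \matrix_(i, j) red (D 'X_[b j]) i 0.

Lemma qo_expand D z : quot_op D -> D (expand z) = \sum_j z j 0 *: D 'X_[b j].
Proof.
move=> qD; have D0 : D 0 = 0 by rewrite -(scale0r 0) (qo_scale qD) !scale0r.
rewrite /expand; elim/big_rec2: _ => [|j p q _ <-]; first exact: D0.
by rewrite (qo_add qD) (qo_scale qD).
Qed.

Lemma red_op D p : quot_op D -> (msize p <= K.+1)%N -> red (D p) = opmx D *m red p.
Proof.
move=> qD sp; have sX j : (msize ('X_[b j] : {mpoly F[N]}) <= K.+1)%N by rewrite msizeX ltnS.
have e : p = (p - expand (red p)) + expand (red p) by rewrite subrK.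
have sB : (msize (p - expand (red p)) <= K.+1)%N.
  by apply: leq_trans (msizeD_le _ _) _; rewrite geq_max sp msizeN msize_expand.
rewrite {1}e (qo_add qD) redD ?(qo_size qD) ?msize_expand // vanish_red ?(qo_size qD) //; last first.
  by apply: (qo_van qD) => //; exact: red_van.
rewrite add0r (qo_expand _ qD); apply: red_eq.
  apply: msize_sum_leq => j; apply: leq_trans (msizeZ_le _ _) _; exact: (qo_size qD).
have -> : expand (opmx D *m red p) = \sum_j red p j 0 *: expand (red (D 'X_[b j])).
  rewrite /expand; under [RHS]eq_bigr => j _ do rewrite scaler_sumr.
  rewrite exchange_big /=; apply: eq_bigr => i _; rewrite mxE scaler_suml.
  by apply: eq_bigr => j _; rewrite mxE scalerA mulrC.
rewrite -sumrB => x Xx; rewrite mpoly_at_sum big1 // => j _; rewrite -scalerBr mpoly_atZ.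
by rewrite (red_van (qo_size qD (sX j)) Xx) mulr0.
Qed.

Lemma opmx_mul D D' z : quot_op D -> quot_op D' ->
  opmx D *m (opmx D' *m z) = red (D (D' (expand z))).
Proof.
move=> qD qD'; rewrite red_op ?(qo_size qD') ?msize_expand //.
by rewrite [in RHS]red_op ?msize_expand // red_expand.
Qed.

Lemma opmx_expand D z : quot_op D -> opmx D *m z = red (D (expand z)).
Proof. by move=> qD; rewrite red_op ?msize_expand // red_expand. Qed.

Lemma mulmx_inj (A B : 'M[F]_s) : (forall z, A *m z = B *m z) -> A = B.
Proof.
move=> h; apply/matrixP => i j; have /colP/(_ i) := h (delta_mx j 0).
by rewrite -!colE !mxE.
Qed.

Lemma opmx_comm D D' : quot_op D -> quot_op D' -> (forall p, D (D' p) = D' (D p)) ->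
  opmx D *m opmx D' = opmx D' *m opmx D.
Proof. by move=> qD qD' h; apply: mulmx_inj => z; rewrite -!mulmxA !opmx_mul // h. Qed.

Lemma opmx_supp D i j : quot_op D -> opmx D i j != 0 ->
  exists2 m, (D 'X_[b j])@_m != 0 & W (b i) = W m.
Proof.
move=> qD; rewrite mxE => /red_supp; apply; apply: (qo_size qD).
by rewrite msizeX ltnS.
Qed.

End Operators.

(** * Row and column weights of the diagonal torus *)

Section Torus.
Variables (F : numClosedFieldType) (n' K : nat).
Local Notation n := n'.+1.
Local Notation r := (n./2).
Local Notation Pn := {mpoly F[n * n]}.
Local Notation ix := (@mxvec_index n n).
Local Notation low := (@low n').
Implicit Types (m : 'X_{1..n * n}) (A : 'M[F]_n).

Definition rowdeg m i := (\sum_j m (ix i j))%N.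
Definition coldeg m j := (\sum_i m (ix i j))%N.

(* Shifted by K, which makes the weights of monomials of degree at most K natural numbers. *)
Definition deg_wt (dg : 'X_{1..n * n} -> 'I_n -> nat) m : 'X_{1..r} :=
  [multinom (K + dg m (low c) - dg m (rev_ord (low c)))%N | c < r].

Definition row_wt := deg_wt rowdeg.
Definition col_wt := deg_wt coldeg.

Definition SOJv : set 'rV[F]_(n * n) := [set v | SOJ (vec_mx v)].

Lemma vanishP p : vanish SOJv p <-> vanJ p.
Proof.
split=> h.
  by move=> A SA; apply: h; rewrite /SOJv /= mxvecK.
by move=> v Sv; rewrite -[v]vec_mxK; exact: h.
Qed.

Lemma mdeg_rowdeg m : mdeg m = (\sum_i rowdeg m i)%N.
Proof.
rewrite mdegE /rowdeg pair_big /= (reindex (uncurry ix)) /=; last exact: curry_mxvec_bij.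
by apply: eq_bigr => -[].
Qed.

Lemma mdeg_coldeg m : mdeg m = (\sum_j coldeg m j)%N.
Proof. by rewrite mdeg_rowdeg /rowdeg exchange_big. Qed.

Lemma rowdeg_leq m i : (rowdeg m i <= mdeg m)%N.
Proof. by rewrite mdeg_rowdeg (bigD1 i) //= leq_addr. Qed.

Lemma coldeg_leq m i : (coldeg m i <= mdeg m)%N.
Proof. by rewrite mdeg_coldeg (bigD1 i) //= leq_addr. Qed.

Lemma peXm m A : pe 'X_[m] A = \prod_i \prod_j A i j ^+ m (ix i j).
Proof.
rewrite /pe /mpoly_at mevalX pair_big /= (reindex (uncurry ix)) /=; last exact: curry_mxvec_bij.
by apply: eq_bigr => -[i j] _ /=; rewrite mxvecE.
Qed.

Lemma pe_scale (u v : 'I_n -> F) m A : pe 'X_[m] (\matrix_(i, j) (u i * v j * A i j)) =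
  (\prod_i u i ^+ rowdeg m i) * (\prod_j v j ^+ coldeg m j) * pe 'X_[m] A.
Proof.
rewrite !peXm; have -> : \prod_j v j ^+ coldeg m j = \prod_i \prod_j v j ^+ m (ix i j).
  by rewrite exchange_big /=; apply: eq_bigr => j _; rewrite -(big_morph (fun e => _ ^+ e) (exprD _) (expr0 _)).
rewrite -!big_split; apply: eq_bigr => i _ /=.
have -> : u i ^+ rowdeg m i = \prod_j u i ^+ m (ix i j) by rewrite -(big_morph (fun e => _ ^+ e) (exprD _) (expr0 _)).
rewrite -!big_split; apply: eq_bigr => j _ /=.
by rewrite mxE !exprMn.
Qed.

Definition torus t (c : 'I_r) (j : 'I_n) : F :=
  if j == low c then t else if j == rev_ord (low c) then t^-1 else 1.

Lemma torus_rev t c j : t != 0 -> torus t c j * torus t c (rev_ord j) = 1.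
Proof.
move=> t0; rewrite /torus -[rev_ord j == rev_ord _](inj_eq rev_ord_inj) !rev_ordK.
have -> : (rev_ord j == low c) = (j == rev_ord (low c)).
  by rewrite -(inj_eq rev_ord_inj) rev_ordK.
case: eqP => [->|]; first by rewrite (negbTE (low_neq_rev _ _)) mulfV.
by case: eqP => _ _; rewrite ?mulVf ?mulr1.
Qed.

Lemma prod_torus t c (e : 'I_n -> nat) : t != 0 -> (e (rev_ord (low c)) <= K)%N ->
  t ^+ K * \prod_j torus t c j ^+ e j = t ^+ (K + e (low c) - e (rev_ord (low c)))%N.
Proof.
move=> t0 le; rewrite (bigD1 (low c)) //= (bigD1 (rev_ord (low c))) ?[_ == low c]eq_sym ?low_neq_rev //=.
rewrite big1 => [|j /andP[/negbTE h1 /negbTE h2]]; last by rewrite /torus h1 h2 expr1n.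
rewrite /torus eqxx [rev_ord _ == low c]eq_sym (negbTE (low_neq_rev _ _)) eqxx mulr1 mulrA -exprD.
rewrite exprVn; apply: (mulIf (expf_neq0 (e (rev_ord (low c))) t0)).
rewrite -mulrA mulVf ?expf_neq0 // mulr1 -exprD subnK //.
exact: leq_trans le (leq_addr _ _).
Qed.

Definition torus_mx t c : 'M[F]_n := diag_mx (\row_j torus t c j).

Lemma torus_SOJ t c : t != 0 -> SOJ (torus_mx t c).
Proof.
move=> t0; split.
  rewrite det_diag; under eq_bigr do rewrite mxE.
  rewrite (bigD1 (low c)) //= (bigD1 (rev_ord (low c))) ?[_ == low c]eq_sym ?low_neq_rev //=.
  rewrite big1 => [|j /andP[/negbTE h1 /negbTE h2]]; last by rewrite /torus h1 h2.
  rewrite mulr1 mulrC; have := torus_rev c (rev_ord (low c)) t0; by rewrite rev_ordK.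
rewrite tr_diag_mx; apply/matrixP => i j; rewrite mul_mx_diag mxE mul_diag_mx !mxE.
case: (j =P rev_ord i) => [->|_]; last by rewrite mulr0 mul0r.
by rewrite mulr1 torus_rev.
Qed.

Lemma scale_diag (u v : 'I_n -> F) A :
  \matrix_(i, j) (u i * v j * A i j) = diag_mx (\row_j u j) *m A *m diag_mx (\row_j v j).
Proof. by apply/matrixP => i j; rewrite mul_mx_diag mxE mul_diag_mx !mxE mulrAC. Qed.

Lemma prod_one (e : 'I_n -> nat) : \prod_j (1 : F) ^+ e j = 1.
Proof. by apply: big1 => j _; rewrite expr1n. Qed.

Lemma diag_one : diag_mx (\row_j (1 : F)) = 1%:M :> 'M[F]_n.
Proof. by apply/matrixP => i j; rewrite !mxE. Qed.

Let at_pe (p : Pn) x : mpoly_at p x = pe p (vec_mx x). Proof. by rewrite /pe vec_mxK. Qed.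

Lemma row_filter w c : filter_stable SOJv K (fun m => deg_wt rowdeg m c == w).
Proof.
apply: filter_stable_stat => x t Xx t0.
exists (mxvec (\matrix_(i, j) (torus t c i * 1 * vec_mx x i j))).
  rewrite /SOJv /= mxvecK (scale_diag _ (fun=> 1)) diag_one mulmx1; apply: SOJM => //; exact: torus_SOJ.
move=> m dm; rewrite !at_pe mxvecK (pe_scale _ (fun=> 1)) prod_one mulr1 mulrA prod_torus ?mnmE //.
exact: leq_trans (rowdeg_leq _ _) dm.
Qed.

Lemma col_filter w c : filter_stable SOJv K (fun m => deg_wt coldeg m c == w).
Proof.
apply: filter_stable_stat => x t Xx t0.
exists (mxvec (\matrix_(i, j) (1 * torus t c j * vec_mx x i j))).
  rewrite /SOJv /= mxvecK (scale_diag (fun=> 1)) diag_one mul1mx; apply: SOJM => //; exact: torus_SOJ.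
move=> m dm; rewrite !at_pe mxvecK (pe_scale (fun=> 1)) prod_one mul1r mulrA prod_torus ?mnmE //.
exact: leq_trans (coldeg_leq _ _) dm.
Qed.

Lemma torus_filter w : filter_stable SOJv K (fun m => (row_wt m, col_wt m) == w).
Proof.
case: w => w1 w2.
apply: (@eq_filter_stable _ _ _ _ (predI (fun m => all (fun c => row_wt m c == w1 c) (enum 'I_r))
   (fun m => all (fun c => col_wt m c == w2 c) (enum 'I_r)))).
  have all_eq (x y : 'X_{1..r}) : all (fun c => x c == y c) (enum 'I_r) = (x == y).
    apply/allP/eqP => [h|->] //; apply/mnmP => c; apply/eqP; apply: h; exact: mem_enum.
  by move=> m /=; rewrite !all_eq.
by apply: filter_stableI; apply: filter_stable_all => c; [exact: row_filter|exact: col_filter].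
Qed.

End Torus.

(** * The Lie algebra action on the quotient *)

Section SoAction.
Variables (F : numClosedFieldType) (n' K : nat).
Local Notation n := n'.+1.
Local Notation r := (n./2).
Local Notation o := (odd n).
Local Notation Pn := {mpoly F[n * n]}.
Local Notation ix := (@mxvec_index n n).
Local Notation low := (@low n').
Local Notation X := (@SOJv F n').
Implicit Types (m : 'X_{1..n * n}) (A Z : 'M[F]_n) (p q : Pn).

Lemma halves (k : 'I_n) : (exists c, k = low c) \/ (exists c, k = rev_ord (low c)) \/
  (o /\ k = mid n').
Proof.
have hE := halfE n'; have [kr|kr] := ltnP k r.
  by left; exists (Ordinal kr); apply: val_inj.
right; have [kr'|kr'] := ltnP (n - k.+1) r.
  left; exists (Ordinal kr'); apply: val_inj => /=; have := ltn_ord k; lia.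
right; suff : o /\ (k = r :> nat) by case=> oo e; split=> //; apply: val_inj.
by move: hE kr kr'; have := ltn_ord k; case: (o) => /=; lia.
Qed.

Local Notation deg_wt := (@deg_wt n' K).

(* A Lie algebra of infinitesimal translations acting on the polynomials in the matrix
   entries, with dg the multidegree it moves: coldeg on the right, rowdeg on the left. *)
Record so_operator (dg : 'X_{1..n * n} -> 'I_n -> nat) (op : 'M[F]_n -> Pn -> Pn) : Prop :=
  SoOperator {
  so_dg_le : forall m i, (dg m i <= mdeg m)%N;
  so_opD : forall Z Y p, op (Z + Y) p = op Z p + op Y p;
  so_opZ : forall c Z p, op (c *: Z) p = c *: op Z p;
  so_op_add : forall Z p q, op Z (p + q) = op Z p + op Z q;
  so_op_scale : forall Z c p, op Z (c *: p) = c *: op Z p;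
  so_op_size : forall Z p, (msize p <= K.+1)%N -> (msize (op Z p) <= K.+1)%N;
  so_op_bracket : forall Z Y p, op Z (op Y p) - op Y (op Z p) = op (Z *m Y - Y *m Z) p;
  so_op_van : forall k l p, k != l -> vanish X p -> vanish X (op (soG F k l) p);
  so_op_filter : forall w c, filter_stable X K (fun m => deg_wt dg m c == w);
  so_op_diag : forall k p m,
    (op (soG F k k) p)@_m = ((dg m k)%:R - (dg m (rev_ord k))%:R) * p@_m;
  so_op_supp : forall k l p m, (op (soG F k l) p)@_m != 0 -> exists2 m0, p@_m0 != 0 &
    (forall x, dg m x + (l == x) = dg m0 x + (k == x))%N \/
    (forall x, dg m x + (rev_ord k == x) = dg m0 x + (rev_ord l == x))%N }.

Variables (T : eqType) (W : 'X_{1..n * n} -> T).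
Variables (s' : nat) (b : 'I_s'.+1 -> 'X_{1..n * n}) (red : Pn -> 'cV[F]_s'.+1).
Local Notation s := s'.+1.
Hypothesis b_deg : forall j, (mdeg (b j) <= K)%N.
Hypothesis b_indep : indep_on X (fun j => 'X_[b j]).
Hypothesis red_van : forall p, (msize p <= K.+1)%N -> vanish X (p - \sum_j red p j 0 *: 'X_[b j]).
Hypothesis red_supp : forall p j, (msize p <= K.+1)%N -> red p j 0 != 0 ->
  exists2 m, p@_m != 0 & W (b j) = W m.

Section OneSide.
Variables (dg : 'X_{1..n * n} -> 'I_n -> nat) (op : 'M[F]_n -> Pn -> Pn).
Local Notation wt := (fun j => deg_wt dg (b j)).
Hypothesis soO : so_operator dg op.
Let dg_le := so_dg_le soO.
Let opD := so_opD soO.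
Let opZ := so_opZ soO.
Let op_add := so_op_add soO.
Let op_scale := so_op_scale soO.
Let op_size := so_op_size soO.
Let op_bracket := so_op_bracket soO.
Let op_van := so_op_van soO.
Let op_filter := so_op_filter soO.
Let op_diag := so_op_diag soO.
Let op_supp := so_op_supp soO.
Hypothesis W_wt : forall m m', W m = W m' -> deg_wt dg m = deg_wt dg m'.

Definition so_mx k l : 'M[F]_s := opmx b red (op (soG F k l)).

Lemma deg_wt_diag m c : (mdeg m <= K)%N ->
  (deg_wt dg m c)%:R - K%:R = (dg m (low c))%:R - (dg m (rev_ord (low c)))%:R :> F.
Proof.
move=> dm; rewrite mnmE natrB ?natrD; first ring.
by apply: leq_trans (leq_addr _ _); exact: leq_trans (dg_le _ _) dm.
Qed.

(** [soG F k k] is not nilpotent, so no Cayley curve is available. It acts by scalars on weight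
    components, and [op_filter] makes these vanish on [X] separately. *)
Let op_van_diag k p : (msize p <= K.+1)%N -> vanish X p -> vanish X (op (soG F k k) p).
Proof.
move=> sp vp.
have main c : vanish X (op (soG F (low c) (low c)) p).
  have -> : op (soG F (low c) (low c)) p =
      \sum_(w < (2 * K).+1) (w%:R - K%:R) *: mfilter (fun m => deg_wt dg m c == w) p.
    apply/mpolyP => m; rewrite op_diag raddf_sum /=.
    have [pm|pm] := eqVneq p@_m 0.
      rewrite pm mulr0 big1 // => w _; by rewrite mcoeffZ mcoeff_mfilter pm if_same mulr0.
    have dm : (mdeg m <= K)%N by exact: mcoeff_mdeg sp pm.
    have lw : (deg_wt dg m c < (2 * K).+1)%N.
      by rewrite mnmE; have := dg_le m (low c); lia.
    rewrite (bigD1 (Ordinal lw)) //= big1 => [|w ww].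
      by rewrite addr0 mcoeffZ mcoeff_mfilter eqxx deg_wt_diag.
    rewrite mcoeffZ mcoeff_mfilter; case: eqP => [e|]; last by rewrite mulr0.
    by case/eqP: ww; apply: val_inj; rewrite /= -e.
  move=> x Xx; rewrite mpoly_at_sum big1 // => w _; rewrite mpoly_atZ op_filter ?mulr0 //.
have [[c ->]|[[c ->]|[oo ->]]] := halves k; first exact: main.
  by rewrite soG_rev -scaleN1r opZ; apply: vanishZ; exact: main.
have -> : soG F (mid n') (mid n') = 0 by rewrite /soG rev_mid // subrr.
by rewrite -(scale0r 0) opZ scale0r => x _; rewrite -mpolyC0 [LHS]mevalC.
Qed.

Lemma so_quot_op k l : quot_op X K (op (soG F k l)).
Proof.
split=> [p q|c p|p|p sp vp]; [exact: op_add|exact: op_scale|exact: op_size|].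
by have [->|kl] := eqVneq k l; [exact: op_van_diag|exact: op_van].
Qed.

Let opmxD Z Y : opmx b red (op (Z + Y)) = opmx b red (op Z) + opmx b red (op Y).
Proof.
apply/matrixP => i j; rewrite !mxE opD (redD b_indep red_van) ?mxE //;
  by apply: op_size; rewrite msizeX ltnS.
Qed.

Let opmxZ c Z : opmx b red (op (c *: Z)) = c *: opmx b red (op Z).
Proof.
apply/matrixP => i j; rewrite !mxE opZ (redZ b_indep red_van) ?mxE //.
by apply: op_size; rewrite msizeX ltnS.
Qed.

Let opmxN Z : opmx b red (op (- Z)) = - opmx b red (op Z).
Proof. by rewrite -scaleN1r opmxZ scaleN1r. Qed.

Let opmxMn Z (c : bool) : opmx b red (op (Z *+ c)) = opmx b red (op Z) *+ c.
Proof. by case: c => //; rewrite !mulr0n -(scale0r 0) opmxZ scale0r. Qed.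

Lemma so_relations_mx : so_relations so_mx.
Proof.
split=> [k l|a c k l]; first by rewrite /so_mx soG_rev opmxN.
set Z := soG F a c; set Y := soG F k l.
have qZ : quot_op X K (op Z) by exact: so_quot_op.
have qY : quot_op X K (op Y) by exact: so_quot_op.
have qB : quot_op X K (op (Z *m Y - Y *m Z)).
  split=> [p q|e p|p|p sp vp]; [exact: op_add|exact: op_scale|exact: op_size|].
  by rewrite -op_bracket; apply: vanishB; [apply: (qo_van qZ)|apply: (qo_van qY)];
    rewrite ?op_size //; [apply: (qo_van qY)|apply: (qo_van qZ)].
transitivity (opmx b red (op (Z *m Y - Y *m Z))).
  apply: mulmx_inj => z; rewrite mulmxBl -!mulmxA.
  rewrite !(opmx_mul b_deg b_indep red_van) // (opmx_expand b_deg b_indep red_van) //.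
  have sz := msize_expand b_deg z.
  by rewrite -(redB b_indep red_van) ?op_size // op_bracket.
by rewrite /Z /Y soG_bracket 3!opmxD 2!opmxN 4!opmxMn.
Qed.

Lemma so_mx_cartan c : so_mx (low c) (low c) = cartan F K wt c.
Proof.
apply/matrixP => i j; rewrite !mxE.
have -> : op (soG F (low c) (low c)) 'X_[b j] = ((deg_wt dg (b j) c)%:R - K%:R) *: 'X_[b j].
  apply/mpolyP => m; rewrite op_diag mcoeffZ mcoeffX; case: (b j =P m) => [<-|_]; last by rewrite !mulr0.
  by rewrite deg_wt_diag.
rewrite (redZ b_indep red_van) ?msizeX ?ltnS //.
have -> : red 'X_[b j] = delta_mx j 0.
  apply: (red_eq b_indep red_van); first by rewrite msizeX ltnS.
  rewrite /expand (bigD1 j) //= mxE !eqxx scale1r big1 => [|i' ij].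
    by rewrite addr0 subrr => x _; rewrite -mpolyC0 [LHS]mevalC.
  by rewrite mxE (negbTE ij) scale0r.
by rewrite !mxE andbT; case: (i =P j) => [->|_]; rewrite ?mulr1 ?mulr0.
Qed.

Lemma so_mx_wt k l i j : so_mx k l i j != 0 -> forall c,
  (deg_wt dg (b i) c + (l == low c) + (k == rev_ord (low c)) =
   deg_wt dg (b j) c + (k == low c) + (l == rev_ord (low c)))%N.
Proof.
move=> h c; have [m mD /W_wt ->] := opmx_supp b_deg red_supp (so_quot_op k l) h.
have dm : (mdeg m <= K)%N by apply: mcoeff_mdeg mD; apply: op_size; rewrite msizeX ltnS.
have [m0 m0b hm] := op_supp mD; have e0 : m0 = b j.
  by move: m0b; rewrite mcoeffX; case: (b j =P m0) => // _; rewrite eqxx.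
rewrite e0 in hm; rewrite !mnmE.
have r1 (x y : 'I_n) : (rev_ord x == y) = (x == rev_ord y) by rewrite -(inj_eq rev_ord_inj) rev_ordK.
have l1 := dg_le m (rev_ord (low c)); have l2 := dg_le (b j) (rev_ord (low c)).
have l3 := b_deg j.
case: hm => hm; have h1 := hm (low c); have h2 := hm (rev_ord (low c)).
  by clear - h1 h2 l1 l2 l3 dm; lia.
rewrite !r1 !rev_ordK in h1 h2.
by clear - h1 h2 l1 l2 l3 dm; lia.
Qed.

Theorem so_mx_root_action :
  root_action o K wt (so_e so_mx) (so_f so_mx).
Proof.
apply: so_root_action.
- exact: so_relations_mx.
- exact: so_mx_cartan.
- by move=> k l i j h c; exact: so_mx_wt.
by move=> j c; rewrite mnmE; have := dg_le (b j) (low c); have := b_deg j; lia.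
Qed.

End OneSide.
End SoAction.

(** * Left and right translations as instances *)

Section Sides.
Variables (F : numClosedFieldType) (n' K : nat).
Local Notation n := n'.+1.
Local Notation r := (n./2).
Local Notation o := (odd n).
Local Notation Pn := {mpoly F[n * n]}.
Local Notation ix := (@mxvec_index n n).
Local Notation low := (@low n').
Local Notation X := (@SOJv F n').
Implicit Types (m : 'X_{1..n * n}) (A Z Y : 'M[F]_n) (p q : Pn).

Lemma rowdegU m i j x : rowdeg (m + U_(ix i j)) x = (rowdeg m x + (i == x))%N.
Proof.
rewrite /rowdeg; under eq_bigr => y _ do rewrite mnmDE mnm1E ix_eq.
rewrite big_split /=; congr (_ + _)%N; case: (i =P x) => [_|_] /=; last by rewrite big1.
by rewrite (bigD1 j) //= eqxx big1 ?addn0 // => y /negbTE; rewrite eq_sym => ->.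
Qed.

Lemma coldegU m i j x : coldeg (m + U_(ix i j)) x = (coldeg m x + (j == x))%N.
Proof.
rewrite /coldeg; under eq_bigr => y _ do rewrite mnmDE mnm1E ix_eq.
rewrite big_split /=; congr (_ + _)%N; case: (j =P x) => [_|_] /=.
  by rewrite (bigD1 i) //= eqxx big1 ?addn0 // => y /negbTE; rewrite eq_sym => ->.
by rewrite big1 // => y _; rewrite andbF.
Qed.

Lemma mcoeff_pol_diag a p m : (pol a a p)@_m = (m a)%:R * p@_m.
Proof.
have -> : pol a a p = \sum_(m' <- msupp p) p@_m' *: pol a a 'X_[m'].
  rewrite {1}(mpolyE p) /pol raddf_sum mulr_sumr; apply: eq_bigr => m' _ /=.
  by rewrite mderivZ scalerAr.
rewrite [in RHS](mpolyE p) !raddf_sum /= mulr_sumr; apply: eq_bigr => m' _.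
rewrite !mcoeffZ polX mcoeffZ [RHS]mulrCA; congr (_ * _).
have [m0|m0] := eqVneq (m' a) 0%N.
  rewrite m0 mulr0n mul0r !mcoeffX; case: (_ =P m) => [<-|_]; last by rewrite mulr0.
  by rewrite m0 mulr0n mul0r.
rewrite submK ?lep1mP // !mcoeffX; case: (_ =P m) => [->|_] //.
by rewrite !mulr0.
Qed.

Lemma msize_pol a b p : (msize p <= K.+1)%N -> (msize (pol a b p) <= K.+1)%N.
Proof.
move=> sp; apply: msize_mcoeff => m /pol_supp[m0 h e].
have := congr1 mdeg e; rewrite !mdegD !mdeg1 => /eqP; rewrite eqn_add2r => /eqP ->.
exact: mcoeff_mdeg sp h.
Qed.

Lemma ltransD Z Y p : ltrans (Z + Y) p = ltrans Z p + ltrans Y p.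
Proof. by rewrite /ltrans map_mxD mulmxDl vfieldDl. Qed.

Lemma rtrans_size Z p : (msize p <= K.+1)%N -> (msize (rtrans Z p) <= K.+1)%N.
Proof.
move=> sp; rewrite [Z]matrix_sum_delta rtrans_sum; apply: msize_sum_leq => k.
rewrite rtrans_sum; apply: msize_sum_leq => l; rewrite rtransZ.
apply: leq_trans (msizeZ_le _ _) _; rewrite rtrans_delta; apply: msize_sum_leq => i.
exact: msize_pol.
Qed.

Lemma ltransZ c Z p : ltrans (c *: Z) p = c *: ltrans Z p.
Proof.
rewrite /ltrans map_mxZ -scalemxAl scaler_sumr; apply: eq_bigr => i _.
rewrite scaler_sumr; apply: eq_bigr => j _; by rewrite [in LHS]mxE mul_mpolyC scalerAl.
Qed.

Lemma ltrans0 p : ltrans 0 p = 0.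
Proof. by rewrite -(scale0r 0) ltransZ scale0r. Qed.

Lemma ltrans_sum I (s : seq I) P (f : I -> 'M[F]_n) p :
  ltrans (\sum_(i <- s | P i) f i) p = \sum_(i <- s | P i) ltrans (f i) p.
Proof. by elim/big_rec2: _ => [|i y x _ <-]; rewrite ?ltrans0 ?ltransD. Qed.

Lemma ltrans_size Z p : (msize p <= K.+1)%N -> (msize (ltrans Z p) <= K.+1)%N.
Proof.
move=> sp; rewrite [Z]matrix_sum_delta ltrans_sum; apply: msize_sum_leq => k.
rewrite ltrans_sum; apply: msize_sum_leq => l; rewrite ltransZ.
apply: leq_trans (msizeZ_le _ _) _; rewrite ltrans_delta; apply: msize_sum_leq => i.
exact: msize_pol.
Qed.

Lemma rtransN Z p : rtrans (- Z) p = - rtrans Z p.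
Proof. by rewrite -scaleN1r rtransZ scaleN1r. Qed.
Lemma ltransN Z p : ltrans (- Z) p = - ltrans Z p.
Proof. by rewrite -scaleN1r ltransZ scaleN1r. Qed.

Lemma mcoeff_sum_pos (I : finType) (f : I -> Pn) m : (\sum_i f i)@_m != 0 -> exists i, (f i)@_m != 0.
Proof.
rewrite raddf_sum /= => h; apply: contrapT => /forallNP h0; case/eqP: h; apply: big1 => i _.
by apply/eqP; apply: contraT => h1; case: (h0 i).
Qed.

Lemma mcoeff_sub_neq0 p q m : (p - q)@_m != 0 -> p@_m != 0 \/ q@_m != 0.
Proof.
rewrite mcoeffB => h; have [p0|] := eqVneq p@_m 0; last by left.
by right; move: h; rewrite p0 sub0r oppr_eq0.
Qed.

Lemma rtrans_supp k l p m : (rtrans (soG F k l) p)@_m != 0 -> exists2 m0, p@_m0 != 0 &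
  (forall x, rowdeg m x = rowdeg m0 x) /\
  ((forall x, coldeg m x + (l == x) = coldeg m0 x + (k == x))%N \/
  (forall x, coldeg m x + (rev_ord k == x) = coldeg m0 x + (rev_ord l == x))%N).
Proof.
have one (a b : 'I_n) : (rtrans (delta_mx a b) p)@_m != 0 -> exists2 m0, p@_m0 != 0 &
  (forall x, rowdeg m x = rowdeg m0 x) /\
  (forall x, coldeg m x + (b == x) = coldeg m0 x + (a == x))%N.
  rewrite rtrans_delta => /mcoeff_sum_pos [i /pol_supp[m0 h e]]; exists m0 => //; split=> x.
    by have := congr1 (fun m => rowdeg m x) e; rewrite !rowdegU => /eqP; rewrite eqn_add2r => /eqP.
  by have := congr1 (fun m => coldeg m x) e; rewrite !coldegU.
have e : rtrans (soG F k l) p = rtrans (delta_mx k l) p - rtrans (delta_mx (rev_ord l) (rev_ord k)) p.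
  by rewrite -rtransN -rtransD.
rewrite e => /mcoeff_sub_neq0 [] /one [m0 h0 [hr hc]]; exists m0 => //; split=> //.
  by left.
by right.
Qed.

Lemma ltrans_supp k l p m : (ltrans (soG F k l)^T p)@_m != 0 -> exists2 m0, p@_m0 != 0 &
  (forall x, coldeg m x = coldeg m0 x) /\
  ((forall x, rowdeg m x + (l == x) = rowdeg m0 x + (k == x))%N \/
  (forall x, rowdeg m x + (rev_ord k == x) = rowdeg m0 x + (rev_ord l == x))%N).
Proof.
have one (a b : 'I_n) : (ltrans (delta_mx b a) p)@_m != 0 -> exists2 m0, p@_m0 != 0 &
  (forall x, coldeg m x = coldeg m0 x) /\
  (forall x, rowdeg m x + (b == x) = rowdeg m0 x + (a == x))%N.
  rewrite ltrans_delta => /mcoeff_sum_pos [i /pol_supp[m0 h e]]; exists m0 => //; split=> x.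
    by have := congr1 (fun m => coldeg m x) e; rewrite !coldegU => /eqP; rewrite eqn_add2r => /eqP.
  by have := congr1 (fun m => rowdeg m x) e; rewrite !rowdegU.
have e : ltrans (soG F k l)^T p = ltrans (delta_mx l k) p - ltrans (delta_mx (rev_ord k) (rev_ord l)) p.
  by rewrite soG_tr -ltransN -ltransD.
rewrite e => /mcoeff_sub_neq0 [] /one [m0 h0 [hr hc]]; exists m0 => //; split=> //.
  by left.
by right.
Qed.

Lemma rtrans_diag k p m : (rtrans (soG F k k) p)@_m =
  ((coldeg m k)%:R - (coldeg m (rev_ord k))%:R) * p@_m.
Proof.
have one a : (rtrans (delta_mx a a) p)@_m = (coldeg m a)%:R * p@_m.
  rewrite rtrans_delta raddf_sum /=; under eq_bigr => i _ do rewrite mcoeff_pol_diag.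
  by rewrite -mulr_suml -natr_sum.
have -> : rtrans (soG F k k) p = rtrans (delta_mx k k) p - rtrans (delta_mx (rev_ord k) (rev_ord k)) p.
  by rewrite -rtransN -rtransD.
by rewrite mulrBl -(one k) -(one (rev_ord k)); exact: mcoeffB.
Qed.

Lemma ltrans_diag k p m : (ltrans (soG F k k)^T p)@_m =
  ((rowdeg m k)%:R - (rowdeg m (rev_ord k))%:R) * p@_m.
Proof.
have one a : (ltrans (delta_mx a a) p)@_m = (rowdeg m a)%:R * p@_m.
  rewrite ltrans_delta raddf_sum /=; under eq_bigr => i _ do rewrite mcoeff_pol_diag.
  by rewrite -mulr_suml -natr_sum.
have -> : ltrans (soG F k k)^T p = ltrans (delta_mx k k) p - ltrans (delta_mx (rev_ord k) (rev_ord k)) p.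
  by rewrite soG_tr -ltransN -ltransD.
by rewrite mulrBl -(one k) -(one (rev_ord k)); exact: mcoeffB.
Qed.

Variables (s' : nat) (b : 'I_s'.+1 -> 'X_{1..n * n}) (red : Pn -> 'cV[F]_s'.+1).
Local Notation s := s'.+1.
Hypothesis b_deg : forall j, (mdeg (b j) <= K)%N.
Hypothesis b_indep : indep_on X (fun j => 'X_[b j]).
Hypothesis red_van : forall p, (msize p <= K.+1)%N -> vanish X (p - \sum_j red p j 0 *: 'X_[b j]).
Hypothesis red_supp : forall p j, (msize p <= K.+1)%N -> red p j 0 != 0 ->
  exists2 m, p@_m != 0 & (row_wt K (b j), col_wt K (b j)) = (row_wt K m, col_wt K m).

Local Notation opL := (fun Z => @ltrans F n' Z^T).
Local Notation opR := (@rtrans F n').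
Local Notation EL := (so_mx b red opL).
Local Notation ER := (so_mx b red opR).

Let bracketL Z Y p : ltrans Z^T (ltrans Y^T p) - ltrans Y^T (ltrans Z^T p) = ltrans (Z *m Y - Y *m Z)^T p.
Proof. by rewrite ltrans_bracket linearB /= !trmx_mul. Qed.

Let vanR k l p : k != l -> vanish X p -> vanish X (rtrans (soG F k l) p).
Proof. by move=> kl /vanishP vp; apply/vanishP; exact: vanJ_rtrans. Qed.

Let vanL k l p : k != l -> vanish X p -> vanish X (ltrans (soG F k l)^T p).
Proof. by rewrite eq_sym => kl /vanishP vp; apply/vanishP; rewrite soG_tr; exact: vanJ_ltrans. Qed.

Lemma so_operatorR : so_operator K (@coldeg n') opR.
Proof.
split.
- exact: coldeg_leq.
- by move=> Z Y p; exact: rtransD.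
- exact: rtransZ.
- by move=> Z p q; exact: vfieldD.
- by move=> Z c p; exact: vfieldZ.
- by move=> Z p; exact: rtrans_size.
- exact: rtrans_bracket.
- exact: vanR.
- exact: col_filter.
- exact: rtrans_diag.
- by move=> k l p m /rtrans_supp[m0 h [_ h1]]; exists m0.
Qed.

Lemma so_operatorL : so_operator K (@rowdeg n') opL.
Proof.
split.
- exact: rowdeg_leq.
- by move=> Z Y p /=; rewrite linearD /= ltransD.
- by move=> c Z p /=; rewrite linearZ /= ltransZ.
- by move=> Z p q; exact: vfieldD.
- by move=> Z c p; exact: vfieldZ.
- by move=> Z p; exact: ltrans_size.
- exact: bracketL.
- exact: vanL.
- exact: row_filter.
- exact: ltrans_diag.
- by move=> k l p m /ltrans_supp[m0 h [_ h1]]; exists m0.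
Qed.

Lemma root_actionR : root_action o K (fun j => col_wt K (b j)) (so_e ER) (so_f ER).
Proof. by apply: (so_mx_root_action b_deg b_indep red_van red_supp so_operatorR) => m m' /(congr1 snd). Qed.

Lemma root_actionL : root_action o K (fun j => row_wt K (b j)) (so_e EL) (so_f EL).
Proof. by apply: (so_mx_root_action b_deg b_indep red_van red_supp so_operatorL) => m m' /(congr1 fst). Qed.

Let qoR k l := so_quot_op so_operatorR k l.
Let qoL k l := so_quot_op so_operatorL k l.

Lemma so_mx_comm k l x y : EL k l *m ER x y = ER x y *m EL k l.
Proof.
apply: (opmx_comm b_deg b_indep red_van (qoL k l) (qoR x y)) => p.
exact: rltrans_comm.
Qed.

Lemma ER_row k l i j : ER k l i j != 0 -> row_wt K (b i) = row_wt K (b j).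
Proof.
move=> /(opmx_supp b_deg red_supp (qoR k l)) [m /rtrans_supp[m0 h [hr _]] /(congr1 fst) /= ->].
have <- : m0 = b j by move: h; rewrite mcoeffX; case: (b j =P m0) => // _; rewrite eqxx.
by apply/mnmP => c; rewrite !mnmE !hr.
Qed.

Lemma EL_col k l i j : EL k l i j != 0 -> col_wt K (b i) = col_wt K (b j).
Proof.
move=> /(opmx_supp b_deg red_supp (qoL k l)) [m /ltrans_supp[m0 h [hr _]] /(congr1 snd) /= ->].
have <- : m0 = b j by move: h; rewrite mcoeffX; case: (b j =P m0) => // _; rewrite eqxx.
by apply/mnmP => c; rewrite !mnmE !hr.
Qed.

End Sides.

(** * Highest weight vectors *)

Section LDU.
Variable F : fieldType.

Definition unip m (U : 'M[F]_m) := forall i j : 'I_m, (j <= i)%N -> U i j = (i == j)%:R.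

Lemma det_unip m (U : 'M[F]_m) : unip U -> \det U = 1.
Proof.
move=> uU; rewrite -det_tr det_trig; last first.
  by apply/is_trig_mxP => i j ij; rewrite mxE uU 1?ltnW // -val_eqE gtn_eqF.
by apply: big1 => i _; rewrite mxE uU // eqxx.
Qed.

(** Gaussian elimination, bordering by one row and one column. The lower factor is written as a
    transpose, so that one notion of unipotent serves both sides. *)
Lemma LDU_exists n' (A : 'M[F]_n'.+1) m : (m <= n'.+1)%N ->
  (forall k, (k <= m)%N -> \det (\matrix_(i < k, j < k) A (inord i) (inord j)) != 0) ->
  exists (L U : 'M[F]_m) (d : 'rV[F]_m), [/\ unip L, unip U &
    \matrix_(i < m, j < m) A (inord i) (inord j) = L^T *m diag_mx d *m U].
Proof.
elim: m => [|m IH] lm hm.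
  exists 1%:M, 1%:M, 0; split; try by case.
  by apply/matrixP => -[].
have [|k km|L' [U' [d' [uL uU e']]]] := IH; [exact: ltnW|by apply: hm; exact: leqW|].
have hM := hm m (leqnSn _); rewrite e' in hM.
rewrite -[m.+1]addn1 in hm *.
set M := (\matrix_(i < m + 1, j < m + 1) A (inord i) (inord j)).
have ulM : ulsubmx M = L'^T *m diag_mx d' *m U' by rewrite -e'; apply/matrixP => i j; rewrite !mxE.
have [LDu Uu] : L'^T *m diag_mx d' \in unitmx /\ U' \in unitmx.
  by apply/andP; rewrite -unitmx_mul unitmxE unitfE.
have [Lu Du] : L'^T \in unitmx /\ diag_mx d' \in unitmx by apply/andP; rewrite -unitmx_mul.
pose y := invmx (L'^T *m diag_mx d') *m ursubmx M.
pose x := dlsubmx M *m invmx (diag_mx d' *m U').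
pose e := drsubmx M - x *m diag_mx d' *m y.
have DUu : diag_mx d' *m U' \in unitmx by rewrite unitmx_mul Du.
have ub (V : 'M[F]_m) (z : 'M[F]_(m, 1)) : unip V -> unip (block_mx V z 0 1%:M).
  move=> uV i j.
  case: (split_ordP i) => i' ->; case: (split_ordP j) => j' ->.
  - by rewrite block_mxEul (inj_eq (@lshift_inj _ _)); exact: uV.
  - by rewrite /= => h; have := ltn_ord i'; lia.
  - by rewrite block_mxEdl mxE eq_rlshift.
  - by rewrite block_mxEdr mxE (inj_eq (@rshift_inj _ _)).
exists (block_mx L' x^T 0 1%:M), (block_mx U' y 0 1%:M), (row_mx d' (e 0 0)%:M); split; try exact: ub.
have -> : diag_mx (row_mx d' (e 0 0)%:M) = block_mx (diag_mx d') 0 0 e.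
  rewrite diag_mx_row; congr block_mx; apply/matrixP => i j; rewrite !mxE !ord1.
  by rewrite !eqxx !mulr1n.
rewrite tr_block_mx !mulmx_block !trmx0 !trmx1 trmxK.
rewrite !(mulmx0, mul0mx, mulmx1, mul1mx, addr0, add0r).
rewrite -[LHS]submxK; congr block_mx.
- exact: ulM.
- by rewrite /y mulKVmx.
- by rewrite -mulmxA /x mulmxKV.
- by rewrite /e addrC subrK.
Qed.

End LDU.

(** * The big cell of the orthogonal group *)

Section BigCell.
Variables (F : numClosedFieldType) (n' : nat).
Local Notation n := n'.+1.
Local Notation J := (antidiag F n').
Local Notation low := (@low n').
Implicit Types (A L U M : 'M[F]_n) (d : 'rV[F]_n).

Lemma unip_strict U : unip U -> strict_upper (U - 1).
Proof. by move=> uU i j ji; rewrite mxE uU // !mxE subrr. Qed.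

Lemma unipM U M : unip U -> unip M -> unip (U *m M).
Proof.
move=> uU uM i j ji; rewrite mxE (bigD1 i) //= uU // eqxx mul1r uM // big1 ?addr0 // => k ki.
have [ki'|ik] := leqP k i; first by rewrite uU // eq_sym (negbTE ki) mul0r.
by rewrite uM ?(leq_trans ji (ltnW ik)) // (_ : (k == j) = false) ?mulr0 // -val_eqE gtn_eqF // (leq_ltn_trans ji).
Qed.

Lemma unip_inv U : unip U -> exists V, [/\ unip V, U *m V = 1%:M & V *m U = 1%:M].
Proof.
move=> uU; have sU := unip_strict uU; have nilU := nilpotent_upper sU.
have VU := geomr nilU (- 1); have UV := geoml nilU (- 1).
rewrite scaleN1r opprK addrC subrK in VU UV.
exists (geom (U - 1) (-1)); split; [|exact: VU|exact: UV].
have ug : upper (geom (U - 1) (-1)).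
  move=> i j ji; rewrite /geom summxE big1 // => k _; rewrite exprZn mxE.
  suff h : upper ((U - 1) ^+ k) by rewrite h // mulr0.
  elim: (k : nat) => [|m IH]; last by rewrite exprS; apply: upperM => //; exact: strict_upperW.
  move=> a b ba; rewrite expr0 mxE (_ : (a == b) = false) //.
  by apply/negbTE; rewrite -val_eqE /=; lia.
have e : geom (U - 1) (-1) = 1 - (U - 1) * geom (U - 1) (-1).
  by rewrite mulrBl mul1r [U * _]VU opprB [1 + _]addrC subrK.
by move=> i j ji; have h := strict_upperM sU ug ji; rewrite {1}e mxE [X in _ + X]mxE h subr0 mxE.
Qed.

Lemma LDU_unique L1 U1 d1 L2 U2 d2 : unip L1 -> unip U1 -> unip L2 -> unip U2 ->
  (forall i, d1 0 i != 0) -> (forall i, d2 0 i != 0) ->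
  L1^T *m diag_mx d1 *m U1 = L2^T *m diag_mx d2 *m U2 -> [/\ L1 = L2, U1 = U2 & d1 = d2].
Proof.
move=> uL1 uU1 uL2 uU2 n1 n2 e.
have [V1 [uV1 UV1 VU1]] := unip_inv uU1; have [M2 [uM2 LM2 ML2]] := unip_inv uL2.
pose l := L1 *m M2; pose q := U2 *m V1.
have ul : unip l by exact: unipM.
have uq : unip q by exact: unipM.
have e2 : l^T *m diag_mx d1 = diag_mx d2 *m q.
  have := congr1 (fun M => M2^T *m M *m V1) e; rewrite /l /q trmx_mul.
  rewrite -!mulmxA UV1 mulmx1 [M2^T *m (L2^T *m _)]mulmxA -trmx_mul LM2 trmx1 mul1mx !mulmxA.
  by [].
have ent i j : l j i * d1 0 j = d2 0 i * q i j.
  by have /matrixP/(_ i j) := e2; rewrite mul_mx_diag mul_diag_mx !mxE.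
have l1 : l = 1%:M.
  apply/matrixP => i j; rewrite [RHS]mxE; have [ji|ij] := leqP j i; first exact: ul.
  have := ent j i; rewrite uq 1?ltnW // (_ : (j == i) = false) ?mulr0; last by rewrite -val_eqE gtn_eqF.
  move=> /eqP; rewrite mulf_eq0 (negbTE (n1 _)) orbF => /eqP ->.
  by rewrite (_ : (i == j) = false) // -val_eqE ltn_eqF.
have q1 : q = 1%:M.
  apply/matrixP => i j; rewrite [RHS]mxE; have [ji|ij] := leqP j i; first exact: uq.
  have := ent i j; rewrite l1 mxE (_ : (j == i) = false) ?mul0r; last by rewrite -val_eqE gtn_eqF.
  move=> /esym/eqP; rewrite mulf_eq0 (negbTE (n2 _)) /= => /eqP ->.
  by rewrite (_ : (i == j) = false) // -val_eqE ltn_eqF.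
split.
- by rewrite -[L1]mulmx1 -ML2 mulmxA -/l l1 mul1mx.
- by rewrite -[U2]mulmx1 -VU1 mulmxA -/q q1 mul1mx.
by apply/rowP => i; have := ent i i; rewrite l1 q1 mxE eqxx mul1r mulr1.
Qed.

Lemma unip_theta V : unip V -> unip (J *m V^T *m J).
Proof.
move=> uV i j ji; rewrite mul_antidiag antidiag_mul mxE uV; last by rewrite /= leq_sub2l.
by rewrite (inj_eq rev_ord_inj) eq_sym.
Qed.

(** [A] is the inverse of [J A^T J], which yields a second factorisation of the same shape.
    Uniqueness then places each factor in the group. *)
Lemma SOJ_LDU A : SOJ A -> (forall k, (k <= n)%N ->
    \det (\matrix_(i < k, j < k) A (inord i) (inord j)) != 0) ->
  exists L U d, [/\ [/\ unip L, unip U & A = L^T *m diag_mx d *m U],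
    L^T *m J *m L = J, U^T *m J *m U = J, SOJ (diag_mx d) & forall i, d 0 i * d 0 (rev_ord i) = 1].
Proof.
move=> [dA oA] hA; have [L [U [d [uL uU eA]]]] := LDU_exists (leqnn n) hA.
have {}eA : A = L^T *m diag_mx d *m U by rewrite -eA; apply/matrixP => i j; rewrite mxE !inord_val.
exists L, U, d.
have dd : \prod_i d 0 i = 1.
  by rewrite -det_diag -dA eA !det_mulmx det_tr (det_unip uL) (det_unip uU) mulr1 mul1r.
have d0 i : d 0 i != 0.
  by apply: contraTneq (oner_neq0 F) => di; rewrite -dd (bigD1 i) //= di mul0r eqxx.
have [V [uV UV VU]] := unip_inv uU; have [M [uM LM ML]] := unip_inv uL.
pose d2 : 'rV[F]_n := \row_i (d 0 (rev_ord i))^-1.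
have d2E : J *m diag_mx d2 *m J *m diag_mx d = 1%:M.
  apply/matrixP => i j; rewrite mul_mx_diag mxE mul_antidiag antidiag_mul !mxE (inj_eq rev_ord_inj) rev_ordK.
  by case: eqP => [->|_]; rewrite ?mulr1n ?mulVf ?mulr0n ?mul0r.
have Ed2 : diag_mx d *m (J *m diag_mx d2 *m J) = 1%:M by exact: mulmx1C.
pose B := (J *m M^T *m J)^T *m diag_mx d2 *m (J *m V^T *m J).
have AB : (J *m A^T *m J) *m B = 1%:M.
  have -> : A^T = U^T *m diag_mx d *m L by rewrite eA !trmx_mul trmxK tr_diag_mx mulmxA.
  rewrite /B !trmx_mul trmxK antidiag_tr -!mulmxA [J *m (J *m (M *m _))]mulmxA antidiagK mul1mx.
  rewrite [L *m (M *m _)]mulmxA LM mul1mx.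
  have -> : diag_mx d *m (J *m (diag_mx d2 *m (J *m (V^T *m J)))) = V^T *m J.
    by rewrite -[RHS]mul1mx -Ed2 !mulmxA.
  by rewrite [U^T *m _]mulmxA -trmx_mul VU trmx1 mul1mx antidiagK.
have e2 : A = B.
  have h : A *m (J *m A^T *m J) = 1%:M.
    by apply: mulmx1C; rewrite -!mulmxA [A^T *m _]mulmxA oA antidiagK.
  by rewrite -[LHS]mulmx1 -AB mulmxA h mul1mx.
have d20 i : d2 0 i != 0 by rewrite mxE invr_neq0.
have [eL eU ed] := LDU_unique uL uU (unip_theta uM) (unip_theta uV) d0 d20 (etrans (esym eA) e2).
have dr i : d 0 i * d 0 (rev_ord i) = 1 by rewrite {1}ed mxE mulVf.
split=> //.
- by rewrite {1}eL !trmx_mul trmxK antidiag_tr -!mulmxA [J *m (J *m _)]mulmxA antidiagK mul1mx ML mulmx1.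
- by rewrite {1}eU !trmx_mul trmxK antidiag_tr -!mulmxA [J *m (J *m _)]mulmxA antidiagK mul1mx VU mulmx1.
split; first by rewrite det_diag.
apply/matrixP => i j; rewrite tr_diag_mx mul_mx_diag mxE mul_diag_mx !mxE.
case: (j =P rev_ord i) => [->|_]; last by rewrite mulr0 mul0r.
by rewrite mulr1 dr.
Qed.

End BigCell.

(** * Weights and uniqueness of joint highest weight vectors *)

Section Joint.
Variables (F : numClosedFieldType) (n' K : nat).
Local Notation n := n'.+1.
Local Notation r := (n./2).
Local Notation o := (odd n).
Local Notation Pn := {mpoly F[n * n]}.
Local Notation ix := (@mxvec_index n n).
Local Notation low := (@low n').
Local Notation mid := (@mid n').
Local Notation X := (@SOJv F n').
Implicit Types (m : 'X_{1..n * n}) (A Z Y : 'M[F]_n) (p q f : Pn) (d : 'rV[F]_n).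

Lemma pos_pairs s' (E : 'I_n -> 'I_n -> 'M[F]_s'.+1) (z : 'cV_s'.+1) : so_relations E ->
  (forall a, pos_root o a -> so_e E a *m z = 0) -> forall k l : 'I_n, (k < l)%N -> E k l *m z = 0.
Proof.
move=> [Er _] hz.
have Er0 k l : E (rev_ord l) (rev_ord k) *m z = 0 -> E k l *m z = 0.
  by rewrite Er mulNmx => /eqP; rewrite oppr_eq0 => /eqP.
have hll (a c : 'I_r) : (a < c)%N -> E (low a) (low c) *m z = 0.
  by move=> ac; apply: (hz (inl (a, c, false))).
have hlr (a c : 'I_r) : (a < c)%N -> E (low a) (rev_ord (low c)) *m z = 0.
  by move=> ac; apply: (hz (inl (a, c, true))).
have hlm (a : 'I_r) : o -> E (low a) mid *m z = 0.
  by move=> oo; apply: (hz (inr a)).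
have hE := halfE n'.
move=> k l kl; case: (halves k) => [[a ka]|[[a ka]|[oo ka]]];
  case: (halves l) => [[c lc]|[[c lc]|[oo' lc]]]; rewrite ?ka ?lc in kl *.
- exact: hll.
- have [ac|ca|/val_inj e] := ltngtP a c; first exact: hlr.
    by apply: Er0; rewrite rev_ordK; exact: hlr.
  have := Er (low a) (rev_ord (low c)); rewrite rev_ordK e => /eqP.
  rewrite -subr_eq0 opprK -mulr2n -scaler_nat scaler_eq0 pnatr_eq0 /= => /eqP ->.
  exact: mul0mx.
- exact: hlm.
- exfalso; move: kl => /=; have := ltn_ord a; have := ltn_ord c; clear - hE; move: (nat_of_ord a) (nat_of_ord c) => x y. lia.
- apply: Er0; rewrite !rev_ordK; apply: hll; move: kl => /=; have := ltn_ord a; have := ltn_ord c; clear - hE; move: (nat_of_ord a) (nat_of_ord c) => x y; lia.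
- exfalso; move: kl => /=; have := ltn_ord a; clear - hE; move: (nat_of_ord a) => x; lia.
- exfalso; move: kl => /=; have := ltn_ord c; clear - hE; move: (nat_of_ord c) => x; lia.
- by apply: Er0; rewrite rev_ordK rev_mid //; exact: hlm.
- by rewrite ltnn in kl.
Qed.

Lemma prod_diag d (e : 'I_n -> nat) : (forall i, d 0 i * d 0 (rev_ord i) = 1) ->
  \prod_i d 0 i = 1 -> (forall c, e (rev_ord (low c)) <= K)%N ->
  (\prod_c d 0 (low c) ^+ K) * \prod_j d 0 j ^+ e j =
  \prod_c d 0 (low c) ^+ (K + e (low c) - e (rev_ord (low c)))%N.
Proof.
move=> dr dd le.
have dm : (if o then d 0 mid else 1) = 1.
  have := big_halves [the Monoid.com_law 1 of *%R] (fun i => d 0 i).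
  by rewrite dd /= big1 ?mul1r // => c _; exact: dr.
rewrite (big_halves [the Monoid.com_law 1 of *%R] (fun j => d 0 j ^+ e j)) /=.
have -> : (if ~~ odd n' then d 0 mid ^+ e mid else 1) = 1.
  by move: dm => /=; case: (~~ odd n') => // ->; rewrite expr1n.
rewrite mulr1 -big_split; apply: eq_bigr => c _ /=.
have dn0 : d 0 (low c) != 0.
  by apply: contraTneq (oner_neq0 F) => h; rewrite -(dr (low c)) h mul0r eqxx.
have -> : d 0 (rev_ord (low c)) = (d 0 (low c))^-1 by rewrite -[LHS](mulKf dn0) dr mulr1.
rewrite mulrA -exprD exprVn; apply: (mulIf (expf_neq0 (e (rev_ord (low c))) dn0)).
rewrite -mulrA mulVf ?expf_neq0 // mulr1 -exprD subnK //.
exact: leq_trans (le c) (leq_addr _ _).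
Qed.

Definition minor k : Pn := \det (\matrix_(i < k, j < k) 'X_(ix (inord i) (inord j))).

Lemma pe_minor k A : pe (minor k) A = \det (\matrix_(i < k, j < k) A (inord i) (inord j)).
Proof.
rewrite /pe /mpoly_at /minor -det_map_mx; congr (\det _); apply/matrixP => i j; rewrite !mxE.
exact: peX.
Qed.

Lemma minor1 k : (k <= n)%N -> pe (minor k) 1%:M = 1.
Proof.
move=> kn; rewrite pe_minor -[RHS](det1 _ k); congr (\det _); apply/matrixP => i j.
rewrite !mxE; congr (_%:R); congr nat_of_bool; rewrite -!val_eqE /=.
by rewrite !inordK // (leq_trans (ltn_ord _)).
Qed.

Hypothesis irrJ : irreducible_on X.

(** The product of the leading principal minors is 1 at the identity, so irreducibility allows it to
    be cancelled. *)
Lemma bigcell_dense f : (forall A, SOJ A -> (forall k, (k <= n)%N -> pe (minor k) A != 0) -> pe f A = 0) ->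
  vanJ f.
Proof.
move=> hf; pose P : Pn := \prod_(k < n.+1) minor k.
have peP A : pe P A = \prod_(k < n.+1) pe (minor k) A by rewrite /pe /mpoly_at /P rmorph_prod.
have : vanish X (f * P).
  apply/vanishP => A SA; rewrite peM.
  have [/forallP h|] := boolP [forall k : 'I_n.+1, pe (minor k) A != 0].
    by rewrite hf ?mul0r // => k kn; exact: (h (Ordinal (kn : (k < n.+1)%N))).
  rewrite negb_forall => /existsP[k]; rewrite negbK => /eqP hk.
  by rewrite peP (bigD1 k) //= hk mul0r mulr0.
move=> /irrJ[/vanishP //|/vanishP h].
have := h _ (SOJ1 F n'); rewrite peP big1 => [/eqP|k _]; first by rewrite oner_eq0.
by apply: minor1; rewrite -ltnS.
Qed.

Variables (s' : nat) (b : 'I_s'.+1 -> 'X_{1..n * n}) (red : Pn -> 'cV[F]_s'.+1).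
Local Notation s := s'.+1.
Hypothesis b_deg : forall j, (mdeg (b j) <= K)%N.
Hypothesis b_indep : indep_on X (fun j => 'X_[b j]).
Hypothesis red_van : forall p, (msize p <= K.+1)%N -> vanish X (p - \sum_j red p j 0 *: 'X_[b j]).
Hypothesis red_supp : forall p j, (msize p <= K.+1)%N -> red p j 0 != 0 ->
  exists2 m, p@_m != 0 & (row_wt K (b j), col_wt K (b j)) = (row_wt K m, col_wt K m).

Local Notation opL := (fun Z => @ltrans F n' Z^T).
Local Notation opR := (@rtrans F n').
Local Notation EL := (so_mx b red opL).
Local Notation ER := (so_mx b red opR).
Local Notation wtL := (fun j => row_wt K (b j)).
Local Notation wtR := (fun j => col_wt K (b j)).
Local Notation jhw := (joint_hw o wtL wtR (so_e EL) (so_e ER)).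
Local Notation ev z := (pe (expand b z)).

Let relL : so_relations EL.
Proof. exact: (so_relations_mx b_deg b_indep red_van (so_operatorL F n' K)). Qed.
Let relR : so_relations ER.
Proof. exact: (so_relations_mx b_deg b_indep red_van (so_operatorR F n' K)). Qed.

Lemma so_mx_kill dg op k l (z : 'cV[F]_s) : so_operator K dg op -> so_mx b red op k l *m z = 0 <->
  vanish X (op (soG F k l) (expand b z)).
Proof.
move=> so; have q := so_quot_op so k l; have sz := msize_expand b_deg z.
rewrite (opmx_expand b_deg b_indep red_van z q); split.
  by apply: (red_vanish red_van); exact: (qo_size q).
by apply: (vanish_red b_indep red_van); exact: (qo_size q).
Qed.

Lemma row_eval (z : 'cV[F]_s) (lam : 'X_{1..r}) A d : (forall i, d 0 i * d 0 (rev_ord i) = 1) -> \prod_i d 0 i = 1 ->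
  (forall j, z j 0 != 0 -> row_wt K (b j) = lam) ->
  (\prod_c d 0 (low c) ^+ K) * ev z (diag_mx d *m A) = (\prod_c d 0 (low c) ^+ lam c) * ev z A.
Proof.
move=> dr dd hz; rewrite /expand !pe_sum !mulr_sumr; apply: eq_bigr => j _; rewrite !peZ.
have [->|zj] := eqVneq (z j 0) 0; first by rewrite !mul0r !mulr0.
rewrite mulrCA [RHS]mulrCA; congr (_ * _); rewrite -(hz j zj).
have -> : diag_mx d *m A = \matrix_(i, j) (d 0 i * 1 * A i j).
  by apply/matrixP => i k; rewrite mul_diag_mx !mxE mulr1.
rewrite (pe_scale (fun i => d 0 i) (fun=> 1)) prod_one mulr1 mulrA prod_diag //; last first.
  by move=> c; exact: leq_trans (rowdeg_leq _ _) (b_deg j).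
by congr (_ * _); apply: eq_bigr => c _; rewrite mnmE.
Qed.

Lemma col_eval (z : 'cV[F]_s) (lam : 'X_{1..r}) A d : (forall i, d 0 i * d 0 (rev_ord i) = 1) -> \prod_i d 0 i = 1 ->
  (forall j, z j 0 != 0 -> col_wt K (b j) = lam) ->
  (\prod_c d 0 (low c) ^+ K) * ev z (A *m diag_mx d) = (\prod_c d 0 (low c) ^+ lam c) * ev z A.
Proof.
move=> dr dd hz; rewrite /expand !pe_sum !mulr_sumr; apply: eq_bigr => j _; rewrite !peZ.
have [->|zj] := eqVneq (z j 0) 0; first by rewrite !mul0r !mulr0.
rewrite mulrCA [RHS]mulrCA; congr (_ * _); rewrite -(hz j zj).
have -> : A *m diag_mx d = \matrix_(i, j) (1 * d 0 j * A i j).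
  by apply/matrixP => i k; rewrite mul_mx_diag !mxE mul1r mulrC.
rewrite (pe_scale (fun=> 1) (fun j => d 0 j)) prod_one mul1r mulrA prod_diag //; last first.
  by move=> c; exact: leq_trans (coldeg_leq _ _) (b_deg j).
by congr (_ * _); apply: eq_bigr => c _; rewrite mnmE.
Qed.

(** With [A = L^T d U], the unipotent factors leave a joint highest weight vector unchanged and the
    diagonal one acts by [lam]. Its values on the big cell are thus all multiples of the value at
    the identity. *)
Lemma bigcell_eval A : SOJ A -> (forall k, (k <= n)%N -> pe (minor k) A != 0) ->
  exists2 d : 'rV[F]_n, forall i, d 0 i != 0 & forall lam lam' z, jhw lam lam' z ->
    (\prod_c d 0 (low c) ^+ K) * ev z A = (\prod_c d 0 (low c) ^+ lam c) * ev z 1%:M.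
Proof.
move=> SA hA; have [|L [U [d [[uL uU eA] oL oU Sd dr]]]] := SOJ_LDU SA.
  by move=> k kn; rewrite -pe_minor; exact: hA.
exists d => [i|lam lam' z [[wL kL] [wR kR]]].
  by apply: contraTneq (oner_neq0 F) => h; rewrite -(dr i) h mul0r eqxx.
have SU : SOJ U by split=> //; exact: det_unip.
have kR' (k l : 'I_n) : (k < l)%N -> vanJ (rtrans (soG F k l) (expand b z)).
  move=> kl; apply/vanishP; apply/(so_mx_kill _ _ _ (so_operatorR F n' K)).
  exact: (pos_pairs relR kR).
have kL' (k l : 'I_n) : (k < l)%N -> vanJ (ltrans (soG F l k) (expand b z)).
  move=> kl; rewrite -soG_tr; apply/vanishP; apply/(so_mx_kill _ _ _ (so_operatorL F n' K)).
  exact: (pos_pairs relL kL).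
rewrite eA -mulmxA (hw_invariant_l kL' (SOJM Sd SU) (unip_strict uL) oL).
rewrite (hw_invariant kR' Sd (unip_strict uU) oU).
have [dd _] := Sd; rewrite det_diag in dd.
by have := row_eval 1%:M dr dd wL; rewrite mulmx1.
Qed.

Lemma joint_hw_eval1 lam lam' z : jhw lam lam' z -> z != 0 -> ev z 1%:M != 0.
Proof.
move=> hz; apply: contraNneq => f1; apply/eqP; apply: (vanish_expand b_indep); apply/vanishP.
apply: bigcell_dense => A SA hA; have [d d0 hd] := bigcell_eval SA hA.
have := hd _ _ _ hz; rewrite f1 mulr0 => /eqP; rewrite mulf_eq0 => /orP[|/eqP //].
by rewrite prodf_seq_eq0 => /hasP[c _ /=]; rewrite expf_eq0 (negbTE (d0 _)) andbF.
Qed.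

(** At the identity a torus element acts equally from the left and from the right. For the bound, a
    coordinate of [lam] is, up to the shift, a difference of two row degrees of one monomial of
    degree at most [K]. *)
Lemma so_joint_wt lam lam' z : jhw lam lam' z -> z != 0 ->
  lam = lam' /\ \sum_i `|(lam i)%:Z - K%:Z| <= K%:Z.
Proof.
move=> hz z0; have f1 := joint_hw_eval1 hz z0; case: hz => [[wL kL] [wR kR]]; split.
  apply/mnmP => c; have t0 : (2 : F) != 0 by rewrite pnatr_eq0.
  (* The powers of 2 are distinct, so this torus element separates the exponents [lam c] and
     [lam' c]. *)
  pose d : 'rV[F]_n := \row_j torus 2 c j.
  have dr i : d 0 i * d 0 (rev_ord i) = 1 by rewrite !mxE torus_rev.
  have dd : \prod_i d 0 i = 1.
    by have [h _] := torus_SOJ c t0; rewrite -det_diag.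
  have := row_eval 1%:M dr dd wL; have := col_eval 1%:M dr dd wR; rewrite mulmx1 mul1mx => -> /(mulIf f1).
  have pe1 (e : 'I_r -> nat) : \prod_c' d 0 (low c') ^+ e c' = 2 ^+ e c.
    rewrite (bigD1 c) //= mxE /torus eqxx big1 ?mulr1 // => c' cc.
    by rewrite mxE /torus (inj_eq (@low_inj n')) (negbTE cc) (negbTE (low_neq_rev _ _)) expr1n.
  by rewrite !pe1 -!natrX => /eqP; rewrite eqr_nat eqn_exp2l // => /eqP.
have [j zj] : exists j, z j 0 != 0.
  apply: contrapT => /forallNP h; case/eqP: z0; apply/colP => j; rewrite mxE; apply/eqP.
  by apply: contraT => h1; case: (h j).
have le : (\sum_c (rowdeg (b j) (low c) + rowdeg (b j) (rev_ord (low c))) <= K)%N.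
  apply: leq_trans (b_deg j); rewrite mdeg_rowdeg.
  by rewrite (big_halves [the Monoid.com_law 0%N of addn]) /= leq_addr.
apply: (@le_trans _ _ (\sum_c (rowdeg (b j) (low c) + rowdeg (b j) (rev_ord (low c)))%N%:Z)).
  apply: ler_sum => c _; rewrite -(wL j zj) mnmE.
  have := leq_trans (rowdeg_leq (b j) (rev_ord (low c))) (b_deg j).
  by move: (rowdeg _ _) (rowdeg _ _) => x y h; lia.
by rewrite -(big_morph Posz PoszD (erefl 0%:Z)) lez_nat.
Qed.

Lemma so_joint_uniq lam z z' : jhw lam lam z -> jhw lam lam z' -> z != 0 -> exists c, z' = c *: z.
Proof.
move=> hz hz' z0; have f1 := joint_hw_eval1 hz z0.
exists (ev z' 1%:M / ev z 1%:M); apply/eqP; rewrite -subr_eq0; apply/eqP.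
apply: (vanish_expand b_indep); apply/vanishP; apply: bigcell_dense => A SA hA.
have [d d0 hd] := bigcell_eval SA hA.
rewrite expandB expandZ -scaleN1r peD !peZ mulN1r.
have dK : \prod_c d 0 (low c) ^+ K != 0.
  by apply/prodf_neq0 => c _; rewrite expf_neq0.
apply: (mulfI dK); rewrite mulr0 mulrBr (hd _ _ _ hz') mulrCA (hd _ _ _ hz).
by move: (\prod_c _) (pe _ _) (pe _ _) f1 => x y t f1; field.
Qed.

End Joint.

(** * Multidegrees of products of minors *)

Section Multihomogeneous.
Variables (F : numClosedFieldType) (n' : nat).
Local Notation n := n'.+1.
Local Notation Pn := {mpoly F[n * n]}.
Local Notation ix := (@mxvec_index n n).
Implicit Types (m : 'X_{1..n * n}) (p q : Pn) (f g : 'I_n -> nat).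

Definition hom f g p := forall m, p@_m != 0 -> rowdeg m =1 f /\ coldeg m =1 g.

Lemma rowdegD m m' x : rowdeg (m + m') x = (rowdeg m x + rowdeg m' x)%N.
Proof. by rewrite -big_split; apply: eq_bigr => j _; rewrite mnmDE. Qed.

Lemma coldegD m m' x : coldeg (m + m') x = (coldeg m x + coldeg m' x)%N.
Proof. by rewrite -big_split; apply: eq_bigr => j _; rewrite mnmDE. Qed.

Lemma eq_hom f g f' g' p : f =1 f' -> g =1 g' -> hom f g p -> hom f' g' p.
Proof. by move=> ef eg h m /h[h1 h2]; split=> x; rewrite ?h1 ?h2. Qed.

Lemma homM f g f' g' p q : hom f g p -> hom f' g' q ->
  hom (fun x => f x + f' x)%N (fun x => g x + g' x)%N (p * q).
Proof.
move=> hp hq m; rewrite -mcoeff_msupp => /msuppM_le /allpairsP[[m1 m2] /= [h1 h2 ->]].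
rewrite !mcoeff_msupp in h1 h2; have [a1 a2] := hp _ h1; have [b1 b2] := hq _ h2.
by split=> x; rewrite ?rowdegD ?coldegD ?a1 ?a2 ?b1 ?b2.
Qed.

Lemma hom1 : hom (fun=> 0%N) (fun=> 0%N) 1.
Proof.
move=> m; rewrite -mpolyX0 mcoeffX; case: (0%MM =P m) => [<- _|_]; last by rewrite eqxx.
by split=> x; rewrite /rowdeg /coldeg big1 // => j _; rewrite mnm0E.
Qed.

Lemma homXn f g p e : hom f g p -> hom (fun x => e * f x)%N (fun x => e * g x)%N (p ^+ e).
Proof.
move=> hp; elim: e => [|e IH]; first by rewrite expr0; exact: hom1.
by rewrite exprS; apply: eq_hom (homM hp IH) => x; rewrite mulSn.
Qed.

Lemma hom_prod (I : Type) (s : seq I) (f g : I -> 'I_n -> nat) (p : I -> Pn) :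
  (forall i, hom (f i) (g i) (p i)) ->
  hom (fun x => \sum_(i <- s) f i x)%N (fun x => \sum_(i <- s) g i x)%N (\prod_(i <- s) p i).
Proof.
move=> h; elim: s => [|i s IH].
  by rewrite big_nil; apply: eq_hom hom1 => x; rewrite big_nil.
by rewrite big_cons; apply: eq_hom (homM (h i) IH) => x; rewrite big_cons.
Qed.

Lemma homZ f g c p : hom f g p -> hom f g (c *: p).
Proof. by move=> hp m; rewrite mcoeffZ mulf_eq0 negb_or => /andP[_ /hp]. Qed.

Lemma hom_sum (I : finType) f g (p : I -> Pn) : (forall i, hom f g (p i)) -> hom f g (\sum_i p i).
Proof. by move=> h m /mcoeff_sum_pos[i /h]. Qed.

Lemma homX i j : hom (fun x => (i == x) : nat) (fun x => (j == x) : nat) 'X_(ix i j).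
Proof.
move=> m; rewrite mcoeffX; case: (_ =P m) => [<- _|_]; last by rewrite eqxx.
have z x : rowdeg (0 : 'X_{1..n * n}) x = 0%N /\ coldeg (0 : 'X_{1..n * n}) x = 0%N.
  by split; rewrite /rowdeg /coldeg big1 // => y _; rewrite mnm0E.
split=> x; have [zr zc] := z x; rewrite -[U_(_)%MM]add0m.
  by rewrite rowdegU zr.
by rewrite coldegU zc.
Qed.

Lemma hom_size f g p : hom f g p -> (msize p <= (\sum_x f x).+1)%N.
Proof.
move=> hp; apply: msize_mcoeff => m /hp[h _]; rewrite mdeg_rowdeg.
by apply: eq_leq; apply: eq_bigr => x _; exact: h.
Qed.

Definition below k (x : 'I_n) : nat := \sum_(i < k) (inord i == x :> 'I_n).

Lemma belowE k x : (k <= n)%N -> below k x = (x < k)%N :> nat.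
Proof.
move=> kn; rewrite /below; have [xk|kx] := ltnP x k.
  have iE (i : 'I_k) : (inord i == x :> 'I_n) = (i == Ordinal xk).
    by rewrite -!val_eqE /= inordK // (leq_trans (ltn_ord i)).
  under eq_bigr => i _ do rewrite iE.
  by rewrite (bigD1 (Ordinal xk)) //= eqxx big1 // => i /negbTE ->.
rewrite big1 // => i _; apply/eqP; rewrite eqb0 -val_eqE /= inordK ?(leq_trans (ltn_ord i)) //.
by rewrite ltn_eqF // (leq_trans (ltn_ord i)).
Qed.

Lemma minor_hom k : hom (below k) (below k) (minor F n' k).
Proof.
rewrite /minor /determinant; apply: hom_sum => s.
rewrite -scaleN1r; have := @hom_prod _ (index_enum 'I_k) (fun i x => (inord i == x :> 'I_n) : nat)
  (fun i x => (inord (s i) == x :> 'I_n) : nat) (fun i => 'X_(ix (inord i) (inord (s i))))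
  (fun i => @homX _ _).
move/(homM (homXn (e := s) (homZ (c := -1) hom1))) => h m; rewrite (_ : \prod_(i < k) _ =
  \prod_(i < k) 'X_(ix (inord i) (inord (s i)))); last by apply: eq_bigr => i _; rewrite mxE.
move/h => [hr hc]; split=> x; rewrite ?hr ?hc muln0 add0n //.
by rewrite /below [RHS](reindex_inj (@perm_inj _ s)).
Qed.

End Multihomogeneous.

Section Minors.
Variables (F : numClosedFieldType) (n' : nat).
Local Notation n := n'.+1.
Local Notation Pn := {mpoly F[n * n]}.
Implicit Types (A u : 'M[F]_n) (p : Pn).

(** The first [k] columns of [u] are zero below row [k], so the corner of [A *m u] is the product of
    the corners. *)
Lemma minor_unip k A u : (k <= n)%N -> unip u -> pe (minor F n' k) (A *m u) = pe (minor F n' k) A.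
Proof.
move=> kn uu; rewrite !pe_minor.
have -> : \matrix_(i < k, j < k) (A *m u) (inord i) (inord j) =
   (\matrix_(i < k, j < k) A (inord i) (inord j)) *m (\matrix_(i < k, j < k) u (inord i) (inord j)).
  apply/matrixP => i j; rewrite !mxE.
  have hl (l : 'I_k) : inord l = widen_ord kn l :> 'I_n.
    by apply: val_inj; rewrite /= inordK // (leq_trans (ltn_ord l)).
  transitivity (\sum_(l < n | (l < k)%N) A (inord i) l * u l (inord j)).
    rewrite [RHS]big_mkcond; apply: eq_bigr => l _; case: ifP => // /negbT; rewrite -leqNgt => kl.
    have -> : u l (inord j) = 0; last by rewrite mulr0.
    have jk : (@inord n' j < k)%N by rewrite inordK // (leq_trans (ltn_ord j)).
    rewrite (uu l (inord j)) ?(leq_trans (ltnW jk)) // (_ : (l == inord j) = false) //.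
    by rewrite -val_eqE gtn_eqF // (leq_trans jk).
  by rewrite (big_ord_narrow kn) /=; apply: eq_bigr => l _; rewrite !mxE (hl l).
rewrite det_mulmx [X in _ * X]det_unip ?mulr1 // => i j ji.
rewrite mxE uu; last by rewrite !inordK // (leq_trans (ltn_ord _)).
by rewrite -val_eqE /= !inordK ?(leq_trans (ltn_ord _)) //.
Qed.

Lemma unip_invariant_rtrans p (k l : 'I_n) : (forall A u, unip u -> pe p (A *m u) = pe p A) ->
  (k < l)%N -> rtrans (delta_mx k l) p = 0.
Proof.
move=> inv kl; apply: mpoly_eval_eq0 => v.
pose cm := map_mx (@polyC F) : 'M[F]_n -> 'M[{poly F}]_n.
pose A : 'M[F]_n := vec_mx (\row_i v i); pose E : 'M[F]_n := delta_mx k l.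
pose C := cm A + 'X *: cm (A *m E).
have evC s : map_mx (horner_eval s) C = A *m (1%:M + s *: E).
  have evc (M : 'M[F]_n) : map_mx (horner_eval s) (cm M) = M.
    by apply/matrixP => i j; rewrite !mxE /horner_eval hornerC.
  by rewrite /C map_mxD map_mxZ !evc /= /horner_eval hornerX mulmxDr mulmx1 -scalemxAr.
have EE : E *m E = 0 by rewrite mul_delta_mx_cond (_ : (l == k) = false) // -val_eqE gtn_eqF.
have dC : forall i j, ((C i j)^`()).[0] = (map_mx (horner_eval 0) C *m E) i j.
  move=> i j; rewrite evC scale0r addr0 mulmx1.
  have -> : C i j = (A i j)%:P + 'X * ((A *m E) i j)%:P.
    by rewrite mxE; congr (_ + _); rewrite mxE //; congr (_ * _); rewrite mxE.
  by rewrite derivD derivC add0r derivM derivX derivC mulr0 addr0 mul1r hornerC.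
have := along_mx p dC; set q := along _ _.
have qs s : q.[s] = pe p A.
  rewrite /q along_pe evC inv // => i j ji; rewrite !mxE.
  have -> : (i == k) && (j == l) = false; last by rewrite mulr0 addr0.
  by apply/negbTE/negP => /andP[/eqP ik /eqP jl]; move: ji; rewrite ik jl leqNgt kl.
have -> : q = (pe p A)%:P.
  by apply/eqP; rewrite -subr_eq0; apply/eqP; apply: polyF_eq0 => s; rewrite hornerD hornerN hornerC qs subrr.
rewrite derivC horner0 evC scale0r addr0 mulmx1 => h; rewrite [RHS]h /pe /mpoly_at /A vec_mxK.
by apply: meval_eq => i; rewrite mxE.
Qed.

End Minors.

(** * Existence of joint highest weight vectors *)

Section Existence.
Variables (F : numClosedFieldType) (n' K : nat).
Local Notation n := n'.+1.
Local Notation r := (n./2).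
Local Notation o := (odd n).
Local Notation Pn := {mpoly F[n * n]}.
Local Notation low := (@low n').
Local Notation X := (@SOJv F n').

Lemma sum_telescope (a : nat -> nat) R x : (forall k, a k.+1 <= a k)%N -> (x <= R)%N ->
  (\sum_(k < R) (a k - a k.+1) * (x < k.+1) = a x - a R)%N.
Proof.
move=> da; elim: R => [|R IH] xR.
  by rewrite big_ord0; move: xR; rewrite leqn0 => /eqP ->; rewrite subnn.
rewrite big_ord_recr /=; have [xR'|Rx] := leqP x R; last first.
  rewrite (_ : x = R.+1) ?subnn ?big1 ?ltnn ?muln0 //; last by lia.
  by move=> i _; rewrite (_ : (_ < _)%N = false) ?muln0 //; apply/negbTE; have := ltn_ord i; lia.
rewrite IH // ltnS xR' muln1.
have : (a R <= a x)%N.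
  elim: R xR' {IH xR} => [|R IH]; first by rewrite leqn0 => /eqP ->.
  rewrite leq_eqVlt => /orP[/eqP <- //|]; rewrite ltnS => /IH; exact: leq_trans (da R).
by have := da R; lia.
Qed.

Variables (s' : nat) (b : 'I_s'.+1 -> 'X_{1..n * n}) (red : Pn -> 'cV[F]_s'.+1).
Local Notation s := s'.+1.
Hypothesis b_deg : forall j, (mdeg (b j) <= K)%N.
Hypothesis b_indep : indep_on X (fun j => 'X_[b j]).
Hypothesis red_van : forall p, (msize p <= K.+1)%N -> vanish X (p - \sum_j red p j 0 *: 'X_[b j]).
Hypothesis red_supp : forall p j, (msize p <= K.+1)%N -> red p j 0 != 0 ->
  exists2 m, p@_m != 0 & (row_wt K (b j), col_wt K (b j)) = (row_wt K m, col_wt K m).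

Local Notation opL := (fun Z => @ltrans F n' Z^T).
Local Notation opR := (@rtrans F n').
Local Notation EL := (so_mx b red opL).
Local Notation ER := (so_mx b red opR).
Local Notation wtL := (fun j => row_wt K (b j)).
Local Notation wtR := (fun j => col_wt K (b j)).
Local Notation jhw := (joint_hw o wtL wtR (so_e EL) (so_e ER)).

(** Principal minors are raised to the differences of consecutive coordinates of [lam], and the
    multidegree telescopes. The product is invariant under upper unipotents on the right and, being
    invariant under transposition, under their transposes on the left. *)
Lemma so_joint_ex (lam : 'X_{1..r}) : (forall i, K <= lam i)%N ->
  (forall i j : 'I_r, (i <= j)%N -> lam j <= lam i)%N ->
  (\sum_i (lam i - K) <= K)%N -> exists2 z, z != 0 & jhw lam lam z.
Proof.
move=> lamK lamD lamS; have hE := halfE n'.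
(* The coordinates of [lam] without the shift, continued by 0 so that the last exponent is the last
   coordinate itself. *)
pose a k := if insub k is Some i then (lam (i : 'I_r) - K)%N else 0%N.
have aE (c : 'I_r) : a c = (lam c - K)%N by rewrite /a valK.
have a0 k : (r <= k)%N -> a k = 0%N by move=> rk; rewrite /a insubF // ltnNge rk.
have da k : (a k.+1 <= a k)%N.
  have [rk|kr] := leqP r k.+1; first by rewrite a0.
  by rewrite (aE (Ordinal kr)) (aE (Ordinal (ltnW kr))); apply: leq_sub2r; apply: lamD => /=.
pose p : Pn := \prod_(k < r) minor F n' k.+1 ^+ (a k - a k.+1).
have rn : (r <= n)%N by lia.
have hp : hom (fun x => a x) (fun x => a x) p.
  have := @hom_prod F n' _ (index_enum 'I_r) _ _ _
    (fun k : 'I_r => @homXn F n' _ _ _ (a k - a k.+1)%N (@minor_hom F n' k.+1)).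
  have e (x : 'I_n) : (\sum_(i < r) (a i - a i.+1) * below i.+1 x = a x)%N.
    rewrite (eq_bigr (fun i : 'I_r => (a i - a i.+1) * (x < i.+1))%N) => [|i _]; last first.
      by rewrite belowE //; exact: leq_trans (ltn_ord i) rn.
    have [xr|rx] := leqP (x : 'I_n) r; first by rewrite sum_telescope // [a r]a0 // subn0.
    rewrite big1 ?a0 ?(ltnW rx) // => i _.
    by rewrite (_ : (_ < _)%N = false) ?muln0 //; apply/negbTE; have := ltn_ord i; lia.
  by apply: eq_hom.
have sumA : (\sum_(x < n) a x <= K)%N.
  rewrite (big_halves [the Monoid.com_law 0%N of addn]) /=.
  rewrite (_ : (if ~~ odd n' then a (uphalf n') else 0%N) = 0%N); last by case: ifP => // _; rewrite a0.
  rewrite addn0; apply: leq_trans lamS; apply: leq_sum => c _.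
  by rewrite (aE c) a0 ?addn0 //; have := ltn_ord c; clear - hE; move: (nat_of_ord c) => x; lia.
have sp : (msize p <= K.+1)%N by apply: leq_trans (hom_size hp) _; rewrite ltnS.
have wtp m : p@_m != 0 -> row_wt K m = lam /\ col_wt K m = lam.
  move=> /hp[hr hc]; split; apply/mnmP => c; rewrite mnmE ?hr ?hc (aE c) a0 ?subn0 ?subnKC //=;
    have := ltn_ord c; clear - hE; move: (nat_of_ord c) => x; lia.
have peP A : pe p A = \prod_(k < r) pe (minor F n' k.+1) A ^+ (a k - a k.+1).
  by rewrite /pe /mpoly_at /p rmorph_prod; apply: eq_bigr => k _; rewrite rmorphXn.
have invR A u : unip u -> pe p (A *m u) = pe p A.
  move=> uu; rewrite !peP; apply: eq_bigr => k _; rewrite minor_unip //.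
  by have := ltn_ord k; lia.
have trE A : pe p A^T = pe p A.
  rewrite !peP; apply: eq_bigr => k _; congr (_ ^+ _); rewrite !pe_minor -det_tr.
  by congr (\det _); apply/matrixP => i j; rewrite !mxE.
have pe0 (q : Pn) : (forall A, pe q A = 0) -> q = 0.
  move=> h; apply: mpoly_eval_eq0 => v; rewrite -[RHS](h (vec_mx (\row_i v i))) /pe vec_mxK.
  by apply: meval_eq => i; rewrite mxE.
have rk (k l : 'I_n) : (k < l)%N -> rtrans (soG F k l) p = 0.
  move=> kl; have -> : rtrans (soG F k l) p = rtrans (delta_mx k l) p - rtrans (delta_mx (rev_ord l) (rev_ord k)) p.
    by rewrite -rtransN -rtransD.
  rewrite (unip_invariant_rtrans invR kl) (unip_invariant_rtrans invR) ?subrr //=.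
  by have := ltn_ord l; have := ltn_ord k; move: kl; move: (nat_of_ord k) (nat_of_ord l) => x y; lia.
have lk (k l : 'I_n) : (k < l)%N -> ltrans (soG F k l)^T p = 0.
  move=> kl; have tp : trp p = p.
    by apply/eqP; rewrite -subr_eq0; apply/eqP; apply: pe0 => A; rewrite -scaleN1r peD peZ pe_trp trE mulN1r subrr.
  have := rk k l kl; rewrite -{1}tp rtrans_trp => h; apply: pe0 => A.
  by rewrite -[A]trmxK -pe_trp h -mpolyC0 peC.
have kill (op : 'M[F]_n -> Pn -> Pn) dg k l : so_operator K dg op -> op (soG F k l) p = 0 ->
    so_mx b red op k l *m red p = 0.
  move=> so h; rewrite -(red_op b_deg b_indep red_van (so_quot_op so k l) sp) h.
  by apply: (vanish_red b_indep red_van); rewrite ?msize0 // => x _; rewrite -mpolyC0 [LHS]mevalC.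
have posE (E : 'I_n -> 'I_n -> 'M[F]_s) : (forall k l : 'I_n, (k < l)%N -> E k l *m red p = 0) ->
    forall t, pos_root o t -> so_e E t *m red p = 0.
  move=> h [[[k l] c]|k] /= pt; apply: h => //=.
  by case: c => //=; have := ltn_ord k; have := ltn_ord l; clear - hE; move: (nat_of_ord k) (nat_of_ord l) => x y; lia.
exists (red p).
  apply/eqP => r0; have := red_vanish red_van sp r0.
  move=> /vanishP /(_ _ (SOJ1 F n')); rewrite peP big1 => [/eqP|k _]; first by rewrite oner_eq0.
  by rewrite minor1 ?expr1n //; have := ltn_ord k; lia.
split; split.
- by move=> j /(red_supp sp)[m /wtp[w _] /(congr1 fst) /= ->].
- by apply: posE => k l kl; apply: (kill _ _ _ _ (so_operatorL F n' K)); exact: lk.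
- by move=> j /(red_supp sp)[m /wtp[_ w] /(congr1 snd) /= ->].
by apply: posE => k l kl; apply: (kill _ _ _ _ (so_operatorR F n' K)); exact: rk.
Qed.

End Existence.

(** * Weyl group symmetries *)

Section SignedPermutations.
Variables (n' : nat).
Local Notation n := n'.+1.
Local Notation r := (n./2).
Local Notation o := (odd n).
Local Notation low := (@low n').
Local Notation mid := (@mid n').
Local Notation signed_perm := ({perm 'I_r} * {ffun 'I_r -> bool})%type.
Implicit Types (w : signed_perm) (k l : 'I_n) (c x y : 'I_r).

Definition flip (b : bool) k := if b then rev_ord k else k.

Lemma halves_flip k : (exists b c, k = flip b (low c)) \/ (o /\ k = mid).
Proof.
have [[c ->]|[[c ->]|]] := halves k; last by right.
  by left; exists false, c.
by left; exists true, c.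
Qed.

Lemma flip_low_inj b b' c c' : flip b (low c) = flip b' (low c') -> b = b' /\ c = c'.
Proof.
case: b; case: b' => /= e; split=> //; first by move/rev_ord_inj/low_inj: e.
- by move/eqP: e; rewrite eq_sym (negbTE (low_neq_rev _ _)).
- by move/eqP: e; rewrite eq_sym (negbTE (low_neq_rev _ _)).
- by move/eqP: e; rewrite (negbTE (low_neq_rev _ _)).
- by move/eqP: e; rewrite (negbTE (low_neq_rev _ _)).
exact: low_inj e.
Qed.

Lemma flip_low_mid b c : o -> flip b (low c) != mid.
Proof.
move=> oo; case: b => /=; last exact: low_neq_mid.
by rewrite -(rev_mid oo) (inj_eq rev_ord_inj) low_neq_mid.
Qed.

Lemma rev_flip b k : rev_ord (flip b k) = flip (~~ b) k.
Proof. by case: b => //=; rewrite rev_ordK. Qed.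

(** The permutation of the [n] indices that a signed permutation of the [r] pairs under [rev_ord]
    induces. *)
Definition wfun w k : 'I_n :=
  if insub (k : nat) is Some c then flip (w.2 c) (low (w.1 c))
  else if insub (rev_ord k : nat) is Some c then flip (~~ w.2 c) (low (w.1 c)) else k.

Lemma wfun_flip w b c : wfun w (flip b (low c)) = flip (b (+) w.2 c) (low (w.1 c)).
Proof.
have hl : insub (low c : nat) = Some c by rewrite /= valK.
rewrite /wfun; case: b; rewrite [flip _ _]/=; last by rewrite hl.
rewrite rev_ordK hl insubF //; have hE := halfE n'.
by have := ltn_ord c; rewrite /=; clear - hE; move: (nat_of_ord c) => x; lia.
Qed.

Lemma wfun_mid w : o -> wfun w mid = mid.
Proof. by move=> oo; rewrite /wfun rev_mid // insubF //= ltnn. Qed.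

Lemma wfun_rev w k : wfun w (rev_ord k) = rev_ord (wfun w k).
Proof.
have [[b [c ->]]|[oo ->]] := halves_flip k; last by rewrite rev_mid // wfun_mid // rev_mid.
by rewrite rev_flip !wfun_flip rev_flip addNb.
Qed.

Lemma wfun_inj w : injective (wfun w).
Proof.
move=> k l; have [[b [c ->]]|[oo ->]] := halves_flip k;
  have [[b' [c' ->]]|[oo' ->]] := halves_flip l => //.
- rewrite !wfun_flip => /flip_low_inj[eb /perm_inj ec]; move: eb; rewrite ec => /addIb -> //.
- by rewrite wfun_flip wfun_mid // => /eqP; rewrite (negbTE (flip_low_mid _ _ oo')).
by rewrite wfun_flip wfun_mid // => /esym/eqP; rewrite (negbTE (flip_low_mid _ _ oo)).
Qed.

Definition wperm w : 'S_n := perm (@wfun_inj w).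

Lemma wperm_ext (s : 'S_n) w : (forall b c, s (flip b (low c)) = flip (b (+) w.2 c) (low (w.1 c))) ->
  (o -> s mid = mid) -> wperm w = s.
Proof.
move=> h hm; apply/permP => k; rewrite permE.
have [[b [c ->]]|[oo ->]] := halves_flip k; first by rewrite wfun_flip h.
by rewrite wfun_mid // hm.
Qed.

Lemma wperm_flip w b c : wperm w (flip b (low c)) = flip (b (+) w.2 c) (low (w.1 c)).
Proof. by rewrite permE wfun_flip. Qed.

Lemma wperm_mid w : o -> wperm w mid = mid.
Proof. by move=> oo; rewrite permE wfun_mid. Qed.

Let noflip : {ffun 'I_r -> bool} := [ffun=> false].

Lemma odd_wperm_perm (s : {perm 'I_r}) : odd_perm (wperm (s, noflip)) = false.
Proof.
have [ts -> _] := prod_tpermP s; elim: ts => [|[x y] ts IH].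
  rewrite big_nil (@wperm_ext 1%g) ?odd_perm1 // => [b c|_]; rewrite ?perm1 //.
  by rewrite /= ffunE addbF ?perm1.
rewrite big_cons /=; set s' := (\prod_(t <- ts) _)%g in IH *.
have fl c x' : rev_ord (low x') != low c by rewrite eq_sym low_neq_rev.
have ml c : (low c == mid) = false by apply/negbTE; exact: low_neq_mid.
have mr c : o -> (rev_ord (low c) == mid) = false by move=> oo; exact: (negbTE (flip_low_mid true c oo)).
have rlinj : injective (fun c => rev_ord (low c)) by move=> u v /rev_ord_inj/low_inj.
rewrite (@wperm_ext (tperm (low x) (low y) * tperm (rev_ord (low x)) (rev_ord (low y)) * wperm (s', noflip))%g).
- rewrite !odd_permM IH !odd_tperm (inj_eq rev_ord_inj) !(inj_eq (@low_inj n')).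
  by case: (x != y).
- move=> b c; rewrite !permM; case: b => /=.
    rewrite (tpermD (low_neq_rev _ _) (low_neq_rev _ _)) -(inj_tperm _ _ _ rlinj).
    have := wperm_flip (s', noflip) true (tperm x y c); rewrite /= !ffunE /= => ->.
    by rewrite ?permM.
  rewrite -(inj_tperm _ _ _ (@low_inj n')) (tpermD (fl _ _) (fl _ _)).
  have := wperm_flip (s', noflip) false (tperm x y c); rewrite /= !ffunE /= => ->.
  by rewrite ?permM.
by move=> oo; rewrite !permM !tpermD ?wperm_mid ?ml ?mr.
Qed.

Lemma odd_wperm_flip (v : {ffun 'I_r -> bool}) : odd_perm (wperm (1%g, v)) = parity v.
Proof.
pose vs (s : seq 'I_r) : {ffun 'I_r -> bool} := [ffun c => c \in s].
have -> : v = vs (enum [pred c | v c]) by apply/ffunP => c; rewrite ffunE mem_enum inE.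
elim: (enum _) (enum_uniq [pred c | v c]) => [_|x s IH /= /andP[xs us]].
  rewrite (@wperm_ext 1%g) ?odd_perm1 => [|b c|_]; rewrite ?perm1 //.
    by rewrite /parity big1 // => c _; rewrite ffunE.
  by rewrite /= ffunE addbF.
have xr : low x != rev_ord (low x) by exact: low_neq_rev.
rewrite (@wperm_ext (wperm (1, vs s) * tperm (low x) (rev_ord (low x)))%g).
- rewrite odd_permM IH // odd_tperm xr /parity (bigD1 x) //= [in RHS](bigD1 x) //= !ffunE.
  rewrite (negbTE xs) mem_head addFb addbC; congr (_ (+) _); apply: eq_bigr => c cx.
  by rewrite !ffunE in_cons (negbTE cx).
- move=> b c; rewrite permM wperm_flip /= !ffunE !perm1 in_cons.
  have [->|cx] := eqVneq c x.
    by rewrite (negbTE xs) addbF /=; case: b; rewrite /= ?tpermL ?tpermR.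
  have d b1 b2 : flip b1 (low x) != flip b2 (low c).
    by apply/eqP => /flip_low_inj[_ e]; rewrite e eqxx in cx.
  by rewrite tpermD ?(d false) ?(d true).
by move=> oo; rewrite permM wperm_mid // tpermD ?low_neq_mid // (flip_low_mid true).
Qed.

(** A permutation of the pairs moves both members alike and is even, while each flip is a
    transposition. *)
Lemma odd_wperm w : odd_perm (wperm w) = parity w.2.
Proof.
case: w => s v; rewrite (@wperm_ext (wperm (1, v) * wperm (s, noflip))%g) /=.
- by rewrite odd_permM odd_wperm_flip odd_wperm_perm addbF.
- by move=> b c; rewrite permM !wperm_flip /= ffunE addbF perm1.
by move=> oo; rewrite permM !wperm_mid.
Qed.

End SignedPermutations.

(** * Substitution by permutations of rows and columns *)

Section Substitution.
Variables (F : numClosedFieldType) (n' : nat).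
Local Notation n := n'.+1.
Local Notation Pn := {mpoly F[n * n]}.
Local Notation ix := (@mxvec_index n n).
Implicit Types (m : 'X_{1..n * n}) (p q : Pn) (s t : 'S_n) (eps : 'I_n -> F) (A Z : 'M[F]_n).

(** The factors [eps] on the columns serve to repair the determinant when n is odd. *)
Definition psub s t eps p : Pn := mmap (@mpolyC (n * n) F)
  (fun k => mxvec (\matrix_(i, j) (eps j *: 'X_(ix (s i) (t j)))) 0 k) p.

Lemma psubX s t eps i j : psub s t eps 'X_(ix i j) = eps j *: 'X_(ix (s i) (t j)).
Proof. by rewrite /psub mmapX mmap1U mxvecE mxE. Qed.

Lemma psubC s t eps c : psub s t eps c%:MP = c%:MP. Proof. exact: mmapC. Qed.
Lemma psubD s t eps p q : psub s t eps (p + q) = psub s t eps p + psub s t eps q.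
Proof. exact: mmapD. Qed.
Lemma psubM s t eps p q : psub s t eps (p * q) = psub s t eps p * psub s t eps q.
Proof. exact: rmorphM. Qed.
Lemma psubZ s t eps c p : psub s t eps (c *: p) = c *: psub s t eps p.
Proof. by rewrite -!mul_mpolyC psubM psubC. Qed.
Lemma psub_sum s t eps (I : Type) (u : seq I) (f : I -> Pn) :
  psub s t eps (\sum_(i <- u) f i) = \sum_(i <- u) psub s t eps (f i).
Proof. exact: raddf_sum. Qed.

Lemma pe_psub s t eps p A :
  pe (psub s t eps p) A = pe p (\matrix_(i, j) (eps j * A (s i) (t j))).
Proof.
elim/mpoly_ringind: p => [c|k|p q h1 h2|p q h1 h2].
- by rewrite psubC !peC.
- by elim/mxvec_indP: k => i j; rewrite psubX peZ !peX mxE.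
- by rewrite psubD !peD h1 h2.
- by rewrite psubM !peM h1 h2.
Qed.

Lemma psub_hom s t eps m : hom (fun x => rowdeg m ((s^-1)%g x)) (fun x => coldeg m ((t^-1)%g x))
  (psub s t eps 'X_[m]).
Proof.
have -> : psub s t eps 'X_[m] = \prod_i \prod_j (eps j *: 'X_(ix (s i) (t j))) ^+ m (ix i j).
  rewrite /psub mmapX /mmap1 pair_big /= (reindex (uncurry ix)) /=; last exact: curry_mxvec_bij.
  by apply: eq_bigr => -[i j] _ /=; rewrite mxvecE mxE.
have h i j := @homXn F n' _ _ _ (m (ix i j)) (homZ (c := eps j) (@homX F n' (s i) (t j))).
apply: eq_hom (hom_prod (s := index_enum _) (fun i => hom_prod (s := index_enum _) (h i))) => x /=.
  rewrite (bigD1 ((s^-1)%g x)) //= [X in (_ + X)%N]big1 ?addn0 => [|i isx].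
    by rewrite /rowdeg; apply: eq_bigr => j _; rewrite permKV eqxx muln1.
  apply: big1 => j _; rewrite (_ : (s i == x) = false) ?muln0 //.
  by apply: contraNF isx => /eqP <-; rewrite permK.
apply: eq_bigr => i _; rewrite (bigD1 ((t^-1)%g x)) //= permKV eqxx muln1 big1 ?addn0 // => j jtx.
rewrite (_ : (t j == x) = false) ?muln0 //.
by apply: contraNF jtx => /eqP <-; rewrite permK.
Qed.

Lemma psub_supp s t eps p m : (psub s t eps p)@_m != 0 ->
  exists2 m0, p@_m0 != 0 & (forall x, rowdeg m (s x) = rowdeg m0 x) /\
     (forall x, coldeg m (t x) = coldeg m0 x).
Proof.
rewrite {1}(mpolyE p) psub_sum => h.
have [m0 h0] : exists m0, (psub s t eps (p@_m0 *: 'X_[m0]))@_m != 0.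
  apply: contrapT => /forallNP h0; case/eqP: h; rewrite raddf_sum big1 // => m0 _ /=.
  by apply/eqP; apply: contraT => h1; case: (h0 m0).
move: h0; rewrite psubZ mcoeffZ mulf_eq0 negb_or => /andP[p0 /psub_hom[hr hc]].
by exists m0 => //; split=> x; rewrite ?hr ?hc permK.
Qed.

Lemma psub_size s t eps p K : (msize p <= K.+1)%N -> (msize (psub s t eps p) <= K.+1)%N.
Proof.
move=> sp; apply: msize_mcoeff => m /psub_supp[m0 h [hr _]].
apply: leq_trans (mcoeff_mdeg sp h); rewrite !mdeg_rowdeg (reindex_inj (@perm_inj _ s)) /=.
by apply: eq_leq; apply: eq_bigr => x _; exact: hr.
Qed.

Lemma psub_SOJ s t eps A : (forall i, s (rev_ord i) = rev_ord (s i)) ->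
  (forall i, t (rev_ord i) = rev_ord (t i)) -> (forall i, eps i * eps (rev_ord i) = 1) ->
  (-1) ^+ s * (-1) ^+ t * \prod_i eps i = 1 :> F -> SOJ A ->
  SOJ (\matrix_(i, j) (eps j * A (s i) (t j))).
Proof.
move=> hs ht he hd [dA oA]; split.
  have -> : \matrix_(i, j) (eps j * A (s i) (t j)) =
      (perm_mx s *m A *m perm_mx (t^-1)%g) *m diag_mx (\row_j eps j).
    rewrite -row_permE -col_permE; apply/matrixP => i j; rewrite mul_mx_diag !mxE mulrC.
    by rewrite ?invgK.
  rewrite !det_mulmx !det_perm dA mulr1 det_diag odd_permV -[RHS]hd; congr (_ * _).
  by apply: eq_bigr => i _; rewrite mxE.
apply/matrixP => i j; have /matrixP/(_ (t i) (t j)) := oA.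
rewrite [X in X = _ -> _]mxE [in X in _ -> X]mxE => h.
transitivity (eps i * eps j * (antidiag F n') (t i) (t j)).
  rewrite -h mulr_sumr [RHS](reindex_inj (@perm_inj _ s)); apply: eq_bigr => k _ /=.
  rewrite !mul_antidiag !mxE hs; ring.
rewrite !mxE -ht (inj_eq perm_inj); case: eqP => [->|_]; last by rewrite mulr0.
by rewrite he mulr1.
Qed.

Lemma psub_ltrans t eps Z p : psub 1 t eps (ltrans Z p) = ltrans Z (psub 1 t eps p).
Proof.
elim/mpoly_ringind: p => [c|k|p q h1 h2|p q h1 h2].
- by rewrite psubC /ltrans !vfieldC -mpolyC0 psubC.
- elim/mxvec_indP: k => i j; rewrite psubX /ltrans vfieldZ !vfieldX !mxE psub_sum scaler_sumr perm1.
  apply: eq_bigr => k _; rewrite !mxE psubM psubC psubX perm1.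
  by rewrite -scalerAr.
- by rewrite /ltrans in h1 h2 *; rewrite psubD !vfieldD psubD h1 h2.
- by rewrite /ltrans in h1 h2 *; rewrite psubM !vfieldM psubD !psubM h1 h2.
Qed.

End Substitution.

(** * The Hilbert function as a sum of squares *)

Section Dimension.
Variables (F : numClosedFieldType) (n' K : nat).
Local Notation n := n'.+1.
Local Notation r := (n./2).
Local Notation o := (odd n).
Local Notation Pn := {mpoly F[n * n]}.
Local Notation low := (@low n').
Local Notation mid := (@mid n').
Local Notation X := (@SOJv F n').
Hypothesis irrJ : irreducible_on X.

Lemma qo_psub (s t : 'S_n) (eps : 'I_n -> F) : (forall i, s (rev_ord i) = rev_ord (s i)) ->
  (forall i, t (rev_ord i) = rev_ord (t i)) -> (forall i, eps i * eps (rev_ord i) = 1) ->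
  (-1) ^+ s * (-1) ^+ t * \prod_i eps i = 1 :> F -> quot_op X K (psub s t eps).
Proof.
move=> hs ht he hd; split=> [p q|c p|p sp|p sp /vanishP vp].
- exact: psubD.
- exact: psubZ.
- exact: psub_size.
by apply/vanishP => A SA; rewrite pe_psub; apply: vp; exact: psub_SOJ.
Qed.

Lemma psubK (s t : 'S_n) (eps : 'I_n -> F) (p : Pn) : (forall i, eps i * eps (t i) = 1) ->
  psub s t eps (psub (s^-1)%g (t^-1)%g eps p) = p.
Proof.
move=> he; apply/eqP; rewrite -subr_eq0; apply/eqP; apply: mpoly_eval_eq0 => v.
have e A : pe (psub s t eps (psub (s^-1)%g (t^-1)%g eps p)) A = pe p A.
  rewrite !pe_psub; congr (pe p _); apply/matrixP => i j; rewrite !mxE.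
  have ej : eps j * eps ((t^-1)%g j) = 1 by rewrite mulrC -{2}[j](permKV t).
  by rewrite mulrA ej mul1r !permKV.
rewrite mevalB; apply/eqP; rewrite subr_eq0; apply/eqP.
have := e (vec_mx (\row_i v i)); rewrite /pe /mpoly_at vec_mxK => h.
by etransitivity; [|etransitivity; [exact: h|]]; apply: meval_eq => i; rewrite mxE.
Qed.

Theorem so_dim : exists h, hilbert X K h /\
  2 ^+ r * r`!%:R * (weyl_dim o (fun i : 'I_r => (rho2 r o i)%:R) : F) ^+ 2 * h%:R =
  wmult F o * \sum_(g : box r o K | \sum_i `|box_wt g i| <= 2 * K%:Z + \sum_(i < r) (rho2 r o i)%:Z)
    box_dim F g ^+ 2.
Proof.
have hE := halfE n'.
have X0 : exists x, X x by exists (mxvec 1%:M); rewrite /SOJv /= mxvecK; exact: SOJ1.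
have [s' [b [red [b_deg b_indep red_van red_supp]]]] := monomial_basis (@torus_filter F n' K) X0.
exists s'.+1; split; first exact: (hilbert_basis b_deg b_indep red_van).
have ro : (0 < r + o)%N by lia.
have wperm_rev w i : wperm w (rev_ord i) = rev_ord (wperm w i) by rewrite !permE wfun_rev.
have wpermV_rev w i : ((wperm w)^-1)%g (rev_ord i) = rev_ord (((wperm w)^-1)%g i).
  by apply: (@perm_inj _ (wperm w)); rewrite permKV wperm_rev permKV.
have wtE (dg : 'X_{1..n * n} -> 'I_n -> nat) m m0 w : (forall m x, dg m x <= mdeg m)%N -> (mdeg m0 <= K)%N ->
    (forall x, dg m (((wperm w)^-1)%g x) = dg m0 x) -> deg_wt K dg m = wact (2 * K) w (deg_wt K dg m0).
  move=> dl dm h; have {}h x : dg m x = dg m0 (wperm w x) by rewrite -h permK.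
  apply/mnmP => c; rewrite !mnmE !h wperm_rev (wperm_flip w false) addFb.
  have h1 := leq_trans (dl m0 (low (w.1 c))) dm.
  have h2 := leq_trans (dl m0 (rev_ord (low (w.1 c)))) dm.
  move: h1 h2; rewrite /flip; case: (w.2 c); rewrite ?rev_ordK.
    by move: (dg m0 _) (dg m0 _) => x y; lia.
  by [].
have unit (s t : 'S_n) (eps : 'I_n -> F) : (forall i, eps i * eps (t i) = 1) -> quot_op X K (psub s t eps) ->
    quot_op X K (psub (s^-1)%g (t^-1)%g eps) ->
    opmx b red (psub s t eps) *m opmx b red (psub (s^-1)%g (t^-1)%g eps) = 1%:M.
  move=> he q1 q2; apply: mulmx_inj => z; rewrite -mulmxA.
  rewrite (opmx_mul b_deg b_indep red_van z q1 q2) psubK // mul1mx.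
  exact: (red_expand b_deg b_indep red_van).
have XE m j : ('X_[b j] : Pn)@_m != 0 -> m = b j.
  by rewrite mcoeffX; case: (b j =P m) => // _; rewrite eqxx.
apply: (sum_weyl_dim ro (root_actionL b_deg b_indep red_van red_supp)
  (root_actionR b_deg b_indep red_van red_supp)).
- by move=> a c _ _; exact: so_mx_comm.
- by move=> a c _ _; exact: so_mx_comm.
- by move=> a c _ _; exact: so_mx_comm.
- by move=> a c _ _; exact: so_mx_comm.
- by move=> a i j _; exact: EL_col.
- by move=> a i j _; exact: EL_col.
- by move=> a i j _; exact: ER_row.
- by move=> a i j _; exact: ER_row.
(* Conjugation by a permutation matrix preserves the group whatever its determinant, so every signed
   permutation acts on the left weights. *)
- move=> w; pose s := ((wperm w)^-1)%g.
  have sgn (u : 'S_n) : (-1) ^+ u * (-1) ^+ u * \prod_(i < n) (fun=> 1) i = 1 :> F.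
    by rewrite -exprD addnn -muln2 mulnC exprM sqrrN !expr1n mul1r big1.
  have q1 : quot_op X K (psub s s (fun=> 1)) by apply: qo_psub => // i; rewrite ?mulr1 ?wpermV_rev.
  have q2 : quot_op X K (psub (s^-1)%g (s^-1)%g (fun=> 1)).
    by apply: qo_psub => // i; rewrite ?mulr1 // /s invgK wperm_rev.
  exists (opmx b red (psub s s (fun=> 1))), (opmx b red (psub (s^-1)%g (s^-1)%g (fun=> 1))).
  split=> [|i j h]; first by apply: unit => // i; rewrite mulr1.
  have [m /psub_supp[m0 /XE -> [hr _]] /(congr1 fst) /= ->] := opmx_supp b_deg red_supp q1 h.
  by apply: wtE => //; exact: rowdeg_leq.
(* Only columns are moved, to commute with left translations, so the determinant has to be 1: for
   odd n the sign of [t] is put on the middle column, for even n [allowed] makes [t] even. *)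
- move=> w aw; pose t := ((wperm w)^-1)%g.
  pose eps (i : 'I_n) : F := if o && (i == mid) then (-1) ^+ t else 1.
  have tmid : o -> t mid = mid by move=> oo; apply: (@perm_inj _ (wperm w)); rewrite permKV wperm_mid.
  have epsr i : eps i * eps (rev_ord i) = 1.
    rewrite /eps; have [oo|oo] : o \/ ~~ o by case: (o); [left|right].
      rewrite oo -{2}(rev_mid oo) (inj_eq rev_ord_inj) /=; case: eqP => _; last by rewrite mulr1.
      by rewrite -exprD addnn -muln2 mulnC exprM sqrrN !expr1n.
    by rewrite (negbTE oo) mulr1.
  have epst i : eps i * eps (t i) = 1.
    rewrite /eps; have [oo|oo] : o \/ ~~ o by case: (o); [left|right].
      rewrite oo -{2}(tmid oo) (inj_eq perm_inj) /=; case: eqP => _; last by rewrite mulr1.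
      by rewrite -exprD addnn -muln2 mulnC exprM sqrrN !expr1n.
    by rewrite (negbTE oo) mulr1.
  have sgn (u : 'S_n) : odd_perm u = odd_perm t -> (-1) ^+ (1%g : 'S_n) * (-1) ^+ u * \prod_i eps i = 1 :> F.
    move=> ->; rewrite odd_perm1 expr0 mul1r /eps.
    have [oo|oo] : o \/ ~~ o by case: (o); [left|right].
      have -> : \prod_i (if o && (i == mid) then (-1) ^+ t else 1) = (-1) ^+ t :> F.
        rewrite (bigD1 mid) //= eqxx big1 => [|i /negbTE ->]; last by rewrite andbF.
        by move: oo => /= ->; rewrite mulr1.
      by rewrite -exprD addnn -muln2 mulnC exprM sqrrN !expr1n.
    rewrite big1 => [|i _]; last by rewrite (negbTE oo).
    rewrite /t odd_permV odd_wperm; move: aw; rewrite /allowed (negbTE oo) /= => /negbTE ->.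
    by rewrite mulr1.
  have q1 : quot_op X K (psub 1 t eps).
    by apply: qo_psub => // [i|i|]; rewrite ?perm1 ?wpermV_rev // sgn.
  have q2 : quot_op X K (psub (1^-1)%g (t^-1)%g eps).
    apply: qo_psub => // [i|i|]; rewrite ?invg1 ?perm1 // ?sgn ?odd_permV //.
    by rewrite /t invgK wperm_rev.
  exists (opmx b red (psub 1 t eps)), (opmx b red (psub (1^-1)%g (t^-1)%g eps)).
  have cL k l : opmx b red (psub 1 t eps) *m so_mx b red (fun Z => ltrans Z^T) k l =
      so_mx b red (fun Z => ltrans Z^T) k l *m opmx b red (psub 1 t eps).
    apply: (opmx_comm b_deg b_indep red_van q1 (so_quot_op (so_operatorL F n' K) k l)) => p.
    exact: psub_ltrans.
  split=> [|i j h|i j h|a _]; first exact: unit.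
  + have [m /psub_supp[m0 /XE -> [_ hc]] /(congr1 snd) /= ->] := opmx_supp b_deg red_supp q1 h.
    by apply: wtE => //; exact: coldeg_leq.
  + have [m /psub_supp[m0 /XE -> [hr _]] /(congr1 fst) /= ->] := opmx_supp b_deg red_supp q1 h.
    by apply/mnmP => c; rewrite !mnmE -!hr !perm1.
  by split; exact: cL.
- by move=> lam lam' z; exact: (so_joint_wt irrJ b_deg b_indep red_van).
- by move=> lam z z'; exact: (so_joint_uniq irrJ b_deg b_indep red_van).
by move=> lam; exact: (so_joint_ex b_deg b_indep red_van red_supp).
Qed.

End Dimension.

(** * Irreducibility *)

Section Irreducibility.
Variables (F : numClosedFieldType) (n' : nat).
Local Notation n := n'.+1.
Local Notation Pn := {mpoly F[n * n]}.
Implicit Types (A B E Z M : 'M[F]_n) (p q : Pn) (d : 'rV[F]_n).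

Definition SOm A := \det A = 1 /\ A^T *m A = 1%:M.
Definition SOv : set 'rV[F]_(n * n) := [set v | SOm (vec_mx v)].

Lemma SOmM A B : SOm A -> SOm B -> SOm (A *m B).
Proof.
move=> [d1 o1] [d2 o2]; split; first by rewrite det_mulmx d1 d2 mulr1.
by rewrite trmx_mul mulmxA -[B^T *m _ *m A]mulmxA o1 mulmx1.
Qed.

Lemma rational_curve p (C : 'M[{poly F}]_n) (dl : {poly F}) : exists k (N : {poly F}),
  forall s, dl.[s] != 0 -> N.[s] = dl.[s] ^+ k * pe p (dl.[s]^-1 *: map_mx (horner_eval s) C).
Proof.
elim/mpoly_ringind: p => [c|k|p q [k [N h]] [l [M g]]|p q [k [N h]] [l [M g]]].
- by exists 0%N, c%:P => s _; rewrite hornerC peC expr0 mul1r.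
- elim/mxvec_indP: k => i j; exists 1%N, (C i j) => s s0.
  by rewrite peX !mxE expr1 mulrA mulfV // mul1r.
- exists (k + l)%N, (N * dl ^+ l + M * dl ^+ k) => s s0.
  by rewrite peD hornerD !hornerM !horner_exp h // g // exprD; ring.
exists (k + l)%N, (N * M) => s s0.
by rewrite peM hornerM h // g // exprD; ring.
Qed.

Definition cay E Z : 'M[F]_n := E *m (1%:M + Z) *m invmx (1%:M - Z).

Lemma det_line A B : exists D : {poly F}, forall s, D.[s] = \det (A + s *: B).
Proof.
pose cm := map_mx (@polyC F) : 'M[F]_n -> 'M[{poly F}]_n.
exists (\det (cm A + 'X *: cm B)) => s.
have evc M : map_mx (horner_eval s) (cm M) = M.
  by apply/matrixP => i j; rewrite !mxE /horner_eval hornerC.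
rewrite -[LHS]/(horner_eval s _) -det_map_mx; congr (\det _).
by rewrite map_mxD map_mxZ !evc /= /horner_eval hornerX.
Qed.

Lemma cay_line p E Z1 Z2 : exists k (N : {poly F}), forall s,
  let Z := Z1 + s *: (Z2 - Z1) in
  \det (1%:M - Z) != 0 -> N.[s] = \det (1%:M - Z) ^+ k * pe p (cay E Z).
Proof.
pose cm := map_mx (@polyC F) : 'M[F]_n -> 'M[{poly F}]_n.
pose Zp := cm Z1 + 'X *: cm (Z2 - Z1).
have evc s M : map_mx (horner_eval s) (cm M) = M.
  by apply/matrixP => i j; rewrite !mxE /horner_eval hornerC.
have evZ s : map_mx (horner_eval s) Zp = Z1 + s *: (Z2 - Z1).
  by rewrite map_mxD map_mxZ !evc /= /horner_eval hornerX.
have ev1 s : map_mx (horner_eval s) (1%:M : 'M[{poly F}]_n) = 1%:M by exact: map_mx1.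
pose C := cm E *m (1%:M + Zp) *m \adj (1%:M - Zp).
have [k [N h]] := rational_curve p C (\det (1%:M - Zp)); exists k, N => s /= dZ.
have dE : (\det (1%:M - Zp)).[s] = \det (1%:M - (Z1 + s *: (Z2 - Z1))).
  by rewrite -[LHS]/(horner_eval s _) -det_map_mx map_mxB ev1 evZ.
rewrite h dE //; congr (_ * pe p _); rewrite /C !map_mxM evc map_mxD ev1 evZ.
rewrite map_mx_adj map_mxB ev1 evZ /cay /invmx unitmxE unitfE dZ.
by rewrite -scalemxAr.
Qed.

Definition skew Z := Z^T = - Z.

Lemma skew_line Z1 Z2 s : skew Z1 -> skew Z2 -> skew (Z1 + s *: (Z2 - Z1)).
Proof.
move=> h1 h2; rewrite /skew !(linearD, linearZ, linearN) /= h1 h2.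
by apply/matrixP => i j; rewrite !mxE; ring.
Qed.

Let comm1 Z : (1%:M - Z) *m (1%:M + Z) = (1%:M + Z) *m (1%:M - Z).
Proof. by rewrite mulmxBl mulmxBr mul1mx mulmx1 mulmxDr mulmxDl mulmx1 mul1mx. Qed.

Lemma cay_SO E Z : SOm E -> skew Z -> \det (1%:M - Z) != 0 -> SOm (cay E Z).
Proof.
move=> SE sZ dZ; rewrite /cay -mulmxA; apply: SOmM => //.
have uZ : 1%:M - Z \in unitmx by rewrite unitmxE unitfE.
have tZ : (1%:M + Z)^T = 1%:M - Z by rewrite linearD /= trmx1 sZ.
have tZ' : (1%:M - Z)^T = 1%:M + Z by rewrite linearB /= trmx1 sZ opprK.
have uZ' : 1%:M + Z \in unitmx by rewrite -tZ' unitmx_tr.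
have dd : \det (1%:M + Z) = \det (1%:M - Z) by rewrite -tZ det_tr.
split; first by rewrite det_mulmx det_inv dd mulfV.
rewrite trmx_mul trmx_inv tZ tZ' -mulmxA [(1%:M - Z) *m (_ *m _)]mulmxA comm1.
by rewrite -[_ *m invmx (1%:M - Z)]mulmxA mulmxV // mulmx1 mulVmx.
Qed.

Lemma SO_cay B : SOm B -> \det (1%:M + B) != 0 ->
  exists2 Z, skew Z /\ \det (1%:M - Z) != 0 & B = cay 1%:M Z.
Proof.
move=> [dB oB] d1; have u1 : 1%:M + B \in unitmx by rewrite unitmxE unitfE.
pose Z := (B - 1%:M) *m invmx (1%:M + B).
have Z1 : Z *m (1%:M + B) = B - 1%:M by rewrite /Z mulmxKV.
have two : (2 : F) != 0 by rewrite pnatr_eq0.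
have m1 : (1%:M - Z) *m (1%:M + B) = 2 *: 1%:M.
  by rewrite mulmxBl mul1mx Z1; apply/matrixP => i j; rewrite !mxE; ring.
have m2 : (1%:M + Z) *m (1%:M + B) = 2 *: B.
  by rewrite mulmxDl mul1mx Z1; apply/matrixP => i j; rewrite !mxE; ring.
have uZ : 1%:M - Z \in unitmx.
  have : (1%:M - Z) *m (1%:M + B) \in unitmx by rewrite m1 unitmxZ ?unitmx1 // unitfE.
  by rewrite unitmx_mul => /andP[].
exists Z; first split; last 1 first.
- have e : 1%:M + B = 2 *: invmx (1%:M - Z).
    by rewrite -[LHS](mulKmx uZ) m1 -scalemxAr mulmx1.
  have := m2; rewrite {1}e -scalemxAr => /(congr1 (fun M => 2^-1 *: M)).
  by rewrite !scalerA mulVf // !scale1r /cay mul1mx => ->.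
- apply/eqP; rewrite -subr_eq0 opprK; apply/eqP; set Y := _ + _.
  have h : (1%:M + B)^T *m Y *m (1%:M + B) = 0.
    have -> : (1%:M + B)^T *m Y *m (1%:M + B) = (Z *m (1%:M + B))^T *m (1%:M + B) +
        (1%:M + B)^T *m (Z *m (1%:M + B)).
      by rewrite /Y; move: (Z) (1%:M + B) => Z' w; rewrite mulmxDr mulmxDl trmx_mul !mulmxA.
    rewrite Z1 [(B - _)^T]linearB [(_ + B)^T]linearD /= trmx1.
    rewrite !(mulmxDl, mulmxDr, mulmxN, mulNmx, mul1mx, mulmx1) oB.
    by apply/matrixP => i j; rewrite !mxE; ring.
  have := congr1 (fun M => invmx (1%:M + B)^T *m M *m invmx (1%:M + B)) h.
  by rewrite mulmx0 mul0mx !mulmxA mulVmx ?unitmx_tr // mul1mx mulmxK.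
by rewrite -unitfE -unitmxE.
Qed.

(** The determinant is affine in each entry of [d], and nonzero at a scalar [d] that is no
    eigenvalue of [- A]. An affine function that is not zero differs from 0 at 1 or at -1, so the
    entries can be replaced one at a time. *)
Lemma sign_matrix A : exists2 d : 'rV[F]_n, forall i, d 0 i = 1 \/ d 0 i = -1 & \det (diag_mx d + A) != 0.
Proof.
suff h k : (k <= n)%N -> exists2 d : 'rV[F]_n, forall i : 'I_n, (i < k)%N -> d 0 i = 1 \/ d 0 i = -1 &
    \det (diag_mx d + A) != 0.
  by have [d h1 h2] := h n (leqnn n); exists d => // i; exact: h1.
elim: k => [_|k IH kn].
  have [x hx] : exists x, (char_poly (- A)).[x] != 0.
    by apply: poly_neq0_eval; rewrite monic_neq0 // char_poly_monic.
  exists (const_mx x) => //; rewrite diag_const_mx; move: hx; congr (_ != _).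
  rewrite /char_poly -[LHS]/(horner_eval x _) -det_map_mx; congr (\det _); apply/matrixP => i j.
  by rewrite /char_poly_mx !mxE /= /horner_eval !(hornerE, hornerMn) opprK.
have [d hd dA] := IH (ltnW kn); pose i0 := Ordinal kn.
pose dx x : 'rV[F]_n := \row_i (if i == i0 then x else d 0 i).
have dxd : dx (d 0 i0) = d by apply/rowP => i; rewrite mxE; case: eqP => [->|].
have two : (2 : F) != 0 by rewrite pnatr_eq0.
have aff x : \det (diag_mx (dx x) + A) = (1 + x) / 2 * \det (diag_mx (dx 1) + A) +
    (1 - x) / 2 * \det (diag_mx (dx (-1)) + A).
  have r' y : row' i0 (diag_mx (dx y) + A) = row' i0 (diag_mx (dx x) + A).
    apply/matrixP => i j; rewrite !mxE; congr (_ *+ _ + _).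
    by rewrite eq_sym (negbTE (neq_lift _ _)).
  apply: (determinant_multilinear (i0 := i0)) => //.
  by apply/rowP => j; rewrite !mxE eqxx; case: (i0 == j); rewrite ?mulr1n ?mulr0n; field.
have hx (y : F) : y = 1 \/ y = -1 -> \det (diag_mx (dx y) + A) != 0 ->
    exists2 d : 'rV[F]_n, forall i : 'I_n, (i < k.+1)%N -> d 0 i = 1 \/ d 0 i = -1 & \det (diag_mx d + A) != 0.
  move=> y1 dxA; exists (dx y) => // i ik; rewrite mxE; case: (i =P i0) => [//|ne].
  apply: hd; rewrite ltn_neqAle -ltnS ik andbT; apply/eqP => e; apply: ne; exact: val_inj.
have [e1|n1] := eqVneq (\det (diag_mx (dx 1) + A)) 0; last exact: (hx 1 (or_introl erefl) n1).
have [e2|n2] := eqVneq (\det (diag_mx (dx (-1)) + A)) 0; last exact: (hx (-1) (or_intror erefl) n2).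
by case/eqP: dA; rewrite -dxd aff e1 e2 !mulr0 addr0.
Qed.

Definition dense_chart p E := forall Z, skew Z -> \det (1%:M - Z) != 0 -> pe p (cay E Z) = 0.

(** The charts at [E] and [E *m R] overlap: at a generic [Z] of the line from [Z1] to [Z2],
    [1%:M + cay R Z] is invertible and [cay (E *m R) Z] is a point [cay E Z'] of the other chart. *)
Lemma chart_flip p E (i j : 'I_n) : i != j ->
  let R : 'M[F]_n := diag_mx (\row_k (if (k == i) || (k == j) then -1 else 1)) in
  dense_chart p E -> dense_chart p (E *m R).
Proof.
move=> ij R hE Z1 sZ1 dZ1; apply/eqP; apply: contraT => pZ.
(* An infinitesimal rotation in the plane of [i] and [j], chosen because
   [1%:M - Z2 + R *m (1%:M + Z2)] is then the matrix of the transposition of [i] and [j] with rows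
   scaled by 2 and -2, hence invertible. *)
pose Z2 : 'M[F]_n := delta_mx i j - delta_mx j i.
have sZ2 : skew Z2 by rewrite /skew linearB /= !trmx_delta opprB.
have [k [N hN]] := cay_line p (E *m R) Z1 Z2.
have [D hD] := det_line (1%:M - Z1) (- (Z2 - Z1)).
have [Q hQ] := det_line (1%:M - Z1 + R *m (1%:M + Z1)) (- (Z2 - Z1) + R *m (Z2 - Z1)).
have DE s : D.[s] = \det (1%:M - (Z1 + s *: (Z2 - Z1))).
  by rewrite hD; congr (\det _); apply/matrixP => a b; rewrite !mxE; ring.
have QE s : Q.[s] = \det (1%:M - (Z1 + s *: (Z2 - Z1)) + R *m (1%:M + (Z1 + s *: (Z2 - Z1)))).
  rewrite hQ; congr (\det _); rewrite [R *m (1%:M + (Z1 + _))]mulmxDr mulmxDr [R *m (Z1 + _)]mulmxDr -scalemxAr.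
  move: (R *m _) (R *m _) (R *m _) => u v w; by apply/matrixP => a b; rewrite !mxE; ring.
have D0 : D != 0.
  by apply: contraNneq dZ1 => D0; have := DE 0; rewrite scale0r addr0 D0 horner0 => <-.
have N0 : N != 0.
  apply: contraNneq pZ => N0; have := hN 0; rewrite /= scale0r addr0 N0 horner0 => /(_ dZ1)/esym/eqP.
  by rewrite mulf_eq0 expf_eq0 (negbTE dZ1) andbF.
have Q0 : Q != 0.
  pose M := 1%:M - Z2 + R *m (1%:M + Z2).
  have ME : M = diag_mx (\row_a (if a == i then - 2 else 2)) *m perm_mx (tperm i j).
    have RM B a b : (R *m B) a b = (if (a == i) || (a == j) then -1 else 1) * B a b.
      by rewrite mul_diag_mx !mxE.
    apply/matrixP => a b; rewrite [M a b]mxE RM mul_diag_mx !mxE.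
    have [->|ai] := eqVneq a i.
      rewrite tpermL (negbTE ij) /=; case: (j =P b) => [<-|jb].
        by rewrite (negbTE ij) !eqxx /=; ring.
      rewrite [b == j]eq_sym (introF eqP jb) /=; ring.
    have [->|aj] := eqVneq a j.
      rewrite tpermR /=; case: (i =P b) => [<-|ib].
        by rewrite [j == i]eq_sym (negbTE ij) !eqxx /=; ring.
      rewrite [b == i]eq_sym (introF eqP ib) /=; ring.
    rewrite tpermD 1?eq_sym //=; ring.
  have dM : \det M != 0.
    rewrite ME det_mulmx det_perm det_diag mulf_neq0 ?signr_eq0 //.
    by apply/prodf_neq0 => a _; rewrite mxE; case: ifP; rewrite ?oppr_eq0 pnatr_eq0.
  apply: contraNneq dM => Q0; have := QE 1.
  by rewrite scale1r [Z1 + _]addrC subrK Q0 horner0 => <-.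
have [s] : exists s, (D * (N * Q)).[s] != 0 by apply: poly_neq0_eval; rewrite !mulf_neq0.
rewrite !hornerM !mulf_eq0 !negb_or => /and3P[]; rewrite DE QE; set Z := Z1 + _ => dZ Ns dQ.
have sZ : skew Z by exact: skew_line.
have uZ : 1%:M - Z \in unitmx by rewrite unitmxE unitfE.
have SR : SOm R.
  split.
    rewrite det_diag (bigD1 i) //= (bigD1 j) 1?eq_sym //= !mxE !eqxx orbT big1 ?mulr1 => [|k' /andP[ki kj]].
      by rewrite mulrNN mulr1.
    by rewrite mxE (negbTE ki) (negbTE kj).
  apply/matrixP => a b; rewrite tr_diag_mx mul_diag_mx !mxE; case: (a =P b) => [_|_]; last by rewrite mulr0.
  by case: ifP; rewrite !mulr1n ?mulrNN ?mulr1.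
have d1 : \det (1%:M + cay R Z) != 0.
  have e : (1%:M + cay R Z) *m (1%:M - Z) = 1%:M - Z + R *m (1%:M + Z).
    by rewrite mulmxDl mul1mx /cay mulmxKV.
  by apply: contraNneq dQ => h; rewrite -e det_mulmx h mul0r.
have [Z' [sZ' dZ'] eZ] := SO_cay (cay_SO SR sZ dZ) d1.
have := hN s dZ; have -> : cay (E *m R) Z = cay E Z'.
  by move: eZ; rewrite /cay mul1mx -!mulmxA => ->; rewrite !mulmxA.
by rewrite hE // mulr0 => h; rewrite h eqxx in Ns.
Qed.

(** As the product of the entries is 1, the entries -1 come in pairs, and [chart_flip] removes one
    pair at a time. *)
Lemma chart_dense p d : (forall i, d 0 i = 1 \/ d 0 i = -1) -> \prod_i d 0 i = 1 ->
  dense_chart p 1%:M -> dense_chart p (diag_mx d).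
Proof.
move=> hd dd p1; have [k] := ubnP #|[pred i | d 0 i == -1]|.
have m11 : (-1 : F) != 1 by rewrite eq_sym -subr_eq0 opprK -mulr2n pnatr_eq0.
elim: k d hd dd => // k IH d hd dd; rewrite ltnS => ck.
have [/existsP[i /eqP di]|] := boolP [exists i, d 0 i == -1]; last first.
  rewrite negb_exists => /forallP h; rewrite (_ : diag_mx d = 1%:M) //.
  apply/matrixP => i j; rewrite !mxE; have [->|e] := hd i; first by [].
  by have := h i; rewrite e eqxx.
have [j ij dj] : exists2 j, i != j & d 0 j = -1.
  apply: contrapT => h; case/eqP: m11; rewrite -[RHS]dd (bigD1 i) //= di big1 ?mulr1 // => j ji.
  have [//|dj] := hd j; case: h; exists j => //; by rewrite eq_sym.
pose d' : 'rV[F]_n := \row_k (if (k == i) || (k == j) then 1 else d 0 k).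
have -> : diag_mx d = diag_mx d' *m diag_mx (\row_k (if (k == i) || (k == j) then -1 else 1)).
  apply/matrixP => a b; rewrite mul_diag_mx !mxE; case: (a =P b) => [_|_]; last by rewrite !mulr0n mulr0.
  rewrite !mulr1n; case: ifP; last by rewrite mulr1.
  by case/orP => /eqP ->; rewrite ?di ?dj mul1r.
apply: chart_flip => //; apply: IH.
- by move=> a; rewrite mxE; case: ifP => _; [left|exact: hd].
- move: dd; rewrite (bigD1 i) //= (bigD1 j) 1?eq_sym //= di dj mulrA mulrNN mulr1 mul1r => dd.
  rewrite (bigD1 i) //= (bigD1 j) 1?eq_sym //= !mxE !eqxx orbT !mul1r -[RHS]dd.
  by apply: eq_bigr => a /andP[ai aj]; rewrite mxE (negbTE ai) (negbTE aj).
apply: leq_trans ck; apply: proper_card; apply/properP; split.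
  by apply/fintype.subsetP => a; rewrite !inE mxE; case: ifP => // _; rewrite eq_sym (negbTE m11).
by exists i; rewrite !inE ?di ?mxE ?eqxx //= eq_sym.
Qed.

Lemma chart_all p A : dense_chart p 1%:M -> SOm A -> pe p A = 0.
Proof.
move=> p1 [dA oA]; have [d hd dAd] := sign_matrix A.
have oD : diag_mx d *m diag_mx d = 1%:M.
  apply/matrixP => i j; rewrite mul_diag_mx !mxE; case: eqP => [->|_]; last by rewrite mulr0.
  by have [->|->] := hd j; rewrite ?mulr1n ?mulr1 ?mulrNN ?mulr1.
pose B := diag_mx d *m A.
have oB : B^T *m B = 1%:M by rewrite trmx_mul tr_diag_mx -mulmxA [diag_mx d *m (_ *m _)]mulmxA oD mul1mx.
have d1 : \det (1%:M + B) != 0.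
  apply: contraNneq dAd => h; have -> : diag_mx d + A = diag_mx d *m (1%:M + B).
    by rewrite mulmxDr mulmx1 /B mulmxA oD mul1mx.
  by rewrite det_mulmx h mulr0.
(* With determinant -1 for [diag_mx d], [B] would be orthogonal of determinant -1 and have the
   eigenvalue -1, against [d1]. *)
have dd : \det (diag_mx d) = 1.
  have := congr1 determinant oD; rewrite det_mulmx det1 -expr2 => /eqP; rewrite sqrf_eq1 => /orP[/eqP //|/eqP dd].
  case/eqP: d1; have e : \det (1%:M + B) = - \det (1%:M + B).
    transitivity (\det ((1%:M + B)^T *m B)).
      by rewrite linearD /= trmx1 mulmxDl mul1mx oB addrC.
    by rewrite det_mulmx det_tr [\det B]det_mulmx dd dA mulr1 mulrN1.
  by move/eqP: e; rewrite -subr_eq0 opprK -mulr2n mulrn_eq0 /= => /eqP.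
have SB : SOm B by split=> //; rewrite det_mulmx dd dA mulr1.
have [Z [sZ dZ] eB] := SO_cay SB d1.
have -> : A = cay (diag_mx d) Z.
  have -> : A = diag_mx d *m B by rewrite /B mulmxA oD mul1mx.
  by rewrite eB /cay mul1mx mulmxA.
apply: chart_dense => //; by rewrite -det_diag.
Qed.

(** Skew matrices form a vector space, so two points of a chart lie on a line, along which a
    vanishing product has a vanishing factor. The overlaps then spread the vanishing from one chart
    to the whole group. *)
Theorem SO_irreducible : irreducible_on SOv.
Proof.
have vP p : vanish SOv p <-> forall A, SOm A -> pe p A = 0.
  split=> h; first by move=> A SA; apply: h; rewrite /SOv /= mxvecK.
  by move=> v Sv; rewrite -[v]vec_mxK; exact: h.
move=> p q /vP pq; have [h1|h1] := pselect (dense_chart p 1%:M).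
  by left; apply/vP => A; exact: chart_all.
right; apply/vP => A; apply: chart_all => Z2 sZ2 dZ2.
have [Z1 /not_implyP[sZ1 /not_implyP[dZ1 pZ1]]] : exists Z, ~ (skew Z -> \det (1%:M - Z) != 0 -> pe p (cay 1%:M Z) = 0).
  by apply: contrapT => /forallNP h; apply: h1 => Z; apply: contrapT; exact: h.
have [k [N hN]] := cay_line p 1%:M Z1 Z2; have [l [M hM]] := cay_line q 1%:M Z1 Z2.
have [D hD] := det_line (1%:M - Z1) (- (Z2 - Z1)).
have DE s : D.[s] = \det (1%:M - (Z1 + s *: (Z2 - Z1))).
  by rewrite hD; congr (\det _); apply/matrixP => a b; rewrite !mxE; ring.
have D0 : D != 0.
  by apply: contraNneq dZ1 => D0; have := DE 0; rewrite scale0r addr0 D0 horner0 => <-.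
have N0 : N != 0.
  apply/eqP => N0; have := hN 0; rewrite /= scale0r addr0 N0 horner0 => /(_ dZ1)/esym/eqP.
  by rewrite mulf_eq0 expf_eq0 (negbTE dZ1) andbF => /eqP.
have S1 : SOm 1%:M by split; rewrite ?det1 // trmx1 mul1mx.
have : D * (N * M) = 0.
  apply: polyF_eq0 => s; rewrite !hornerM; have [->|Ds] := eqVneq D.[s] 0; first by rewrite mul0r.
  rewrite DE in Ds; have := pq _ (cay_SO S1 (skew_line s sZ1 sZ2) Ds); rewrite peM => h.
  by rewrite (hN s Ds) (hM s Ds) mulrACA h !mulr0.
move/eqP; rewrite !mulf_eq0 (negbTE D0) (negbTE N0) /= => /eqP M0.
have := hM 1; rewrite /= scale1r [Z1 + _]addrC subrK M0 horner0 => /(_ dZ2)/esym/eqP.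
by rewrite mulf_eq0 expf_eq0 (negbTE dZ2) andbF => /eqP.
Qed.

End Irreducibility.

(** * The leading coefficient *)

Section Convolution.
Implicit Types (f g : nat -> rat).

Definition conv f g K : rat := \sum_(j < K.+1) f j * g (K - j)%N.

Variable o : bool.

(* The contribution to a sum over the integers congruent to o modulo 2 of those of
   absolute value 2 j + o. *)
Definition layer (e j : nat) : rat := (if (j == 0)%N && ~~ o then 1 else 2) * (2 * j%:R + o%:R) ^+ e.

(** The constant is that of [binpoly_powX], with [2 j + o] written as [2 (j + o / 2)]. The
    exceptional weight of [j = 0] is felt only for [e = 0], where it subtracts one copy of [g], of
    lower degree. *)
Lemma binpoly_layer b B e g : binpoly b B g ->
  binpoly (e + b).+1 (2 ^+ e.+1 * e`!%:R * B) (conv (layer e) g).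
Proof.
move=> hg; have pw : binpoly e (2 ^+ e.+1 * e`!%:R) (fun j => 2 * (2 * j%:R + o%:R) ^+ e).
  apply: binpoly_ext (binpolyZ (2 ^+ e.+1) (binpoly_powX e (o%:R / 2))) => j.
  by rewrite exprS -mulrA -exprMn; congr (_ * _ ^+ _); field.
have h := binpoly_conv pw hg.
have [/andP[/eqP e0 oo]|ne] := boolP ((e == 0)%N && ~~ o); last first.
  apply: binpoly_ext h => K; apply: eq_bigr => j _; congr (_ * _); rewrite /layer.
  case: eqP => [->|_] //=; case: ifP => // oo; move: ne; rewrite oo andbT => e0.
  by rewrite (negbTE oo) mulr0 addr0 !expr0n (negbTE e0) !mulr0.
have g1 : binpoly (e + b).+1 0 g by apply: (binpoly_lowern _ hg); rewrite e0.
have := binpolyD h (binpolyZ (-1) g1); rewrite mulr0 addr0; apply: binpoly_ext => K.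
rewrite /conv !big_ord_recl /= subn0 /layer (negbTE oo) e0 !expr0 /= !mulr1.
have -> : \sum_(i < K) 2 * g (K - bump 0 i)%N = \sum_(i < K) (2 : rat) * (2 * (bump 0 i)%:R + 0) ^+ 0 * g (K - bump 0 i)%N.
  by apply: eq_bigr => i _; rewrite expr0 mulr1.
under eq_bigr => i _ do rewrite expr0 mulr1.
by ring.
Qed.

Definition layers (es : seq nat) : nat -> rat := foldr (fun e f => conv (layer e) f) (fun=> 1) es.

Lemma binpoly_layers es : binpoly (\sum_(e <- es) e.+1)%N (\prod_(e <- es) (2 ^+ e.+1 * e`!%:R)) (layers es).
Proof.
elim: es => [|e es IH].
  by rewrite !big_nil; apply: binpoly_ext (binpoly_bin 0) => k; rewrite bin0.
by rewrite !big_cons addSn; exact: binpoly_layer.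
Qed.

End Convolution.

(** * Squared determinants summed over a simplex *)

Section LatticeSum.
Variables (r : nat) (o : bool).
Local Notation rho2 := (rho2 r o).
Local Notation layer := (layer o).
Local Notation layers := (layers o).

(** The [j] such that [2 x] lies at distance [2 j + o] from the doubled centre [2 L + o] of the
    box. *)
Definition half_dist L x : nat := if (L + o <= x)%N then (x - (L + o))%N else (L - x)%N.

Lemma half_distE L x : `|2 * x%:Z - (2 * L + o)%N%:Z| = (2 * half_dist L x + o)%N%:Z.
Proof. by rewrite /half_dist; case: (o) => /=; case: ifP; lia. Qed.

Lemma count_half_dist L j : (j <= L)%N ->
  (\sum_(x < (2 * L + o).+1) (half_dist L x == j) = if (j == 0) && ~~ o then 1 else 2)%N.
Proof.
move=> jL; have l1 : (L - j < (2 * L + o).+1)%N by lia.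
have l2 : (L + o + j < (2 * L + o).+1)%N by lia.
have h1 : half_dist L (L - j) = j by rewrite /half_dist; case: ifP; case: (o) => /=; lia.
have h2 : half_dist L (L + o + j) = j by rewrite /half_dist; case: ifP; lia.
have other x : half_dist L x = j -> x = (L - j)%N \/ x = (L + o + j)%N.
  by rewrite /half_dist; case: ifP; lia.
rewrite (bigD1 (Ordinal l1)) //= h1 eqxx; case: ifP => [/andP[/eqP j0 oo]|jo].
  rewrite big1 ?addn0 // => x xl; apply/eqP; rewrite eqb0; apply/eqP => hx; case/eqP: xl.
  apply: val_inj; rewrite /= j0 subn0; case: (other _ hx) => ->; rewrite j0 ?(negbTE oo); lia.
rewrite (bigD1 (Ordinal l2)) //=; last by rewrite -val_eqE /=; move: jo; case: (o) => /=; lia.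
rewrite h2 eqxx big1 // => x /andP[x1 x2]; apply/eqP; rewrite eqb0; apply/eqP => hx.
by case: (other _ hx) => e; [case/eqP: x1|case/eqP: x2]; apply: val_inj.
Qed.

(** Generating functions: the sum is the coefficient of ['X^M] in a product of one polynomial per
    coordinate with a truncated geometric series, which turns an equation on the total into an
    inequality. Up to degree [L] the box contains the layers entirely. *)
Lemma sum_layers L M (e : 'I_r -> nat) : (M <= L)%N ->
  \sum_(g : {ffun 'I_r -> 'I_(2 * L + o).+1} | (\sum_i half_dist L (g i) <= M)%N)
    \prod_i (2 * (half_dist L (g i))%:R + o%:R) ^+ e i = layers [seq e i | i <- index_enum 'I_r] M.
Proof.
move=> ML; pose t := half_dist L.
pose a i : {poly rat} := \sum_(x < (2 * L + o).+1) ((2 * (t x)%:R + o%:R) ^+ e i) *: 'X^(t x).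
pose geo : {poly rat} := \poly_(j < L.+1) 1.
have aE i j : (j <= L)%N -> (a i)`_j = layer (e i) j.
  move=> jL; rewrite coef_sum /layer.
  rewrite (eq_bigr (fun x : 'I_(2 * L + o).+1 => (2 * j%:R + o%:R) ^+ e i * (t x == j)%:R)).
    rewrite -mulr_sumr -natr_sum count_half_dist // mulrC; congr (_ * _); by case: ifP.
  by move=> x _; rewrite coefZ coefXn eq_sym; case: eqP => [->|_]; rewrite ?mulr0.
have step (s : seq 'I_r) m : (m <= L)%N -> ((\prod_(i <- s) a i) * geo)`_m = layers [seq e i | i <- s] m.
  elim: s m => [|i s IH] m mL; first by rewrite big_nil mul1r coef_poly ltnS mL.
  rewrite big_cons -mulrA coefM /= /conv; apply: eq_bigr => j _.
  have jm : (j <= m)%N by rewrite -ltnS.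
  by rewrite aE ?(leq_trans jm) // IH // (leq_trans (leq_subr _ _)).
rewrite -step // /a bigA_distr_bigA mulr_suml coef_sum big_mkcond; apply: eq_bigr => g _ /=.
rewrite scaler_prod -(big_morph (fun e => 'X^e) (exprD 'X) (expr0 'X)) -scalerAl coefZ coefXnM.
rewrite coef_poly -/t ltnNge; case: ifP => _ /=; last by rewrite mulr0.
by rewrite ltnS (leq_trans (leq_subr _ _) ML) mulr1.
Qed.

Definition lattice_dim (t : 'I_r -> nat) : rat := \det (\matrix_(i, j < r) (2 * (t i)%:R + o%:R) ^+ rho2 j).

Lemma sum_lattice_dim L M : (M <= L)%N ->
  \sum_(g : {ffun 'I_r -> 'I_(2 * L + o).+1} | (\sum_i half_dist L (g i) <= M)%N)
    lattice_dim (fun i => half_dist L (g i)) ^+ 2 =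
  \sum_(s : 'S_r) \sum_(u : 'S_r) (-1) ^+ s * (-1) ^+ u *
    layers [seq (rho2 (s i) + rho2 (u i))%N | i <- index_enum 'I_r] M.
Proof.
move=> ML; under [RHS]eq_bigr => s _ do under eq_bigr => u _ do
  rewrite -(sum_layers (fun i => rho2 (s i) + rho2 (u i))%N ML) mulr_sumr.
under [RHS]eq_bigr => s _ do rewrite exchange_big.
rewrite [RHS]exchange_big /=; apply: eq_bigr => g _.
rewrite expr2 {1}/lattice_dim /determinant mulr_suml; apply: eq_bigr => s _.
rewrite /lattice_dim /determinant mulr_sumr; apply: eq_bigr => u _.
rewrite mulrACA; congr (_ * _); rewrite -big_split; apply: eq_bigr => i _ /=.
by rewrite !mxE exprD.
Qed.

Lemma sum_perm_fact (G : 'I_r -> 'I_r -> rat) :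
  \sum_(s : 'S_r) \sum_(u : 'S_r) (-1) ^+ s * (-1) ^+ u * \prod_i G (s i) (u i) =
  r`!%:R * \det (\matrix_(i, j) G i j).
Proof.
transitivity (\sum_(s : 'S_r) \det (\matrix_(i, j) G i j)); last first.
  by rewrite sumr_const card_Sn mulr_natl.
apply: eq_bigr => s _; rewrite (reindex_inj (mulgI s)) /determinant; apply: eq_bigr => v _.
rewrite odd_permM signr_addb mulrA -signr_addb addbb mul1r; congr (_ * _).
rewrite [RHS](reindex_inj (@perm_inj _ s)); apply: eq_bigr => i _ /=.
by rewrite mxE permM.
Qed.

Let dd := (\sum_(i < r) (rho2 i + rho2 i).+1)%N.

(** All pairs of permutations give the same degree [dd], since only the sum of the exponents enters;
    their leading coefficients resum to a determinant by [sum_perm_fact]. *)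
Lemma binpoly_lattice : binpoly dd
  (2 ^+ dd * r`!%:R * \det (\matrix_(i, j < r) ((rho2 i + rho2 j)`!%:R : rat)))
  (fun M => \sum_(s : 'S_r) \sum_(u : 'S_r) (-1) ^+ s * (-1) ^+ u *
    layers [seq (rho2 (s i) + rho2 (u i))%N | i <- index_enum 'I_r] M).
Proof.
have ddE (s u : 'S_r) : (\sum_(i < r) (rho2 (s i) + rho2 (u i)).+1 = dd)%N.
  rewrite /dd; under eq_bigr => i _ do rewrite -addn1.
  under [RHS]eq_bigr => i _ do rewrite -addn1.
  rewrite !big_split /= [X in (_ + _ + X)%N]big_const_ord; congr (_ + _ + _)%N.
  - by rewrite [RHS](reindex_inj (@perm_inj _ s)).
  - by rewrite [RHS](reindex_inj (@perm_inj _ u)).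
  by rewrite big_const_ord.
rewrite -mulrA -sum_perm_fact mulr_sumr.
apply: binpoly_sum => s; rewrite mulr_sumr; apply: binpoly_sum => u.
have := binpolyZ ((-1) ^+ s * (-1) ^+ u) (binpoly_layers o [seq (rho2 (s i) + rho2 (u i))%N | i <- index_enum 'I_r]).
rewrite !big_map ddE big_split /= -(big_morph (fun e => 2 ^+ e) (exprD 2) (expr0 2)) ddE.
by rewrite mulrCA.
Qed.

Lemma rho2E (i : 'I_r) : rho2 i = (2 * (r - i.+1) + o)%N.
Proof. by rewrite /rho2 /wexp; have := ltn_ord i; case: (o) => /=; lia. Qed.

Lemma rho2_rev (i : 'I_r) : rho2 (rev_ord i) = (2 * i + o)%N.
Proof. by rewrite rho2E /=; have := ltn_ord i; lia. Qed.

Lemma sum_rho2 : (\sum_(i < r) rho2 i = 2 * 'C(r, 2) + r * o)%N.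
Proof.
rewrite (reindex_inj rev_ord_inj) /=; under eq_bigr => i _ do rewrite rho2_rev.
by rewrite big_split /= -big_distrr /= -(big_mkord xpredT id) bin2_sum sum_nat_const card_ord.
Qed.

Lemma double_bin2 m : (2 * 'C(m, 2) = m * m.-1)%N.
Proof.
elim: m => [|m IH]; first by rewrite bin0n.
by rewrite binS bin1 mulnDr IH; case: (m) => [|k] //=; nia.
Qed.

Lemma ddE2 : dd = ((r.*2 + o) * (r.*2 + o).-1 %/ 2)%N.
Proof.
rewrite /dd; under eq_bigr => i _ do rewrite -addn1.
rewrite !big_split /= !sum_rho2 sum_nat_const card_ord muln1.
have h := double_bin2 r.
have e : ((r.*2 + o) * (r.*2 + o).-1 = 2 * (2 * (2 * 'C(r, 2) + r * o) + r))%N.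
  by rewrite h; case: (r) => [|r1]; case: (o) => /=; nia.
by rewrite e mulKn //; lia.
Qed.

Lemma prod_ascending c m : (\prod_(b < m) (c + b.+1) * c`! = (c + m)`!)%N.
Proof.
elim: m => [|m IH]; first by rewrite big_ord0 mul1n addn0.
by rewrite big_ord_recr /= mulnAC IH addnS factS mulnC.
Qed.

(** For even n each row [a > 0] of the Vandermonde product in [lattice_dim_rho] yields only half of
    [4 ^ a (2 a)!]; [kappa] counts these halves. *)
Let kappa : nat := if o then 0 else r.-1.

(* The argument is twice the half sum of the positive roots, as 2 (r - i.+1) + o = rho2 i. *)
Lemma lattice_dim_rho : lattice_dim (fun i => (r - i.+1)%N) * 2 ^+ kappa =
  2 ^+ (r * r.-1) * \prod_(i < r) (rho2 i)`!%:R.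
Proof.
pose y (i : 'I_r) : rat := 2 * i%:R + o%:R.
have -> : lattice_dim (fun i => (r - i.+1)%N) = \det (\matrix_(i, j < r) y i ^+ (2 * j + o)).
  pose rp : 'S_r := perm rev_ord_inj.
  have -> : \matrix_(i, j < r) y i ^+ (2 * j + o) =
    row_perm rp (col_perm rp (\matrix_(i, j < r) (2 * (r - i.+1)%:R + o%:R) ^+ rho2 j)).
    by apply/matrixP => i j; rewrite !mxE !permE rho2_rev /= subnS subKn ?(ltnW (ltn_ord i)) // /y; congr ((_ * _%:R + _) ^+ _); have := ltn_ord i; lia.
  by rewrite row_permE col_permE !det_mulmx !det_perm odd_permV mulrCA -signr_addb addbb mulr1.
have -> : \matrix_(i, j < r) y i ^+ (2 * j + o) =
    diag_mx (\row_i y i ^+ o) *m (Vandermonde r (\row_i y i ^+ 2))^T.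
  by apply/matrixP => i j; rewrite mul_diag_mx !mxE addnC exprD exprM.
rewrite det_mulmx det_diag det_tr det_Vandermonde.
have -> : \prod_(i < r) \prod_(j < r | (i < j)%N) ((\row_i0 y i0 ^+ 2) 0 j - (\row_i0 y i0 ^+ 2) 0 i) =
   \prod_(a < r) \prod_(b < r | (b < a)%N) (4 * (a%:R - b%:R) * (a%:R + b%:R + o%:R)) :> rat.
  rewrite (exchange_big_dep predT) //=; apply: eq_bigr => a _; apply: eq_bigr => b _.
  by rewrite !mxE /y; ring.
rewrite -big_split /=.
have ga (a : 'I_r) : (\row_i y i ^+ o) 0 a * \prod_(b < r | (b < a)%N) (4 * (a%:R - b%:R) * (a%:R + b%:R + o%:R)) *
    2 ^+ (~~ o && (0 < a)%N) = 4 ^+ a * (2 * a + o)`!%:R :> rat.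
  rewrite (big_ord_narrow (ltnW (ltn_ord a))) /= mxE big_split /= big_split /= prodr_const card_ord.
  have -> : \prod_(b < a) (a%:R - b%:R) = a`!%:R :> rat.
    rewrite fact_prod big_add1 /= big_mkord natr_prod (reindex_inj rev_ord_inj); apply: eq_bigr => b _ /=.
    by rewrite -natrB; [congr (_%:R); have := ltn_ord b; lia | have := ltn_ord b; lia].
  rewrite /y; move: (nat_of_ord a) => m.
  have [oo|oo] : o \/ ~~ o by case: (o); [left|right].
    rewrite oo /= expr0 mulr1 expr1.
    have h := congr1 (fun x => x%:R : rat) (prod_ascending m m); rewrite /= natrM natr_prod in h.
    rewrite (eq_bigr (fun b : 'I_m => (m + b.+1)%:R)) => [|b _]; last by rewrite /= -!natrD; congr (_%:R); lia.
    have -> : (2 * m + 1)`!%:R = (2 * m%:R + 1) * (m + m)`!%:R :> rat.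
      rewrite (_ : (2 * m + 1)%N = (m + m).+1); last by lia.
      by rewrite factS natrM -[X in X * _ = _]natr1 natrD; congr (_ * _); ring.
    rewrite -h.
    by move: (\prod_(b < m) _) (4 ^+ m) (m`!%:R : rat) => u v w; ring.
  rewrite (negbTE oo) /= expr0 mul1r addn0; case: m => [|m].
    by rewrite !big_ord0 !expr0 !mul1r.
  have h := congr1 (fun x => x%:R : rat) (prod_ascending m m.+1); rewrite /= natrM natr_prod in h.
  rewrite (eq_bigr (fun b : 'I_m.+1 => (m + b.+1)%:R)) => [|b _]; last first.
    by rewrite addr0 -natrD; congr (_%:R); lia.
  rewrite (_ : (2 * m.+1)%N = (m + m.+1).+1) ?factS ?natrM; last by lia.
  rewrite -h expr1 (_ : (m + m.+1).+1%:R = 2 * m.+1%:R :> rat); last first.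
    by rewrite -natrM; congr (_%:R); lia.
  by move: (\prod_(b < m.+1) _) (4 ^+ m.+1) (m`!%:R : rat) (m.+1%:R : rat) => u v w z; ring.
have kE : (kappa = \sum_(a < r) (~~ o && (0 < a)))%N.
  rewrite /kappa; case: (o) => /=; first by rewrite big1.
  case: (r) => [|k]; first by rewrite big_ord0.
  by rewrite big_ord_recl /= add0n sum_nat_const card_ord muln1.
rewrite kE (big_morph (fun e => 2 ^+ e) (exprD (2 : rat)) (expr0 2)) -big_split /=.
rewrite (eq_bigr _ (fun a _ => ga a)) big_split /=; congr (_ * _).
  rewrite -double_bin2 (eq_bigr (fun a : 'I_r => 2 ^+ (2 * a))) => [|a _]; last by rewrite exprM expr2 -natrM.
  rewrite -(big_morph (fun e => 2 ^+ e) (exprD (2 : rat)) (expr0 2)) -big_distrr /=.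
  by rewrite -(big_mkord xpredT id) bin2_sum.
rewrite [RHS](reindex_inj rev_ord_inj) /=; apply: eq_bigr => a _.
by rewrite -[(2 * _ + _)%N]rho2_rev.
Qed.

Lemma distinct_sum (f : 'I_r -> nat) (A : {set 'I_r}) : {in A &, injective f} ->
  ('C(#|A|, 2) <= \sum_(i in A) f i)%N.
Proof.
have [k] := ubnP #|A|; elim: k A => // k IH A; rewrite ltnS => Ak injf.
have [->|[x xA]] := set_0Vmem A; first by rewrite cards0 bin0n.
case: (@arg_maxnP _ x (mem A) f xA) => i iA imax.
have cA : (#|A| <= (f i).+1)%N.
  rewrite -[(f i).+1]card_ord -(card_in_imset (f := fun x => inord (f x) : 'I_(f i).+1)); first exact: max_card.
  have le y : y \in A -> (f y < (f i).+1)%N by move=> yA; rewrite ltnS; exact: imax.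
  by move=> a b aA bA /(congr1 val); rewrite /= !inordK ?le //; exact: injf.
have iA' : i \in A by [].
rewrite (big_setD1 i) //= (cardsD1 i A) iA' add1n binS bin1.
have := IH (A :\ i)%SET; rewrite (cardsD1 i A) iA' in Ak cA * => /(_ Ak) h.
have {}h := h (fun a b ha hb => injf a b (fintype.subsetP (subD1set A i) _ ha) (fintype.subsetP (subD1set A i) _ hb)).
by rewrite addnC; apply: leq_add => //; rewrite add1n ltnS in cA.
Qed.

Lemma distinct_sum1 (f : 'I_r -> nat) i0 : injective f -> (f i0 + 'C(r.-1, 2) <= \sum_i f i)%N.
Proof.
move=> injf; rewrite (bigD1 i0) //= leq_add2l.
have := @distinct_sum f [set~ i0]%SET (fun a b _ _ => @injf a b).
rewrite cardsC1 card_ord => /leq_trans; apply; apply: eq_leq; apply: eq_bigl => i.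
by rewrite !inE.
Qed.

Lemma sign_lattice_dim (nu : 'I_r -> int) (t : 'I_r -> nat) :
  (forall i, `|nu i| = (2 * t i + o)%N%:Z) ->
  (\det (\matrix_(i, j < r) ((nu i)%:~R : rat) ^+ rho2 j)) ^+ 2 = lattice_dim t ^+ 2.
Proof.
move=> ht; pose b i := (nu i < 0)%R.
have -> : \matrix_(i, j < r) ((nu i)%:~R : rat) ^+ rho2 j =
    diag_mx (\row_i (-1) ^+ (b i && o)) *m \matrix_(i, j < r) (2 * (t i)%:R + o%:R) ^+ rho2 j.
  apply/matrixP => i j; rewrite mul_diag_mx !mxE.
  have -> : (nu i)%:~R = (-1) ^+ (b i) * (2 * (t i)%:R + o%:R) :> rat.
    have <- : (`|nu i|%:~R : rat) = 2 * (t i)%:R + o%:R by rewrite ht -natrM -natrD.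
    by rewrite {1}(realEsign (num_real (nu i))) rmorphM rmorphXn rmorphN1.
  rewrite exprMn; congr (_ * _); rewrite rho2E -exprM; case: (b i); rewrite ?mul0n ?expr0 //= mul1n.
  by rewrite exprD exprM sqrrN !expr1n mul1r.
rewrite det_mulmx exprMn det_diag expr2 -big_split big1 ?mul1r // => i _.
by rewrite /= !mxE; case: (b i && o); rewrite /= ?expr0 ?expr1 ?mulrNN mulr1.
Qed.

Lemma lattice_dim_inj t : lattice_dim t != 0 -> injective t.
Proof.
move=> dt a c e; apply/eqP; apply: contraT => ac; case/eqP: dt.
by apply: (determinant_alternate ac) => j; rewrite !mxE e.
Qed.

(** The bound [K + 'C(r, 2)] can exceed the half-width of the original box, whereas [sum_layers]
    needs a box at least as wide. Nothing is added: nonzero determinants have distinct distances,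
    and with one coordinate outside the original box their sum is too large. *)
Lemma sum_box K L : (K + r + 'C(r, 2) <= L)%N ->
  \sum_(g : box r o K | \sum_i `|box_wt g i| <= 2 * K%:Z + \sum_(i < r) (rho2 i)%:Z)
    (\det (\matrix_(i, j < r) ((box_wt g i)%:~R : rat) ^+ rho2 j)) ^+ 2 =
  \sum_(g : {ffun 'I_r -> 'I_(2 * L + o).+1} | (\sum_i half_dist L (g i) <= K + 'C(r, 2))%N)
    lattice_dim (fun i => half_dist L (g i)) ^+ 2.
Proof.
move=> KL; pose q := wexp r o; pose D := (L - (K + r.-1))%N.
have qE (i : 'I_r) : (2 * K + q + 2 * D = 2 * L + o)%N.
  by rewrite /q /wexp /D; have := ltn_ord i; case: (o) => /=; lia.
pose inr (g : {ffun 'I_r -> 'I_(2 * L + o).+1}) := [forall i, (D <= g i) && (g i <= D + (2 * K + q))]%N.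
rewrite [RHS](bigID inr) /= [X in _ = _ + X]big1 ?addr0; last first.
  move=> g /andP[sg]; rewrite negb_forall => /existsP[i0 gi0].
  apply/eqP; rewrite sqrf_eq0; apply: contraT => /lattice_dim_inj/(distinct_sum1 i0) h.
  have h2 := leq_trans h sg; have := half_distE L (g i0); have := qE i0; have := ltn_ord i0.
  have b1 : ('C(r, 2) = 'C(r.-1, 2) + r.-1)%N.
    have r0 : (0 < r)%N by exact: leq_ltn_trans (ltn_ord i0).
    by rewrite -{1}(prednK r0) binS bin1.
  move: h2 gi0; rewrite b1 /half_dist /D; move: (nat_of_ord (g i0)) => x; clear - KL b1; case: ifP; case: (o) => /=; lia.
pose h (g : box r o K) : {ffun 'I_r -> 'I_(2 * L + o).+1} := [ffun i => inord (g i + D)].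
pose h' (g : {ffun 'I_r -> 'I_(2 * L + o).+1}) : box r o K := [ffun i => inord (g i - D)].
have hE (g : box r o K) i : h g i = (g i + D)%N :> nat.
  by rewrite ffunE inordK //; have := ltn_ord (g i); have := qE i; rewrite /q; move: (nat_of_ord (g i)) => x; lia.
have h'E g i : inr g -> h' g i = (g i - D)%N :> nat.
  move=> /forallP/(_ i) gi; rewrite ffunE inordK //.
  by move: gi; rewrite /q; move: (nat_of_ord (g i)) => x; lia.
rewrite [RHS](reindex_onto h h') /=; last first.
  move=> g /andP[_ ig]; apply/ffunP => i; apply: val_inj; rewrite /= hE h'E // subnK //.
  by have /forallP/(_ i)/andP[] := ig.
have inrh g : inr (h g).
  apply/forallP => i; rewrite hE leq_addl /=; have := ltn_ord (g i).
  by rewrite /q; move: (nat_of_ord (g i)) => x; lia.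
have hK g : h' (h g) = g.
  by apply/ffunP => i; apply: val_inj; rewrite /= h'E // hE addnK.
have wE g i : `|box_wt g i| = (2 * half_dist L (h g i) + o)%N%:Z.
  rewrite -half_distE hE /box_wt; congr `|_|; have := qE i; rewrite /q.
  by move: (nat_of_ord (g i)) => x; lia.
apply: eq_big => g; last by move=> _; exact: sign_lattice_dim.
rewrite inrh hK eqxx !andbT (eq_bigr _ (fun i _ => wE g i)).
rewrite -!(big_morph Posz PoszD (erefl 0%:Z)) sum_rho2 big_split /= -big_distrr /= sum_nat_const card_ord.
by apply/idP/idP; lia.
Qed.

Let fact_det : rat := \det (\matrix_(i, j < r) ((rho2 i + rho2 j)`!%:R : rat)).
Let fact_prod : rat := \prod_(i < r) (rho2 i)`!%:R.

Lemma binomial_det : fact_det =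
  fact_prod ^+ 2 * \det (\matrix_(i, j < r) ('C(rho2 i + rho2 j, rho2 i)%:R : rat)).
Proof.
have -> : fact_det = \det (diag_mx (\row_i (rho2 i)`!%:R) *m
   (\matrix_(i, j < r) ('C(rho2 i + rho2 j, rho2 i)%:R : rat)) *m diag_mx (\row_i (rho2 i)`!%:R)).
  congr (\det _); apply/matrixP => i j; rewrite mul_mx_diag mxE mul_diag_mx !mxE -!natrM.
  congr (_%:R); have := bin_fact (leq_addr (rho2 j) (rho2 i)); rewrite addKn => <-; nia.
rewrite !det_mulmx !det_diag expr2 mulrAC; congr (_ * _ * _).
  by apply: eq_bigr => i _; rewrite mxE.
by apply: eq_bigr => i _; rewrite mxE.
Qed.

Lemma fact_prod_neq0 : fact_prod != 0.
Proof. by apply/prodf_neq0 => i _; rewrite pnatr_eq0 -lt0n fact_gt0. Qed.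

(** Vandermonde's convolution writes the matrix as [B *m B^T] with the binomials ['C(rho2 i, k)] in
    [B], a Gram matrix over [rat]. The rows of [B] are independent because the [rho2 i] are
    distinct. *)
Lemma binomial_det_neq0 : \det (\matrix_(i, j < r) ('C(rho2 i + rho2 j, rho2 i)%:R : rat)) != 0.
Proof.
pose q := wexp r o; have rq i : (rho2 i <= q)%N by exact: leq_subr.
pose B : 'M[rat]_(r, q.+1) := \matrix_(i, k) 'C(rho2 i, k)%:R.
have -> : \matrix_(i, j < r) ('C(rho2 i + rho2 j, rho2 i)%:R : rat) = B *m B^T.
  apply/matrixP => i j; rewrite !mxE addnC -binomial.Vandermonde.
  rewrite (big_ord_widen q.+1 (fun k => 'C(rho2 j, k) * 'C(rho2 i, rho2 i - k))%N) ?ltnS ?rq //.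
  rewrite natr_sum big_mkcond; apply: eq_bigr => k _; rewrite !mxE -natrM mulnC.
  case: ifP => [ki|/negbT]; first by rewrite bin_sub.
  by rewrite -leqNgt => ki; rewrite [X in (X * _)%N]bin_small.
apply/negP => /det0P[v v0]; rewrite mulmxA => /(congr1 (fun M => M *m v^T)).
rewrite mul0mx -mulmxA -trmx_mul => vBB.
have vB k : (v *m B) 0 k = 0.
  have /matrixP/(_ 0 0) := vBB; rewrite mxE [RHS]mxE => h.
  have /psumr_eq0P : \sum_k (v *m B) 0 k ^+ 2 = 0.
    by rewrite -[RHS]h; apply: eq_bigr => l _; rewrite [X in _ * X]mxE expr2.
  move=> /(_ (fun _ _ => sqr_ge0 _) k isT) /eqP; by rewrite sqrf_eq0 => /eqP.
case/eqP: v0; apply/rowP => i; rewrite [RHS]mxE.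
have [k] := ubnP (i : nat); elim: k i => // k IH i; rewrite ltnS => ik.
have ri : (rho2 i < q.+1)%N by rewrite ltnS.
have := vB (Ordinal ri); rewrite mxE (bigD1 i) //= mxE binn mulr1 big1 ?addr0 // => l li.
rewrite mxE /=; have [il|il] := ltnP l i; first by rewrite IH ?mul0r // (leq_trans il).
have lt : (rho2 l < rho2 i)%N.
  rewrite !rho2E; have := ltn_ord l; have : (i < l)%N by rewrite ltn_neqAle il eq_sym andbT.
  by lia.
by rewrite bin_small ?mulr0.
Qed.

Variable F : numClosedFieldType.

Theorem binpoly_weyl (h : nat -> nat) : (0 < r + o)%N ->
  (forall K, 2 ^+ r * r`!%:R * (weyl_dim o (fun i : 'I_r => (rho2 i)%:R) : F) ^+ 2 * (h K)%:R =
  wmult F o * \sum_(g : box r o K | \sum_i `|box_wt g i| <= 2 * K%:Z + \sum_(i < r) (rho2 i)%:Z)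
    box_dim F g ^+ 2) ->
  binpoly ((r.*2 + o) * (r.*2 + o).-1 %/ 2)
    (2 ^+ (r.*2 + o).-1 * \det (\matrix_(i, j < r) ('C(rho2 i + rho2 j, rho2 i)%:R : rat)))
    (fun K => (h K)%:R).
Proof.
move=> ro hF; pose rho := lattice_dim (fun i => (r - i.+1)%N).
pose wm : rat := if o then 1 else 2.
pose LS M := \sum_(s : 'S_r) \sum_(u : 'S_r) (-1) ^+ s * (-1) ^+ u *
    layers [seq (rho2 (s i) + rho2 (u i))%N | i <- index_enum 'I_r] M.
have rd (M : 'M[rat]_r) : ratr (\det M) = \det (map_mx (@ratr F) M) by rewrite det_map_mx.
have hQ K : 2 ^+ r * r`!%:R * rho ^+ 2 * (h K)%:R = wm * LS (K + 'C(r, 2))%N.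
  apply: (fmorph_inj (@ratr F)); rewrite !rmorphM !rmorphXn /= !ratr_nat.
  have -> : ratr rho = weyl_dim o (fun i : 'I_r => (rho2 i)%:R) :> F.
    rewrite rd /weyl_dim; congr (\det _); apply/matrixP => i j.
    rewrite !mxE rmorphXn /=; congr (_ ^+ _).
    by rewrite [rho2 i]rho2E natrD natrM rmorphD rmorphM /= !ratr_nat.
  have -> : ratr wm = wmult F o by rewrite /wm /wmult; case: (o); rewrite ?rmorph1 ?ratr_nat.
  rewrite hF; congr (_ * _).
  rewrite /LS -(sum_lattice_dim (L := (K + r + 'C(r, 2))%N)); last by lia.
  rewrite -sum_box // rmorph_sum; apply: eq_bigr => g _ /=.
  rewrite rmorphXn /= rd /box_dim /weyl_dim; congr (\det _ ^+ 2); apply/matrixP => i j.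
  by rewrite !mxE rmorphXn /= ratr_int.
have rho0 : rho != 0.
  have := lattice_dim_rho; rewrite -/rho => e; apply: contraTneq (oner_neq0 rat) => r0.
  have : (2 : rat) ^+ (r * r.-1) * fact_prod != 0.
    by rewrite mulf_neq0 ?fact_prod_neq0 // expf_neq0 // pnatr_eq0.
  by rewrite -/fact_prod in e; rewrite -e r0 mul0r eqxx.
pose c := 2 ^+ r * r`!%:R * rho ^+ 2.
have c0 : c != 0.
  by rewrite /c !mulf_neq0 ?expf_neq0 ?pnatr_eq0 // -lt0n fact_gt0.
have hb := binpolyZ (c^-1 * wm) (binpoly_shift 'C(r, 2) binpoly_lattice).
rewrite ddE2 in hb; have {}hb := binpoly_ext (g := fun K => (h K)%:R) _ hb.
set lead := _ * _ in hb *; suff -> : 2 ^+ (r.*2 + o).-1 * \det (\matrix_(i, j < r) ('C(rho2 i + rho2 j, rho2 i)%:R : rat)) =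
   c^-1 * wm * (2 ^+ ((r.*2 + o) * (r.*2 + o).-1 %/ 2) * r`!%:R * fact_det).
  by apply: hb => K; rewrite -mulrA -hQ mulKf.
rewrite binomial_det; move: (\det _) => dt {hb lead}.
have e := lattice_dim_rho; rewrite -/rho -/fact_prod in e.
have k0 : (2 : rat) ^+ kappa != 0 by rewrite expf_neq0 ?pnatr_eq0.
apply: (mulfI c0); rewrite !mulrA mulfV // mul1r.
apply: (mulfI (expf_neq0 2 k0)).
have -> : c = 2 ^+ r * r`!%:R * rho ^+ 2 by [].
have -> : (2 ^+ kappa) ^+ 2 * (2 ^+ r * r`!%:R * rho ^+ 2 * 2 ^+ (r.*2 + o).-1 * dt) =
   (rho * 2 ^+ kappa) ^+ 2 * (2 ^+ r * 2 ^+ (r.*2 + o).-1) * (r`!%:R * dt).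
  by move: ((2 : rat) ^+ kappa) ((2 : rat) ^+ r) ((2 : rat) ^+ _) (r`!%:R : rat) => x y z t; ring.
rewrite e exprMn.
(* The powers of 2 balance: with [n = 2 r + o], [2 r (r - 1) + r + (n - 1)] equals
   [2 kappa + n (n - 1) / 2], plus 1 for even n. *)
have key : (2 ^+ (r * r.-1)) ^+ 2 * (2 ^+ r * 2 ^+ (r.*2 + o).-1) =
    (2 ^+ kappa) ^+ 2 * (wm * 2 ^+ ((r.*2 + o) * (r.*2 + o).-1 %/ 2)) :> rat.
  have -> : wm = 2 ^+ (~~ o) by rewrite /wm; case: (o); rewrite ?expr0 ?expr1.
  rewrite -!exprM -!exprD; congr (2 ^+ _).
  have -> : ((r.*2 + o) * (r.*2 + o).-1 %/ 2 = dd)%N by rewrite ddE2.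
  have h2 : (2 * dd = (r.*2 + o) * (r.*2 + o).-1)%N.
    rewrite /dd; under eq_bigr => i _ do rewrite -addn1.
    rewrite !big_split /= !sum_rho2 sum_nat_const card_ord muln1 double_bin2.
    by case: (r) => [|r1]; case: (o) => /=; nia.
  move: h2 ro; rewrite /kappa; move: dd => d2; case: (r) => [|r1]; case: (o) => /=; nia.
move: key; move: ((2 : rat) ^+ (r * r.-1)) ((2 : rat) ^+ kappa) ((2 : rat) ^+ r) ((2 : rat) ^+ (r.*2 + o).-1)
  ((2 : rat) ^+ (_ %/ 2)) (r`!%:R : rat) fact_prod => x y z t u v w key.
transitivity (x ^+ 2 * (z * t) * (w ^+ 2 * v * dt)); first ring.
by rewrite key; ring.
Qed.

End LatticeSum.

(** * The degree of SO(n) *)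

Section LinearChange.
Variables (F : numClosedFieldType) (N : nat) (T T' : 'M[F]_N).
Hypotheses (TT : T *m T' = 1%:M) (TT' : T' *m T = 1%:M).
Implicit Types (p q : {mpoly F[N]}).

Definition lsub (S : 'M[F]_N) p : {mpoly F[N]} := p \mPo [tuple linform (col i S) | i < N].

Lemma lsubE S p x : mpoly_at (lsub S p) x = mpoly_at p (x *m S).
Proof.
rewrite /mpoly_at comp_mpoly_meval; apply: meval_eq => i; rewrite tnth_mktuple linformE !mxE.
by apply: eq_bigr => k _; rewrite !mxE.
Qed.

Lemma lsub_size S p k : (msize p <= k.+1)%N -> (msize (lsub S p) <= k.+1)%N.
Proof.
move=> sp; rewrite (mpoly_monE sp) /lsub raddf_sum /=; apply: msize_sum_leq => t.
rewrite linearZ /=; apply: leq_trans (msizeZ_le _ _) _; rewrite comp_mpolyX.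
apply: leq_trans (msize_prod_leq (a := fun i => (1 * mon_mnm t i)%N) _ _) _.
  by move=> i; apply: msizeXn_leq; rewrite tnth_mktuple; exact: msize_linform.
by under eq_bigr => i _ do rewrite mul1n; rewrite -mdegE ltnS mdeg_mon.
Qed.

Variables (X Y : set 'rV[F]_N).
Hypothesis XY : forall x, X x <-> Y (x *m T).

Let YX y : Y y -> X (y *m T'). Proof. by move=> Yy; apply/XY; rewrite -mulmxA TT' mulmx1. Qed.

Lemma irreducible_linear : irreducible_on Y -> irreducible_on X.
Proof.
have v S p (U V : set 'rV[F]_N) : (forall x, U x -> V (x *m S)) -> vanish V p -> vanish U (lsub S p).
  by move=> UV vp x Ux; rewrite lsubE vp //; exact: UV.
have back p : vanish Y (lsub T' p) -> vanish X p.
  move=> vp x Xx; have := vp (x *m T) (proj1 (XY x) Xx).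
  by rewrite lsubE -mulmxA TT mulmx1.
move=> irr p q pq; have [|h|h] := irr (lsub T' p) (lsub T' q); last 2 first.
- by left; exact: back.
- by right; exact: back.
by move=> y Yy; rewrite mpoly_atM !lsubE -mpoly_atM; apply: pq; exact: YX.
Qed.

Let indep_lsub (S S' : 'M[F]_N) (U V : set 'rV[F]_N) s (p : 'I_s -> {mpoly F[N]}) :
  (forall x, U x -> V (x *m S)) -> S *m S' = 1%:M -> indep_on U p -> indep_on V (fun i => lsub S' (p i)).
Proof.
move=> UV SS ip c vc; apply: ip => x Ux; rewrite -[RHS](vc _ (UV _ Ux)) !mpoly_at_sum.
by apply: eq_bigr => i _; rewrite !mpoly_atZ lsubE -mulmxA SS mulmx1.
Qed.

Lemma hilbert_linear k h : hilbert X k h -> hilbert Y k h.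
Proof.
move=> [[p sp ip] ub]; split.
  exists (fun i => lsub T' (p i)); first by move=> i; exact: lsub_size.
  by apply: (indep_lsub (S := T)) ip => // x /XY.
move=> s q sq iq; apply: (ub s (fun i => lsub T (q i))); first by move=> i; exact: lsub_size.
exact: (indep_lsub YX).
Qed.

End LinearChange.

(** * From the standard form to the antidiagonal one *)

Section Conjugation.
Variables (F : numClosedFieldType) (n' : nat).
Local Notation n := n'.+1.
Local Notation J := (antidiag F n').

(* (1 + i J)^2 = 2 i J. *)
Let alpha : F := sqrtC (2 * 'i)^-1.
Definition antidiag_root : 'M[F]_n := alpha *: (1%:M + 'i *: J).
Local Notation P := antidiag_root.

Lemma antidiag_root_sqr : P *m P = J.
Proof.
rewrite /P -scalemxAl -scalemxAr scalerA -expr2 sqrtCK mulmxDl !mulmxDr !mul1mx mulmx1.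
rewrite -!scalemxAl -!scalemxAr antidiagK scalerA -expr2 sqrCi scaleN1r.
have i0 : ('i : F) != 0 by exact: neq0Ci.
by apply/matrixP => i j; rewrite !mxE; field; rewrite ?i0.
Qed.

Lemma antidiag_root_tr : P^T = P.
Proof. by rewrite /P linearZ linearD linearZ /= trmx1 antidiag_tr. Qed.

Let unitP : P \in unitmx.
Proof.
by have := antidiag_unit F n'; rewrite -antidiag_root_sqr unitmx_mul => /andP[].
Qed.

Let Q : 'M[F]_n := invmx P.
Let QP : Q *m P = 1%:M. Proof. exact: mulVmx. Qed.
Let PQ : P *m Q = 1%:M. Proof. exact: mulmxV. Qed.

(** [P] is a symmetric square root of [J], so conjugation by it exchanges the two forms:
    [(Q A P)^T J (Q A P) = P A^T A P]. *)
Lemma SOm_SOJ A : SOm A <-> SOJ (Q *m A *m P).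
Proof.
have e : \det (Q *m A *m P) = \det A.
  by rewrite (det_mulmx (Q *m A)) (det_mulmx Q) mulrAC -det_mulmx QP det1 mul1r.
have tQ : Q^T = Q.
  by rewrite /Q trmx_inv antidiag_root_tr.
have QJQ : Q *m J *m Q = 1%:M by rewrite -antidiag_root_sqr !mulmxA QP mul1mx PQ.
have o : (Q *m A *m P)^T *m J *m (Q *m A *m P) = P *m (A^T *m A) *m P.
  rewrite !trmx_mul antidiag_root_tr tQ -!mulmxA; congr (P *m (_ *m _)).
  by rewrite !mulmxA QJQ mul1mx.
split=> -[dA oA]; split; rewrite ?e // -?e //.
  by rewrite o oA mulmx1 antidiag_root_sqr.
have : Q *m (P *m (A^T *m A) *m P) *m Q = Q *m J *m Q by rewrite -o oA.
by rewrite QJQ !mulmxA QP mul1mx -mulmxA PQ mulmx1.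
Qed.

Let T : 'M[F]_(n * n) := lin_mulmx Q *m lin_mulmxr P.
Let T' : 'M[F]_(n * n) := lin_mulmx P *m lin_mulmxr Q.

Let vT (A : 'M[F]_n) : mxvec A *m T = mxvec (Q *m A *m P).
Proof. by rewrite /T mulmxA !mul_vec_lin. Qed.
Let vT' (A : 'M[F]_n) : mxvec A *m T' = mxvec (P *m A *m Q).
Proof. by rewrite /T' mulmxA !mul_vec_lin. Qed.

Let row_ext (M : 'M[F]_(n * n)) : (forall A : 'M[F]_n, mxvec A *m M = mxvec A) -> M = 1%:M.
Proof.
move=> h; apply/row_matrixP => i; rewrite row1 rowE -[delta_mx 0 i]vec_mxK.
exact: h.
Qed.

Let TT : T *m T' = 1%:M.
Proof. by apply: row_ext => A; rewrite mulmxA vT vT' !mulmxA PQ mul1mx -mulmxA PQ mulmx1. Qed.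
Let TT' : T' *m T = 1%:M. Proof. exact: mulmx1C. Qed.

Let conj v : SOv v <-> SOJv (v *m T).
Proof. by rewrite /SOv /SOJv /= -{2}[v]vec_mxK vT mxvecK; exact: SOm_SOJ. Qed.

Let conj' v : SOJv v <-> SOv (v *m T').
Proof. by rewrite (conj (v *m T')) -mulmxA TT' mulmx1. Qed.

Lemma SOJ_irreducible : irreducible_on (@SOJv F n').
Proof. exact: (irreducible_linear TT' TT conj' (@SO_irreducible F n')). Qed.

Lemma SO_hilbert : exists h : nat -> nat, (forall k, hilbert (@SOv F n') k (h k)) /\
  binpoly ((n * n.-1) %/ 2) (2 ^+ n.-1 *
    \det (\matrix_(i, j < n./2) ('C(rho2 n./2 (odd n) i + rho2 n./2 (odd n) j, rho2 n./2 (odd n) i)%:R : rat)))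
    (fun k => (h k)%:R).
Proof.
have [h hP] := boolp.choice (fun K => so_dim K SOJ_irreducible); exists h; split.
  by move=> k; have [hk _] := hP k; exact: (hilbert_linear TT' TT conj' hk).
have nE : (n./2.*2 + odd n = n)%N by rewrite addnC odd_double_half.
have := @binpoly_weyl n./2 (odd n) F h; rewrite nE; apply; first by move: nE; lia.
by move=> K; have [_] := hP K.
Qed.

End Conjugation.

(* The matrix indices i, j start at 0, so i.+1, j.+1 range over 1 .. n./2;
   none of the natural-number subtractions truncates. *)
Theorem theorem1p1 (R : realType) (n : nat) (n_gt0 : (0 < n)%N) :
  exists2 D : nat, has_degree (SO_variety R n) D &
    D%:Z = 2 ^+ (n - 1) *
       \det (\matrix_(i < n./2, j < n./2)
         ('C(2 * n - 2 * i.+1 - 2 * j.+1, n - 2 * i.+1)%N)%:Z).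
Proof.
case: n n_gt0 => // n' _; set C := (\matrix_(_, _) _ : 'M[int]__).
have [h [hX hb]] := @SO_hilbert R[i] n'.
have SOE v : SO_variety R n'.+1 v <-> SOv v.
  split=> [[A SA <-]|Sv]; first by rewrite /SOv /= mxvecK.
  by exists (vec_mx v) => //; rewrite vec_mxK.
have SO_eq : SO_variety R n'.+1 = @SOv R[i] n' by apply/seteqP; split=> v /SOE.
pose M : 'M[rat]_((n'.+1)./2) := \matrix_(i, j)
  'C(rho2 n'.+1./2 (odd n'.+1) i + rho2 n'.+1./2 (odd n'.+1) j, rho2 n'.+1./2 (odd n'.+1) i)%:R.
have nE : (n'.+1./2.*2 + odd n'.+1 = n'.+1)%N by rewrite addnC odd_double_half.
have CM : (\det C)%:~R = \det M :> rat.
  rewrite -det_map_mx; congr (\det _); apply/matrixP => i j; rewrite !mxE.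
  (* [rho2] at the index [i] counted from 0 is the lower binomial index of the statement; its values
     at [i] and [j] add up to the upper one. *)
  have e (x : 'I_((n'.+1)./2)) : (rho2 n'.+1./2 (odd n'.+1) x = n'.+1 - 2 * x.+1)%N.
    by rewrite /rho2 /wexp nE; have := ltn_ord x; lia.
  rewrite !e; congr ('C(_, _)%:R); have := ltn_ord i; have := ltn_ord j.
  by move: nE; move: (nat_of_ord i) (nat_of_ord j) => x y; lia.
have lead : (2 ^+ (n'.+1 - 1) * \det C)%:~R = 2 ^+ n'.+1.-1 * \det M :> rat.
  by rewrite rmorphM rmorphXn /= CM subn1.
(* The leading coefficient of a nonnegative function is nonnegative, and [binomial_det_neq0]
   excludes 0; taking the absolute value below changes nothing. *)
have D0 : 0 < 2 ^+ (n'.+1 - 1) * \det C.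
  rewrite -(ltr0z rat) lead lt_neqAle eq_sym mulf_neq0 ?expf_neq0 ?pnatr_eq0 //=.
    by apply: binpoly_ge0 hb => k; exact: ler0n.
  exact: binomial_det_neq0.
exists (absz (2 ^+ (n'.+1 - 1) * \det C)); last by rewrite gtz0_abs.
rewrite SO_eq; apply: (@degree_of_hilbert R[i] _ _ ((n'.+1 * n'.+1.-1) %/ 2)%N _ _ _ _ h).
- exact: SO_irreducible.
- move=> x hx; rewrite /SOv /=.
  have at_pe p : (forall A : 'M_n'.+1, SOm A -> pe p A = 0) -> pe p (vec_mx x) = 0.
    move=> hp; rewrite /pe vec_mxK; apply: hx => v Sv; rewrite -[v]vec_mxK; exact: hp.
  split.
    have peE A : pe (\det (genmx R[i] n') - 1%:MP) A = \det A - 1.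
      rewrite -scaleN1r peD peZ peC mulN1r; congr (_ - _).
      rewrite /pe /mpoly_at -det_map_mx; congr (\det _); apply/matrixP => i j; rewrite !mxE.
      exact: peX.
    have := at_pe (\det (genmx R[i] n') - 1%:MP); rewrite peE => /(_ _)/eqP.
    by rewrite subr_eq0 => h1; apply/eqP; apply: h1 => A [dA _]; rewrite peE dA subrr.
  apply/matrixP => i j.
  pose p : {mpoly R[i][n'.+1 * n'.+1]} := \sum_k 'X_(mxvec_index k i) * 'X_(mxvec_index k j) - ((i == j)%:R)%:MP.
  have peE A : pe p A = (A^T *m A) i j - (1%:M : 'M_n'.+1) i j.
    rewrite /p -scaleN1r peD peZ peC mulN1r !mxE pe_sum; congr (_ - _).
    by apply: eq_bigr => k _; rewrite peM !peX mxE.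
  have := at_pe p; rewrite peE => /(_ _)/eqP; rewrite subr_eq0 => h1; apply/eqP; apply: h1 => A [_ oA].
  by rewrite peE oA subrr.
- by exists (mxvec 1%:M); rewrite /SOv /= mxvecK; split; rewrite ?det1 // trmx1 mul1mx.
- apply: leq_trans (leq_div _ _) _; apply: leq_mul => //; exact: leq_pred.
- exact: hX.
- by rewrite absz_gt0 gt_eqF.
have -> : (absz (2 ^+ (n'.+1 - 1) * \det C))%:R = 2 ^+ n'.+1.-1 * \det M :> rat.
  by rewrite -lead pmulrn gtz0_abs.
exact: hb.
Qed.
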